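(* Let $\mathbf{x}^{(t)}\in\mathbf{R}^d$, $t\in\mathbf{Z}$, satisfy the vector autoregression $\mathbf{x}^{(t)}=\sum_{j=1}^p\mathbf{A}^{(j)}\mathbf{x}^{(t-j)}+\boldsymbol\epsilon^{(t)}$ with $\mathbf{A}^{(j)}\in\mathbf{R}^{d\times d}$ and white noise innovations: $\mathbf{E}\boldsymbol\epsilon^{(t)}=0$, $\mathbf{E}\boldsymbol\epsilon^{(t)}\boldsymbol\epsilon^{(t)\top}=\boldsymbol\Sigma_{\boldsymbol\epsilon}$ for all $t$, $\mathbf{E}\boldsymbol\epsilon^{(t_1)}\boldsymbol\epsilon^{(t_2)\top}=0$ for $t_1\ne t_2$. The vectors $\mathbf{x}^{(t)}$, $t=1,\dots,T$, are observed. Let $\mathbf{W},\mathbf{S},\mathbf{y}^{(l)},\boldsymbol\eta^{(l)},\mathbf{z}^{(t)},\mathbf{S}^\dagger,\boldsymbol\Sigma^{(0)},\mathcal{B}_l,\widetilde{\mathbf{S}},\widetilde{\mathcal{B}}_l,\mathcal{F}_{\mathcal B}(\cdot),\boldsymbol\Lambda^{(l_1,l_2)},\widehat{\mathbf{S}}$ and the bootstrap roots $\boldsymbol\Delta^*_{jl}$ (constructed with kernel $K$ and bandwidth $k_T$) be as defined in the context. Assume: (1) $\mathbf{x}^{(t)},t\in\mathbf{Z}$, are $(m,\alpha)$-short range dependent with constants $m>8$, $\alpha>1$; $p=O(1)$; $d=O(T^{\alpha_d})$ with a constant $0\le\alpha_d<\frac{m\alpha}{2+24\alpha}$. (2) $\lambda=c_\lambda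 T^{-\alpha_\lambda}$ with constants $c_\lambda>0$ and $0<\alpha_\lambda<\frac12-\frac{4\alpha_d}{m}$; $b_T\to0$ and $b_T/\lambda\to\infty$ as $T\to\infty$; $\max_{l=1,\dots,d}\vert\mathcal{B}_l\vert=O(1)$ and $\max_{l=1,\dots,d}\vert\mathcal{B}_l\vert>0$; $\min_{l=1,\dots,d,\ j\in\mathcal{B}_l}\vert\mathbf{S}_{jl}\vert>2b_T$; all eigenvalues of $\mathbf{S}^\dagger$ are less than $1$ in absolute value; the minimum eigenvalue of $\boldsymbol\Sigma^{(0)}$ is greater than a constant $c>0$. (3) There is a constant $c'>0$ such that for all sufficiently large $T$, $\boldsymbol\Lambda^{(l,l)}_{jj}>c'$ for all $l=1,\dots,d$ and $j\in\mathcal{B}_l$. (4) $K$ is a kernel function, and $k_T>0$ satisfies $k_T\to\infty$, $v_T\log^9(T)=o(1)$ and $k_T\,T^{\frac{8\alpha_d}{m}-\frac12}\log(T)^{\frac{19}{2}}\to0$ as $T\to\infty$, where $v_T=k_T^{1-\alpha}$ if $1<\alpha<2$, $v_T=\log(k_T)/k_T$ if $\alpha=2$, $v_T=1/k_T$ if $\alpha>2$. Then $$\max_{j_1,j_2=1,\dots,pd,\ l_1,l_2=1,\dots,d}\big\vert\mathbf{E}^*\boldsymbol\Delta^*_{j_1l_1}\boldsymbol\Delta^*_{j_2l_2}-\boldsymbol\Lambda^{(l_1,l_2)}_{j_1j_2}\big\vert=O_p\Big(v_T+k_T\,T^{\frac{8\alpha_d}{m}-\frac12}\sqrt{\log(T)}\Big).$$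 Moreover, $$\sup_{x\in\mathbf{R}}\Big\vert\mathrm{Prob}^*\Big(\max_{j=1,\dots,pd,\ l=1,\dots,d}\vert\boldsymbol\Delta^*_{jl}\vert\le x\Big)-\mathrm{Prob}\Big(\max_{l=1,\dots,d,\ j\in\mathcal{B}_l}\vert\boldsymbol\Gamma_{jl}\vert\le x\Big)\Big\vert=o_p(1),$$ where $\boldsymbol\Gamma_{jl}$ are joint normal random variables with $\mathbf{E}\boldsymbol\Gamma_{jl}=0$ and $\mathrm{Cov}(\boldsymbol\Gamma_{j_1l_1},\boldsymbol\Gamma_{j_2l_2})=\boldsymbol\Lambda^{(l_1,l_2)}_{j_1j_2}$.
   Context: $T$ is the sample size; $d$, $p$, the matrices $\mathbf{A}^{(j)}$ and the laws of the processes may depend on $T$; $O,o,O_p,o_p$ refer to $T\to\infty$, and ''constant'' means independent of $T$. $\Vert X\Vert_m=(\mathbf{E}\vert X\vert^m)^{1/m}$. $\vert\cdot\vert_1,\vert\cdot\vert_2$ are the vector $\ell_1,\ell_2$ norms; $\vert\mathcal{B}\vert$ is the cardinality of a set; $\mathbf{M}_{\cdot l}$ is the $l$th column of $\mathbf{M}$. $\mathbf{E}^*$ and $\mathrm{Prob}^*$ denote conditional expectation and probability given $\mathbf{x}^{(1)},\dots,\mathbf{x}^{(T)}$. $(m,\alpha)$-short range dependence of random vectors $\mathbf{v}^{(t)}\in\mathbf{R}^d$, $t\in\mathbf{Z}$: there are independent (not necessarily identically distributed) random variables $e_t,t\in\mathbf{Z}$, and measurable functions with $\mathbf{v}^{(t)}_i=g^{(t,T)}_i(\dots,e_{t-1},e_t)$.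 Let $e_t^\dagger$ be independent random variables, independent of $(e_s)_{s\in\mathbf{Z}}$, with $e^\dagger_t$ distributed as $e_t$; for $j\ge0$ let $\mathbf{v}^{(t,j)}_i=g^{(t,T)}_i(\dots,e_{t-j-1},e^\dagger_{t-j},e_{t-j+1},\dots,e_t)$ and $\delta^{(j)}=\sup_{i,\,t\in\mathbf{Z}}\Vert\mathbf{v}^{(t)}_i-\mathbf{v}^{(t,j)}_i\Vert_m$. It is required that $\mathbf{E}\mathbf{v}^{(t)}=0$ for all $t$, $\sup_{t,i}\Vert\mathbf{v}^{(t)}_i\Vert_m=O(1)$, and $\sup_{k\ge0}(1+k)^\alpha\sum_{j=k}^\infty\delta^{(j)}=O(1)$. Kernel function: $K:\mathbf{R}\to[0,\infty)$ is symmetric, continuously differentiable, $K(0)=1$, $\int_{\mathbf{R}}K(x)dx<\infty$, $K$ is decreasing on $[0,\infty)$, and its Fourier transform $\mathcal{F}K(x)=\int_{\mathbf{R}}K(t)\exp(-2\pi\mathrm{i}tx)dt$ satisfies $\mathcal{F}K(x)\ge0$ for all $x$ and $\int_{\mathbf{R}}\mathcal{F}K(x)dx<\infty$. Definitions. $\mathbf{z}^{(t)}=(\mathbf{x}^{(t)\top},\mathbf{x}^{(t-1)\top},\dots,\mathbf{x}^{(t-p+1)\top})^\top\in\mathbf{R}^{pd}$. $\mathbf{W}$ is the $(T-p)\times pd$ matrix with rows $\mathbf{z}^{(p)\top},\mathbf{z}^{(p+1)\top},\dots,\mathbf{z}^{(T-1)\top}$. $\mathbf{S}=[\mathbf{A}^{(1)},\dots,\mathbf{A}^{(p)}]^\top\in\mathbf{R}^{pd\times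 d}$. For $l=1,\dots,d$: $\mathbf{y}^{(l)}=(\mathbf{x}^{(p+1)}_l,\dots,\mathbf{x}^{(T)}_l)^\top$ and $\boldsymbol\eta^{(l)}=(\boldsymbol\epsilon^{(p+1)}_l,\dots,\boldsymbol\epsilon^{(T)}_l)^\top$, so $\mathbf{y}^{(l)}=\mathbf{W}\mathbf{S}_{\cdot l}+\boldsymbol\eta^{(l)}$. $\mathcal{B}_l=\{j\in\{1,\dots,pd\}:\mathbf{S}_{jl}\ne0\}$. $\boldsymbol\Sigma^{(0)}=\mathbf{E}\mathbf{z}^{(p)}\mathbf{z}^{(p)\top}$. $\mathbf{S}^\dagger$ is the $pd\times pd$ transpose of the block companion matrix whose first $d$ rows are $\mathbf{S}^\top$ and whose remaining $(p-1)d$ rows are $[\mathbf{I}_{(p-1)d}\ \ 0]$. Lasso with parameter $\lambda$: $\widetilde{\mathbf{S}}\in\mathbf{R}^{pd\times d}$ has columns $\widetilde{\mathbf{S}}_{\cdot l}\in\mathrm{argmin}_{\mathbf{s}\in\mathbf{R}^{pd}}\frac{1}{2T}\vert\mathbf{y}^{(l)}-\mathbf{W}\mathbf{s}\vert_2^2+\lambda\vert\mathbf{s}\vert_1$. With threshold $b_T$: $\widetilde{\mathcal{B}}_l=\{j\in\{1,\dots,pd\}:\vert\widetilde{\mathbf{S}}_{jl}\vert>b_T\}$. Partial inverse operator: for a square matrix $\mathbf{A}\in\mathbf{R}^{n\times n}$ and $\mathcal{B}=\{k_1<\dots<k_v\}\subset\{1,\dots,n\}$, let $\mathbf{A}_{\mathcal{B}}=(\mathbf{A}_{k_sk_t})_{s,t=1,\dots,v}$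 and let $\mathbf{Z}$ be the Moore–Penrose pseudo-inverse of $\mathbf{A}_{\mathcal{B}}$; $\mathcal{F}_{\mathcal{B}}(\mathbf{A})\in\mathbf{R}^{n\times n}$ has $(k_s,k_t)$ entry $\mathbf{Z}_{st}$ and all other entries $0$. Post-selection estimator: $\widehat{\mathbf{S}}\in\mathbf{R}^{pd\times d}$ with columns $\widehat{\mathbf{S}}_{\cdot l}=\mathcal{F}_{\widetilde{\mathcal{B}}_l}\big(\frac1T\mathbf{W}^\top\mathbf{W}\big)\frac1T\mathbf{W}^\top\mathbf{y}^{(l)}$, $l=1,\dots,d$. $\boldsymbol\Lambda^{(l_1,l_2)}=\mathcal{F}_{\mathcal{B}_{l_1}}(\boldsymbol\Sigma^{(0)})\big(\frac1T\mathbf{E}\mathbf{W}^\top\boldsymbol\eta^{(l_1)}\boldsymbol\eta^{(l_2)\top}\mathbf{W}\big)\mathcal{F}_{\mathcal{B}_{l_2}}(\boldsymbol\Sigma^{(0)})$ for $l_1,l_2=1,\dots,d$. Second-order wild bootstrap: let $\widehat{\boldsymbol\Sigma}^{(1)}=\frac1T\sum_{t=p}^{T-1}\mathbf{z}^{(t)}\mathbf{z}^{(t+1)\top}$; let $\widehat{\mathbf{S}}^\dagger\in\mathbf{R}^{pd\times pd}$ be the matrix whose first $d$ columns are $\widehat{\mathbf{S}}$ and whose remaining $(p-1)d$ columns are $\mathbf{I}_{(p-1)d}$ stacked on top of a $d\times(p-1)d$ zero block; let $\widehat{\boldsymbol\Theta}^{(t)}=\mathbf{z}^{(t)}\mathbf{z}^{(t+1)\top}-\mathbf{z}^{(t)}\mathbf{z}^{(t)\top}\widehat{\mathbf{S}}^\dagger$,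 $t=p,\dots,T-1$. Let $e^{(t)}$, $t=1,\dots,T$ (bootstrap multipliers, independent of the observations), be joint normal with $\mathbf{E}e^{(t)}=0$ and $\mathbf{E}e^{(t_1)}e^{(t_2)}=K\big(\frac{t_1-t_2}{k_T}\big)$. Put $\widehat{\boldsymbol\Sigma}^{(1)*}=\widehat{\boldsymbol\Sigma}^{(1)}+\frac1T\sum_{t=p}^{T-1}\widehat{\boldsymbol\Theta}^{(t)}e^{(t)}$, $\widehat{\mathbf{S}}^*_{\cdot l}=\mathcal{F}_{\widetilde{\mathcal{B}}_l}\big(\frac1T\mathbf{W}^\top\mathbf{W}\big)\widehat{\boldsymbol\Sigma}^{(1)*}_{\cdot l}$ and $\boldsymbol\Delta^*_{jl}=\sqrt{T}(\widehat{\mathbf{S}}^*_{jl}-\widehat{\mathbf{S}}_{jl})$ for $j=1,\dots,pd$, $l=1,\dots,d$ (this is $0$ when $j\notin\widetilde{\mathcal{B}}_l$). *)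

(* Defs.v *)
From HB Require Import structures.
From mathcomp Require Import all_boot all_order all_algebra.
From mathcomp Require Import complex.
From mathcomp Require Import all_classical all_reals all_analysis.

Set Implicit Arguments.
Unset Strict Implicit.
Unset Printing Implicit Defensive.

Import Order.TTheory GRing.Theory Num.Theory.
Import numFieldNormedType.Exports.

Local Open Scope classical_set_scope.
Local Open Scope ring_scope.

Definition cylinders (R : realType) (I : Type) : set (set (I -> R)) :=
  [set A | exists i (B : set R), measurable B /\ A = [set f | B (f i)]].

(* R^I with the product sigma-algebra; I may be infinite *)
Definition fspace (R : realType) (I : Type) := g_sigma_algebraType (@cylinders R I).

Section Probability.
Context {R : realType}.
Context {disp : measure_display} {Om : measurableType disp}.
Variable P : probability Om R.

Definition mutually_independent (I : choiceType) (X : I -> Om -> R) : Prop :=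
  forall (s : seq I) (B : I -> set R), uniq s -> (forall i, measurable (B i)) ->
    P [set w | forall i, i \in s -> B i (X i w)] =
    (\prod_(i <- s) P (X i @^-1` B i))%E.

Definition independent_vectors (I J : Type) (X : I -> Om -> R)
    (Y : J -> Om -> R) : Prop :=
  forall (A : set (fspace R I)) (B : set (fspace R J)),
    measurable A -> measurable B ->
    P [set w | A (X ^~ w) /\ B (Y ^~ w)] =
    (P [set w | A (X ^~ w)] * P [set w | B (Y ^~ w)])%E.

(* N(mu, s^2); [normal_prob mu 0] is not the point mass, hence the case split *)
Definition normal_law (mu s : R) (B : set R) : \bar R :=
  if s == 0 then (\d_mu B)%E else normal_prob mu s B.

(* (X_i)_{i in D} is jointly normal, possibly with a singular covariance *)
Definition joint_normal (I : finType) (D : {set I}) (X : I -> Om -> R) : Prop :=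
  forall a : I -> R, exists mu s : R, 0 <= s /\
    forall B : set R, measurable B ->
      P [set w | B (\sum_(i in D) a i * X i w)] = normal_law mu s B.

Definition expectation_mx (m n : nat) (M : Om -> 'M[R]_(m, n)) : 'M[R]_(m, n) :=
  \matrix_(i, j) fine 'E_P[fun w => M w i j].

(* k is a regular conditional distribution of Y given X *)
Definition is_cond_law (I J : Type) (X : I -> Om -> R) (Y : J -> Om -> R)
    (k : R.-pker (fspace R I) ~> (fspace R J)) : Prop :=
  forall (A : set (fspace R I)) (B : set (fspace R J)),
    measurable A -> measurable B ->
    P [set w | A (X ^~ w) /\ B (Y ^~ w)] =
    (\int[P]_(w in [set w | A (X ^~ w)]) k (X ^~ w) B)%E.

(* the outer probability of A is at most eta; for measurable A this is
   P A <= eta *)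
Definition outer_prob_le (A : set Om) (eta : R) : Prop :=
  exists E : set Om, [/\ measurable E, A `<=` E & (P E <= eta%:E)%E].

End Probability.

Section StochasticOrder.
Context {R : realType} {disp : nat -> measure_display}
  {Om : forall T, measurableType (disp T)}.
Variable P : forall T, probability (Om T) R.

Definition bigO_p (X : forall T, Om T -> R) (r : nat -> R) : Prop :=
  forall eta : R, 0 < eta -> exists M : R, \forall T \near \oo,
    outer_prob_le (P T) [set w | M * `|r T| < `|X T w|] eta.

Definition littleo_p1 (X : forall T, Om T -> R) : Prop :=
  forall eps eta : R, 0 < eps -> 0 < eta -> \forall T \near \oo,
    outer_prob_le (P T) [set w | eps < `|X T w|] eta.

(* The past is stored backwards: entry s of the argument of g is e_{t-s}.
   The independent copy e^dagger of e is the second coordinate of Om x Om under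
   P \x P, so that the j-th coupling reads e_{t-j} from that coordinate. *)
Definition coupling_defect (T d : nat) (v : int -> 'I_d -> Om T -> R)
    (e : int -> Om T -> R) (g : int -> 'I_d -> fspace R nat -> R) (m : R)
    (j : nat) : \bar R :=
  ereal_sup [set r | exists (t : int) (i : 'I_d), r =
    Lnorm (P T \x P T)%E m%:E (EFin \o (fun w : Om T * Om T =>
      v t i w.1 -
      g t i (fun s : nat => e (t - s%:Z) (if s == j then w.2 else w.1))))].

Definition short_range_dependent (d : nat -> nat)
    (v : forall T, int -> 'I_(d T) -> Om T -> R) (m alpha : R) : Prop :=
  exists (e : forall T, int -> {RV (P T) >-> R})
         (g : forall T, int -> 'I_(d T) -> {mfun (fspace R nat) >-> R}),
  [/\ forall T, mutually_independent (P T) (e T),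
      forall T t i, {ae P T, forall w,
        v T t i w = g T t i (fun s : nat => e T (t - s%:Z) w)},
      forall T t i, ('E_(P T)[v T t i] = 0)%E,
      exists C : R, \forall T \near \oo, forall t i,
        ('N[P T]_(m%:E)[EFin \o v T t i] <= C%:E)%E
    & exists C : R, \forall T \near \oo, forall k : nat,
        (((1 + k%:R) `^ alpha)%:E *
           \sum_(k <= j <oo) coupling_defect (v T) (e T) (g T) m j
         <= C%:E)%E].

End StochasticOrder.

Section Kernel.
Context {R : realType}.
Local Notation leb := (@lebesgue_measure R).

Definition fourier (K : R -> R) (x : R) : R[i] :=
  Complex (\int[leb]_t (K t * cos (2 * pi * t * x)))
          (- \int[leb]_t (K t * sin (2 * pi * t * x))).

(* [0 <= fourier K x] is the order of R[i]: real and nonnegative *)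
Record kernel_function (K : R -> R) : Prop := {
  kernel_ge0 : forall x, 0 <= K x;
  kernel_sym : forall x, K (- x) = K x;
  kernel_derivable : forall x : R, derivable K x 1;
  kernel_C1 : continuous (derive1 K);
  kernel0 : K 0 = 1;
  kernel_integrable : (\int[leb]_x (K x)%:E < +oo)%E;
  kernel_decreasing : forall x y, 0 <= x -> x <= y -> K y <= K x;
  kernel_fourier_ge0 : forall x, 0 <= fourier K x;
  kernel_fourier_integrable :
    (\int[leb]_x (complex.Re (fourier K x))%:E < +oo)%E }.

Definition vrate (alpha k : R) : R :=
  if alpha < 2 then k `^ (1 - alpha)
  else if alpha == 2 then ln k / k else k^-1.

End Kernel.

Section PartialInverse.
Context {R : realType}.

Definition is_pinv (n : nat) (A Z : 'M[R]_n) : Prop :=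
  [/\ A *m Z *m A = A, Z *m A *m Z = Z,
      (A *m Z)^T = A *m Z & (Z *m A)^T = Z *m A].

(* Moore-Penrose pseudo-inverse *)
Definition pinv (n : nat) (A : 'M[R]_n) : 'M[R]_n := xget 0 [set Z | is_pinv A Z].

Definition partial_inverse (n : nat) (B : {set 'I_n}) (A : 'M[R]_n) : 'M[R]_n :=
  let k := enum_val : 'I_#|B| -> 'I_n in
  \sum_s \sum_t pinv (mxsub k k A) s t *: delta_mx (k s) (k t).

End PartialInverse.

Lemma lag_block_subproof (p d : nat) (k : 'I_(p * d)) : (k %/ d < p)%N.
Proof.
by case: d k => [|d] k; [case: k => k; rewrite muln0 | rewrite ltn_divLR].
Qed.

Lemma block_coord_subproof (p d : nat) (k : 'I_(p * d)) : (k %% d < d)%N.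
Proof.
by case: d k => [|d] k; [case: k => k; rewrite muln0 | rewrite ltn_mod].
Qed.

(* index k of R^{pd} is coordinate [block_coord k] of block [lag_block k] *)
Definition lag_block (p d : nat) (k : 'I_(p * d)) : 'I_p :=
  Ordinal (lag_block_subproof k).
Definition block_coord (p d : nat) (k : 'I_(p * d)) : 'I_d :=
  Ordinal (block_coord_subproof k).

Section Autoregression.
Context {R : realType}.
Variables (T p d : nat).
Implicit Types (X : int -> 'cV[R]_d) (S : 'M[R]_(p * d, d)).

Definition zvec X (t : int) : 'cV[R]_(p * d) :=
  \col_k X (t - (lag_block k)%:Z) (block_coord k) 0.

Definition Wmx X : 'M[R]_(T - p, p * d) :=
  \matrix_(r, k) zvec X (p + r)%N%:Z k 0.

(* y^(l) for X = x, eta^(l) for X = epsilon *)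
Definition response X (l : 'I_d) : 'cV[R]_(T - p) :=
  \col_r X (p + r).+1%N%:Z l 0.

(* A i is the coefficient matrix of lag i + 1 *)
Definition coef_mx (A : 'I_p -> 'M[R]_d) : 'M[R]_(p * d, d) :=
  \matrix_(k, l) A (lag_block k) l (block_coord k).

Definition companion S : 'M[R]_(p * d) :=
  \matrix_(k, i) if (i < d)%N then S k (block_coord i) else (k + d == i :> nat)%N%:R.

Definition active_set S (l : 'I_d) : {set 'I_(p * d)} := [set j | S j l != 0].

Definition thresholded S (b : R) (l : 'I_d) : {set 'I_(p * d)} :=
  [set j | b < `|S j l|].

Definition lasso_objective X (lam : R) (l : 'I_d) (s : 'cV[R]_(p * d)) : R :=
  (2 * T%:R)^-1 * (\sum_r (response X l - Wmx X *m s) r 0 ^+ 2)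
  + lam * \sum_k `|s k 0|.

Definition is_lasso X (lam : R) S : Prop :=
  forall l s, lasso_objective X lam l (col l S) <= lasso_objective X lam l s.

Definition gram X : 'M[R]_(p * d) := T%:R^-1 *: ((Wmx X)^T *m Wmx X).

Definition post_selection X (B : 'I_d -> {set 'I_(p * d)}) : 'M[R]_(p * d, d) :=
  \matrix_(j, l) (partial_inverse (B l) (gram X) *m
                  (T%:R^-1 *: ((Wmx X)^T *m response X l))) j 0.

Definition Sigma1_hat X : 'M[R]_(p * d) :=
  T%:R^-1 *: \sum_(p <= t < T) zvec X t%:Z *m (zvec X t.+1%:Z)^T.

Definition Theta_hat X S (t : nat) : 'M[R]_(p * d) :=
  zvec X t%:Z *m (zvec X t.+1%:Z)^T
  - zvec X t%:Z *m (zvec X t%:Z)^T *m companion S.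

Definition Sigma1_star X S (e : nat -> R) : 'M[R]_(p * d) :=
  Sigma1_hat X + T%:R^-1 *: \sum_(p <= t < T) e t *: Theta_hat X S t.

(* right multiplication by [pid_mx d] keeps the first d columns *)
Definition bootstrap_estimator X (B : 'I_d -> {set 'I_(p * d)}) (e : nat -> R) :
    'M[R]_(p * d, d) :=
  \matrix_(j, l) (partial_inverse (B l) (gram X) *m
    col l (Sigma1_star X (post_selection X B) e *m
           (pid_mx d : 'M[R]_(p * d, d)))) j 0.

Definition bootstrap_root X (B : 'I_d -> {set 'I_(p * d)}) (e : nat -> R) :
    'M[R]_(p * d, d) :=
  Num.sqrt T%:R *: (bootstrap_estimator X B e - post_selection X B).

End Autoregression.

Section Population.
Context {R : realType} {disp : measure_display} {Om : measurableType disp}.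
Variables (P : probability Om R) (T p d : nat).
Implicit Types v x eps : int -> 'I_d -> Om -> R.

Definition sample_path v (w : Om) : int -> 'cV[R]_d := fun t => \col_i v t i w.

Definition observations x : 'I_T * 'I_d -> Om -> R :=
  fun ti w => x ti.1.+1%:Z ti.2 w.

Definition Sigma0 x : 'M[R]_(p * d) :=
  expectation_mx P (fun w => zvec p (sample_path x w) p%:Z *m
                             (zvec p (sample_path x w) p%:Z)^T).

Definition Lambda x eps (S : 'M[R]_(p * d, d)) (l1 l2 : 'I_d) : 'M[R]_(p * d) :=
  partial_inverse (active_set S l1) (Sigma0 x) *m
  (T%:R^-1 *: expectation_mx P (fun w =>
     (Wmx T p (sample_path x w))^T *m response T p (sample_path eps w) l1 *m
     (response T p (sample_path eps w) l2)^T *m Wmx T p (sample_path x w))) *m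
  partial_inverse (active_set S l2) (Sigma0 x).

Definition is_VAR x eps (A : 'I_p -> 'M[R]_d) : Prop :=
  forall t : int, {ae P, forall w, sample_path x w t =
    \sum_j A j *m sample_path x w (t - j.+1%:Z) + sample_path eps w t}.

Definition white_noise eps (Sig : 'M[R]_d) : Prop :=
  [/\ forall t i, ('E_P[eps t i] = 0)%E,
      forall t i j, ('E_P[(fun w => eps t i w * eps t j w)%R] = (Sig i j)%:E)%E
    & forall t1 t2 i j, t1 != t2 ->
        ('E_P[(fun w => eps t1 i w * eps t2 j w)%R] = 0)%E].

(* e t for t = 1, ..., T are the multipliers; other values are irrelevant *)
Definition bootstrap_multipliers (K : R -> R) (k : R) x (e : nat -> Om -> R) :
    Prop :=
  [/\ joint_normal P [set: 'I_T] (fun t => e t.+1),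
      independent_vectors P (observations x) (fun t : 'I_T => e t.+1),
      forall t : 'I_T, ('E_P[e t.+1] = 0)%E
    & forall t1 t2 : 'I_T, ('E_P[(fun w => e t1.+1 w * e t2.+1 w)%R] =
        (K ((t1.+1%:R - t2.+1%:R) / k)%R)%:E)%E].

(* the Gaussian comparison family, indexed by the pairs (j, l) with j in B l;
   its values outside that index set are irrelevant *)
Definition gaussian_family (n d : nat) (B : 'I_d -> {set 'I_n})
    (L : 'I_d -> 'I_d -> 'M[R]_n) (G : 'I_n * 'I_d -> Om -> R) : Prop :=
  [/\ joint_normal P [set jl | jl.1 \in B jl.2] G,
      forall jl, jl.1 \in B jl.2 -> ('E_P[G jl] = 0)%E
    & forall jl1 jl2, jl1.1 \in B jl1.2 -> jl2.1 \in B jl2.2 ->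
        covariance P (G jl1) (G jl2) = (L jl1.2 jl2.2 jl1.1 jl2.1)%:E].

End Population.

Section Conclusion.
Context {R : realType}.
Variables (n d : nat).

(* Estar and the law under Prob^star of an n x d random matrix are read off its
   conditional distribution Q *)
Definition second_moment (Q : {measure set (fspace R ('I_n * 'I_d)) -> \bar R})
    (j1 : 'I_n) (l1 : 'I_d) (j2 : 'I_n) (l2 : 'I_d) : R :=
  \int[Q]_v (v (j1, l1) * v (j2, l2)).

Definition covariance_error
    (Q : {measure set (fspace R ('I_n * 'I_d)) -> \bar R})
    (L : 'I_d -> 'I_d -> 'M[R]_n) : R :=
  \big[Num.max/0]_j1 \big[Num.max/0]_j2 \big[Num.max/0]_l1 \big[Num.max/0]_l2
    `|second_moment Q j1 l1 j2 l2 - L l1 l2 j1 j2|.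

Definition max_abs (D : {set 'I_n * 'I_d}) (v : 'I_n * 'I_d -> R) : R :=
  \big[Num.max/0]_(jl in D) `|v jl|.

End Conclusion.

Definition kolmogorov_distance (R : realType) (F G : R -> R) : R :=
  sup [set `|F u - G u| | u in [set: R]].

(* Main.v *)
(** Writing the scores as products of short-range dependent processes, an Efron-Stein inequality for
    the couplings bounds the moments of order m/2 and m/4 of the centred Gram matrix, of the cross
    moments and of the kernel-weighted sums of products of scores.  By Markov and a union bound, off
    an event of small probability the lasso selects the active sets exactly and, given the data, the
    bootstrap root is Gaussian with a covariance close to Lambda: the kernel bias is O(v_T), the
    stochastic error O(k_T T^(8 ad/m - 1/2)).  For the Kolmogorov distance the orthant is smoothed;
    two Gaussian laws are compared by iterating T_(sqrt 2 t) = T_t T_t for the Gaussian smoothing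
    operators, and the maximum does not concentrate because a Gaussian vector can be shifted along a
    row of its covariance (Cameron-Martin). *)

Require Import Defs.
From HB Require Import structures.
From mathcomp Require Import all_boot all_order all_algebra.
From mathcomp Require Import complex.
From mathcomp Require Import all_classical all_reals all_analysis.
From mathcomp Require Import measurable_realfun zify ring lra.

Set Implicit Arguments.
Unset Strict Implicit.
Unset Printing Implicit Defensive.

Import Order.TTheory GRing.Theory Num.Theory.
Import numFieldNormedType.Exports.

Local Open Scope classical_set_scope.
Local Open Scope ring_scope.

Local Notation measT := (measurable_fun setT).

Local Notation via x := (@le_trans _ _ x).

(** Neither stationarity nor uncorrelatedness of the noise with the past is assumed. Both follow
    from the spectral condition: the cross moments of z_(s-k) with eps_t, and the difference of the
    covariance matrices of z at two times pushed k steps back, are bounded orbits of a stable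
    recursion run backwards, hence zero. Joint normality is known only through the laws of linear
    combinations, so Gaussian laws are identified by their moment generating functions. In their
    comparison each iteration doubles both the error and t^2; from t = 2^(-n/2) the covariance term
    comes back at full size, while the third-order remainder, which depends on the dimension, is
    multiplied by 2^(-n/2). The second derivatives of the smoothed orthant have absolute sum at most
    3 b^2 in every dimension, so the dimension enters only through the choice of b. The exponent 8
    ad/m comes from union bounds of order m/4 over pairs of active indices only: at most (d s)^2,
    with s a bound on the active sets. The conditional law of the root is a given kernel; it is
    identified almost surely, on the event of exact selection, through countably many rational
    rectangles. *)

Lemma eq_ler {disp : Order.disp_t} {T : porderType disp} (x y : T) : x = y -> (x <= y)%O.
Proof. by move=> ->. Qed.

Ltac preimage := match goal with |- measurable ?A => rewrite -(setTI A) end.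

(** Sign goals by recursion on the head symbol. For a strict sum both ways are tried, since one
    strictly positive summand suffices. *)
Ltac pos :=
  lazymatch goal with
  | |- is_true (0 <= _ + _) => first [ assumption | apply: addr_ge0; pos ]
  | |- is_true (0 <= _ * _) => first [ assumption | exact: sqr_ge0 | apply: mulr_ge0; pos ]
  | |- is_true (0 <= _^-1) => rewrite invr_ge0; pos
  | |- is_true (0 <= _ ^+ _) => first [ exact: sqr_ge0 | apply: exprn_ge0; pos ]
  | |- is_true (0 <= _ `^ _) => exact: powR_ge0
  | |- is_true (0 <= expR _) => exact: expR_ge0
  | |- is_true (0 <= Num.sqrt _) => exact: sqrtr_ge0
  | |- is_true (0 <= \sum_(_ <- _ | _) _) => apply: sumr_ge0 => ? _; pos
  | |- is_true (0 <= _) => first [ assumption | apply: ltW; assumption | by [] | apply: ltW; pos ]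
  | |- is_true (0 < _ * _) => apply: mulr_gt0; pos
  | |- is_true (0 < _^-1) => rewrite invr_gt0; pos
  | |- is_true (0 < _ ^+ _) => apply: exprn_gt0; pos
  | |- is_true (0 < _ `^ _) => apply: powR_gt0; pos
  | |- is_true (0 < expR _) => exact: expR_gt0
  | |- is_true (0 < Num.sqrt _) => rewrite sqrtr_gt0; pos
  | |- is_true (0 < _ - _) => rewrite subr_gt0; first [ assumption | by [] ]
  | |- is_true (0 < _ + _) => first [ apply: ltr_wpDl; pos | apply: ltr_wpDr; pos ]
  | |- is_true (0 < _) => first [ assumption | by [] ]
  end.

(** * Measurability of powers and absolute values *)

Section MeasurablePowers.
Context {R : realType} {d : measure_display} {X : measurableType d}.

Lemma measurable_pow (q : R) (f : X -> R) : measT f -> measT (fun x => f x `^ q).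
Proof.
move=> mf; apply: (measurableT_comp (f := fun t : R => t `^ q)).
  exact: measurable_powR.
by [].
Qed.

Lemma measurable_abs (f : X -> R) : measT f -> measT (fun x => `|f x|).
Proof. by move=> mf; exact: (measurableT_comp _ mf). Qed.

End MeasurablePowers.

Ltac meas :=
  first [ assumption | exact: measurable_fst | exact: measurable_snd |
  lazymatch goal with
  | |- forall _, _ => move=> ?; meas
  | |- measurable_fun _ (fun x => @?f x - @?g x) => apply: measurable_funB; meas
  | |- measurable_fun _ (fun x => @?f x + @?g x) => apply: measurable_funD; meas
  | |- measurable_fun _ (fun x => @?f x * @?g x) => apply: measurable_funM; meas
  | |- measurable_fun _ (fun x => @?f x ^+ _) => apply: measurable_funX; meas
  | |- measurable_fun _ (fun x => `|@?f x|) => apply: measurable_abs; meas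
  | |- measurable_fun _ (fun x => @?f x `^ _) => apply: measurable_pow; meas
  | |- measurable_fun _ (fun x => - @?f x) => apply: measurable_funN; meas
  | |- measurable_fun _ (fun x => (@?f x)%:E) => apply/measurable_EFinP; meas
  | |- measurable_fun _ (fun x => \sum_(i <- _ | _) @?f i x) => apply: measurable_sum; meas
  | |- measurable_fun _ (fun x => ?g (@?f x)) => apply: (@measurableT_comp _ _ _ _ _ _ g _ f);
      [ first [ assumption | by [] ] | meas ]
  end | by [] ].

(** * The product sigma-algebra on real functions *)

Section FunctionSpace.
Context {R : realType}.

Lemma meas_eval (I : Type) (i : I) : measT (fun f : fspace R I => f i).
Proof.
move=> _ B mB; rewrite setTI; apply: sub_sigma_algebra.
by exists i, B.
Qed.

Lemma meas_fspace d (X : measurableType d) (I : Type) (h : X -> fspace R I) :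
  (forall i, measT (fun x => h x i)) -> measT h.
Proof.
move=> mh; apply: (@measurability _ _ X (fspace R I) setT h (@cylinders R I)) => //.
move=> _ [_ [i [B [mB ->]]] <-]; rewrite setTI.
by have := mh i measurableT B mB; rewrite setTI.
Qed.

(** Rational end points make the rectangles a countable class when the index set is finite; this
    later turns almost sure equality on each rectangle into almost sure equality of laws. The empty
    list gives the whole space. *)
Definition ray_rect (I : choiceType) (s : seq I) (q : I -> rat) : set (fspace R I) :=
  [set f | forall i, i \in s -> ratr (q i) < f i].

Lemma measurable_ray_rect (I : choiceType) (s : seq I) (q : I -> rat) :
  measurable (@ray_rect I s q).
Proof.
elim: s => [|i s IH].
  rewrite (_ : ray_rect _ _ = setT)//.
  by apply/seteqP; split => // f _ i.
rewrite (_ : ray_rect _ _ = ((fun f : fspace R I => f i) @^-1` `]ratr (q i), +oo[)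
  `&` @ray_rect I s q).
  apply: measurableI => //; preimage.
  by apply: meas_eval => //; by meas.
apply/seteqP; split => f /=.
  move=> H; split; first by rewrite in_itv/= andbT; apply: H; rewrite mem_head.
  by move=> j js; apply: H; rewrite in_cons js orbT.
move=> [+ H] j; rewrite in_itv/= andbT => Hi.
by rewrite in_cons => /orP[/eqP->//|]; apply: H.
Qed.

Lemma itv_rat_bigcup (x : R) :
  `]x, +oo[%classic = \bigcup_(q : rat) (if x < ratr q then `]ratr q, +oo[%classic else set0).
Proof.
apply/seteqP; split => y /=.
  rewrite in_itv/= andbT => xy; have [q] := rat_in_itvoo xy.
  rewrite in_itv/= => /andP[xq qy].
  by exists q => //; rewrite xq/= in_itv/= qy.
move=> [q _]; case: ifPn => // xq /=; rewrite !in_itv/= !andbT.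
exact: lt_trans.
Qed.

(** Uniqueness on a pi-system: rectangles are stable under intersection, and since a ray is a
    countable union of rational rays they generate every cylinder. *)
Lemma fspace_measure_unique (I : choiceType) (m1 m2 : {measure set (fspace R I) -> \bar R}) :
  (m1 setT < +oo)%E -> (forall s q, m1 (ray_rect s q) = m2 (ray_rect s q)) ->
  forall A : set (fspace R I), measurable A -> m1 A = m2 A.
Proof.
move=> m1fin m12 A mA.
pose G : set (set (fspace R I)) := [set B | exists s q, B = ray_rect s q].
have GT : G setT.
  exists [::], (fun=> 0); apply/seteqP; split => // f _ i.
have mG : G `<=` measurable.
  by move=> _ [s [q ->]]; exact: measurable_ray_rect.
have GI : setI_closed G.
  move=> _ _ [s1 [q1 ->]] [s2 [q2 ->]].
  (* On a coordinate shared by both lists the intersection of two rays starts at the larger end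
     point. *)
  exists (s1 ++ s2), (fun i => if i \in s1 then
    (if i \in s2 then Num.max (q1 i) (q2 i) else q1 i) else q2 i).
  apply/seteqP; split => f /=.
    move=> [H1 H2] i; rewrite mem_cat; case: ifPn => /= is1.
      case: ifPn => is2 _; last exact: H1.
      by rewrite maxEle; case: ifPn => _; [apply: H2|apply: H1].
    exact: H2.
  move=> H; split => i ii; have := H i; rewrite mem_cat ii ?orbT/= => /(_ isT).
    case: ifP => // _; apply: le_lt_trans.
    by rewrite ler_rat le_max lexx.
  case: ifP => // _; apply: le_lt_trans.
  by rewrite ler_rat le_max lexx orbT.
have sG : <<s G >> A.
  move: A mA; apply: smallest_sub.
    exact: smallest_sigma_algebra.
  move=> _ [i [B [mB ->]]].
  pose GS : measurableType _ := g_sigma_algebraType G.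
  have mi : measT (fun f : GS => (f : I -> R) i).
    apply: (measurability _ (RGenOInfty.measurableE R)).
    move=> _ [_ [x ->] <-]; rewrite setTI itv_rat_bigcup preimage_bigcup.
    apply: bigcupT_measurable_rat => q; case: ifPn => _; last by rewrite preimage_set0.
    apply: sub_sigma_algebra; exists [:: i], (fun=> q).
    apply/seteqP; split => f /=; rewrite in_itv/= andbT.
      by move=> h j; rewrite inE => /eqP->.
    by move=> /(_ i); rewrite inE; apply.
  have := mi measurableT B mB; rewrite setTI.
  by [].
apply: (@g_sigma_algebra_measure_unique _ _ _ G mG (fun=> setT)) => //.
- by rewrite bigcup_const//; exists 0%N.
- by move=> _ [s [q ->]]; exact: m12.
Qed.

End FunctionSpace.

(** * Exchanging innovations with an independent copy *)

Section Swap.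
Context {R : realType} {dO : measure_display} {Om : measurableType dO} (P : probability Om R)
  (e : int -> Om -> R) (me : forall i, measT (e i)) (ie : mutually_independent P e).

Local Notation E := (fspace R int).
Local Notation PP := (P \x P)%E.

Definition innov (w : Om) : fspace R int := fun u => e u w.

(** All couplings used below are [mix A (innov e w.1) (innov e w.2)] for some set of times [A]: on
    the product space the second coordinate carries the independent copy. *)
Definition mix (A : pred int) (a b : fspace R int) : fspace R int :=
  fun u => if A u then a u else b u.

Let J (w : Om * Om) : fspace R (int * bool)%type :=
  fun ic => e ic.1 (if ic.2 then w.2 else w.1).

Lemma meas_innov : measT innov.
Proof. by apply: meas_fspace => i; exact: me. Qed.

Lemma measurable_mix A d (X : measurableType d) (f g : X -> E) : measT f -> measT g ->
  measT (fun x => mix A (f x) (g x)).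
Proof.
move=> mf mg; apply: meas_fspace => i; rewrite /mix.
case: (A i).
  exact: (measurableT_comp (meas_eval i) mf).
exact: (measurableT_comp (meas_eval i) mg).
Qed.

Let mJ : measT J.
Proof.
apply: meas_fspace => -[i []] /=.
  exact: (measurableT_comp (me i) measurable_snd).
exact: (measurableT_comp (me i) measurable_fst).
Qed.

(** Independence within each copy and independence of the two copies make the doubled family,
    indexed by time and copy, independent. *)
Let J_rect (s : seq (int * bool)) (q : int * bool -> rat) : uniq s ->
  PP [set w | forall ic, ic \in s -> ratr (q ic) < J w ic] =
  (\prod_(ic <- s) P (e ic.1 @^-1` `]ratr (q ic), +oo[))%E.
Proof.
move=> us.
pose sb (c : bool) := [seq ic.1 | ic <- s & ic.2 == c].
have usb c : uniq (sb c).
  rewrite map_inj_in_uniq ?filter_uniq// => -[i1 c1] [i2 c2].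
  by rewrite !mem_filter/= => /andP[/eqP-> _] /andP[/eqP-> _] ->.
pose Bs (c : bool) (i : int) : set R := `]ratr (q (i, c)), +oo[%classic.
have mBs c i : measurable (Bs c i) by exact: measurable_itv.
pose X c := [set w | forall i, i \in sb c -> Bs c i (e i w)].
have insb c i : (i \in sb c) = ((i, c) \in s).
  apply/mapP/idP => [[[j c']]|ics].
    by rewrite mem_filter/= => /andP[/eqP-> ?] ->.
  by exists (i, c) => //; rewrite mem_filter/= eqxx.
have mX c : measurable (X c).
  rewrite (_ : X c = \big[setI/setT]_(i <- sb c) (e i @^-1` Bs c i)).
    apply: bigsetI_measurable => i _.
    by preimage; exact: me.
  rewrite -bigcap_seq; apply/seteqP; split => w /= H i; exact: H.
have -> : [set w | forall ic, ic \in s -> ratr (q ic) < J w ic] = X false `*` X true.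
  apply/seteqP; split => w /=.
    by move=> H; split => i; rewrite insb /Bs/= => /H; rewrite in_itv/= andbT.
  move=> [H1 H2] [i []] ics; [have := H2 i|have := H1 i];
    by rewrite insb /Bs/= in_itv/= andbT; apply.
have -> : PP (X false `*` X true) = (P (X false) * P (X true))%E.
  exact: product_measure1E.
have PX c : P (X c) = (\prod_(ic <- s | ic.2 == c) P (e ic.1 @^-1` `]ratr (q ic), +oo[))%E.
  rewrite ie// big_map big_filter; apply: eq_bigr => -[i c'] /= /eqP->.
  by [].
rewrite !PX [RHS](bigID (fun ic : int * bool => ic.2 == false))/=.
by congr (_ * _)%E; apply: eq_bigl => -[i []].
Qed.

(** Mixing is a permutation of the doubled index set: outside [A] the copy label is flipped. *)
Let pA (A : pred int) (ic : int * bool) : int * bool := (ic.1, ic.2 (+) ~~ A ic.1).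

Let pAK A : involutive (pA A).
Proof. by move=> [i c]; rewrite /pA/=; congr pair; rewrite -addbA addbb addbF. Qed.

(** The probability of a rectangle of the doubled family depends on an index only through its time,
    because both copies of an innovation have one law. It is therefore invariant under [pA], and
    rectangles determine the law of the pair. *)
Lemma swap_measure (A : pred int) (Z : set (E * E)) : measurable Z ->
  PP [set w | Z (mix A (innov w.1) (innov w.2), mix A (innov w.2) (innov w.1))] =
  PP [set w | Z (innov w.1, innov w.2)].
Proof.
move=> mZ.
pose JA (w : Om * Om) : fspace R (int * bool)%type := fun ic => J w (pA A ic).
have mJA : measT JA.
  apply: meas_fspace => ic.
  exact: (measurableT_comp (meas_eval (pA A ic)) mJ).
pose split (f : fspace R (int * bool)%type) : E * E :=
  ((fun i => f (i, false)), (fun i => f (i, true))).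
have msplit : measT split.
  apply/measurable_fun_pairP; split; by apply: meas_fspace => i; exact: meas_eval.
have mZ' : measurable (split @^-1` Z).
  by preimage; exact: msplit.
have PPT : PP setT = 1%E.
  rewrite -setXTT; transitivity (P setT * P setT)%E; first exact: product_measure1E.
  by rewrite probability_setT mule1.
have H : (forall s q, PP (JA @^-1` ray_rect s q) = PP (J @^-1` ray_rect s q)) ->
  PP (JA @^-1` (split @^-1` Z)) = PP (J @^-1` (split @^-1` Z)).
  move=> HR.
  have := @fspace_measure_unique R (int * bool)%type (pushforward PP JA) (pushforward PP J).
  move=> /(_ mJA mJ) K; apply: (K _ HR) => //.
  by rewrite -[X in (X < _)%E]/(PP setT) PPT ltry.
transitivity (PP (JA @^-1` (split @^-1` Z))).
  congr (PP _); apply/seteqP; split => w /=;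
    rewrite (_ : split (JA w) = (mix A (innov w.1) (innov w.2), mix A (innov w.2) (innov w.1)))//;
    by congr pair; apply/funext => i; rewrite /mix /innov /JA /J /pA/=; case: (A i).
rewrite H//.
move=> s q.
have e1 : J @^-1` ray_rect s q = [set w | forall ic, ic \in undup s -> ratr (q ic) < J w ic].
  by apply/seteqP; split => w /= K ic; [rewrite mem_undup|rewrite -mem_undup]; exact: K.
have e2 : JA @^-1` ray_rect s q =
  [set w | forall ic, ic \in map (pA A) (undup s) -> ratr (q (pA A ic)) < J w ic].
  apply/seteqP; split => w /= K ic.
    move=> /mapP[ic']; rewrite mem_undup => ics ->; rewrite pAK.
    by have := K _ ics.
  move=> ics; have := K (pA A ic); rewrite pAK; apply.
  by rewrite map_f// mem_undup.
rewrite e1 e2 !J_rect ?undup_uniq//; last first.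
  by rewrite map_inj_uniq ?undup_uniq//; exact: inv_inj (@pAK A).
by rewrite big_map; apply: eq_bigr => -[i c] _; rewrite /= pAK.
Qed.

(** Image measures transport the positive and the negative part of [F] separately. *)
Lemma integral_swap (A : pred int) (F : E * E -> \bar R) : measT F ->
  (\int[PP]_w F (mix A (innov w.1) (innov w.2), mix A (innov w.2) (innov w.1)) =
  \int[PP]_w F (innov w.1, innov w.2))%E.
Proof.
move=> mF.
pose f1 (w : Om * Om) : E * E := (innov w.1, innov w.2).
pose f2 (w : Om * Om) : E * E := (mix A (innov w.1) (innov w.2), mix A (innov w.2) (innov w.1)).
have m1 : measT (fun w : Om * Om => innov w.1).
  exact: (measurableT_comp meas_innov measurable_fst).
have m2 : measT (fun w : Om * Om => innov w.2).
  exact: (measurableT_comp meas_innov measurable_snd).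
have mf1 : measT f1 by apply/measurable_fun_pairP; split.
have mf2 : measT f2.
  by apply/measurable_fun_pairP; split; exact: measurable_mix.
have key (G : E * E -> \bar R) : measT G -> (forall x, 0 <= G x)%E ->
  (\int[PP]_w G (f2 w) = \int[PP]_w G (f1 w))%E.
  move=> mG G0.
  have := @ge0_integral_pushforward _ _ _ _ R _ mf2 PP setT G measurableT mG (fun y _ => G0 y).
  have := @ge0_integral_pushforward _ _ _ _ R _ mf1 PP setT G measurableT mG (fun y _ => G0 y).
  rewrite !preimage_setT /comp => <- <-.
  apply: eq_measure_integral => Z mZ _.
  exact: swap_measure.
rewrite -[LHS]/(\int[PP]_w (F \o f2) w)%E -[RHS]/(\int[PP]_w (F \o f1) w)%E.
rewrite (integralE PP setT (F \o f2)) (integralE PP setT (F \o f1)).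
rewrite (funepos_comp F f1) (funepos_comp F f2) (funeneg_comp F f1) (funeneg_comp F f2).
congr (_ - _)%E.
  by apply: key => //; exact: measurable_funepos.
by apply: key => //; exact: measurable_funeneg.
Qed.

End Swap.

(** Integrability and expectation of real functions are locked, so that rewriting cannot unfold them
    into extended-real integrals. *)
HB.lock Definition intg {R : realType} {d0 : measure_display} {X : measurableType d0}
  (P : probability X R) (f : X -> R) : bool := P.-integrable setT (EFin \o f).
HB.lock Definition Ex {R : realType} {d0 : measure_display} {X : measurableType d0}
  (P : probability X R) (f : X -> R) : R := \int[P]_w f w.

(** * Real-valued expectation *)

Section Expectation.
Context {R : realType} {d0 : measure_display} {X : measurableType d0}.
Implicit Types (P : probability X R) (f g h : X -> R).

Lemma intgE P f : intg P f = P.-integrable setT (EFin \o f).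
Proof. by rewrite intg.unlock. Qed.

Lemma ExE0 P f : Ex P f = \int[P]_w f w.
Proof. by rewrite Ex.unlock. Qed.

Lemma intg_meas P f : intg P f -> measT f.
Proof. by rewrite intgE => /measurable_int /measurable_EFinP. Qed.

Lemma intgD P f g : intg P f -> intg P g -> intg P (fun w => f w + g w).
Proof. by rewrite !intgE => /integrableD H /H; apply. Qed.

Lemma intgB P f g : intg P f -> intg P g -> intg P (fun w => f w - g w).
Proof. by rewrite !intgE => /integrableB H /H; apply. Qed.

Lemma intgZ P f (c : R) : intg P f -> intg P (fun w => c * f w).
Proof. by rewrite !intgE => /integrableZl; apply. Qed.

Lemma intg_le P f g : measT f -> intg P g -> (forall w, `|f w| <= g w) -> intg P f.
Proof.
rewrite !intgE => mf ig fg; apply: (le_integrable measurableT _ _ ig).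
  exact/measurable_EFinP.
by move=> w _ /=; rewrite lee_fin (le_trans (fg w))// ler_norm.
Qed.

Lemma intg_cst P (c : R) : intg P (fun=> c).
Proof. by rewrite intgE; exact: finite_measure_integrable_cst. Qed.

Lemma intg_bnd P f (c : R) : measT f -> (forall w, `|f w| <= c) -> intg P f.
Proof. by move=> mf fc; apply: (intg_le mf (intg_cst P c)). Qed.

Lemma intg_abs P f : intg P f -> intg P (fun w => `|f w|).
Proof. by rewrite !intgE => /integrable_abse. Qed.

Lemma intg_bndM P f g (c : R) : measT f -> (forall w, `|f w| <= c) ->
  intg P g -> intg P (fun w => f w * g w).
Proof.
move=> mf fc ig; apply: (@intg_le _ _ (fun w => c * `|g w|)).
- by apply: measurable_funM => //; exact: intg_meas ig.
- exact/intgZ/intg_abs.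
- by move=> w; rewrite normrM ler_wpM2r.
Qed.

Lemma intg_sum P (I : Type) (r : seq I) (Q : pred I) (f : I -> X -> R) :
  (forall i, Q i -> intg P (f i)) -> intg P (fun w => \sum_(i <- r | Q i) f i w).
Proof.
move=> H; elim: r => [|i r IH].
  by under eq_fun do rewrite big_nil; exact: intg_cst.
have [Qi|/negbTE Qi] := boolP (Q i); under eq_fun do rewrite big_cons Qi; last by [].
by apply: intgD => //; exact: H.
Qed.

Lemma ExD P f g : intg P f -> intg P g -> Ex P (fun w => f w + g w) = Ex P f + Ex P g.
Proof. by rewrite ?intgE => *; rewrite !ExE0 RintegralD. Qed.

Lemma ExB P f g : intg P f -> intg P g -> Ex P (fun w => f w - g w) = Ex P f - Ex P g.
Proof. by rewrite ?intgE => *; rewrite !ExE0 RintegralB. Qed.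

Lemma ExZ P f (c : R) : intg P f -> Ex P (fun w => c * f w) = c * Ex P f.
Proof. by rewrite ?intgE => *; rewrite !ExE0 RintegralZl. Qed.

Lemma Ex_cst P (c : R) : Ex P (fun=> c) = c.
Proof.
have /(congr1 fine) PT := probability_setT P.
by rewrite ExE0 Rintegral_cst// -[RHS]mulr1; congr (_ * _).
Qed.

Lemma Ex_le P f g : intg P f -> intg P g -> (forall w, f w <= g w) -> Ex P f <= Ex P g.
Proof. by rewrite ?intgE => *; rewrite !ExE0 le_Rintegral. Qed.

Lemma Ex_ge0 P f : (forall w, 0 <= f w) -> 0 <= Ex P f.
Proof. by rewrite ?intgE => *; rewrite !ExE0 Rintegral_ge0. Qed.

Lemma Ex_abs P f : intg P f -> `|Ex P f| <= Ex P (fun w => `|f w|).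
Proof. by rewrite ?intgE => *; rewrite !ExE0 le_normr_Rintegral. Qed.

Lemma Ex_absle P f g : intg P f -> intg P g -> (forall w, `|f w| <= g w) -> `|Ex P f| <= Ex P g.
Proof.
move=> fi gi fg; apply: (le_trans (Ex_abs fi)); apply: Ex_le => //.
exact: intg_abs.
Qed.

Lemma Ex_sum P (I : Type) (r : seq I) (Q : pred I) (f : I -> X -> R) :
  (forall i, Q i -> intg P (f i)) ->
  Ex P (fun w => \sum_(i <- r | Q i) f i w) = \sum_(i <- r | Q i) Ex P (f i).
Proof.
move=> H; elim: r => [|i r IH].
  by rewrite big_nil; under eq_fun do rewrite big_nil; exact: Ex_cst.
rewrite big_cons.
have [Qi|/negbTE Qi] := boolP (Q i); under eq_fun do rewrite big_cons Qi; last by [].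
rewrite ExD ?IH//; first exact: H.
exact: intg_sum.
Qed.

Lemma ExE P f : intg P f -> (\int[P]_w (f w)%:E)%E = (Ex P f)%:E.
Proof. by rewrite intgE => fi; rewrite ExE0 fineK//; exact: integrable_fin_num. Qed.

Lemma intg_ge0 P f (c : R) : measT f -> (forall w, 0 <= f w) ->
  (\int[P]_w (f w)%:E <= c%:E)%E -> intg P f /\ Ex P f <= c.
Proof.
move=> mf f0 fc.
have fi : intg P f.
  rewrite intgE; apply/integrableP; split; first exact/measurable_EFinP.
  under eq_integral do rewrite /= ger0_norm//.
  exact: (le_lt_trans fc (ltry _)).
by split => //; rewrite -lee_fin -ExE.
Qed.

(** The common form of the Jensen, Minkowski and Cauchy-Schwarz inequalities below: quantities are
    normalised so that their expectation is at most 1, and a pointwise convex bound passes to the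
    expectation. *)
Lemma Ex_conv P f g h (s t : R) : intg P f -> intg P g ->
  measT h -> (forall w, 0 <= h w) -> Ex P f <= 1 -> Ex P g <= 1 ->
  0 <= s -> 0 <= t -> s + t <= 1 -> (forall w, h w <= s * f w + t * g w) -> intg P h /\ Ex P h <= 1.
Proof.
move=> fi gi mh h0 f1 g1 s0 t0 st hfg.
have ifg : intg P (fun w => s * f w + t * g w) by apply: intgD; exact: intgZ.
have hi : intg P h by apply: (intg_le mh ifg) => w; rewrite ger0_norm.
split => //; apply: (le_trans (Ex_le hi ifg hfg)).
rewrite ExD; [|exact: intgZ..]; rewrite !ExZ//.
apply: le_trans st; apply: lerD; exact: ler_piMr.
Qed.

End Expectation.

Lemma le_meas {R : realType} d (T : measurableType d) (mu : {measure set T -> \bar R})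
  (A B : set T) : measurable A -> measurable B -> A `<=` B -> (mu A <= mu B)%E.
Proof. by move=> mA mB AB; apply: le_measure => //; rewrite inE. Qed.

(** * Inequalities for real powers and truncation *)

Section RealPowers.
Context {R : realType}.
Implicit Types (x y a b q r : R).

Lemma powRV x q : 0 <= x -> x^-1 `^ q = (x `^ q)^-1.
Proof. by move=> x0; rewrite -(powR_inv1 x0) -powRrM mulN1r powRN. Qed.

Lemma powR_div x y q : 0 <= x -> 0 <= y -> (x / y) `^ q = x `^ q / y `^ q.
Proof. by move=> x0 y0; rewrite powRM ?invr_ge0// powRV. Qed.

(** Young's inequality for the conjugate exponents r/q and r/(r-q), with second factor 1; it gives
    monotonicity of moments in their order. *)
Lemma powR_young x q r : 0 <= x -> 0 < q -> q <= r -> x `^ q <= (1 - q / r) + (q / r) * x `^ r.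
Proof.
move=> x0 q0; rewrite le_eqVlt => /predU1P[<-|qr].
  by rewrite divff ?gt_eqF// subrr add0r mul1r.
have r0 := lt_trans q0 qr.
have p1 : 0 < r / q by pos.
have p2 : 0 < r / (r - q) by pos.
have := @conjugate_powR R (x `^ q) 1 (r / q) (r / (r - q)) (powR_ge0 _ _) ler01 p1 p2.
rewrite mulr1 powR1 -powRrM.
have -> : q * (r / q) = r by field; rewrite gt_eqF.
have -> : x `^ r / (r / q) + 1 / (r / (r - q)) = 1 - q / r + q / r * x `^ r.
  by field; rewrite !gt_eqF////; pos.
apply; field; rewrite !gt_eqF////; pos.
Qed.

Lemma powR_mean x y a b q : 0 <= x -> 0 <= y -> 0 <= a -> 0 <= b -> a + b = 1 -> 1 <= q ->
  (a * x + b * y) `^ q <= a * x `^ q + b * y `^ q.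
Proof.
move=> x0 y0 a0 b0 ab q1.
have a01 : 0 <= a <= 1 by rewrite a0 -ab lerDl.
have := @convex_powR R q q1 (Itv01 a0 (andP a01).2) x y.
rewrite !inE/= !in_itv/= !andbT => /(_ x0 y0).
rewrite [X in X `^ _ <= _ -> _]convRE [X in _ <= X -> _]convRE/= /unstable.onem.
by have -> : 1 - a = b by rewrite -ab addrC addKr.
Qed.

(** Young's inequality at x/y with exponents 1 and r is Bernoulli's inequality, which becomes this
    mean value bound after multiplication by r y^r. *)
Lemma powR_sub_le x y r : 0 <= x -> x <= y -> 1 <= r ->
  y `^ r - x `^ r <= r * y `^ (r - 1) * (y - x).
Proof.
move=> x0 xy r1; have y0 := le_trans x0 xy.
have [yE|yN0] := eqVneq y 0.
  have -> : x = 0 by apply/le_anti; rewrite x0 -yE xy.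
  by rewrite yE subrr subr0 mulr0.
have yp : 0 < y by rewrite lt0r yN0.
have r0 : 0 < r by apply: lt_le_trans r1.
have := @powR_young (x / y) 1 r (divr_ge0 x0 y0) ltr01 r1.
rewrite powRr1 ?divr_ge0//.
rewrite powR_div//.
have yr : y `^ r = y `^ (r - 1) * y.
  rewrite -{3}(powRr1 y0) -powRD ?subrK// yN0 implybT//.
have yr1 : 0 < y `^ (r - 1) by pos.
rewrite yr => H.
have : (x / y) * (r * (y `^ (r - 1) * y)) <=
  (1 - 1 / r + 1 / r * (x `^ r / (y `^ (r - 1) * y))) * (r * (y `^ (r - 1) * y)).
  by apply: ler_wpM2r H; rewrite !mulr_ge0//// ltW.
have -> : (x / y) * (r * (y `^ (r - 1) * y)) = r * y `^ (r - 1) * x.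
  by field; rewrite gt_eqF.
have -> : (1 - 1 / r + 1 / r * (x `^ r / (y `^ (r - 1) * y))) * (r * (y `^ (r - 1) * y))
  = (r - 1) * (y `^ (r - 1) * y) + x `^ r.
  by field; rewrite !gt_eqF.
by nra.
Qed.

(** The signed power, the derivative of |x|^q / q; it is the test function paired with a statistic
    when its q-th moment is estimated. *)
Definition spow q x : R := if 0 <= x then x `^ (q - 1) else - ((- x) `^ (q - 1)).

Lemma spow_norm q x : `|spow q x| = `|x| `^ (q - 1).
Proof.
rewrite /spow; case: ifPn => x0; first by rewrite !ger0_norm//; pos.
by rewrite normrN ger0_norm ?powR_ge0// ltr0_norm// ltNge.
Qed.

(** Points of one sign reduce to the mean value bound; across zero the two moduli add up, and so do
    the distances to zero. *)
Lemma spow_lip q x y : 2 <= q ->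
  `|spow q x - spow q y| <= (q - 1) * (`|x| `^ (q - 2) + `|y| `^ (q - 2)) * `|x - y|.
Proof.
move=> q2.
have q1 : 1 <= q - 1 by lra.
have q12 : q - 1 - 1 = q - 2 by lra.
wlog xy : x y / x <= y.
  move=> H; have [/H//|/ltW/H] := leP x y.
  by rewrite distrC (distrC y) (addrC (`|y| `^ _)).
have pos a b : 0 <= a -> a <= b -> b `^ (q - 1) - a `^ (q - 1) <=
  (q - 1) * (a `^ (q - 2) + b `^ (q - 2)) * (b - a).
  move=> a0 ab; apply: (le_trans (powR_sub_le a0 ab q1)).
  rewrite q12 ler_wpM2r ?subr_ge0// ler_wpM2l//; first lra.
  by rewrite lerDr powR_ge0.
have mono a b : 0 <= a -> a <= b -> a `^ (q - 1) <= b `^ (q - 1).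
  by move=> a0 ab; apply: ge0_ler_powR => //; rewrite ?nnegrE//; lra.
have [x0|x0] := leP 0 x.
  have y0 := le_trans x0 xy.
  rewrite /spow x0 y0 (ger0_norm x0) (ger0_norm y0) distrC.
  rewrite ger0_norm; last by rewrite subr_ge0 mono.
  by rewrite distrC ger0_norm ?subr_ge0//; exact: pos.
have [y0|y0] := leP 0 y; last first.
  rewrite /spow (leNgt 0 x) (leNgt 0 y) x0 y0/= (ltr0_norm x0) (ltr0_norm y0).
  have y0' : 0 <= - y by lra.
  have yx' : - y <= - x by lra.
  have H1 := pos _ _ y0' yx'; have H2 := mono _ _ y0' yx'.
  rewrite -opprD normrN ger0_norm ?subr_ge0// (distrC x).
  rewrite (ger0_norm (_ : 0 <= y - x)) ?subr_ge0//; apply: (le_trans H1).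
  by rewrite [X in _ * X * _]addrC opprK (addrC (- x)).
rewrite /spow (leNgt 0 x) x0/= y0 (ltr0_norm x0) (ger0_norm y0).
rewrite -opprD normrN ger0_norm; last by pos.
rewrite ltr0_norm; last lra.
have E a : 0 <= a -> a `^ (q - 1) = a `^ (q - 2) * a.
  move=> a0; have [->|a1] := eqVneq a 0; first by rewrite mulr0 powR0//; lra.
  rewrite -{3}(powRr1 a0) -powRD; first by congr (_ `^ _); lra.
  by rewrite a1 implybT.
rewrite !E; [|lra..].
set A := (- x) `^ (q - 2); set B := y `^ (q - 2).
have A0 : 0 <= A by exact: powR_ge0.
have B0 : 0 <= B by exact: powR_ge0.
rewrite opprB; apply: (via ((A + B) * (y - x))); first by nra.
by rewrite -mulrA ler_peMl// mulr_ge0 ?subr_ge0// addr_ge0.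
Qed.

(** Each of the three factors is at most their maximum M, and M^q is one of the terms on the
    right. *)
Lemma powR_amgm q a x y : 2 <= q -> 0 <= a -> 0 <= x -> 0 <= y ->
  a `^ (q - 2) * x * y <= a `^ q + x `^ q + y `^ q.
Proof.
move=> q2 a0 x0 y0.
set M := Num.max a (Num.max x y).
have aM : a <= M by rewrite le_max lexx.
have xM : x <= M by rewrite !le_max lexx orbT.
have yM : y <= M by rewrite !le_max lexx !orbT.
have M0 : 0 <= M by apply: le_trans aM.
apply: (via (M `^ q)).
  have [ME|MN0] := eqVneq M 0.
    have -> : x = 0 by apply/le_anti; rewrite x0 -ME xM.
    by rewrite mulr0 mul0r powR_ge0.
  have -> : M `^ q = M `^ (q - 2) * M * M.
    rewrite -mulrA -expr2 -powR_mulrn// -powRD; first by rewrite subrK.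
    by rewrite MN0 implybT.
  apply: ler_pM => //; first by pos.
  apply: ler_pM => //; first exact: powR_ge0.
  by apply: ge0_ler_powR => //; rewrite//; lra.
have : [|| M == a, M == x | M == y].
  by rewrite /M !maxEle; do ![case: ifP => _]; rewrite ?eqxx ?orbT.
by move=> /or3P[] /eqP->; rewrite ?lerDr -?addrA ?lerDl
  ?addr_ge0 ?powR_ge0//; do ?[rewrite addrC -addrA lerDl addr_ge0//; pos];
  rewrite addrCA lerDl addr_ge0//; pos.
Qed.

Definition clip L x : R := Num.max (- L) (Num.min x L).

Lemma clip_bnd L x : 0 <= L -> `|clip L x| <= L.
Proof.
move=> L0; rewrite ler_norml /clip le_max lexx/= ge_max ge_min lexx orbT andbT.
by rewrite (le_trans _ L0)// oppr_le0.
Qed.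

Lemma clip_lip L x y : `|clip L x - clip L y| <= `|x - y|.
Proof.
wlog xy : x y / x <= y.
  move=> H; have [/H//|/ltW/H] := leP x y.
  by rewrite distrC (distrC y).
have E z : clip L z = Num.max (- L) L /\ L <= z \/ clip L z = Num.max (- L) z /\ z <= L.
  by rewrite /clip; have [zL|/ltW zL] := leP z L; [right|left].
have M u : Num.max (- L) u = - L /\ u <= - L \/ Num.max (- L) u = u /\ - L <= u.
  by have [zL|/ltW zL] := leP (- L) u; [right|left].
rewrite (distrC x) (ger0_norm (_ : 0 <= y - x)) ?subr_ge0// ler_norml.
by case: (E x) => -[-> ?]; case: (E y) => -[-> ?];
  case: (M x) => -[Mx ?]; case: (M y) => -[My ?]; case: (M L) => -[ML ?];
  rewrite ?Mx; apply/andP; split; lra.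
Qed.

Lemma clip_sub L x : 0 <= L -> `|x - clip L x| <= `|x|.
Proof.
move=> L0; have [x0|x0] := leP 0 x.
  have c1 : 0 <= clip L x by rewrite /clip le_max le_min x0 L0 orbT.
  have c2 : clip L x <= x.
    by rewrite /clip ge_max ge_min lexx/= (le_trans _ x0)// oppr_le0.
  by rewrite (ger0_norm x0) ger0_norm//; lra.
have c1 : clip L x <= 0 by rewrite /clip ge_max ge_min (ltW x0) oppr_le0 L0.
have c2 : x <= clip L x.
  by rewrite /clip le_max le_min lexx/= (le_trans (ltW x0) L0) orbT.
by rewrite (ltr0_norm x0) ler0_norm//; lra.
Qed.

(** Truncation keeps the sign and shrinks the modulus, so pairing the power of the truncated value
    with the untruncated one only gains. *)
Lemma clip_spow q L x : 0 < L -> 1 <= q -> `|clip L x| `^ q <= spow q (clip L x) * x.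
Proof.
move=> L0 q1; have {}L0' := ltW L0.
have E a : 0 <= a -> a `^ q = a `^ (q - 1) * a.
  move=> a0; have [->|a1] := eqVneq a 0; first by rewrite mulr0 powR0//; lra.
  rewrite -{3}(powRr1 a0) -powRD; first by rewrite subrK.
  by rewrite a1 implybT.
rewrite E//.
have [x0|x0] := leP 0 x.
  have c0 : 0 <= clip L x by rewrite /clip le_max le_min x0 L0' orbT.
  have cx : clip L x <= x by rewrite /clip ge_max ge_min lexx/= (le_trans _ x0)// oppr_le0.
  by rewrite /spow c0 ger0_norm// ler_wpM2l//; pos.
have c0 : clip L x < 0.
  by rewrite /clip gt_max gt_min x0 oppr_lt0 L0.
have cx : x <= clip L x.
  by rewrite /clip le_max le_min lexx/= (le_trans (ltW x0) L0') orbT.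
rewrite (ltr0_norm c0) /spow (leNgt 0) c0/=.
by rewrite mulNr -mulrN ler_wpM2l ?powR_ge0// lerN2.
Qed.

End RealPowers.

Import HBSimple.

(** * Approximation of the remote past by the independent copy *)

Section Tail.
Context {R : realType} {dO : measure_display} {Om : measurableType dO} (P : probability Om R)
  (e : int -> Om -> R) (me : forall i, measT (e i)) (ie : mutually_independent P e).

Local Notation E := (fspace R int).
Local Notation PP := (P \x P)%E.

(** Innovations up to time u are kept, later ones come from the copy: as u tends to minus infinity
    the sequence becomes the copy, independent of the original. *)
Definition past (u : int) (w : Om * Om) : E :=
  mix (fun v => (v <= u)%R) (innov e w.1) (innov e w.2).

Let ma : measT (fun w : Om * Om => innov e w.1).
Proof. exact: (measurableT_comp (meas_innov me) measurable_fst). Qed.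

Let mb : measT (fun w : Om * Om => innov e w.2).
Proof. exact: (measurableT_comp (meas_innov me) measurable_snd). Qed.

Lemma measurable_past u : measT (past u).
Proof. exact: measurable_mix. Qed.

Lemma integral_mix (A : pred int) (F : E -> \bar R) : measT F ->
  (\int[PP]_w F (mix A (innov e w.1) (innov e w.2)) = \int[PP]_w F (innov e w.1))%E.
Proof.
move=> mF.
exact: (@integral_swap _ _ _ _ _ me ie A (F \o fst) (measurableT_comp mF measurable_fst)).
Qed.

Lemma integral_fst (f : Om -> \bar R) : measT f -> (forall w, 0 <= f w)%E ->
  (\int[PP]_w f w.1 = \int[P]_w f w)%E.
Proof.
move=> mf f0; rewrite fubini_tonelli1//=; last meas.
apply: eq_integral => x _; rewrite /fubini_F/= integral_cst//.
transitivity (f x * 1)%E; last exact: mule1.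
by congr (_ * _)%E; exact: probability_setT.
Qed.

(** The event where membership in [B] distinguishes the past kept up to time -N from the full
    copy. *)
Let D (N : nat) (B : set E) : set (Om * Om) :=
  [set w | (B (past (- N%:Z) w) /\ ~ B (innov e w.2)) \/
           (~ B (past (- N%:Z) w) /\ B (innov e w.2))].

Let mpre d d' (Y : measurableType d) (Z : measurableType d') (f : Y -> Z) (B : set Z) :
  measT f -> measurable B -> measurable [set y | B (f y)].
Proof. by move=> mf mB; preimage; exact: mf. Qed.

Let mD N B : measurable B -> measurable (D N B).
Proof.
move=> mB.
have m1 : measurable [set w | B (past (- N%:Z) w)] by apply: mpre => //; exact: measurable_past.
have m2 : measurable [set w : Om * Om | B (innov e w.2)] by exact: mpre.
apply: measurableU; apply: measurableI => //; exact: measurableC.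
Qed.

Let close (B : set E) := measurable B /\ forall eps : R, 0 < eps ->
  exists N0, forall N, (N0 <= N)%N -> (PP (D N B) <= eps%:E)%E.

Let preim_prob (h : Om * Om -> E) (B : set E) : measT h -> (forall F : E -> \bar R, measT F ->
  (\int[PP]_w F (h w) = \int[PP]_w F (innov e w.1))%E) -> measurable B ->
  PP [set w | B (h w)] = P [set w | B (innov e w)].
Proof.
move=> mh H mB.
have := H (EFin \o \1_B) ltac:(exact/measurable_EFinP/measurable_indic).
rewrite (integral_fst (f := fun w => (\1_B (innov e w))%:E)); last 2 first.
- apply/measurable_EFinP; apply: (measurableT_comp (measurable_indic mB)).
  exact: meas_innov.
- by move=> w; rewrite lee_fin.
have -> : (fun x => (EFin \o \1_B) (h x)) = (fun x => (\1_[set w | B (h w)] x : R)%:E).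
  by apply/funext.
have -> : (fun x => (\1_B (innov e x))%:E) = (fun x => (\1_[set w | B (innov e w)] x : R)%:E).
  by apply/funext.
rewrite !integral_indic ?setIT//; apply: mpre => //.
exact: meas_innov.
Qed.

Let prob_past N B : measurable B -> PP [set w | B (past N w)] = P [set w | B (innov e w)].
Proof.
move=> mB; apply: preim_prob => //; first exact: measurable_past.
by move=> F mF; rewrite integral_mix.
Qed.

Lemma integral_snd_swap (F : E -> \bar R) : measT F ->
  (\int[PP]_w F (innov e w.2) = \int[PP]_w F (innov e w.1))%E.
Proof. by move=> mF; rewrite -(integral_mix pred0 mF). Qed.

Let prob_snd B : measurable B -> PP [set w : Om * Om | B (innov e w.2)] = P [set w | B (innov e w)].
Proof. by move=> mB; apply: preim_prob => // F mF; rewrite integral_snd_swap. Qed.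

(** The sets for which the probability of [D N B] vanishes as N grows form a sigma-algebra. It
    contains the cylinders, since coordinate i is read from the copy once -N < i. A countable union
    is cut to finitely many sets; the remainder has the same small probability under both laws. *)
Let close_all B : measurable B -> close B.
Proof.
move: B; apply: smallest_sub; last first.
  move=> _ [i [B [mB ->]]]; split.
    by apply: sub_sigma_algebra; exists i, B.
  move=> eps eps0; exists (`|i|.+1)%N => N iN.
  rewrite (_ : D _ _ = set0) ?measure0 ?ltW//.
  apply/seteqP; split => // w; rewrite /D /= /past /mix.
  rewrite (_ : (i <= - N%:Z)%R = false); first by case=> -[].
  by apply/negbTE; rewrite -ltNge; move: iN; clear; lia.
split.
- split; first meas.
  move=> eps eps0; exists 0%N => N _.
  rewrite (_ : D _ _ = set0) ?measure0 ?ltW//.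
  by apply/seteqP; split => // w [[]|[]].
- move=> B [mB cB]; rewrite setTD; split; first exact: measurableC.
  move=> eps /cB[N0 HN]; exists N0 => N /HN; apply: le_trans.
  apply: le_meas.
  - by apply: mD; exact: measurableC.
  - exact: mD.
  - by move=> w [[h1 h2]|[h1 h2]]; [right|left]; split => //; exact: contrapT.
- move=> F0 cF; pose F : (set E)^nat := F0.
  have mF i : measurable (F i) := (cF i).1.
  change (close (\bigcup_i F i)).
  split; first exact: bigcupT_measurable.
  move=> eps eps0.
  pose G n := \big[setU/set0]_(i < n) F i.
  have mG n : measurable (G n) by exact: bigsetU_measurable.
  pose H n : set E := (\bigcup_i F i) `\` G n.
  have mH n : measurable (H n) by apply: measurableD => //; exact: bigcupT_measurable.
  have [n Hn] : exists n, (P [set w | H n (innov e w)] <= (eps / 4)%:E)%E.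
    pose HH n := [set w | H n (innov e w)].
    have mHH n : measurable (HH n) by apply: mpre => //; exact: meas_innov.
    have : P (HH n) @[n --> \oo] --> P (\bigcap_n HH n).
      apply: nonincreasing_cvg_mu => //.
      - by rewrite (le_lt_trans (probability_le1 _ _))// ltry.
      - exact: bigcapT_measurable.
      - move=> n1 n2 n12; apply/subsetPset => w [? h]; split => // h'; apply: h.
        exact: (subset_bigsetU n12).
    rewrite (_ : \bigcap_n HH n = set0); last first.
      apply/seteqP; split => // w Hw; have [[i _ Fi] _] := Hw 0%N I.
      have [_] := Hw i.+1 I; apply; rewrite /G -bigcup_mkord.
      by exists i => //=.
    rewrite measure0 => /fine_cvgP[_ /cvgrPdist_lt].
    have e4 : 0 < eps / 4 by pos.
    move=> /(_ _ e4)[n0 _ /(_ n0 (leqnn _))]; rewrite /= sub0r normrN => K.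
    have fP : P (HH n0) \is a fin_num by exact: fin_num_measure.
    exists n0; rewrite -/(HH n0) -(fineK fP) lee_fin.
    by rewrite (le_trans (ler_norm _))// ltW.
  have [N0 HN0] : exists N0, forall N i, (N0 <= N)%N -> (i < n)%N ->
    (PP (D N (F i)) <= (eps / 2 / n.+1%:R)%:E)%E.
    have e1 : 0 < eps / 2 / n.+1%:R by pos.
    have /choice[f Hf] : forall i, exists N0, forall N, (N0 <= N)%N ->
      (PP (D N (F i)) <= (eps / 2 / n.+1%:R)%:E)%E.
      by move=> i; have [_ /(_ _ e1)] := cF i.
    exists (\max_(i < n) f i)%N => N i NN ii; apply: Hf.
    by apply: leq_trans NN; exact: (leq_bigmax (Ordinal ii)).
  exists N0 => N NN.
  pose U1 : set (Om * Om) := \big[setU/set0]_(i < n) D N (F i).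
  pose U2 : set (Om * Om) := [set w | H n (past (- N%:Z) w)].
  pose U3 : set (Om * Om) := [set w | H n (innov e w.2)].
  have mU1 : measurable U1 by apply: bigsetU_measurable => i _; exact: mD.
  have mU2 : measurable U2 by apply: mpre => //; exact: measurable_past.
  have mU3 : measurable U3 by exact: mpre.
  have sub : D N (\bigcup_i F i) `<=` U1 `|` (U2 `|` U3).
    move=> w; case: (pselect (U2 w)) => [? _|n2]; first by right; left.
    case: (pselect (U3 w)) => [? _|n3]; first by right; right.
    move=> Hw; left; rewrite /U1 -(bigcup_mkord n (fun i => D N (F i))).
    case: Hw => -[h1 h2].
      have : G n (past (- N%:Z) w) by apply: contrapT => h; apply: n2.
      rewrite /G -bigcup_mkord => -[i /= ii Fi]; exists i => //; left; split => //.
      by move=> Fi'; apply: h2; exists i.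
    have : G n (innov e w.2) by apply: contrapT => h; apply: n3.
    rewrite /G -bigcup_mkord => -[i /= ii Fi]; exists i => //; right; split => //.
    by move=> Fi'; apply: h1; exists i.
  apply: (via (PP (U1 `|` (U2 `|` U3)))).
    apply: le_meas => //; first by apply: mD; exact: bigcupT_measurable.
    by apply: measurableU => //; exact: measurableU.
  apply: (le_trans (measureU2 _ mU1 (measurableU _ _ mU2 mU3))).
  have -> : eps%:E = ((eps / 2)%:E + ((eps / 4)%:E + (eps / 4)%:E))%E.
    by rewrite -!EFinD; congr EFin; field.
  apply: leeD; last first.
    apply: (le_trans (measureU2 _ mU2 mU3)); apply: leeD.
      by apply: le_trans Hn; rewrite -(prob_past (- N%:Z) (mH n)) lexx.
    by apply: le_trans Hn; rewrite -(prob_snd (mH n)) lexx.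
  have : (PP U1 <= \sum_(i < n) PP (D N (F i)))%E.
    by apply: (@Boole_inequality _ _ _ PP (fun i => D N (F i)) n) => i _; exact: mD.
  move=> /le_trans; apply.
  apply: (via (\sum_(i < n) (eps / 2 / n.+1%:R)%:E)%E).
    by apply: lee_sum => i _; exact: HN0.
  rewrite sumEFin lee_fin sumr_const card_ord -[X in X <= _]mulr_natr.
  rewrite mulrAC ler_pdivrMr// ler_wpM2l ?divr_ge0 ?ltW//.
  by rewrite ltr_nat.
Qed.

(** Simple functions reduce the claim to sets; the error of the simple approximation is the same for
    both arguments, because [past] and the copy have the law of the innovations. *)
Lemma past_cvg (g : E -> R) : measT g ->
  intg P (fun w => g (innov e w)) -> forall eps : R, 0 < eps -> exists N0, forall N, (N0 <= N)%N ->
  (\int[PP]_w (`|g (past (- N%:Z) w) - g (innov e w.2)|)%:E <= eps%:E)%E.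
Proof.
move=> mg ig eps eps0.
have mginn : measT (innov e) by exact: meas_innov.
pose mu := pushforward P (innov e).
have igmu : mu.-integrable setT (EFin \o g).
  apply: integrable_pushforward => //; first exact/measurable_EFinP.
  by move: ig; rewrite intgE.
have [g_ [_ _ gcvg]] := approximation_sfun_integrable measurableT igmu.
have e3 : 0 < eps / 3 by rewrite divr_gt0.
have [n Hn] : exists n, (\int[P]_w (`|g (innov e w) - g_ n (innov e w)|)%:E <= (eps / 3)%:E)%E.
  move: gcvg => /fine_cvgP[[n1 _ H1] /cvgrPdist_lt /(_ _ e3)[n2 _ H2]].
  exists (maxn n1 n2).
  have := H1 _ (leq_maxl n1 n2) => /= fin.
  have := H2 _ (leq_maxr n1 n2); rewrite /= sub0r normrN => K.
  have -> : (\int[P]_w (`|g (innov e w) - g_ (maxn n1 n2) (innov e w)|)%:E =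
    \int[mu]_z `|(EFin \o g) z - (g_ (maxn n1 n2) z)%:E|)%E.
    rewrite ge0_integral_pushforward//.
    by apply/measurable_EFinP; apply: measurableT_comp => //; exact: measurable_funB.
  rewrite -[leLHS]fineK// lee_fin.
  by rewrite (le_trans (ler_norm _))// ltW.
pose s := g_ n.
have ms : measT s by [].
have [N0 HN0] : exists N0, forall N, (N0 <= N)%N ->
  (\int[PP]_w (`|s (past (- N%:Z) w) - s (innov e w.2)|)%:E <= (eps / 3)%:E)%E.
  pose r := (finmap.enum_fset (fset_set (range s))).
  pose B y := s @^-1` [set y].
  have mB y : measurable (B y) by rewrite /B; exact: measurable_funPTI.
  have sE z : s z = \sum_(y <- r) y * \1_(B y) z by rewrite fimfunE fsbig_finite.
  pose M := \sum_(y <- r) `|y| + 1.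
  have M0 : 0 < M by rewrite ltr_pwDr// sumr_ge0.
  have eM : 0 < eps / 3 / M by rewrite !divr_gt0.
  have /choice[f Hf] : forall y : R, exists N0, forall N, (N0 <= N)%N ->
    (PP (D N (B y)) <= (eps / 3 / M)%:E)%E.
    by move=> y; have [_ /(_ _ eM)] := close_all (mB y).
  exists (\max_(y <- r) f y)%N => N NN.
  apply: (via (\int[PP]_w (\sum_(y <- r) `|y| * \1_(D N (B y)) w)%:E)%E).
    apply: ge0_le_integral => //.
    - apply/measurable_EFinP; apply: measurableT_comp => //; apply: measurable_funB.
        exact: (measurableT_comp ms (measurable_past _)).
      exact: (measurableT_comp ms mb).
    - apply/measurable_EFinP; apply: measurable_sum => y; apply: measurable_funM => //.
      by apply: measurable_indic; exact: mD.
    - move=> w _; rewrite lee_fin !sE -sumrB.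
      apply: (le_trans (ler_norm_sum _ _ _)); apply: ler_sum => y _.
      rewrite -mulrBr normrM ler_wpM2l// !indicE.
      have [h1|h1] := pselect (B y (past (- N%:Z) w)); have [h2|h2] := pselect (B y (innov e w.2)).
      + by rewrite !(mem_set (A := B y))// subrr normr0.
      + rewrite (mem_set (A := B y) h1) (memNset (A := B y) h2) subr0 normr1.
        by rewrite mem_set//; left.
      + rewrite (memNset (A := B y) h1) (mem_set (A := B y) h2) sub0r normrN normr1.
        by rewrite mem_set//; right.
      + by rewrite !(memNset (A := B y))// subrr normr0.
  under eq_integral do rewrite -sumEFin.
  rewrite ge0_integral_sum//; last first.
    move=> y; apply/measurable_EFinP; apply: measurable_funM => //.
    by apply: measurable_indic; exact: mD.
  apply: (via (\sum_(y <- r) (`|y| * (eps / 3 / M))%:E)%E).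
    rewrite big_seq [leRHS]big_seq; apply: lee_sum => y yr.
    under eq_integral do rewrite EFinM.
    rewrite ge0_integralZl_EFin//; last first.
      by apply/measurable_EFinP/measurable_indic; exact: mD.
    rewrite integral_indic ?setIT//; last exact: mD.
    rewrite EFinM lee_wpmul2l// ?lee_fin//; apply: Hf.
    by apply: leq_trans NN; exact: leq_bigmax_seq.
  rewrite sumEFin lee_fin -mulr_suml mulrA ler_pdivrMr// mulrC ler_wpM2l ?ltW//.
  by rewrite /M ltrDl.
exists N0 => N NN.
have mgs : measT (fun f : E => (`|g f - s f|)%:E).
  by apply/measurable_EFinP; apply: measurableT_comp => //; exact: measurable_funB.
have mm : measT (fun w : Om * Om => past (- N%:Z) w) by exact: measurable_past.
have K : (\int[PP]_w (`|g (innov e w.1) - s (innov e w.1)|)%:E <= (eps / 3)%:E)%E.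
  rewrite (integral_fst (f := fun w => (`|g (innov e w) - s (innov e w)|)%:E))//.
  exact: (measurableT_comp mgs mginn).
apply: (via (\int[PP]_w ((`|g (past (- N%:Z) w) - s (past (- N%:Z) w)|)%:E +
  ((`|s (past (- N%:Z) w) - s (innov e w.2)|)%:E + (`|g (innov e w.2) - s (innov e w.2)|)%:E)))%E).
  apply: ge0_le_integral => //.
  - apply/measurable_EFinP; apply: measurableT_comp => //; apply: measurable_funB.
      exact: (measurableT_comp mg mm).
    exact: (measurableT_comp mg mb).
  - apply: emeasurable_funD; first exact: (measurableT_comp mgs mm).
    apply: emeasurable_funD; last exact: (measurableT_comp mgs mb).
    by meas.
  - move=> w _; rewrite -!EFinD lee_fin.
    set a := g (past _ w); set b := s (past _ w); set c := s _; set d := g _.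
    have -> : a - d = (a - b) + ((b - c) + (c - d)) by ring.
    rewrite (distrC d); apply: (le_trans (ler_normD _ _)); rewrite lerD2l.
    exact: ler_normD.
have m1 := measurableT_comp mgs mm; have m3 := measurableT_comp mgs mb.
have m2 : measT (fun w => (`|s (past (- N%:Z) w) - s (innov e w.2)|)%:E).
  by meas.
rewrite (ge0_integralD _ measurableT _ m1 _ (emeasurable_funD m2 m3))//.
rewrite (ge0_integralD _ measurableT _ m2 _ m3)//.
rewrite (integral_mix _ mgs) (integral_snd_swap mgs).
have -> : eps%:E = ((eps / 3)%:E + ((eps / 3)%:E + (eps / 3)%:E))%E.
  by rewrite -!EFinD; congr EFin; field.
apply: leeD => //; last by apply: leeD => //; exact: HN0.
all: by move=> w _ /=; rewrite -?EFinD lee_fin//; pos.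
Qed.

End Tail.

(** * Expectations on product spaces *)

Section ProductExpectation.
Context {R : realType} {d1 d2 : measure_display} {X1 : measurableType d1} {X2 : measurableType d2}
  (P1 : probability X1 R) (P2 : probability X2 R).
Local Notation PP := (P1 \x P2)%E.

Lemma Ex_fubini (F : X1 * X2 -> R) : intg PP F -> (forall x, intg P2 (fun y => F (x, y))) ->
  Ex PP F = Ex P1 (fun x => Ex P2 (fun y => F (x, y))).
Proof.
rewrite intgE => iF i2; rewrite !ExE0 /Rintegral -(integral12_prod_meas1 iF).
congr fine; apply: eq_integral => x _; rewrite /fubini_F /= ExE0 fineK//.
by apply: integrable_fin_num => //; have := i2 x; rewrite intgE.
Qed.

Lemma Ex_fubini2 (F : X1 * X2 -> R) : intg PP F -> (forall y, intg P1 (fun x => F (x, y))) ->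
  Ex PP F = Ex P2 (fun y => Ex P1 (fun x => F (x, y))).
Proof.
rewrite intgE => iF i2; rewrite !ExE0 /Rintegral -(integral21_prod_meas1 iF).
congr fine; apply: eq_integral => x _; rewrite /fubini_G /= ExE0 fineK//.
by apply: integrable_fin_num => //; have := i2 x; rewrite intgE.
Qed.

Lemma intg_prod (f : X1 -> R) (g : X2 -> R) : intg P1 f -> intg P2 g ->
  intg PP (fun w => f w.1 * g w.2).
Proof.
move=> fi gi; have mf := intg_meas fi; have mg := intg_meas gi.
rewrite intgE; apply/integrableP; split.
  apply/measurable_EFinP/measurable_funM.
    by meas.
  by meas.
rewrite fubini_tonelli1//=; last first.
  by meas.
rewrite /fubini_F /=.
under eq_integral => x _.
  under eq_integral => y _ do rewrite normrM EFinM.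
  rewrite ge0_integralZl_EFin//; last first.
    by meas.
  rewrite ExE; last exact: intg_abs.
  rewrite -EFinM mulrC EFinM; over.
rewrite ge0_integralZl_EFin//; last 2 first.
- by meas.
- exact: Ex_ge0.
by rewrite ExE; [rewrite -EFinM ltry|exact: intg_abs].
Qed.

Lemma Ex_prod (f : X1 -> R) (g : X2 -> R) : intg P1 f -> intg P2 g ->
  Ex PP (fun w => f w.1 * g w.2) = Ex P1 f * Ex P2 g.
Proof.
move=> fi gi; rewrite Ex_fubini//=; last 2 first.
- exact: intg_prod.
- by move=> x; exact: intgZ.
under eq_fun => x do rewrite ExZ// mulrC.
by rewrite ExZ// mulrC.
Qed.

Lemma intg_fst (f : X1 -> R) : intg P1 f -> intg PP (fun w => f w.1).
Proof.
move=> fi; have := intg_prod fi (intg_cst P2 1).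
by under eq_fun do rewrite mulr1.
Qed.

Lemma Ex_fst (f : X1 -> R) : intg P1 f -> Ex PP (fun w => f w.1) = Ex P1 f.
Proof.
move=> fi; have := Ex_prod fi (intg_cst P2 1).
by rewrite Ex_cst mulr1; under eq_fun do rewrite mulr1.
Qed.

Lemma intg_snd (f : X2 -> R) : intg P2 f -> intg PP (fun w => f w.2).
Proof.
move=> fi; have := intg_prod (intg_cst P1 1) fi.
by under eq_fun do rewrite mul1r.
Qed.

End ProductExpectation.

(** * Removal of truncation *)

Section TruncatedPowers.
Context {R : realType} {d : measure_display} {X : measurableType d}.

Lemma measurable_clip (L : R) (f : X -> R) : measT f -> measT (fun x => clip L (f x)).
Proof. by move=> mf; apply: measurable_maxr => //; exact: measurable_minr. Qed.

Lemma measurable_spow (q : R) (f : X -> R) : measT f -> measT (fun x => spow q (f x)).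
Proof.
move=> mf; apply: (measurableT_comp (f := spow q)) => //.
apply: measurable_fun_ifT => //.
- exact: measurable_fun_ler.
- by meas.
Qed.

Lemma clip_abs (L x : R) : 0 <= L -> `|clip L x| = Num.min `|x| L.
Proof.
move=> L0; rewrite /clip; have [x0|x0] := leP 0 x.
  rewrite max_r ?le_min ?(le_trans _ x0) ?oppr_le0//.
    by rewrite !ger0_norm ?le_min ?x0.
  by rewrite /= (le_trans _ L0)// oppr_le0.
rewrite min_l ?(le_trans (ltW x0))//.
have [Lx|xL] := leP (- L) x.
  by rewrite ltr0_norm// min_l// lerNl.
by rewrite normrN ger0_norm// min_r// ler0_norm ?(ltW x0)// lerNr ltW.
Qed.

(** Monotone convergence along the truncation levels n + 1: a bound uniform in the level bounds the
    full moment, integrability included. *)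
Lemma intg_clip_pow (P : probability X R) (q c : R) (f : X -> R) : 0 < q -> measT f ->
  (forall L, 0 < L -> Ex P (fun x => `|clip L (f x)| `^ q) <= c) ->
  intg P (fun x => `|f x| `^ q) /\ Ex P (fun x => `|f x| `^ q) <= c.
Proof.
move=> q0 mf H.
have mg n : measT (fun x => `|clip n.+1%:R (f x)| `^ q).
  by apply: measurable_pow; apply: measurable_abs; exact: measurable_clip.
apply: intg_ge0.
- by meas.
- by move=> x; exact: powR_ge0.
pose g (n : nat) x := (`|clip n.+1%:R (f x)| `^ q)%:E.
have gmono w n1 n2 : (n1 <= n2)%N -> (g n1 w <= g n2 w)%E.
  move=> n12; rewrite lee_fin; apply: ge0_ler_powR; rewrite ?(ltW q0)//.
  rewrite !clip_abs// le_min ge_min lexx/= ge_min; apply/orP; right.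
  by rewrite ler_nat.
have -> : (\int[P]_w (`|f w| `^ q)%:E = \int[P]_w limn (g ^~ w))%E.
  apply: eq_integral => w _; apply/esym/cvg_lim => //.
  apply: cvg_near_cst; near=> n.
  congr (_ `^ _)%:E; rewrite clip_abs// min_l//.
  have nf : `|f w| <= n%:R by near: n; exact: nbhs_infty_ger.
  by rewrite (le_trans nf)// ler_nat.
rewrite monotone_convergence//; last 3 first.
- by move=> n; apply/measurable_EFinP; exact: mg.
- by move=> n w _; rewrite lee_fin powR_ge0.
- by move=> w _ n1 n2; exact: gmono.
apply: lime_le.
  apply: ereal_nondecreasing_is_cvgn => n1 n2 n12; apply: ge0_le_integral => //.
  - by move=> w _; rewrite lee_fin powR_ge0.
  - by apply/measurable_EFinP; exact: mg.
  - by apply/measurable_EFinP; by meas.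
  - by move=> w _; exact: gmono.
apply: nearW => n; rewrite ExE; first by rewrite lee_fin; apply: H.
apply: (@intg_bnd _ _ _ _ _ (n.+1%:R `^ q)) => // w.
rewrite ger0_norm//; apply: ge0_ler_powR; rewrite ?nnegrE ?(ltW q0)//.
by apply: clip_bnd.
Unshelve. all: by end_near. Qed.

End TruncatedPowers.

(** * Replacing one innovation by its copy *)

Section EfronStein.
Context {R : realType} {dO : measure_display} {Om : measurableType dO} (P : probability Om R)
  (e : int -> Om -> R) (me : forall i, measT (e i)) (ie : mutually_independent P e).

Local Notation E := (fspace R int).
Local Notation PP := (P \x P)%E.

Definition resample (u : int) (w : Om * Om) : E :=
  mix (fun v => v != u) (innov e w.1) (innov e w.2).

Let ma : measT (fun w : Om * Om => innov e w.1).
Proof. exact: (measurableT_comp (meas_innov me) measurable_fst). Qed.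

Let mb : measT (fun w : Om * Om => innov e w.2).
Proof. exact: (measurableT_comp (meas_innov me) measurable_snd). Qed.

Lemma measurable_resample u : measT (resample u).
Proof. exact: measurable_mix. Qed.

Lemma Ex_swap (A : pred int) (F : E * E -> R) : measT F ->
  Ex PP (fun w => F (mix A (innov e w.1) (innov e w.2), mix A (innov e w.2) (innov e w.1)))
  = Ex PP (fun w => F (innov e w.1, innov e w.2)).
Proof.
move=> mF; rewrite !ExE0 /Rintegral; congr fine.
apply: (@integral_swap _ _ _ _ _ me ie A (EFin \o F)).
exact/measurable_EFinP.
Qed.

Lemma intg_swap (A : pred int) (F : E * E -> R) : measT F ->
  intg PP (fun w => F (innov e w.1, innov e w.2)) ->
  intg PP (fun w => F (mix A (innov e w.1) (innov e w.2), mix A (innov e w.2) (innov e w.1))).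
Proof.
rewrite !intgE => mF /integrableP[mi fi]; apply/integrableP; split.
  apply/measurable_EFinP; apply: (measurableT_comp mF).
  by apply/measurable_fun_pairP; split; exact: measurable_mix.
rewrite (@integral_swap _ _ _ _ _ me ie A (fun x => `|(F x)%:E|%E))//.
by meas.
Qed.

Lemma Ex_mix (A : pred int) (F : E -> R) : measT F ->
  Ex PP (fun w => F (mix A (innov e w.1) (innov e w.2))) = Ex PP (fun w => F (innov e w.1)).
Proof. by move=> mF; exact: (Ex_swap A (measurableT_comp mF measurable_fst)). Qed.

Lemma intg_mix (A : pred int) (F : E -> R) : measT F -> intg PP (fun w => F (innov e w.1)) ->
  intg PP (fun w => F (mix A (innov e w.1) (innov e w.2))).
Proof. by move=> mF; exact: (intg_swap A (measurableT_comp mF measurable_fst)). Qed.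

(** In [past e u] the copy occupies every time after u; replacing time u as well moves the cut to u
    - 1. *)
Lemma resample_past u (w : Om * Om) :
  mix (fun v => v != u) (past e u w) (mix (fun v => v <= u)%R (innov e w.2) (innov e w.1))
  = past e (u - 1) w.
Proof.
apply/funext => v; rewrite /past /mix.
have [->|vu] := eqVneq v u; first by rewrite lexx lerBrDl -lerBrDr subrr.
have -> : (v <= u - 1)%R = (v <= u)%R by move/eqP: vu => vu; apply/idP/idP; lia.
by [].
Qed.

(** Exchanging the innovations of the single time u between the two sequences interchanges
    [past e u] and [past e (u - 1)]. The increments of covariances below are estimated through this
    antisymmetry. *)
Lemma past_swap u (w : Om * Om) :
  mix (fun v => v <= u)%R (mix (fun v => v != u) (innov e w.1) (innov e w.2))
  (mix (fun v => v != u) (innov e w.2) (innov e w.1)) = past e (u - 1) w.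
Proof.
apply/funext => v; rewrite /past /mix.
have [->|vu] := eqVneq v u; first by rewrite lexx lerBrDl -lerBrDr subrr.
have -> : (v <= u - 1)%R = (v <= u)%R by move/eqP: vu => vu; apply/idP/idP; lia.
by [].
Qed.

Lemma past_swap1 u (w : Om * Om) :
  mix (fun v => v <= u - 1)%R (mix (fun v => v != u) (innov e w.1) (innov e w.2))
  (mix (fun v => v != u) (innov e w.2) (innov e w.1)) = past e u w.
Proof.
apply/funext => v; rewrite /past /mix.
have [->|vu] := eqVneq v u; first by rewrite lexx lerBrDl -lerBrDr subrr.
have -> : (v <= u - 1)%R = (v <= u)%R by move/eqP: vu => vu; apply/idP/idP; lia.
by [].
Qed.

(** Exchanging all times after u carries the pair (original, resampled at u) to the pair
    ([past e u], [past e (u - 1)]), so the two differences have the same law. *)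
Lemma past_diff (q c : R) (u : int) (S : E -> R) : measT S ->
  intg PP (fun w => (`|S (innov e w.1) - S (resample u w)| / c) `^ q) ->
  intg PP (fun w => (`|S (past e u w) - S (past e (u - 1) w)| / c) `^ q) /\
  Ex PP (fun w => (`|S (past e u w) - S (past e (u - 1) w)| / c) `^ q) =
  Ex PP (fun w => (`|S (innov e w.1) - S (resample u w)| / c) `^ q).
Proof.
move=> mS iS.
pose F (x : E * E) := (`|S x.1 - S (mix (fun v => v != u) x.1 x.2)| / c) `^ q.
have mF : measT F.
  apply: measurable_pow; apply: measurable_funM => //; apply: measurable_abs.
  apply: measurable_funB; first exact: measurableT_comp.
  by apply: (measurableT_comp mS); apply: measurable_mix.
have H := intg_swap (fun v => v <= u)%R mF iS.
have H' := Ex_swap (fun v => v <= u)%R mF.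
rewrite /F/= in H, H'.
by under eq_fun => w do rewrite -resample_past; split.
Qed.

(** The past kept up to a remote time is close in L1 to the copy, which is independent of the first
    sequence and where the expectation of [S] vanishes. *)
Lemma Ex_past0 (f S : E -> R) (c : R) : measT S -> measT f ->
  (forall x, `|f x| <= c) -> 0 < c -> intg P (fun w => S (innov e w)) ->
  Ex P (fun w => S (innov e w)) = 0 -> forall eps : R, 0 < eps -> exists N0, forall N, (N0 <= N)%N ->
  `|Ex PP (fun w => f (innov e w.1) * S (past e (- N%:Z) w))| <= eps.
Proof.
move=> mS mf fc c0 iS ES eps eps0.
have ec : 0 < eps / c by pos.
have [N0 HN0] := past_cvg me ie mS iS ec.
exists N0 => N /HN0 H.
have iSa : intg PP (fun w => S (innov e w.1)) by exact: (intg_fst P iS).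
have iSb : intg PP (fun w => S (innov e w.2)) by exact: (intg_snd P iS).
have iSp : intg PP (fun w => S (past e (- N%:Z) w)) by exact: intg_mix.
have mfa : measT (fun w : Om * Om => f (innov e w.1)).
  by meas.
have iD := intgB iSp iSb.
have ifD := intg_bndM mfa (fun w => fc (innov e w.1)) iD.
have ifb := intg_bndM mfa (fun w => fc (innov e w.1)) iSb.
have -> : Ex PP (fun w => f (innov e w.1) * S (past e (- N%:Z) w)) =
  Ex PP (fun w => f (innov e w.1) * (S (past e (- N%:Z) w) - S (innov e w.2)))
  + Ex PP (fun w => f (innov e w.1) * S (innov e w.2)).
  by rewrite -ExD//; congr Ex; apply/funext => w; ring.
have -> : Ex PP (fun w => f (innov e w.1) * S (innov e w.2)) = 0.
  have ifP : intg P (fun w => f (innov e w)).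
    by apply: (@intg_bnd _ _ _ _ _ c) => //; exact: (measurableT_comp mf (meas_innov me)).
  by rewrite (Ex_prod ifP iS) ES mulr0.
rewrite addr0.
have iA := intg_abs iD.
apply: (via (Ex PP (fun w => c * `|S (past e (- N%:Z) w) - S (innov e w.2)|))).
  by apply: Ex_absle => //; [exact: intgZ|move=> w; rewrite normrM ler_wpM2r].
rewrite ExZ// -ler_pdivlMl// mulrC -lee_fin -ExE//.
Qed.

End EfronStein.

(** * Arithmetic of the Efron-Stein step *)

Section EfronSteinArithmetic.
Context {R : realType}.

Lemma es_ar1 (x y : R) : x <= 1 -> y + y + 2 * (x + x) <= 2 * (y + 2).
Proof. by lra. Qed.

Lemma es_ar2 (x y z : R) : x <= x / 2 + y + z / 2 -> x <= 2 * y + z.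
Proof. by lra. Qed.

Lemma es_ar3 (t : int) (N : nat) : t - (absz (t + (N + `|t|)%N%:Z))%:Z = - (N + `|t|)%N%:Z.
Proof. by lia. Qed.

(** [powR_amgm] applied to a/s, x/d and y/d: each factor is measured in its own unit, so that
    normalised moments can be inserted. *)
Lemma es_key (q s d a x y : R) : 2 <= q -> 0 < s -> 0 < d -> 0 <= a -> 0 <= x -> 0 <= y ->
  a `^ (q - 2) * (x * y) <=
  s `^ (q - 2) * (d * (d * ((a / s) `^ q + ((x / d) `^ q + (y / d) `^ q)))).
Proof.
move=> q2 s0 d0 a0 x0 y0.
have as0 : 0 <= a / s by rewrite divr_ge0// ltW.
have xd0 : 0 <= x / d by pos.
have yd0 : 0 <= y / d by pos.
have := powR_amgm q2 as0 xd0 yd0.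
have -> : a `^ (q - 2) * (x * y) = s `^ (q - 2) * (d * (d *
  ((a / s) `^ (q - 2) * (x / d) * (y / d)))).
  rewrite powR_div ?(ltW s0)//.
  have sq0 : 0 < s `^ (q - 2) by pos.
  move: (s `^ _) sq0 (a `^ _) => t t0 A.
  by field; rewrite !lt0r_neq0.
move=> H; rewrite ler_wpM2l ?powR_ge0// !(ler_wpM2l (ltW d0))//.
by rewrite addrA.
Qed.

Lemma es_key2 (q s d a b x y : R) : 2 <= q -> 0 < s -> 0 < d -> 0 <= a -> 0 <= b ->
  0 <= x -> 0 <= y -> (q - 1) * (a `^ (q - 2) + b `^ (q - 2)) * x * y <=
  (q - 1) * (s `^ (q - 2) * d ^+ 2) *
  ((a / s) `^ q + (b / s) `^ q + 2 * ((x / d) `^ q + (y / d) `^ q)).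
Proof.
move=> q2 s0 d0 a0 b0 x0 y0.
have k1 := es_key q2 s0 d0 a0 x0 y0; have k2 := es_key q2 s0 d0 b0 x0 y0.
rewrite -!mulrA ler_wpM2l//; first lra.
rewrite mulrDl; apply: (le_trans (lerD k1 k2)).
rewrite -!mulrDr ler_wpM2l ?powR_ge0// !(ler_wpM2l (ltW d0))//.
by apply: eq_ler; ring.
Qed.

End EfronSteinArithmetic.

(** * The Efron-Stein moment inequality of order q *)

Section EfronSteinInequality.
Context {R : realType} {dO : measure_display} {Om : measurableType dO} (P : probability Om R)
  (e : int -> Om -> R) (me : forall i, measT (e i)) (ie : mutually_independent P e).

Local Notation E := (fspace R int).
Local Notation PP := (P \x P)%E.

Let ma : measT (fun w : Om * Om => innov e w.1).
Proof. exact: (measurableT_comp (meas_innov me) measurable_fst). Qed.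
Context (S : E -> R) (q D : R) (t0 : int) (d : nat -> R) (q2 : 2 <= q) (mS : measT S)
  (adS : forall x y, S (mix (fun v => v <= t0)%R x y) = S x) (iS : intg P (fun w => S (innov e w)))
  (ES : Ex P (fun w => S (innov e w)) = 0) (d0 : forall k, 0 < d k)
  (iSd : forall k, intg PP (fun w => (`|S (innov e w.1) - S (resample e (t0 - k%:Z) w)| / d k) `^ q))
  (ESd : forall k, Ex PP (fun w => (`|S (innov e w.1) - S (resample e (t0 - k%:Z) w)| / d k) `^ q) <= 1)
  (D0 : 0 < D) (dD : forall n, \sum_(k < n) d k ^+ 2 <= D).

Section Truncation.
Context (L : R) (L0 : 0 < L).

Let phi (x : E) : R := spow q (clip L (S x)).
Let c (x : E) : R := `|clip L (S x)|.
(** The square 2 (q - 1) D is chosen so that (q - 1) sg^(q-2) D equals sg^q / 2: half of the moment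
    [I0] is then absorbed by the left-hand side. *)
Let sg := Num.sqrt (2 * (q - 1) * D).
Let I0 := Ex PP (fun w => c (innov e w.1) `^ q).
(** [f 0] dominates the truncated moment [I0], and [f n] tends to 0 because [S] is centred; each
    increment isolates one innovation. *)
Let f (k : nat) := Ex PP (fun w => phi (innov e w.1) * S (past e (t0 - k%:Z) w)).

Let q1 : 0 < q - 1. Proof. by rewrite subr_gt0 (lt_le_trans _ q2)// ltr1n. Qed.

Let q0 : 0 <= q. Proof. exact: le_trans q2. Qed.

Let sg2 : sg ^+ 2 = 2 * (q - 1) * D.
Proof. by rewrite sqr_sqrtr// mulr_ge0 ?(ltW D0)// mulr_ge0 ?(ltW q1). Qed.

Let sg0 : 0 < sg.
Proof. by rewrite sqrtr_gt0 mulr_gt0// mulr_gt0. Qed.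

Let mphi : measT phi.
Proof. by apply: measurable_spow; exact: measurable_clip. Qed.

Let phiB x : `|phi x| <= L `^ (q - 1).
Proof.
rewrite /phi spow_norm; apply: ge0_ler_powR; rewrite ?nnegrE ?(ltW q1) ?(ltW L0)//.
by apply: clip_bnd; exact: ltW.
Qed.

Let mc : measT c.
Proof. by apply: measurable_abs; exact: measurable_clip. Qed.

Let cB x : c x <= L. Proof. by apply: clip_bnd; exact: ltW. Qed.

Let c0 x : 0 <= c x. Proof. exact: normr_ge0. Qed.

Let icq : forall h : Om * Om -> E, measT h -> intg PP (fun w => (c (h w) / sg) `^ q).
Proof.
move=> h mh; apply: (@intg_bnd _ _ _ _ _ ((L / sg) `^ q)).
  by meas.
move=> w; rewrite ger0_norm ?powR_ge0//; apply: ge0_ler_powR; rewrite ?nnegrE//.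
- by pos.
- by pos.
- by rewrite ler_wpM2r//; pos.
Qed.

Let EI0 : Ex PP (fun w => (c (innov e w.1) / sg) `^ q) = I0 / sg `^ q.
Proof.
have ii : intg PP (fun w => c (innov e w.1) `^ q).
  apply: (@intg_bnd _ _ _ _ _ (L `^ q)).
    by meas.
  move=> w; rewrite ger0_norm ?powR_ge0//; apply: ge0_ler_powR; rewrite ?nnegrE//.
  exact: ltW.
rewrite mulrC /I0 -ExZ//; congr Ex; apply/funext => w.
by rewrite powR_div ?(ltW sg0)// mulrC.
Qed.

Let iphiS (h : Om * Om -> E) : measT h -> intg PP (fun w => S (h w)) ->
  intg PP (fun w => phi (innov e w.1) * S (h w)).
Proof.
move=> mh ih; apply: (intg_bndM _ _ ih); first meas.
by move=> w; exact: phiB.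
Qed.

Let iSa : intg PP (fun w => S (innov e w.1)). Proof. exact: (intg_fst P iS). Qed.

Let iSp u : intg PP (fun w => S (past e u w)).
Proof. exact: (intg_mix me ie _ mS iSa). Qed.

(** By the exchange at time u the increment is half the expectation of a product of two differences,
    one of [phi] and one of [S]; the Lipschitz bound of the signed power then produces the square of
    [d k]. *)
Let step (k : nat) : f k - f k.+1 <= (q - 1) * (sg `^ (q - 2) * d k ^+ 2) * (I0 / sg `^ q + 2).
Proof.
pose u := t0 - k%:Z.
have uE : t0 - k.+1%:Z = u - 1 by rewrite /u; lia.
pose F (x : E * E) := phi x.1 * (S (mix (fun v => v <= u)%R x.1 x.2)
  - S (mix (fun v => v <= u - 1)%R x.1 x.2)).
have m1 : measT (fun x : E * E => x.1) by exact: measurable_fst.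
have m2 : measT (fun x : E * E => x.2) by exact: measurable_snd.
have mF : measT F.
  apply: measurable_funM; first exact: (measurableT_comp mphi m1).
  apply: measurable_funB; apply: (measurableT_comp mS); exact: measurable_mix.
have i1 : intg PP (fun w => phi (innov e w.1) * S (past e u w)).
  by apply: iphiS => //; exact: measurable_past.
have i2 : intg PP (fun w => phi (innov e w.1) * S (past e (u - 1) w)).
  by apply: iphiS => //; exact: measurable_past.
have fE : f k - f k.+1 = Ex PP (fun w => F (innov e w.1, innov e w.2)).
  rewrite /f uE -ExB//; congr Ex; apply/funext => w.
  by rewrite /F /= mulrBr.
have iF : intg PP (fun w => F (innov e w.1, innov e w.2)).
  rewrite (_ : (fun w => _) = (fun w => phi (innov e w.1) * S (past e u w)
    - phi (innov e w.1) * S (past e (u - 1) w))); first exact: intgB.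
  by apply/funext => w; rewrite /F /= mulrBr.
have iF' := intg_swap me ie (fun v => v != u) mF iF.
have EF' := Ex_swap me ie (fun v => v != u) mF.
pose X w := S (innov e w.1) - S (resample e u w).
pose Y w := S (past e u w) - S (past e (u - 1) w).
pose G w := phi (innov e w.1) - phi (resample e u w).
(* The increment is added to its image under the exchange at u: there the difference of [S] changes
   sign and [phi] is taken at the resampled point. *)
have EFG : 2 * (f k - f k.+1) = Ex PP (fun w => G w * Y w).
  rewrite mulr2n mulrDl mul1r fE -{2}EF' -ExD//; congr Ex; apply/funext => w.
  rewrite /F /= past_swap past_swap1 -/(resample e u w) /G /Y /past.
  by ring.
have iGY : intg PP (fun w => G w * Y w).
  rewrite (_ : (fun w => _) = (fun w => F (innov e w.1, innov e w.2) +
    F (mix (fun v => v != u) (innov e w.1) (innov e w.2),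
    mix (fun v => v != u) (innov e w.2) (innov e w.1)))); first exact: intgD.
  apply/funext => w.
  rewrite /F /= past_swap past_swap1 -/(resample e u w) /G /Y /past.
  by ring.
have [iY EY] := past_diff me ie mS (iSd k).
pose B w := (q - 1) * (sg `^ (q - 2) * d k ^+ 2) *
  ((c (innov e w.1) / sg) `^ q + (c (resample e u w) / sg) `^ q +
  2 * ((`|X w| / d k) `^ q + (`|Y w| / d k) `^ q)).
have j1 := icq ma.
have j2 := icq (measurable_resample me u).
have iB : intg PP B.
  apply: intgZ; apply: intgD; first exact: intgD.
  by apply: intgZ; apply: intgD; [exact: iSd|exact: iY].
have EB : Ex PP B <= 2 * ((q - 1) * (sg `^ (q - 2) * d k ^+ 2) * (I0 / sg `^ q + 2)).
  have K0 : 0 <= (q - 1) * (sg `^ (q - 2) * d k ^+ 2).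
    by rewrite mulr_ge0 ?(ltW q1)// mulr_ge0//; pos.
  rewrite mulrCA [X in X <= _]ExZ; last first.
    apply: intgD; first exact: intgD.
    by apply: intgZ; apply: intgD; [exact: iSd|exact: iY].
  rewrite ler_wpM2l// ExD; last 2 first.
  - exact: intgD.
  - by apply: intgZ; apply: intgD; [exact: iSd|exact: iY].
  rewrite ExD// ExZ; last by apply: intgD; [exact: iSd|exact: iY].
  rewrite ExD; [|exact: iSd|exact: iY].
  have -> : Ex PP (fun w => (c (resample e u w) / sg) `^ q) =
    Ex PP (fun w => (c (innov e w.1) / sg) `^ q).
    apply: (Ex_mix me ie (fun v => v != u) (F := fun x => (c x / sg) `^ q)).
    by meas.
  rewrite EI0 /Y EY; have := ESd k; rewrite -/u -/X => H.
  exact: es_ar1.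
have GY w : `|G w * Y w| <= B w.
  rewrite normrM.
  apply: (via ((q - 1) * (c (innov e w.1) `^ (q - 2) + c (resample e u w) `^ (q - 2))
    * `|X w| * `|Y w|)).
    rewrite ler_wpM2r//; apply: (le_trans (spow_lip _ _ q2)).
    rewrite ler_wpM2l ?clip_lip// mulr_ge0 ?(ltW q1)// addr_ge0//; pos.
  exact: (es_key2 q2 sg0 (d0 k) (c0 _) (c0 _) (normr_ge0 _) (normr_ge0 _)).
have H := Ex_absle iGY iB GY.
have := le_trans (ler_norm _) (le_trans H EB); rewrite -EFG.
by rewrite ler_pM2l.
Qed.

Let telescope n : f 0 - f n <= (q - 1) * sg `^ (q - 2) * D * (I0 / sg `^ q + 2).
Proof.
have -> : f 0 - f n = \sum_(k < n) (f k - f k.+1).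
  elim: n => [|n IH]; first by rewrite big_ord0 subrr.
  by rewrite big_ord_recr/= -IH; ring.
have I00 : 0 <= I0 / sg `^ q + 2.
  rewrite addr_ge0// divr_ge0 ?powR_ge0//.
  by apply: Ex_ge0 => w; exact: powR_ge0.
apply: (via (\sum_(k < n) ((q - 1) * sg `^ (q - 2) * (I0 / sg `^ q + 2)) * d k ^+ 2)).
  by apply: ler_sum => k _; apply: (le_trans (step k)); apply: eq_ler; ring.
rewrite -mulr_sumr [leRHS]mulrAC ler_wpM2l//.
by rewrite mulr_ge0// mulr_ge0 ?powR_ge0 ?(ltW q1).
Qed.

Let I0le : I0 <= f 0.
Proof.
have f0E : f 0 = Ex PP (fun w => phi (innov e w.1) * S (innov e w.1)).
  by rewrite /f; congr Ex; apply/funext => w; rewrite subr0 /past adS.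
rewrite f0E; apply: Ex_le.
- apply: (@intg_bnd _ _ _ _ _ (L `^ q)).
    by meas.
  move=> w; rewrite ger0_norm ?powR_ge0//; apply: ge0_ler_powR; rewrite ?nnegrE//.
  exact: ltW.
- exact: iphiS.
- by move=> w; apply: clip_spow => //; apply: le_trans q2; rewrite ler1n.
Qed.

Lemma efron_stein_clip : Ex P (fun w => `|clip L (S (innov e w))| `^ q) <= 2 * sg `^ q.
Proof.
have sgq : sg `^ q = sg `^ (q - 2) * (2 * (q - 1) * D).
  rewrite -sg2 -powR_mulrn ?(ltW sg0)// -powRD; first by rewrite subrK.
  by rewrite (gt_eqF sg0) implybT.
have sgq0 : 0 < sg `^ q by pos.
have II : I0 = Ex P (fun w => `|clip L (S (innov e w))| `^ q).
  apply: (Ex_fst P (f := fun w => `|clip L (S (innov e w))| `^ q)).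
  apply: (@intg_bnd _ _ _ _ _ (L `^ q)).
    by apply: measurable_pow; exact: (measurableT_comp mc (meas_innov me)).
  move=> w; rewrite ger0_norm//; apply: ge0_ler_powR; rewrite ?nnegrE ?(ltW L0)//.
  exact: cB.
rewrite -II; apply/ler_addgt0Pr => eps eps0.
have e2 : 0 < eps / 2 by pos.
have Lq : 0 < L `^ (q - 1) by pos.
have [N0 HN0] := Ex_past0 me ie mS mphi phiB Lq iS ES e2.
(* The lag t0 + M is nonnegative, hence equal to its absolute value, and the corresponding past ends
   at time -M. *)
pose M := (N0 + `|t0|)%N.
have Mt : t0 - (absz (t0 + M%:Z))%:Z = - M%:Z by exact: es_ar3.
have fM : `|f (absz (t0 + M%:Z))| <= eps / 2.
  by rewrite /f Mt; apply: HN0; rewrite leq_addr.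
have H := telescope (absz (t0 + M%:Z)).
have H2 : I0 <= (q - 1) * sg `^ (q - 2) * D * (I0 / sg `^ q + 2) + eps / 2.
  apply: (le_trans I0le); rewrite -lerBlDr.
  apply: le_trans H; rewrite lerD2l lerN2.
  by apply: le_trans fM; exact: ler_norm.
have HE : (q - 1) * sg `^ (q - 2) * D * (I0 / sg `^ q + 2) = I0 / 2 + sg `^ q.
  have -> : (q - 1) * sg `^ (q - 2) * D = sg `^ q / 2 by rewrite sgq; field.
  by field; rewrite gt_eqF.
by move: H2; rewrite HE; exact: es_ar2.
Qed.

End Truncation.

(** The factor 2 left by the absorption is at most 2^q, which the leading 2 of [C] pays for. *)
Lemma efron_stein : let C := 2 * Num.sqrt (2 * (q - 1) * D) in
  intg P (fun w => (`|S (innov e w)| / C) `^ q) /\ Ex P (fun w => (`|S (innov e w)| / C) `^ q) <= 1.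
Proof.
set sg := Num.sqrt _ => C.
have q1 : 0 < q - 1 by rewrite subr_gt0 (lt_le_trans _ q2)// ltr1n.
have sg0 : 0 < sg by rewrite sqrtr_gt0 mulr_gt0// mulr_gt0.
have C0 : 0 < C by rewrite mulr_gt0.
have q0 : 0 < q by apply: lt_le_trans q2.
have [i1 E1] := intg_clip_pow q0 (measurableT_comp mS (meas_innov me)) efron_stein_clip.
have CE w : (`|S (innov e w)| / C) `^ q = (C `^ q)^-1 * `|S (innov e w)| `^ q.
  by rewrite powR_div ?(ltW C0)// mulrC.
under eq_fun do rewrite CE.
split; first exact: intgZ.
rewrite ExZ//.
rewrite ler_pdivrMl ?powR_gt0// mulr1; apply: (le_trans E1).
rewrite /C powRM ?(ltW sg0)// ler_wpM2r//.
rewrite -{1}(powRr1 (ltW (ltr0n R 2))).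
by apply: ler_powR; [rewrite ler1n|apply: le_trans q2; rewrite ler1n].
Qed.

End EfronSteinInequality.

(** * Moments as normalised bounds *)

Section Moments.
Context {R : realType} {d0 : measure_display} {X : measurableType d0} (mu : probability X R).
Implicit Types (f g : X -> R) (q C : R).

(* (E |f|^q)^(1/q) <= C *)
Definition mom q f C := [/\ measT f, 0 < C,
  intg mu (fun w => (`|f w| / C) `^ q) & Ex mu (fun w => (`|f w| / C) `^ q) <= 1].

Let mpow q f C : measT f -> measT (fun w => (`|f w| / C) `^ q).
Proof.
by meas.
Qed.

Lemma mom_ge0 q f C : mom q f C -> 0 < C. Proof. by case. Qed.

Lemma mom_meas q f C : mom q f C -> measT f. Proof. by case. Qed.

Lemma mom_le q q' f C : 0 < q -> q <= q' -> mom q' f C -> mom q f C.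
Proof.
move=> q0 qq [mf C0 fi fE]; have q'0 := lt_le_trans q0 qq.
have [] := @Ex_conv _ _ _ mu (fun=> 1) _ (fun w => (`|f w| / C) `^ q)
  (1 - q / q') (q / q') (intg_cst _ _) fi.
- exact: mpow.
- by move=> w; exact: powR_ge0.
- by rewrite Ex_cst.
- exact: fE.
- by rewrite subr_ge0 ler_pdivrMr// mul1r.
- by pos.
- by rewrite subrK.
- move=> w; rewrite mulr1; apply: powR_young => //.
  by pos.
by move=> h1 h2; split.
Qed.

Lemma mom_wle q f C C' : 0 <= q -> C <= C' -> mom q f C -> mom q f C'.
Proof.
move=> q0 CC [mf C0 fi fE]; have C'0 := lt_le_trans C0 CC.
have le w : (`|f w| / C') `^ q <= (`|f w| / C) `^ q.
  apply: ge0_ler_powR => //; rewrite ?nnegrE ?divr_ge0 ?(ltW C0) ?(ltW C'0)//.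
  by rewrite ler_wpM2l// lef_pV2.
have i' : intg mu (fun w => (`|f w| / C') `^ q).
  apply: (intg_le (mpow _ _ mf) fi) => w.
  by rewrite ger0_norm//; pos.
split => //; exact: le_trans (Ex_le i' fi le) fE.
Qed.

(** Minkowski by convexity: |f + g| / (C + D) is at most the average of |f| / C and |g| / D with
    weights proportional to C and D. *)
Lemma mom_add q f g C D : 1 <= q -> mom q f C -> mom q g D -> mom q (fun w => f w + g w) (C + D).
Proof.
move=> q1 [mf C0 fi fE] [mg D0 gi gE].
have CD0 : 0 < C + D by pos.
have [] := @Ex_conv _ _ _ mu _ _ (fun w => (`|f w + g w| / (C + D)) `^ q)
  (C / (C + D)) (D / (C + D)) fi gi.
- by meas.
- by move=> w; exact: powR_ge0.
- exact: fE.
- exact: gE.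
- by pos.
- by pos.
- by rewrite -mulrDl divff// gt_eqF.
- move=> w.
  have a0 : 0 <= `|f w| / C by pos.
  have b0 : 0 <= `|g w| / D by pos.
  have s0 : 0 <= C / (C + D) by pos.
  have t0 : 0 <= D / (C + D) by pos.
  have st : C / (C + D) + D / (C + D) = 1 by rewrite -mulrDl divff// gt_eqF.
  apply: le_trans (powR_mean a0 b0 s0 t0 st q1).
  apply: ge0_ler_powR; rewrite ?nnegrE.
  + exact: le_trans q1.
  + by pos.
  + by pos.
  have -> : C / (C + D) * (`|f w| / C) + D / (C + D) * (`|g w| / D) =
    (`|f w| + `|g w|) / (C + D) by field; rewrite !gt_eqF.
  by rewrite ler_wpM2r ?invr_ge0 ?(ltW CD0)// ler_normD.
by move=> h1 h2; split => //; meas.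
Qed.

Lemma mom_mul q f g C D : 0 <= q -> mom (2 * q) f C -> mom (2 * q) g D ->
  mom q (fun w => f w * g w) (C * D).
Proof.
move=> q0 [mf C0 fi fE] [mg D0 gi gE].
have CD0 : 0 < C * D by pos.
have [] := @Ex_conv _ _ _ mu _ _ (fun w => (`|f w * g w| / (C * D)) `^ q) 2^-1 2^-1 fi gi.
- by meas.
- by move=> w; exact: powR_ge0.
- exact: fE.
- exact: gE.
- by pos.
- by pos.
- by lra.
- move=> w.
  have a0 : 0 <= `|f w| / C by pos.
  have b0 : 0 <= `|g w| / D by pos.
  have -> : `|f w * g w| / (C * D) = (`|f w| / C) * (`|g w| / D).
    by rewrite normrM; field; rewrite !gt_eqF.
  rewrite powRM// mulrC [in X in _ <= X]mulrC.
  rewrite !(mulrC 2 q) !powRrM !powR_mulrn ?powR_ge0//.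
  set x := (`|f w| / C) `^ q; set y := (`|g w| / D) `^ q.
  by have := sqr_ge0 (x - y); lra.
by move=> h1 h2; split => //; meas.
Qed.

Lemma mom_scale q f C (c : R) : 0 < c -> mom q f C -> mom q (fun w => c * f w) (c * C).
Proof.
move=> c0 [mf C0 fi fE].
have E w : `|c * f w| / (c * C) = `|f w| / C.
  by rewrite normrM gtr0_norm//; field; rewrite !gt_eqF.
by split; rewrite ?mulr_gt0//; [exact: measurable_funM|under eq_fun do rewrite E|
  under eq_fun do rewrite E].
Qed.

Lemma mom_opp q f C : mom q f C -> mom q (fun w => - f w) C.
Proof.
move=> [mf C0 fi fE]; split => //; first meas.
- by under eq_fun do rewrite normrN.
- by under eq_fun do rewrite normrN.
Qed.

Lemma mom_cst q C (a : R) : 0 < q -> 0 < C -> `|a| <= C -> mom q (fun=> a) C.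
Proof.
move=> q0 C0 aC; split => //; first exact: intg_cst.
rewrite Ex_cst; apply: (via (1 `^ q)); last by rewrite powR1.
apply: ge0_ler_powR; rewrite ?nnegrE ?(ltW q0)//.
  by pos.
by rewrite ler_pdivrMr// mul1r.
Qed.

(** The slack [eta] keeps the bound positive for an empty sum, as [mom] requires. *)
Lemma mom_sum q (I : Type) (r : seq I) (Q : pred I) (f : I -> X -> R) (C : I -> R) (eta : R) :
  1 <= q -> 0 < eta -> (forall i, Q i -> mom q (f i) (C i)) ->
  mom q (fun w => \sum_(i <- r | Q i) f i w) (eta + \sum_(i <- r | Q i) C i).
Proof.
move=> q1 eta0 H; have q0 : 0 < q by apply: lt_le_trans q1.
elim: r => [|i r IH].
  under eq_fun do rewrite big_nil; rewrite big_nil addr0.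
  by apply: mom_cst => //; rewrite normr0 ltW.
rewrite big_cons.
have [Qi|/negbTE Qi] := boolP (Q i); under eq_fun do rewrite big_cons Qi; last by [].
by rewrite addrCA; apply: mom_add => //; exact: H.
Qed.

Lemma mom_intg q f C : 1 <= q -> mom q f C -> intg mu f.
Proof.
move=> q1 fm; have := mom_le ltr01 q1 fm => -[mf C0 fi _].
apply: (intg_le mf (intgZ C fi)) => w.
rewrite powRr1 ?divr_ge0 ?(ltW C0)//.
by rewrite mulrC divfK// gt_eqF.
Qed.

Lemma mom_markov q f C (u : R) : 0 < q -> 0 < u -> mom q f C ->
  (mu [set w | (u * C < `|f w|)%R] <= (u `^ (- q))%:E)%E.
Proof.
move=> q0 u0 [mf C0 fi fE].
have mA : measurable [set w | u * C < `|f w|].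
  preimage; apply: measurable_fun_ltr => //.
  by meas.
have -> : mu [set w | u * C < `|f w|] = (\int[mu]_w (\1_[set w | (u * C < `|f w|)%R] w)%:E)%E.
  by rewrite integral_indic// setIT.
have i1 : intg mu (\1_[set w | u * C < `|f w|] : X -> R).
  apply: (@intg_bnd _ _ _ _ _ 1) => // w.
  by rewrite indicE; case: (_ \in _); rewrite ?normr1 ?normr0.
rewrite ExE// lee_fin.
apply: (via (Ex mu (fun w => u `^ (- q) * (`|f w| / C) `^ q))); last first.
  by rewrite ExZ// -[leRHS]mulr1 ler_wpM2l//; pos.
apply: Ex_le => //; first exact: intgZ.
move=> w; rewrite indicE; case: (boolP (w \in _)) => [|_]; last by rewrite mulr_ge0//; pos.
rewrite inE/= => H; rewrite powRN ler_pdivlMl ?powR_gt0// mulr1.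
apply: ge0_ler_powR; rewrite ?nnegrE ?(ltW q0) ?(ltW u0)//.
  by pos.
by rewrite ler_pdivlMr// ltW.
Qed.

End Moments.

(** Dependence of a sum of n terms on the innovation k steps before its last time: the term i steps
    before the last sees it at lag k - i, and not at all if i > k. *)
Definition shifted_sum {R : realType} (dl : nat -> R) (n k : nat) : R :=
  \sum_(i < n) (if (i <= k)%N then dl (k - i)%N else 0).

(** * Functionals of the innovations with decaying dependence *)

Section GoodProcesses.
Context {R : realType} {dO : measure_display} {Om : measurableType dO} (P : probability Om R)
  (e : int -> Om -> R) (me : forall i, measT (e i)) (ie : mutually_independent P e).

Local Notation E := (fspace R int).
Local Notation PP := (P \x P)%E.

Definition adapted (t : int) (Y : E -> R) :=
  forall x y, Y (mix (fun v => v <= t)%R x y) = Y x.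

Lemma adapted_eq t Y x y : adapted t Y -> (forall v, (v <= t)%R -> x v = y v) -> Y x = Y y.
Proof.
move=> aY xy; rewrite -(aY x y); congr Y; apply/funext => v; rewrite /mix.
by case: ifPn => // /xy.
Qed.

Lemma adapted_le t t' Y : (t <= t')%R -> adapted t Y -> adapted t' Y.
Proof.
move=> tt' aY x y; apply: (adapted_eq aY) => v vt.
by rewrite /mix (le_trans vt tt').
Qed.

Lemma adapted_resample t Y u (w : Om * Om) : adapted t Y -> (t < u)%R ->
  Y (resample e u w) = Y (innov e w.1).
Proof.
move=> aY tu; apply: (adapted_eq aY) => v vt; rewrite /resample /mix.
case: eqP => // vu; move: tu; rewrite -vu => /(le_lt_trans vt).
by rewrite ltxx.
Qed.

(** The dependence coefficients carry the factor [C], so that [dl] stays the same under sums and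
    products and only the constant changes. *)
Definition good q C (t : int) (dl : nat -> R) (Y : E -> R) :=
  [/\ measT Y, adapted t Y,
      mom P q (fun w => Y (innov e w)) C &
      forall k : nat, mom PP q (fun w => Y (innov e w.1) - Y (resample e (t - k%:Z) w))
        (C * dl k)].

Let ma : measT (fun w : Om * Om => innov e w.1).
Proof. exact: (measurableT_comp (meas_innov me) measurable_fst). Qed.

Lemma mom_fst q (f : Om -> R) C : mom P q f C -> mom PP q (fun w => f w.1) C.
Proof.
move=> [mf C0 fi fE]; split => //.
- by meas.
- exact: (intg_fst P fi).
- by rewrite (Ex_fst P fi).
Qed.

Lemma mom_resample q C Y u : measT Y -> mom P q (fun w => Y (innov e w)) C ->
  mom PP q (fun w => Y (resample e u w)) C.
Proof.
move=> mY /mom_fst [mf C0 fi fE].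
have mF : measT (fun x : E => (`|Y x| / C) `^ q).
  by meas.
split => //.
- by apply: (measurableT_comp mY); exact: measurable_resample.
- exact: (intg_mix me ie (fun v => v != u) mF fi).
- by have -> := Ex_mix me ie (fun v => v != u) mF.
Qed.

Lemma good_add q C D t dl Y Z : 1 <= q -> good q C t dl Y -> good q D t dl Z ->
  good q (C + D) t dl (fun x => Y x + Z x).
Proof.
move=> q1 [mY aY bY dY] [mZ aZ bZ dZ]; split.
- by meas.
- by move=> x y; rewrite aY aZ.
- exact: mom_add.
- move=> k; rewrite mulrDl; have := mom_add q1 (dY k) (dZ k).
  by congr mom; apply/funext => w; ring.
Qed.

(** YZ - Y'Z' = Y (Z - Z') + (Y - Y') Z', where the resampled factor has the moments of the
    original; the two terms give the factor 2. *)
Lemma good_mul q C D t dl Y Z : 1 <= q -> good (2 * q) C t dl Y -> good (2 * q) D t dl Z ->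
  good q (2 * (C * D)) t dl (fun x => Y x * Z x).
Proof.
move=> q1 [mY aY bY dY] [mZ aZ bZ dZ].
have q0 : 0 <= q by apply: le_trans q1.
have C0 := mom_ge0 bY; have D0 := mom_ge0 bZ.
split.
- by meas.
- by move=> x y; rewrite aY aZ.
- apply: mom_wle (mom_mul q0 bY bZ) => //.
  by rewrite ler_peMl ?ler1n// mulr_ge0// ltW.
- move=> k; have := mom_add q1 (mom_mul q0 (mom_fst bY) (dZ k))
  (mom_mul q0 (dY k) (mom_resample (t - k%:Z) mZ bZ)).
  congr mom; first by apply/funext => w; ring.
  by ring.
Qed.

Lemma good_scale q C t dl Y (c : R) : 0 < c -> good q C t dl Y ->
  good q (c * C) t dl (fun x => c * Y x).
Proof.
move=> c0 [mY aY bY dY]; split.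
- by meas.
- by move=> x y; rewrite aY.
- exact: mom_scale.
- move=> k; rewrite -mulrA; have := mom_scale c0 (dY k).
  by congr mom; apply/funext => w; ring.
Qed.

Lemma good_opp q C t dl Y : good q C t dl Y -> good q C t dl (fun x => - Y x).
Proof.
move=> [mY aY bY dY]; split.
- by meas.
- by move=> x y; rewrite aY.
- exact: mom_opp.
- move=> k; have := mom_opp (dY k).
  by congr mom; apply/funext => w; ring.
Qed.

Lemma good_wle q C C' t dl Y : (forall k, 0 < dl k) -> 0 <= q -> C <= C' ->
  good q C t dl Y -> good q C' t dl Y.
Proof.
move=> dl0 q0 CC [mY aY bY dY]; split => //; first exact: mom_wle bY.
by move=> k; apply: mom_wle (dY k) => //; rewrite ler_wpM2r// ltW.
Qed.

(** A variable known h steps earlier sees the innovation of lag k at its own lag k - h; for k < h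
    the difference is zero and any positive bound serves. *)
Lemma good_shift q C t (h : nat) dl dl' Y : 0 < q -> (forall k, 0 < dl k) ->
  (forall k, dl' k <= dl (k + h)%N) -> good q C (t - h%:Z) dl' Y -> good q C t dl Y.
Proof.
move=> q0 dl0 dd [mY aY bY dY]; have C0 := mom_ge0 bY; split => //.
  by apply: adapted_le aY; rewrite lerBlDr lerDl.
move=> k; have [hk|kh] := leqP h k.
  have -> : t - k%:Z = t - h%:Z - (k - h)%N%:Z by lia.
  apply: mom_wle (dY (k - h)%N); first exact: ltW.
  by rewrite ler_wpM2l ?(ltW C0)// (le_trans (dd _))// subnK.
rewrite (_ : (fun w => _) = fun=> 0).
  by apply: mom_cst => //; rewrite ?normr0 ?mulr_ge0 ?mulr_gt0 ?(ltW C0) ?(ltW (dl0 k)).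
apply/funext => w; rewrite (adapted_resample _ aY) ?subrr//.
by rewrite ltrD2l ltrN2 ltz_nat.
Qed.

Section Concentration.
Context (dl : nat -> R) (A : R) (dl0 : forall k, 0 < dl k) (dlA : forall n, \sum_(k < n) dl k <= A).

Local Notation dsh := (shifted_sum dl).

Let A0 : 0 < A.
Proof. by have := dlA 1; rewrite big_ord1; apply: lt_le_trans. Qed.

Lemma dsh_gt0 n k : (0 < n)%N -> 0 < dsh n k.
Proof.
case: n => // n _; rewrite /shifted_sum big_ord_recl/= subn0 ltr_pwDl// sumr_ge0// => i _.
by case: ifP => // _; exact: ltW.
Qed.

Lemma dsh_le n k : dsh n k <= A.
Proof.
apply: le_trans (dlA k.+1); rewrite /shifted_sum.
rewrite -(big_mkord xpredT (fun i => if (i <= k)%N then dl (k - i) else 0)).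
rewrite -(big_mkord xpredT dl) [leRHS]big_nat_rev/= add0n.
apply: (via (\sum_(0 <= i < minn n k.+1) dl (k - i))).
  rewrite (big_cat_nat _ (n := minn n k.+1)) ?geq_minl//=.
  rewrite [X in _ + X]big_nat [X in _ + X]big1 ?addr0.
    apply: eq_ler; rewrite !big_nat; apply: eq_bigr => i.
    by rewrite leq0n/= leq_min => /andP[_]; rewrite ltnS => ->.
  move=> i /andP[]; rewrite geq_min => /orP[ni /(leq_ltn_trans ni)|ki _].
    by rewrite ltnn.
  by rewrite leqNgt ki.
rewrite [leRHS](big_cat_nat _ (n := minn n k.+1)) ?geq_minr//=.
under [X in _ <= X + _]eq_bigr do rewrite subSS.
by rewrite lerDl sumr_ge0// => i _; exact: ltW.
Qed.

(** With [dsh_le] this bounds the sum of squares by n A^2, the source of the square root of n in the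
    concentration bounds. *)
Lemma dsh_sum n N : \sum_(k < N) dsh n k <= n%:R * A.
Proof.
rewrite /shifted_sum exchange_big/=.
apply: (via (\sum_(i < n) A)); last by rewrite sumr_const card_ord mulr_natl.
apply: ler_sum => i _; apply: le_trans (dlA N).
rewrite -(big_mkord xpredT (fun k => if (i <= k)%N then dl (k - i) else 0)).
rewrite -(big_mkord xpredT dl).
have [iN|Ni] := leqP i N; last first.
  rewrite big_nat big1 ?sumr_ge0//; first by move=> k _; exact: ltW.
  by move=> k /andP[_ kN]; rewrite leqNgt (ltn_trans kN Ni).
rewrite (big_cat_nat _ (n := i))//= [X in X + _]big_nat [X in X + _]big1 ?add0r; last first.
  by move=> k /andP[_ ki]; rewrite leqNgt ki.
rewrite -{1}(add0n (nat_of_ord i)) big_addn.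
rewrite [leRHS](big_cat_nat _ (n := N - i)) ?leq_subr//=.
rewrite -[X in X <= _]addr0 lerD//; last by pos; exact: ltW.
by apply: ler_sum => k _; rewrite leq_addl addnK.
Qed.

(* Concentration of a statistic of n consecutive times whose dependence on the
   innovation at lag k is that of a sum of n terms with dependence dl. *)
Lemma good_concentration (q B : R) (n : nat) (t0 : int) (S : E -> R) : 2 <= q -> 0 < B ->
  (0 < n)%N -> measT S -> adapted t0 S -> intg P (fun w => S (innov e w)) ->
  (forall k : nat, mom PP q (fun w => S (innov e w.1) - S (resample e (t0 - k%:Z) w))
  (B * dsh n k)) -> mom P q (fun w => S (innov e w) - Ex P (fun w => S (innov e w)))
  (2 * Num.sqrt (2 * (q - 1)) * (B * A * Num.sqrt n%:R)).
Proof.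
move=> q2 B0 n0 mS aS iS dS.
pose S' x := S x - Ex P (fun w => S (innov e w)).
pose D := (B * A) ^+ 2 * n%:R.
have q1 : 0 < q - 1 by rewrite subr_gt0 (lt_le_trans _ q2)// ltr1n.
have D0 : 0 < D by rewrite mulr_gt0 ?exprn_gt0 ?ltr0n// mulr_gt0.
have E1 w u : S' (innov e w.1) - S' (resample e u w) =
  S (innov e w.1) - S (resample e u w) by rewrite /S'; ring.
have [] := @efron_stein _ _ _ P e me ie S' q D t0 (fun k => B * dsh n k) q2.
- exact: measurable_funB.
- by move=> x y; rewrite /S' aS.
- by apply: intgB => //; exact: intg_cst.
- by rewrite /S' ExB ?Ex_cst ?subrr//; exact: intg_cst.
- by move=> k; rewrite mulr_gt0// dsh_gt0.
- by move=> k; under eq_fun do rewrite E1; case: (dS k).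
- by move=> k; under eq_fun do rewrite E1; case: (dS k).
- exact: D0.
- move=> N; apply: (via (\sum_(k < N) (B ^+ 2 * A) * dsh n k)).
    apply: ler_sum => k _; rewrite exprMn -mulrA ler_wpM2l ?sqr_ge0//.
    by rewrite expr2 ler_wpM2r ?dsh_le// ltW// dsh_gt0.
  rewrite -mulr_sumr; apply: (le_trans (ler_wpM2l _ (dsh_sum n N))).
    by pos.
  by apply: eq_ler; rewrite /D; ring.
have -> : 2 * Num.sqrt (2 * (q - 1) * D) = 2 * Num.sqrt (2 * (q - 1)) * (B * A * Num.sqrt n%:R).
  have -> : Num.sqrt (2 * (q - 1) * D) = Num.sqrt (2 * (q - 1)) * Num.sqrt D.
    by rewrite sqrtrM// mulr_ge0// ltW.
  have -> : Num.sqrt D = B * A * Num.sqrt n%:R.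
    by rewrite /D sqrtrM ?sqr_ge0// sqrtr_sqr gtr0_norm//; pos.
  by rewrite !mulrA.
move=> h1 h2; split => //.
- apply: measurable_funB => //; exact: (measurableT_comp mS (meas_innov me)).
- rewrite !mulr_gt0// sqrtr_gt0 ?mulr_gt0// ltr0n//.
Qed.

End Concentration.

(** Times after s can be exchanged at once, because [f] does not see them. The innovations of [g] at
    times s, s - 1, ... are then replaced one after the other; each replacement costs F d_k by
    Cauchy-Schwarz, and in the limit [g] is independent of [f] with mean zero. The limit is taken
    for bounded [f], hence the truncation, removed at the end through the expectation of f^2 |g|. *)
Lemma covariance_decay (f g : E -> R) (s : int) (F D : R) (d : nat -> R) :
  measT f -> measT g -> adapted s f -> mom P 2 (fun w => f (innov e w)) F ->
  intg P (fun w => g (innov e w)) -> Ex P (fun w => g (innov e w)) = 0 ->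
  intg P (fun w => f (innov e w) ^+ 2 * `|g (innov e w)|) ->
  intg P (fun w => f (innov e w) * g (innov e w)) ->
  (forall k : nat, mom PP 2 (fun w => g (innov e w.1) - g (resample e (s - k%:Z) w)) (d k)) ->
  (forall n, \sum_(k < n) d k <= D) -> `|Ex P (fun w => f (innov e w) * g (innov e w))| <= F * D.
Proof.
move=> mf mg af bf ig Eg ifg2 ifg dg dD.
have F0 := mom_ge0 bf.
have mfa : measT (fun w => f (innov e w)).
  exact: (measurableT_comp mf (meas_innov me)).
have iga : intg PP (fun w => g (innov e w.1)) by exact: (intg_fst P ig).
have clipcase (L : R) : 0 < L -> `|Ex P (fun w => clip L (f (innov e w)) * g (innov e w))| <= F * D.
  move=> L0.
  pose fL x := clip L (f x).
  have mfL : measT fL by exact: measurable_clip.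
  have bL x : `|fL x| <= L by apply: clip_bnd; exact: ltW.
  have mfLa : measT (fun w : Om * Om => fL (innov e w.1)).
    exact: (measurableT_comp mfL ma).
  have ip u : intg PP (fun w => fL (innov e w.1) * g (past e u w)).
    apply: (intg_bndM mfLa (fun w => bL _)).
    exact: (intg_mix me ie _ mg iga).
  have ifLg : intg P (fun w => fL (innov e w) * g (innov e w)).
    apply: (intg_bndM _ (fun w => bL _) ig).
    exact: (measurableT_comp mfL (meas_innov me)).
  pose f' (k : nat) := Ex PP (fun w => fL (innov e w.1) * g (past e (s - k%:Z) w)).
  have f'0 : f' 0 = Ex P (fun w => fL (innov e w) * g (innov e w)).
    rewrite -(Ex_fst P ifLg) /f' subr0.
    rewrite -(Ex_mix me ie (fun v => v <= s)%R (F := fun x => fL x * g x)).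
      by congr Ex; apply/funext => w; rewrite /fL af.
    exact: measurable_funM.
  have stepk k : `|f' k - f' k.+1| <= F * d k.
    have dk0 := mom_ge0 (dg k).
    have uE : s - k.+1%:Z = s - k%:Z - 1 by lia.
    rewrite /f' uE -ExB//.
    have [[_ _ iX EX] [_ _ iF EF]] := (dg k, mom_fst bf).
    have [iY EY] := past_diff me ie mg iX.
    set u := s - k%:Z.
    pose Bd w := F * d k / 2 * ((`|f (innov e w.1)| / F) `^ 2 +
      (`|g (past e u w) - g (past e (u - 1) w)| / d k) `^ 2).
    have iBd : intg PP Bd by apply: intgZ; exact: intgD.
    have EBd : Ex PP Bd <= F * d k.
      rewrite ExZ; last exact: intgD.
      rewrite ExD// EY.
      apply: (via (F * d k / 2 * (1 + 1))).
        rewrite ler_wpM2l ?lerD// mulr_ge0// mulr_ge0// ltW//.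
      by apply: eq_ler; field.
    apply: le_trans EBd.
    have := Ex_absle (intgB (ip u) (ip (u - 1))) iBd; apply => w.
    rewrite -mulrBr normrM /Bd.
    set x := `|g _ - g _|; set z := f _.
    have zL : `|fL (innov e w.1)| <= `|z|.
      by rewrite /fL clip_abs ?ge_min ?lexx// ltW.
    apply: (via (`|z| * x)); first by rewrite ler_wpM2r ?normr_ge0.
    have z0 : 0 <= `|z| / F by pos.
    have x0 : 0 <= x / d k by rewrite divr_ge0 ?normr_ge0// ltW.
    rewrite !powR_mulrn//.
    have -> : `|z| * x = F * d k / 2 * (2 * ((`|z| / F) * (x / d k))).
      by field; rewrite !gt_eqF.
    rewrite ler_wpM2l ?mulr_ge0 ?(ltW F0) ?(ltW dk0)//.
    by have := sqr_ge0 (`|z| / F - x / d k); lra.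
  rewrite -f'0; apply/ler_addgt0Pr => eps eps0.
  have [N0 HN0] := Ex_past0 me ie mg mfL bL L0 ig Eg eps0.
  pose n := absz (s + (N0 + `|s|)%N%:Z).
  have nE : s - n%:Z = - (N0 + `|s|)%N%:Z by exact: es_ar3.
  have fn : `|f' n| <= eps by rewrite /f' nE; apply: HN0; rewrite leq_addr.
  have tel : `|f' 0 - f' n| <= F * D.
    have -> : f' 0 - f' n = \sum_(k < n) (f' k - f' k.+1).
      clear; elim: n => [|n IH]; first by rewrite big_ord0 subrr.
      by rewrite big_ord_recr/= -IH; ring.
    apply: (le_trans (ler_norm_sum _ _ _)).
    apply: (via (\sum_(k < n) F * d k)); first by apply: ler_sum => k _.
    by rewrite -mulr_sumr ler_wpM2l// ltW.
  rewrite -(subrK (f' n) (f' 0)); apply: (le_trans (ler_normD _ _)).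
  exact: lerD.
apply/ler_addgt0Pr => eps eps0.
pose M := Ex P (fun w => f (innov e w) ^+ 2 * `|g (innov e w)|).
have M0 : 0 <= M by apply: Ex_ge0 => w; rewrite mulr_ge0// sqr_ge0.
(* The truncation error |f - clip L f| is at most f^2 / L, so this level makes it at most eps in
   expectation. *)
pose L := M / eps + 1.
have L0 : 0 < L by rewrite ltr_pwDr// divr_ge0// ltW.
have i1 : intg P (fun w => clip L (f (innov e w)) * g (innov e w)).
  apply: (@intg_bndM _ _ _ _ _ _ L) => //; first exact: measurable_clip.
  by move=> w; apply: clip_bnd; exact: ltW.
have := clipcase L L0 => H.
have K : `|Ex P (fun w => f (innov e w) * g (innov e w)) -
  Ex P (fun w => clip L (f (innov e w)) * g (innov e w))| <= eps.
  rewrite -ExB//; apply: (via (L^-1 * M)); last first.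
    rewrite ler_pdivrMl// /L mulrDl divfK ?gt_eqF// mul1r.
    by rewrite lerDl ltW.
  rewrite /M -ExZ//; apply: Ex_absle; [exact: intgB|exact: intgZ|move=> w].
  rewrite -mulrBl normrM mulrA ler_wpM2r//.
  set z := f _; rewrite ler_pdivlMl//.
  have [zL|Lz] := leP `|z| L.
    have -> : clip L z = z.
      move: zL; rewrite ler_norml /clip => /andP[z1 z2].
      by rewrite (min_l z2) (max_r z1).
    by rewrite subrr normr0 mulr0 sqr_ge0.
  rewrite -[leRHS]ger0_norm ?sqr_ge0// normrX expr2.
  apply: ler_pM => //; [exact: ltW|exact: ltW|].
  by apply: clip_sub; exact: ltW.
rewrite -(subrK (Ex P (fun w => clip L (f (innov e w)) * g (innov e w)))
  (Ex P (fun w => f (innov e w) * g (innov e w)))).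
apply: (le_trans (ler_normD _ _)).
by rewrite addrC lerD.
Qed.

End GoodProcesses.

Import HBNNSimple.

(** * Normal laws and their exponential moments *)

Section NormalMgf.
Context {R : realType}.
Local Notation leb := (@lebesgue_measure R).

Lemma integral_density d (X : measurableType d) (mu nu : {measure set X -> \bar R})
  (p : X -> R) (f : X -> \bar R) : measT p -> (forall x, 0 <= p x) ->
  (forall A, measurable A -> nu A = \int[mu]_(x in A) (p x)%:E)%E ->
  measT f -> (forall x, 0 <= f x)%E -> (\int[nu]_x f x = \int[mu]_x (f x * (p x)%:E))%E.
Proof.
move=> mp p0 nuE mf f0; pose h := nnsfun_approx measurableT mf.
have mh n : measT (EFin \o h n) by exact/measurable_EFinP.
have hnd x : {homo (fun n => h n x) : a b / (a <= b)%N >-> a <= b}.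
  by move=> a b ab; exact/lefP/nd_nnsfun_approx.
have cf x : (h n x)%:E @[n --> \oo] --> f x by exact: cvg_nnsfun_approx.
have -> : (\int[nu]_x f x = limn (fun n => \int[nu]_x (h n x)%:E))%E.
  under eq_integral => x _ do rewrite -(cvg_lim _ (cf x))//.
  apply: monotone_convergence => //.
  - by move=> n x _; rewrite lee_fin.
  - by move=> x _ a b ab; rewrite lee_fin; exact: hnd.
have -> : (\int[mu]_x (f x * (p x)%:E) = limn (fun n => \int[mu]_x ((h n x)%:E * (p x)%:E)))%E.
  have cfp x : ((h n x)%:E * (p x)%:E)%E @[n --> \oo] --> (f x * (p x)%:E)%E.
    by apply: cvgeZr.
  under eq_integral => x _ do rewrite -(cvg_lim _ (cfp x))//.
  apply: monotone_convergence => //.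
  - by move=> n; apply/emeasurable_funM => //; exact/measurable_EFinP.
  - by move=> n x _; rewrite -EFinM lee_fin mulr_ge0.
  - by move=> x _ a b ab; rewrite -!EFinM lee_fin ler_wpM2r//; exact: hnd.
apply: congr_lim; apply/funext => n.
transitivity (\int[nu]_x (\sum_(y \in range (h n)) (y * \1_(h n @^-1` [set y]) x)%:E))%E.
  by apply: eq_integral => t _; rewrite /= fimfunE -fsumEFin.
rewrite ge0_integral_fsum//; last 2 first.
- by meas.
- by move=> m y Ey; exact: nnfun_muleindic_ge0.
transitivity (\int[mu]_x (\sum_(y \in range (h n))
  (y * \1_(h n @^-1` [set y]) x)%:E * (p x)%:E))%E; last first.
  apply: eq_integral => x _.
  rewrite -ge0_mule_fsuml => [|y]; last exact: nnfun_muleindic_ge0.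
  by rewrite fsumEFin // -(fimfunE _ x).
rewrite ge0_integral_fsum//; last 2 first.
- move=> y; apply: emeasurable_funM => //; last exact/measurable_EFinP.
  by meas.
- by move=> y x _; apply: mule_ge0; [exact: nnfun_muleindic_ge0|rewrite lee_fin].
apply: eq_fsbigr => r rhn.
have r0 : 0 <= r by move: rhn; rewrite inE => -[x _ <-].
under eq_integral do rewrite EFinM.
rewrite ge0_integralZl//; last meas.
rewrite integral_indic// setIT nuE//.
under [RHS]eq_integral do rewrite EFinM -muleA.
rewrite ge0_integralZl//.
- congr (_ * _)%E; rewrite integral_mkcond; apply: eq_integral => x _.
  by rewrite patchE indicE; case: (x \in _); rewrite ?mul1e ?mul0e.
- by apply: emeasurable_funM; by meas.
- by move=> x _; rewrite -EFinM lee_fin mulr_ge0.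
Qed.

Lemma normal_pdf_tilt (mu s t x : R) : s != 0 -> expR (t * x) * normal_pdf mu s x =
  expR (t * mu + s ^+ 2 * t ^+ 2 / 2) * normal_pdf (mu + s ^+ 2 * t) s x.
Proof.
move=> s0; rewrite !normal_pdfE// /normal_fun mulrCA [RHS]mulrCA; congr (_ * _).
rewrite -!expRD; congr expR; rewrite -mulr_natr; field.
exact: s0.
Qed.

(** The exponential tilt of a normal density is a multiple of another normal density, of integral
    one; the degenerate law is a point mass and is treated apart. *)
Lemma normal_law_mgf d (Om : measurableType d) (P : probability Om R) (U : Om -> R)
  (mu s t : R) : measT U -> (forall B, measurable B -> P [set w | B (U w)] = normal_law mu s B) ->
  intg P (fun w => expR (t * U w)) /\
  Ex P (fun w => expR (t * U w)) = expR (t * mu + s ^+ 2 * t ^+ 2 / 2).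
Proof.
move=> mU lawU.
pose V : Om -> measurableTypeR R := U.
pose g (x : measurableTypeR R) := (expR (t * (x : R)))%:E.
have mg : measT g.
  by apply/measurable_EFinP; by meas.
have g0 x : (0 <= g x)%E by rewrite lee_fin expR_ge0.
suff E : (\int[P]_w g (U w) = (expR (t * mu + s ^+ 2 * t ^+ 2 / 2))%:E)%E.
  have [] := @intg_ge0 _ _ _ P (fun w => expR (t * U w)) (expR (t * mu + s ^+ 2 * t ^+ 2 / 2)).
  - by meas.
  - by move=> w; exact: expR_ge0.
  - by rewrite -E.
  by move=> i _; split => //; apply: EFin_inj; rewrite -(ExE i) -E.
have -> : (\int[P]_w g (U w) = \int[pushforward P V]_x g x)%E.
  by rewrite ge0_integral_pushforward// setTI.
have [s0|s0] := eqVneq s 0.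
  transitivity (\int[\d_(mu : measurableTypeR R)]_x g x)%E.
    apply: eq_measure_integral.
    by move=> A mA _; apply: etrans (lawU A mA) _; rewrite /normal_law s0 eqxx.
  rewrite integral_dirac// /g s0 expr0n/= mul0r mul0r addr0.
  by rewrite diracE mem_set// mul1e.
transitivity (\int[normal_prob mu s]_x g x)%E.
  apply: eq_measure_integral.
  by move=> A mA _; apply: etrans (lawU A mA) _; rewrite /normal_law (negbTE s0).
rewrite (@integral_density _ _ leb (normal_prob mu s) (normal_pdf mu s))//.
- under eq_integral => x _ do rewrite /g -EFinM normal_pdf_tilt// EFinM.
  rewrite ge0_integralZl//.
  + by rewrite integral_normal_pdf mule1.
  + by apply/measurable_EFinP; exact: measurable_normal_pdf.
  + by move=> x _; rewrite lee_fin normal_pdf_ge0.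
- exact: measurable_normal_pdf.
- exact: normal_pdf_ge0.
Qed.

End NormalMgf.

Lemma Ex_dominated {R : realType} d (X : measurableType d) (P : probability X R)
  (f_ : nat -> X -> R) (f g : X -> R) :
  (forall n, intg P (f_ n)) -> intg P g -> (forall n w, `|f_ n w| <= g w) ->
  (forall w, f_ n w @[n --> \oo] --> f w) -> intg P f /\ Ex P (f_ n) @[n --> \oo] --> Ex P f.
Proof.
move=> fi gi fg ff.
have mf_ n : measT (f_ n) := intg_meas (fi n).
have mf : measT f by apply: (@measurable_fun_cvg _ _ _ _ f_) => // w _.
have [] := @dominated_convergence _ X R P setT measurableT
  (fun n => EFin \o f_ n) (EFin \o f) (EFin \o g).
- by move=> n; exact/measurable_EFinP.
- exact/measurable_EFinP.
- by apply: aeW => w _; apply/cvg_EFin; [near=> n|exact: ff].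
- by rewrite -intgE.
- by apply: aeW => w n _; rewrite lee_fin.
rewrite -intgE => fi' _ c; split => //.
move: c; rewrite /= [X in _ --> X](ExE fi'); under eq_fun do rewrite (ExE (fi _)).
by move=> /fine_cvgP[_].
Unshelve. all: by end_near. Qed.

(** * Exponential bounds and difference quotients *)

Section ExpBounds.
Context {R : realType}.
Implicit Types x : R.

Lemma expR_ge_abs x : `|x| <= expR `|x|.
Proof. by apply: le_trans (expR_ge1Dx _); rewrite lerDr. Qed.

Lemma expR_sub1_le x : `|expR x - 1| <= `|x| * expR `|x|.
Proof.
have H y : 0 <= y -> expR y - 1 <= y * expR y.
  move=> y0; have := expR_ge1Dx (- y); rewrite expRN => h.
  have e0 : 0 < expR y by pos.
  by move: h; rewrite -(ler_pM2r e0) mulVf ?gt_eqF// => h; lra.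
have [x0|x0] := leP 0 x.
  rewrite ger0_norm ?(ger0_norm x0) ?H// subr_ge0.
  by apply: le_trans (expR_ge1Dx _); rewrite lerDl.
rewrite ltr0_norm ?(ltr0_norm x0); last by rewrite subr_lt0 expR_lt1.
have := expR_ge1Dx x => h.
have e1 : 1 <= expR (- x) by apply: le_trans (expR_ge1Dx _); lra.
by apply: (via (- x * 1)); [lra|rewrite ler_wpM2l//; lra].
Qed.

Lemma expR_sub1D_le x : `|expR x - 1 - x| <= x ^+ 2 * expR `|x|.
Proof.
have h1 := expR_ge1Dx x; have h2 := expR_ge1Dx (- x).
have e0 : 0 < expR x by pos.
have h : expR x - 1 - x <= x * (expR x - 1).
  move: h2; rewrite expRN -(ler_pM2r e0) mulVf ?gt_eqF// => h2; lra.
rewrite ger0_norm; last by lra.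
apply: (le_trans h); apply: (le_trans (ler_norm _)).
by rewrite normrM -real_normK ?num_real// expr2 -mulrA ler_wpM2l// expR_sub1_le.
Qed.

(** Recovers x as a limit of exponentials. With the domination of [difference_quotient_le],
    polynomials are reached from exponentials under the expectation. *)
Lemma difference_quotient_cvg x : n.+1%:R * (expR (x / n.+1%:R) - 1) @[n --> \oo] --> x.
Proof.
apply/cvgrPdist_le => e e0.
have : x ^+ 2 * expR `|x| / n.+1%:R @[n --> \oo] --> (0 : R).
  rewrite -[X in _ --> X](mulr0 (x ^+ 2 * expR `|x|)); apply: cvgM; first exact: cvg_cst.
  exact: cvg_harmonic.
move=> /cvgrPdist_le /(_ _ e0); apply: filterS => n.
rewrite sub0r normrN => h; apply: le_trans (le_trans h (lexx _)).
have n0 : 0 < n.+1%:R :> R by rewrite ltr0n.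
rewrite [leRHS]ger0_norm; last first.
  by pos.
set y := x / n.+1%:R.
have xE : x = n.+1%:R * y by rewrite /y mulrC divfK ?gt_eqF.
rewrite {1}xE -mulrBr normrM (ger0_norm (ltW n0)) distrC.
apply: (le_trans (ler_wpM2l (ltW n0) (expR_sub1D_le y))).
have yx : `|y| <= `|x|.
  by rewrite /y normrM normfV (ger0_norm (ltW n0)) ler_pdivrMr// ler_peMr// ler1n.
have -> : x ^+ 2 * expR `|x| / n.+1%:R = n.+1%:R * (y ^+ 2 * expR `|x|).
  by rewrite /y; move: (n.+1%:R) (lt0r_neq0 n0) => N N0; field.
by apply: ler_wpM2l; [exact: ltW|rewrite ler_wpM2l ?sqr_ge0// ler_expR].
Qed.

Lemma difference_quotient_le x n : `|n.+1%:R * (expR (x / n.+1%:R) - 1)| <= expR (2 * `|x|).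
Proof.
have n0 : 0 < n.+1%:R :> R by rewrite ltr0n.
set y := x / n.+1%:R.
have xE : x = n.+1%:R * y by rewrite /y mulrC divfK ?gt_eqF.
rewrite normrM (ger0_norm (ltW n0)).
apply: (le_trans (ler_wpM2l (ltW n0) (expR_sub1_le y))).
have yx : `|y| <= `|x|.
  by rewrite /y normrM normfV (ger0_norm (ltW n0)) ler_pdivrMr// ler_peMr// ler1n.
rewrite mulrA -{1}(ger0_norm (ltW n0)) -normrM -xE mulr_natl mulr2n expRD.
by rewrite ler_pM// ?expR_ge_abs// ler_expR.
Qed.

Lemma cos_coeff_le x n : `|cos_coeff x n| <= exp_coeff `|x| n.
Proof.
rewrite /cos_coeff /exp_coeff /= !normrM normfV normrX normrX normrN1 expr1n.
rewrite !normr_nat mulr1; apply: ler_wpM2r; first by pos.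
by rewrite ler_piMl//; case: odd.
Qed.

Lemma sin_coeff_le x n : `|sin_coeff x n| <= exp_coeff `|x| n.
Proof.
rewrite /sin_coeff /exp_coeff /= !normrM normfV normrX normrX normrN1 expr1n.
rewrite !normr_nat mulr1; apply: ler_wpM2r; first by pos.
by rewrite ler_piMl//; case: odd.
Qed.

Lemma series_exp_coeff_le x n : 0 <= x -> series (exp_coeff x) n <= expR x.
Proof.
move=> x0; rewrite /expR; apply: nondecreasing_cvgn_le.
  by apply: nondecreasing_series => k _ _; exact: exp_coeff_ge0.
exact: is_cvg_series_exp_coeff.
Qed.

Lemma series_coeff_le (f : R -> nat -> R) x n : (forall k, `|f x k| <= exp_coeff `|x| k) ->
  `|series (f x) n| <= expR `|x|.
Proof.
move=> fx; apply: le_trans (series_exp_coeff_le n (normr_ge0 x)).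
by rewrite /series /=; apply: (le_trans (ler_norm_sum _ _ _)); exact: ler_sum.
Qed.

End ExpBounds.

(* The odd cubic (3u - u^3)/2 fixes 0 and +-1; its iterates converge to the sign on [-1, 1]. *)
Section SignIteration.
Context {R : realType}.
Implicit Types u : R.

Definition cubic u := (3 * u - u ^+ 3) / 2.

Lemma cubic_bnd u : `|u| <= 1 -> `|cubic u| <= 1.
Proof.
rewrite !ler_norml /cubic => /andP[a b]; have : 0 <= (1 - u) ^+ 2 * (2 + u) by rewrite mulr_ge0 ?sqr_ge0//; lra.
have : 0 <= (1 + u) ^+ 2 * (2 - u) by rewrite mulr_ge0 ?sqr_ge0//; lra.
by move=> h1 h2; apply/andP; split; lra.
Qed.

Lemma iter_cubic_odd n u : iter n cubic (- u) = - iter n cubic u.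
Proof. by elim: n => //= n ->; rewrite /cubic; field. Qed.

(** As 1 - cubic v = (1 - v)^2 (2 + v) / 2, the distance to 1 shrinks at each step by the factor (1
    - v)(2 + v) / 2, at most 1 - u/2 for v >= u. *)
Lemma iter_cubic_pos n u : 0 < u -> u <= 1 -> 
  u <= iter n cubic u <= 1 /\ 1 - iter n cubic u <= (1 - u / 2) ^+ n.
Proof.
move=> u0 u1; elim: n => [|n [/andP[IH1 IH2] IH3]] /=.
  by rewrite lexx u1 expr0; split => //; lra.
set v := iter n cubic u in IH1 IH2 IH3 *.
have v0 : 0 < v by lra.
split.
  apply/andP; split; last first.
    by apply: le_trans (ler_norm _) _; apply: cubic_bnd; rewrite ger0_norm// ltW.
  apply: (le_trans IH1); rewrite /cubic.
  have : 0 <= v * ((1 - v) * (1 + v)) by rewrite !mulr_ge0//; lra.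
  lra.
rewrite exprS; apply: (via ((1 - u / 2) * (1 - v))); last by rewrite ler_wpM2l//; lra.
have : 0 <= (1 - v) * (v - u) by rewrite mulr_ge0; lra.
have : 0 <= (1 - v) * v ^+ 2 by rewrite mulr_ge0 ?sqr_ge0//; lra.
rewrite /cubic; lra.
Qed.

Lemma iter_cubic_cvg u : `|u| <= 1 -> iter n cubic u @[n --> \oo] --> Num.sg u.
Proof.
have H v : 0 < v -> v <= 1 -> iter n cubic v @[n --> \oo] --> (1 : R).
  move=> v0 v1; apply/cvgrPdist_le => e e0.
  have : (1 - v / 2) ^+ n @[n --> \oo] --> (0 : R).
    by apply: cvg_expr; rewrite ger0_norm; lra.
  move=> /cvgrPdist_le /(_ _ e0); apply: filterS => n; rewrite sub0r normrN => h.
  have [/andP[a b] c] := iter_cubic_pos n v0 v1.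
  rewrite ger0_norm ?subr_ge0//; apply: (le_trans c).
  by apply: le_trans h; exact: ler_norm.
rewrite ler_norml => /andP[a b]; have [u0|u0|->] := ltgtP u 0.
- rewrite ltr0_sg//; have /cvgN : iter n cubic (- u) @[n --> \oo] --> (1 : R) by apply: H; lra.
  apply: cvg_trans; apply: near_eq_cvg; apply: nearW => n.
  by rewrite -[RHS]opprK -iter_cubic_odd.
- by rewrite gtr0_sg//; exact: H.
rewrite sgr0; apply: cvg_near_cst; apply: nearW => n.
by elim: n => //= n ->; rewrite /cubic expr0n/= !mulr0 subrr mul0r.
Qed.

End SignIteration.

(** * Measures determined by their exponential moments *)

Section MgfUniqueness.
Context {R : realType} {d1 d2 : measure_display} {X1 : measurableType d1} {X2 : measurableType d2}
  (P1 : probability X1 R) (P2 : probability X2 R) (I : finType) (V1 : X1 -> I -> R)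
  (V2 : X2 -> I -> R) (W1 : X1 -> R) (W2 : X2 -> R) (mV1 : forall i, measT (fun w => V1 w i))
  (mV2 : forall i, measT (fun w => V2 w i)) (mW1 : measT W1) (mW2 : measT W2)
  (W1_ge0 : forall w, 0 <= W1 w) (W2_ge0 : forall w, 0 <= W2 w).
Implicit Types (h q : (I -> R) -> R).

Definition both_intg h :=
  intg P1 (fun w => W1 w * h (V1 w)) /\ intg P2 (fun w => W2 w * h (V2 w)).

(** The weights [W1], [W2] stand for densities, so that a change of measure is covered as well as
    equality of two laws. From exponentials one passes to products with coordinates, then to sine
    and cosine, to signs, and to indicators. *)
Definition same_Ex h := both_intg h /\
  Ex P1 (fun w => W1 w * h (V1 w)) = Ex P2 (fun w => W2 w * h (V2 w)).

Definition lin (a v : I -> R) : R := \sum_i a i * v i.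
Context (mgf : forall a, same_Ex (fun v => expR (lin a v))).

Lemma same_ExD h1 h2 : same_Ex h1 -> same_Ex h2 -> same_Ex (fun v => h1 v + h2 v).
Proof.
move=> [[a1 b1] e1] [[a2 b2] e2].
have E1 : (fun w => W1 w * (h1 (V1 w) + h2 (V1 w))) =
  (fun w => W1 w * h1 (V1 w) + W1 w * h2 (V1 w)) by apply/funext => w; rewrite mulrDr.
have E2 : (fun w => W2 w * (h1 (V2 w) + h2 (V2 w))) =
  (fun w => W2 w * h1 (V2 w) + W2 w * h2 (V2 w)) by apply/funext => w; rewrite mulrDr.
split; first by split; [rewrite E1|rewrite E2]; exact: intgD.
by rewrite E1 E2 !ExD// e1 e2.
Qed.

Lemma same_ExZ (c : R) h : same_Ex h -> same_Ex (fun v => c * h v).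
Proof.
move=> [[a1 b1] e1].
have E1 : (fun w => W1 w * (c * h (V1 w))) =
  (fun w => c * (W1 w * h (V1 w))) by apply/funext => w; rewrite mulrCA.
have E2 : (fun w => W2 w * (c * h (V2 w))) =
  (fun w => c * (W2 w * h (V2 w))) by apply/funext => w; rewrite mulrCA.
split; first by split; [rewrite E1|rewrite E2]; exact: intgZ.
by rewrite E1 E2 !ExZ// e1.
Qed.

Lemma same_Ex_lim (h_ : nat -> (I -> R) -> R) h g : (forall n, same_Ex (h_ n)) ->
  both_intg g -> (forall n v, `|h_ n v| <= g v) -> (forall v, h_ n v @[n --> \oo] --> h v) ->
  same_Ex h.
Proof.
move=> sh [g1 g2] hg hh.
have H d (X : measurableType d) (P : probability X R) (V : X -> I -> R) (W : X -> R) :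
  (forall w, 0 <= W w) -> (forall n, intg P (fun w => W w * h_ n (V w))) ->
  intg P (fun w => W w * g (V w)) -> intg P (fun w => W w * h (V w)) /\
  Ex P (fun w => W w * h_ n (V w)) @[n --> \oo] --> Ex P (fun w => W w * h (V w)).
  move=> W0 hi gi; apply: (Ex_dominated hi gi).
    by move=> n w; rewrite normrM (ger0_norm (W0 w)) ler_wpM2l.
  by move=> w; apply: cvgM; [exact: cvg_cst|exact: hh].
have [i1 c1] := H _ _ P1 V1 W1 W1_ge0 (fun n => (sh n).1.1) g1.
have [i2 c2] := H _ _ P2 V2 W2 W2_ge0 (fun n => (sh n).1.2) g2.
split; first by split.
rewrite -(cvg_lim _ c1)// -(cvg_lim _ c2)//.
by congr (lim (_ @ \oo)); apply/funext => n; case: (sh n).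
Qed.

Definition nrm (v : I -> R) : R := \sum_i `|v i|.

Lemma nrm_ge0 v : 0 <= nrm v. Proof. exact: sumr_ge0. Qed.

Lemma coord_nrm v i : `|v i| <= nrm v.
Proof. by rewrite /nrm (bigD1 i)//= lerDl sumr_ge0. Qed.

Lemma lin_nrm a v : `|lin a v| <= nrm a * nrm v.
Proof.
rewrite /lin; apply: (le_trans (ler_norm_sum _ _ _)).
rewrite {1}/nrm mulr_suml; apply: ler_sum => i _; rewrite normrM.
by rewrite ler_wpM2l// coord_nrm.
Qed.

(** The exponential of c times the l1 norm is at each point one of the finitely many exponentials of
    linear forms with coefficients c or -c, hence at most their sum. *)
Lemma both_intg_nrm (c : R) : both_intg (fun v => expR (c * nrm v)).
Proof.
pose a (s : {ffun I -> bool}) (i : I) : R := if s i then c else - c.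
have H v : expR (c * nrm v) <= \sum_(s : {ffun I -> bool}) expR (lin (a s) v).
  rewrite (bigD1 [ffun i => 0 <= v i])//=.
  rewrite -[leLHS]addr0; apply: lerD; last by pos.
  rewrite ler_expR /nrm /lin mulr_sumr; apply: ler_sum => i _; rewrite /a ffunE.
  by case: (leP 0 (v i)) => vi; [rewrite ger0_norm|rewrite ltr0_norm// mulrN mulNr].
have G d (X : measurableType d) (P : probability X R) (V : X -> I -> R) (W : X -> R) :
  (forall w, 0 <= W w) -> (forall i, measT (fun w => V w i)) ->
  measT W -> (forall s, intg P (fun w => W w * expR (lin (a s) (V w)))) ->
  intg P (fun w => W w * expR (c * nrm (V w))).
  move=> W0 mV mW iV; apply: (@intg_le _ _ _ P _
    (fun w => \sum_(s : {ffun I -> bool}) W w * expR (lin (a s) (V w)))).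
  - apply: measurable_funM => //; apply: measurableT_comp => //.
    apply: measurable_funM => //; apply: measurable_sum => i.
    by meas.
  - by apply: intg_sum => s _; exact: iV.
  - move=> w; rewrite ger0_norm ?mulr_ge0// -mulr_sumr.
    by rewrite ler_wpM2l.
by split; apply: G => // s; have [[]] := mgf (a s).
Qed.

(** Keeping an arbitrary exponential factor makes the class stable under multiplication by a
    coordinate: the factor is differentiated in its i-th coefficient. The growth bound supplies the
    dominating functions. *)
Definition nice h := (exists C c : R, forall v, `|h v| <= C * expR (c * nrm v)) /\
  forall a, same_Ex (fun v => h v * expR (lin a v)).

Lemma nice_lim (h_ : nat -> (I -> R) -> R) h (C c : R) : (forall n, nice (h_ n)) ->
  (forall n v, `|h_ n v| <= C * expR (c * nrm v)) ->
  (forall v, h_ n v @[n --> \oo] --> h v) -> nice h.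
Proof.
move=> nh hb hh; split.
  exists C, c => v.
  rewrite -(cvg_lim _ (cvg_norm (hh v)))//; apply: limr_le.
    by apply/cvg_ex; exists `|h v|; exact: cvg_norm.
  by apply: nearW => n; exact: hb.
move=> a; apply: (@same_Ex_lim (fun n v => h_ n v * expR (lin a v)) _
  (fun v => C * expR ((c + nrm a) * nrm v))).
- by move=> n; case: (nh n).
- have [i1 i2] := both_intg_nrm (c + nrm a); split.
  + by under eq_fun do rewrite mulrCA; exact: intgZ.
  + by under eq_fun do rewrite mulrCA; exact: intgZ.
- move=> n v; rewrite normrM mulrDl expRD mulrA; apply: ler_pM => //.
  by rewrite ger0_norm// ler_expR (le_trans (ler_norm _))// lin_nrm.
- by move=> v; apply: cvgM; [exact: hh|exact: cvg_cst].
Qed.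

Lemma same_Ex_eq h h' : h =1 h' -> same_Ex h -> same_Ex h'.
Proof. by move=> /funext ->. Qed.

Lemma nice_eq h h' : h =1 h' -> nice h -> nice h'.
Proof. by move=> /funext ->. Qed.

Lemma nice1 : nice (fun=> 1).
Proof.
split; first by exists 1, 0 => v; rewrite mul0r expR0 mulr1 normr1.
by move=> a; apply: same_Ex_eq (mgf a) => v; rewrite mul1r.
Qed.

Lemma niceD h1 h2 : nice h1 -> nice h2 -> nice (fun v => h1 v + h2 v).
Proof.
move=> [[C1 [c1 b1]] s1] [[C2 [c2 b2]] s2]; split.
  exists (`|C1| + `|C2|), (Num.max c1 c2) => v.
  apply: (le_trans (ler_normD _ _)); rewrite mulrDl; apply: lerD.
    apply: (le_trans (b1 v)); apply: (via (`|C1| * expR (c1 * nrm v))).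
      by rewrite ler_wpM2r// ler_norm.
    by rewrite ler_wpM2l// ler_expR ler_wpM2r ?nrm_ge0// le_max lexx.
  apply: (le_trans (b2 v)); apply: (via (`|C2| * expR (c2 * nrm v))).
    by rewrite ler_wpM2r// ler_norm.
  by rewrite ler_wpM2l// ler_expR ler_wpM2r ?nrm_ge0// le_max lexx orbT.
move=> a; apply: same_Ex_eq (same_ExD (s1 a) (s2 a)) => v.
by rewrite mulrDl.
Qed.

Lemma niceZ (k : R) h : nice h -> nice (fun v => k * h v).
Proof.
move=> [[C [c b]] s]; split.
  exists (`|k| * C), c => v; rewrite normrM -mulrA; exact: ler_wpM2l.
by move=> a; apply: same_Ex_eq (same_ExZ k (s a)) => v; rewrite mulrA.
Qed.

Lemma nice_coord h i : nice h -> nice (fun v => h v * v i).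
Proof.
move=> [[C [c b]] s].
have b' v : `|h v * expR (2 * `|v i|)| <= C * expR ((c + 2) * nrm v).
  rewrite normrM [(c + 2) * _]mulrDl expRD mulrA; apply: ler_pM => //.
  by rewrite ger0_norm// ler_expR ler_wpM2l// coord_nrm.
split.
  exists C, (c + 2) => v; apply: le_trans (b' v).
  rewrite [leLHS]normrM [leRHS]normrM ler_wpM2l// [leRHS]ger0_norm//.
  by apply: (le_trans (expR_ge_abs _)); rewrite ler_expR mulr_natl mulr2n lerDl.
move=> a; apply: (@same_Ex_lim (fun n v => h v * (n.+1%:R * (expR (v i / n.+1%:R) - 1)) *
  expR (lin a v)) _ (fun v => C * expR ((c + 2 + nrm a) * nrm v))).
- move=> n; pose an j := a j + (if j == i then n.+1%:R^-1 else 0).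
  apply: same_Ex_eq (same_ExZ n.+1%:R (same_ExD (s an) (same_ExZ (-1) (s a)))) => v.
  suff -> : lin an v = lin a v + v i / n.+1%:R by rewrite expRD; ring.
  rewrite /lin /an; under eq_bigr do rewrite mulrDl; rewrite big_split/=; congr (_ + _).
  by rewrite (bigD1 i)//= eqxx big1 ?addr0 1?mulrC// => j /negbTE ->; rewrite mul0r.
- have [i1 i2] := both_intg_nrm (c + 2 + nrm a); split.
  + by under eq_fun do rewrite mulrCA; exact: intgZ.
  + by under eq_fun do rewrite mulrCA; exact: intgZ.
- move=> n v; rewrite normrM [(c + 2 + _) * _]mulrDl expRD [C * (_ * _)]mulrA; apply: ler_pM => //.
    apply: le_trans (b' v); rewrite !normrM ler_wpM2l// [leRHS]ger0_norm//.
    by rewrite -normrM difference_quotient_le.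
  by rewrite ger0_norm// ler_expR (le_trans (ler_norm _))// lin_nrm.
- move=> v; apply: cvgM; last exact: cvg_cst.
  by apply: cvgM; [exact: cvg_cst|exact: difference_quotient_cvg].
Qed.

(** Partial sums are polynomials in one coordinate, dominated by the exponential series. *)
Lemma nice_series (f : R -> nat -> R) (F : R -> R) (u : nat -> R) (t : R) h i :
  (forall x, f x = fun k => u k * x ^+ k) -> (forall x k, `|f x k| <= exp_coeff `|x| k) ->
  (forall x, series (f x) n @[n --> \oo] --> F x) -> nice h -> nice (fun v => h v * F (t * v i)).
Proof.
move=> fE fx fF nh; have [[C [c b]] _] := nh.
apply: (@nice_lim (fun n v => h v * series (f (t * v i)) n) _ C (c + `|t|)).
- have npow k : nice (fun v => h v * v i ^+ k).
    elim: k => [|k IH]; first by apply: nice_eq nh => v; rewrite expr0 mulr1.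
    by apply: nice_eq (nice_coord i IH) => v; rewrite exprSr mulrA.
  elim => [|n IH].
    by apply: nice_eq (niceZ 0 nh) => v; rewrite /series/= big_geq// mul0r mulr0.
  apply: nice_eq (niceD IH (niceZ (u n * t ^+ n) (npow n))) => v.
  by rewrite [in RHS]/series/= big_nat_recr//= fE exprMn -/(series _ _) /series/=; ring.
- move=> n v; rewrite normrM mulrDl expRD mulrA; apply: ler_pM => //.
  apply: (le_trans (series_coeff_le n (fx _))); rewrite ler_expR normrM.
  by rewrite ler_wpM2l// coord_nrm.
- by move=> v; apply: cvgM; [exact: cvg_cst|exact: fF].
Qed.

Lemma nice_sin (t : R) h i : nice h -> nice (fun v => h v * sin (t * v i)).
Proof.
apply: (@nice_series sin_coeff _ _ t h i) => [x|x k|x].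
- exact: sin_coeffE.
- exact: sin_coeff_le.
- by rewrite sin.unlock; exact: is_cvg_series_sin_coeff.
Qed.

Lemma nice_cos (t : R) h i : nice h -> nice (fun v => h v * cos (t * v i)).
Proof.
apply: (@nice_series cos_coeff _ _ t h i) => [x|x k|x].
- exact: cos_coeffE.
- exact: cos_coeff_le.
- by rewrite cos.unlock; exact: is_cvg_series_cos_coeff.
Qed.

(** Bounded multipliers of the class [nice]. The bound 1 makes them stable under products and
    pointwise limits, and keeps the iteration of [cubic] in the interval where it converges to the
    sign. *)
Definition mul1 q := (forall v, `|q v| <= 1) /\ forall h, nice h -> nice (fun v => h v * q v).

Lemma mul1_eq q q' : q =1 q' -> mul1 q -> mul1 q'.
Proof. by move=> /funext ->. Qed.

Lemma mul1_lim (q_ : nat -> (I -> R) -> R) q : (forall n, mul1 (q_ n)) ->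
  (forall v, q_ n v @[n --> \oo] --> q v) -> mul1 q.
Proof.
move=> mq qq; split.
  move=> v; rewrite -(cvg_lim _ (cvg_norm (qq v)))//; apply: limr_le.
    by apply/cvg_ex; exists `|q v|; exact: cvg_norm.
  by apply: nearW => n; case: (mq n).
move=> h nh; have [[C [c b]] _] := nh.
apply: (@nice_lim (fun n v => h v * q_ n v) _ C c).
- by move=> n; case: (mq n) => _; exact.
- move=> n v; rewrite normrM; apply: le_trans (b v).
  by rewrite ler_piMr//; case: (mq n).
- by move=> v; apply: cvgM; [exact: cvg_cst|exact: qq].
Qed.

Lemma mul1M q q' : mul1 q -> mul1 q' -> mul1 (fun v => q v * q' v).
Proof.
move=> [b n] [b' n']; split; first by move=> v; rewrite normrM mulr_ile1.
by move=> h /n /n'; apply: nice_eq => v; rewrite mulrA.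
Qed.

Lemma mul1_cubic q : mul1 q -> mul1 (fun v => cubic (q v)).
Proof.
move=> [b n]; split; first by move=> v; exact: cubic_bnd.
move=> h nh; apply: nice_eq (niceD (niceZ (3 / 2) (n _ nh)) (niceZ (- 2^-1) (n _ (n _ (n _ nh))))) => v.
by rewrite /cubic; field.
Qed.

Lemma mul1_sg q : mul1 q -> mul1 (fun v => Num.sg (q v)).
Proof.
move=> mq; apply: (@mul1_lim (fun n v => iter n cubic (q v))).
  by elim => [|n IH] //=; exact: mul1_cubic.
by move=> v; apply: iter_cubic_cvg; case: mq.
Qed.

Lemma mul1_sin (t r : R) i : mul1 (fun v => sin (t * v i + r)).
Proof.
split; first by move=> v; rewrite ler_norml sin_geN1 sin_le1.
move=> h nh; apply: nice_eq (niceD (niceZ (cos r) (nice_sin t i nh))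
  (niceZ (sin r) (nice_cos t i nh))) => v.
by rewrite sinD; ring.
Qed.

(** For large n the modulus of (v_i - r) / (n + 1) is below pi, where the sine has the sign of its
    argument. *)
Lemma mul1_sg_coord (r : R) i : mul1 (fun v => Num.sg (v i - r)).
Proof.
apply: (@mul1_lim (fun n v => Num.sg (sin (n.+1%:R^-1 * v i + (- r / n.+1%:R))))).
  by move=> n; exact/mul1_sg/mul1_sin.
move=> v; apply: cvg_near_cst.
have : (v i - r) * n.+1%:R^-1 @[n --> \oo] --> (0 : R).
  rewrite -[X in _ --> X](mulr0 (v i - r)); apply: cvgM; first exact: cvg_cst.
  exact: cvg_harmonic.
move=> /cvgrPdist_lt /(_ _ (pi_gt0 R)); apply: filterS => n.
rewrite sub0r normrN.
have -> : n.+1%:R^-1 * v i + - r / n.+1%:R = (v i - r) / n.+1%:R by ring.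
have [x0|x0|->] := ltgtP (v i - r) 0.
- rewrite ltr_norml => /andP[a _]; rewrite (ltr0_sg x0); apply: ltr0_sg.
  rewrite -[X in sin X]opprK sinN oppr_lt0; apply: sin_gt0_pi.
  by rewrite oppr_gt0 pmulr_llt0// x0/= ltrNl.
- rewrite ltr_norml => /andP[_ a]; rewrite (gtr0_sg x0); apply: gtr0_sg.
  by apply: sin_gt0_pi; rewrite mulr_gt0.
- by rewrite mul0r sin0.
Qed.

Definition mulset (A : set (I -> R)) := mul1 (fun v => \1_A v).

(** The sign vanishes at the end point; comparing with r + 1/(n + 1) instead of r makes the limit
    exactly the indicator of the open ray. *)
Lemma mulset_ray (r : R) i : mulset [set v | r < v i].
Proof.
apply: (@mul1_lim (fun n v => (1 + Num.sg (v i - (r + n.+1%:R^-1))) / 2)).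
  move=> n; have [b m] := mul1_sg_coord (r + n.+1%:R^-1) i; split.
    move=> v; have := b v; rewrite !ler_norml => /andP[]; set x := Num.sg _ => h1 h2.
    by apply/andP; split; lra.
  move=> h nh; apply: nice_eq (niceD (niceZ 2^-1 nh) (niceZ 2^-1 (m _ nh))) => v.
  by field.
move=> v; apply: cvg_near_cst; rewrite indicE.
have [rv|rv] := ltP r (v i).
  rewrite mem_set//.
  have : n.+1%:R^-1 @[n --> \oo] --> (0 : R) by exact: cvg_harmonic.
  have d0 : 0 < v i - r by pos.
  move=> /cvgrPdist_lt /(_ _ d0); apply: filterS => n.
  rewrite sub0r normrN ger0_norm// => h.
  have -> : Num.sg (v i - (r + n.+1%:R^-1)) = 1 by apply: gtr0_sg; rewrite subr_gt0 -ltrBrDl.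
  by rewrite /=; lra.
apply: nearW => n; rewrite memNset; last by move=> /=; rewrite ltNge rv.
have -> : Num.sg (v i - (r + n.+1%:R^-1)) = -1 by apply: ltr0_sg; rewrite subr_lt0 (le_lt_trans rv)// ltrDl.
by rewrite /=; lra.
Qed.

Lemma mulsetC A : mulset A -> mulset (~` A).
Proof.
move=> [b m]; split; first by move=> v; rewrite indicE; case: (_ \in _); rewrite ?normr1 ?normr0.
move=> h nh; apply: nice_eq (niceD nh (niceZ (-1) (m _ nh))) => v.
by rewrite !indicE in_setC; case: (_ \in _) => /=; ring.
Qed.

Lemma mulsetI A B : mulset A -> mulset B -> mulset (A `&` B).
Proof. by move=> mA mB; apply: mul1_eq (mul1M mA mB) => v; rewrite indicI. Qed.

Lemma mulset0 : mulset set0.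
Proof.
split; first by move=> v; rewrite indicE; case: (_ \in _); rewrite ?normr1 ?normr0.
by move=> h nh; apply: nice_eq (niceZ 0 nh) => v; rewrite indic0 mulr0 mul0r.
Qed.

Lemma mulset_bigcup (F : nat -> set (I -> R)) : (forall n, mulset (F n)) -> mulset (\bigcup_n F n).
Proof.
move=> mF; pose G n := \big[setU/set0]_(k < n) F k.
have mG n : mulset (G n).
  elim: n => [|n IH]; first by rewrite /G big_ord0; exact: mulset0.
  rewrite /G big_ord_recr/= -/(G n) -[_ `|` _]setCK setCU.
  by apply/mulsetC/mulsetI; exact: mulsetC.
apply: (mul1_lim mG) => v; apply: cvg_near_cst.
have [[k _ Fk]|nF] := pselect ((\bigcup_n F n) v); last first.
  apply: nearW => n; rewrite !indicE !memNset// /G -bigcup_mkord => -[k _ Fk].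
  by apply: nF; exists k.
exists k.+1 => // n /= kn; rewrite !indicE !mem_set//; first by exists k.
by rewrite /G -bigcup_mkord; exists k.
Qed.

(** The sets whose indicator is a multiplier form a sigma-algebra containing the rays in each
    coordinate. *)
Lemma mgf_same_Ex (A : set (fspace R I)) : measurable A -> same_Ex (fun v => \1_A v).
Proof.
move=> mA; suff [_ /(_ _ nice1)[_ /(_ (fun=> 0))]] : mulset A.
  by apply: same_Ex_eq => v; rewrite /lin big1 ?expR0 ?mulr1 ?mul1r// => i _; rewrite mul0r.
move: A mA; apply: smallest_sub.
  split; first exact: mulset0.
    by move=> B mB; rewrite setTD; exact: mulsetC.
  exact: mulset_bigcup.
move=> A [i [B [mB ->]]].
pose S := [set C : set R | mulset [set v | C (v i)]].
suff : @measurable _ (measurableTypeR R) `<=` S by exact.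
rewrite RGenOInfty.measurableE; apply: smallest_sub.
  split.
  - by rewrite /S/=; apply: eq_ind mulset0 _ _; apply/seteqP; split.
  - by move=> C mC; rewrite setTD; exact: (mulsetC mC).
  - move=> F mF; rewrite /S/=; apply: eq_ind (mulset_bigcup mF) _ _.
    by apply/seteqP; split => v [k _ Fk]; exists k.
move=> C [r ->]; rewrite /S/=; apply: eq_ind (mulset_ray r i) _ _.
by apply/seteqP; split => v /=; rewrite in_itv/= andbT.
Qed.

End MgfUniqueness.

(** * Mean and variance from exponential moments *)

Section NormalMoments.
Context {R : realType} {d : measure_display} {X : measurableType d} (P : probability X R).

Lemma normr_half (x : R) : 2 * `|x / 2| = `|x|.
Proof. by rewrite normrM normfV (ger0_norm (ler0n _ 2)) mulrC divfK. Qed.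

Lemma intg_exp_abs (U : X -> R) : measT U -> (forall t, intg P (fun w => expR (t * U w))) ->
  forall t, intg P (fun w => expR (t * `|U w|)).
Proof.
move=> mU iU t; apply: (@intg_le _ _ _ P _ (fun w => expR (t * U w) + expR (- t * U w))).
- by meas.
- exact: intgD.
move=> w; rewrite ger0_norm//; have [u0|u0] := leP 0 (U w).
  by rewrite ger0_norm// lerDl expR_ge0.
by rewrite ltr0_norm// mulrN mulNr lerDr expR_ge0.
Qed.

Lemma intg_exp_pow (U : X -> R) k : measT U ->
  (forall t, intg P (fun w => expR (t * U w))) -> intg P (fun w => `|U w| ^+ k).
Proof.
move=> mU iU; apply: (@intg_le _ _ _ P _ (fun w => expR (k%:R * `|U w|))).
- by meas.
- exact: intg_exp_abs.
move=> w; rewrite normrX normr_id expRM_natl.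
by rewrite lerXn2r ?nnegrE// expR_ge_abs.
Qed.

Lemma mgf_mean_arith (m mu s t : R) : 0 <= t -> t <= 1 ->
  t * m <= expR (t * mu + s ^+ 2 * t ^+ 2 / 2) - 1 ->
  t * (m - mu) <= t * (t * (s ^+ 2 + (`|mu| + s ^+ 2) ^+ 2 * expR (`|mu| + s ^+ 2))).
Proof.
move=> t0 t1 h; set y := t * mu + _ in h.
have s0 : 0 <= s ^+ 2 by pos.
have yb : `|y| <= t * (`|mu| + s ^+ 2).
  apply: (le_trans (ler_normD _ _)); rewrite normrM (ger0_norm t0) mulrDr lerD2l.
  rewrite ger0_norm; last by pos.
  have : t * (t * s ^+ 2) <= 1 * (t * s ^+ 2) by rewrite ler_wpM2r// mulr_ge0.
  have : 0 <= t * s ^+ 2 by pos.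
  by lra.
have := ler_norm (expR y - 1 - y); move/le_trans/(_ (expR_sub1D_le y)) => h2.
have h3 : y ^+ 2 * expR `|y| <= (t * (`|mu| + s ^+ 2)) ^+ 2 * expR (`|mu| + s ^+ 2).
  rewrite -(real_normK (num_real y)); apply: ler_pM; rewrite//.
  - by rewrite lerXn2r ?nnegrE// mulr_ge0// addr_ge0.
  - by rewrite ler_expR; apply: (le_trans yb); rewrite ler_piMl// addr_ge0.
have h4 : t * (t * s ^+ 2 / 2) <= t * (t * s ^+ 2).
  have : 0 <= t * (t * s ^+ 2) by pos.
  by lra.
rewrite exprMn in h3.
set E := (`|mu| + s ^+ 2) ^+ 2 * expR _ in h3 *.
have {}h3 : y ^+ 2 * expR `|y| <= t ^+ 2 * E by rewrite /E mulrA.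
have yE : y = t * mu + t * (t * s ^+ 2 / 2) by rewrite /y; ring.
have -> : t * (t * (s ^+ 2 + E)) = t * (t * s ^+ 2) + t ^+ 2 * E by ring.
by lra.
Qed.

Lemma le_eps_scale (a K : R) : (forall t, 0 < t -> t <= 1 -> a <= t * K) -> a <= 0.
Proof.
move=> h; apply/ler_addgt0Pr => e e0; rewrite add0r.
have K0 : 0 < `|K| + 1 by rewrite ltr_wpDl.
have [e1|e1] := leP (e / (`|K| + 1)) 1; last first.
  apply: (le_trans (h 1 ltr01 (lexx _))); rewrite mul1r; apply: (le_trans (ler_norm _)).
  apply: (via (`|K| + 1)); first by rewrite lerDl.
  by move: e1; rewrite ltr_pdivlMr// mul1r => /ltW.
apply: (le_trans (h _ (divr_gt0 e0 K0) e1)); rewrite mulrAC ler_pdivrMr//.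
by rewrite ler_wpM2l ?(ltW e0)// (le_trans (ler_norm _))// lerDl.
Qed.

(** From e^y >= 1 + y one gets t E U <= E e^(tU) - 1 = t mu + O(t^2); letting t tend to 0 from both
    sides gives the mean. *)
Lemma normal_mean (U : X -> R) (mu s : R) : measT U ->
  (forall t, intg P (fun w => expR (t * U w)) /\
  Ex P (fun w => expR (t * U w)) = expR (t * mu + s ^+ 2 * t ^+ 2 / 2)) -> intg P U /\ Ex P U = mu.
Proof.
move=> mU H.
have iU : intg P U.
  apply: (@intg_le _ _ _ P _ (fun w => `|U w| ^+ 1)) => //.
  by apply: intg_exp_pow => // t; case: (H t).
split => //.
have J t : t * Ex P U <= expR (t * mu + s ^+ 2 * t ^+ 2 / 2) - 1.
  have [it <-] := H t; rewrite lerBrDl -ExZ//.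
  rewrite -[X in X + _](Ex_cst P) -ExD//; [|exact: intg_cst|exact: intgZ].
  apply: Ex_le => //; first by apply: intgD; [exact: intg_cst|exact: intgZ].
  by move=> w; exact: expR_ge1Dx.
set K := s ^+ 2 + (`|mu| + s ^+ 2) ^+ 2 * expR (`|mu| + s ^+ 2).
apply/eqP; rewrite eq_le; apply/andP; split; rewrite -subr_le0.
  apply: (@le_eps_scale _ K) => t t0 t1.
  by rewrite -(ler_pM2l t0); apply: mgf_mean_arith => //; exact: ltW.
apply: (@le_eps_scale _ K) => t t0 t1; rewrite -(ler_pM2l t0).
have := @mgf_mean_arith (- Ex P U) (- mu) s t (ltW t0) t1.
rewrite normrN -/K; have := J (- t); rewrite sqrrN !mulNr -!mulrN => h /(_ h).
by rewrite opprK addrC.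
Qed.

(** The second difference quotient N^2 (e^(U/N) + e^(-U/N) - 2) is the square of a difference of two
    first quotients, hence dominated, and tends to U^2. *)
Lemma normal_variance (U : X -> R) (s : R) : measT U ->
  (forall t, intg P (fun w => expR (t * U w)) /\
  Ex P (fun w => expR (t * U w)) = expR (s ^+ 2 * t ^+ 2 / 2)) ->
  intg P (fun w => U w ^+ 2) /\ Ex P (fun w => U w ^+ 2) = s ^+ 2.
Proof.
move=> mU H; have iU t : intg P (fun w => expR (t * U w)) by case: (H t).
pose N n : R := n.+1%:R.
pose f n w := N n ^+ 2 * (expR ((N n)^-1 * U w) + (expR (- (N n)^-1 * U w) + (-2))).
have fE n w : f n w = (n.+1%:R * (expR (U w / 2 / n.+1%:R) - 1) -
  n.+1%:R * (expR (- U w / 2 / n.+1%:R) - 1)) ^+ 2.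
  rewrite -mulrBr exprMn /f -/(N n); congr (_ * _).
  have -> : (N n)^-1 * U w = U w / 2 / N n + U w / 2 / N n by field.
  have -> : - (N n)^-1 * U w = - U w / 2 / N n + - U w / 2 / N n by field.
  have h : expR (U w / 2 / N n) * expR (- U w / 2 / N n) = 1.
    by rewrite -expRD -[RHS]expR0; congr expR; field.
  rewrite !expRD; move: h; set a := expR _; set b := expR _ => h.
  by rewrite -[X in - X]/(1 + 1 : R) -{1 2}h; ring.
have [] := @Ex_dominated _ _ _ P f (fun w => U w ^+ 2) (fun w => 4 * expR (2 * `|U w|)).
- move=> n; apply: intgZ; apply: intgD => //; apply: intgD => //; exact: intg_cst.
- by apply: intgZ; exact: intg_exp_abs.
- move=> n w; rewrite fE ger0_norm ?sqr_ge0//.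
  have h1 := difference_quotient_le (U w / 2) n.
  have h2 := difference_quotient_le (- U w / 2) n.
  have e1 : 2 * `|U w / 2| = `|U w| by exact: normr_half.
  have e2 : 2 * `|- U w / 2| = `|U w| by rewrite mulNr normrN; exact: normr_half.
  rewrite e1 in h1; rewrite e2 in h2.
  rewrite -(real_normK (num_real _)); apply: (via ((2 * expR `|U w|) ^+ 2)).
    rewrite lerXn2r ?nnegrE//; apply: (le_trans (ler_normB _ _)).
    by rewrite [leRHS]mulr_natl mulr2n lerD.
  by rewrite exprMn -expRM_natl; lra.
- move=> w; have h := cvgB (@difference_quotient_cvg R (U w / 2)) (@difference_quotient_cvg R (- U w / 2)).
  have -> : U w ^+ 2 = (U w / 2 - (- U w / 2)) * (U w / 2 - (- U w / 2)) by field.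
  apply: cvg_trans (cvgM (h _) (h _)); apply: near_eq_cvg; apply: nearW => n.
  by rewrite fE expr2.
move=> iU2 c; split => //.
rewrite -(cvg_lim _ c)//; apply: cvg_lim => //.
(* The expectation of the second quotient is a first quotient with step N^2, N = n + 1; the index
   N^2 - 1 accounts for the successor in the quotient. *)
have c2 : 2 * (((n.+1 ^ 2).-1).+1%:R * (expR (s ^+ 2 / 2 / ((n.+1 ^ 2).-1).+1%:R) - 1)) @[n --> \oo] --> s ^+ 2.
  have -> : s ^+ 2 = 2 * (s ^+ 2 / 2) by field.
  apply: cvgM; first exact: cvg_cst.
  have := @difference_quotient_cvg R (2 * (s ^+ 2 / 2) / 2).
  have -> : 2 * (s ^+ 2 / 2) / 2 = s ^+ 2 / 2 by field.
  move=> h; apply: (cvg_comp (fun n : nat => (n.+1 ^ 2).-1) _ _ h).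
  apply/cvgnyPge => A; exists A => // n An.
  rewrite /mkset -ltnS prednK// expnS expn1 (leq_trans (_ : A < n.+1)%N)//.
  exact: leq_pmulr.
apply: cvg_trans c2; apply: near_eq_cvg; apply: nearW => n.
rewrite /f ExZ; last by apply: intgD => //; apply: intgD => //; exact: intg_cst.
rewrite ExD//; last by apply: intgD => //; exact: intg_cst.
rewrite ExD//; last exact: intg_cst.
have [_ ->] := H (N n)^-1; have [_ ->] := H (- (N n)^-1).
rewrite Ex_cst sqrrN prednK// natrX -/(N n).
have -> : s ^+ 2 * (N n)^-1 ^+ 2 / 2 = s ^+ 2 / 2 / N n ^+ 2 by field.
by ring.
Qed.

End NormalMoments.

(** * Centred Gaussian vectors *)

Section GaussianSystems.
Context {R : realType}.

(* centred jointly normal with covariance C, stated through the moment generating function *)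
Definition gaussian_sys d (X : measurableType d) (P : probability X R) (I : finType)
    (V : X -> I -> R) (C : I -> I -> R) :=
  [/\ forall i, measT (fun w => V w i), forall i j, C i j = C j i &
  forall a : I -> R, intg P (fun w => expR (lin a (V w))) /\
    Ex P (fun w => expR (lin a (V w))) = expR ((\sum_i \sum_j a i * a j * C i j) / 2)].

Lemma measurable_lin d (X : measurableType d) (I : finType) (V : X -> I -> R) (a : I -> R) :
  (forall i, measT (fun w => V w i)) -> measT (fun w => lin a (V w)).
Proof. by move=> mV; apply: measurable_sum => i; exact: measurable_funM. Qed.

Definition qform (I : finType) (C : I -> I -> R) (a : I -> R) : R :=
  \sum_i \sum_j a i * a j * C i j.

Lemma qform_scale (I : finType) (C : I -> I -> R) (a : I -> R) (t : R) :
  qform C (fun i => t * a i) = t ^+ 2 * qform C a.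
Proof.
rewrite /qform mulr_sumr; apply: eq_bigr => i _; rewrite mulr_sumr.
by apply: eq_bigr => j _; ring.
Qed.

Lemma lin_scale (I : finType) (a v : I -> R) (t : R) : lin (fun i => t * a i) v = t * lin a v.
Proof. by rewrite /lin mulr_sumr; apply: eq_bigr => i _; rewrite mulrA. Qed.

Lemma qform_lin2 d (X : measurableType d) (P : probability X R) (I : finType)
  (V : X -> I -> R) (C : I -> I -> R) (a : I -> R) :
  (forall i j, intg P (fun w => V w i * V w j) /\ Ex P (fun w => V w i * V w j) = C i j) ->
  intg P (fun w => lin a (V w) ^+ 2) /\ Ex P (fun w => lin a (V w) ^+ 2) = qform C a.
Proof.
move=> H.
have E w : lin a (V w) ^+ 2 = \sum_i \sum_j (a i * a j) * (V w i * V w j).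
  rewrite expr2 /lin mulr_suml; apply: eq_bigr => i _; rewrite mulr_sumr.
  by apply: eq_bigr => j _; ring.
under eq_fun do rewrite E.
have i2 i j : intg P (fun w => (a i * a j) * (V w i * V w j)) by apply: intgZ; case: (H i j).
split; first by apply: intg_sum => i _; exact: intg_sum.
rewrite Ex_sum; last by move=> i _; exact: intg_sum.
apply: eq_bigr => i _; rewrite Ex_sum//; apply: eq_bigr => j _.
by have [h <-] := H i j; rewrite ExZ.
Qed.

(** A linear combination is normal with unknown parameters; its mean and variance are read off the
    exponential moments and must agree with 0 and with the quadratic form of the second moments. *)
Lemma gaussian_sys_normal d (X : measurableType d) (P : probability X R) (I : finType)
  (V : X -> I -> R) (C : I -> I -> R) : (forall i, measT (fun w => V w i)) ->
  (forall a : I -> R, exists mu s : R, forall B, measurable B ->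
  P [set w | B (lin a (V w))] = normal_law mu s B) -> (forall i, Ex P (fun w => V w i) = 0) ->
  (forall i j, Ex P (fun w => V w i * V w j) = C i j) -> gaussian_sys P V C.
Proof.
move=> mV nV V0 VC.
have mom a : exists mu s, (forall t, intg P (fun w => expR (t * lin a (V w))) /\
  Ex P (fun w => expR (t * lin a (V w))) = expR (t * mu + s ^+ 2 * t ^+ 2 / 2)).
  have [mu [s H]] := nV a; exists mu, s => t.
  by apply: normal_law_mgf => //; exact: measurable_lin.
have linE i w : lin (fun j => (j == i)%:R) (V w) = V w i.
  by rewrite /lin (bigD1 i)//= eqxx mul1r big1 ?addr0// => j /negbTE ->; rewrite mul0r.
have iV i : intg P (fun w => V w i).
  have [mu [s /(normal_mean (measurable_lin _ mV))[h _]]] := mom (fun j => (j == i)%:R).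
  by move: h; under eq_fun do rewrite linE.
have iV2 i : intg P (fun w => `|V w i| ^+ 2).
  have [mu [s H]] := mom (fun j => (j == i)%:R).
  apply: intg_exp_pow => // t; have [h _] := H t.
  by move: h; under eq_fun do rewrite linE.
have iVV i j : intg P (fun w => V w i * V w j).
  apply: (@intg_le _ _ _ P _ (fun w => `|V w i| ^+ 2 + `|V w j| ^+ 2)).
  - by meas.
  - exact: intgD.
  move=> w; rewrite normrM; have := sqr_ge0 (`|V w i| - `|V w j|).
  have : 0 <= `|V w i| * `|V w j| by pos.
  by rewrite sqrrB; lra.
split => //; first by move=> i j; rewrite -!VC; congr (Ex P _); apply/funext => w; rewrite mulrC.
move=> a; have [mu [s H]] := mom a.
have [_ mu0] := normal_mean (measurable_lin a mV) H.
have {}mu0 : mu = 0.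
  rewrite -mu0 /lin Ex_sum => [|i _]; last exact: intgZ.
  by rewrite big1// => i _; rewrite ExZ// V0 mulr0.
have [_ s2] : intg P (fun w => lin a (V w) ^+ 2) /\ Ex P (fun w => lin a (V w) ^+ 2) = s ^+ 2.
  apply: normal_variance; first exact: measurable_lin.
  by move=> t; have := H t; rewrite mu0 mulr0 add0r.
have [_ q] := @qform_lin2 _ _ P I V C a (fun i j => conj (iVV i j) (VC i j)).
have [h1 h2] := H 1.
have E : (fun w => expR (1 * lin a (V w))) = (fun w => expR (lin a (V w))).
  by apply/funext => w; rewrite mul1r.
rewrite E in h1 h2; split => //; rewrite h2 mu0 mulr0 add0r expr1n mulr1.
by rewrite -s2 q.
Qed.

Section OneSystem.
Context {d : measure_display} {X : measurableType d} {I : finType} (P : probability X R)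
  (V : X -> I -> R) (C : I -> I -> R) (gV : gaussian_sys P V C).

Lemma gaussian_meas i : measT (fun w => V w i).
Proof. by case: gV. Qed.

Lemma gaussian_lin a t : intg P (fun w => expR (t * lin a (V w))) /\
  Ex P (fun w => expR (t * lin a (V w))) = expR (t ^+ 2 * qform C a / 2).
Proof.
have [_ _ H] := gV; have := H (fun i => t * a i); rewrite -/(qform _ _) qform_scale.
by under eq_fun do rewrite lin_scale.
Qed.

(** A negative value would give both e^y and e^(-y) expectation below 1, although their sum is at
    least 2. *)
Lemma qform_ge0 a : 0 <= qform C a.
Proof.
rewrite leNgt; apply/negP => q0.
have [iU EU] := gaussian_lin a 1; have [iN EN] := gaussian_lin a (-1).
have : 2 <= Ex P (fun w => expR (1 * lin a (V w))) + Ex P (fun w => expR (-1 * lin a (V w))).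
  rewrite -ExD// -[leLHS](Ex_cst P); apply: Ex_le; [exact: intg_cst|exact: intgD|].
  move=> w; rewrite mul1r mulN1r; have := expR_ge1Dx (lin a (V w)).
  by have := expR_ge1Dx (- lin a (V w)); lra.
rewrite EU EN sqrrN expr1n mul1r.
have : expR (qform C a / 2) < 1 by rewrite expR_lt1; lra.
lra.
Qed.

Lemma gaussian_moments a : [/\ intg P (fun w => lin a (V w)), Ex P (fun w => lin a (V w)) = 0,
  intg P (fun w => lin a (V w) ^+ 2) & Ex P (fun w => lin a (V w) ^+ 2) = qform C a].
Proof.
pose s := Num.sqrt (qform C a).
have s2 : s ^+ 2 = qform C a by rewrite sqr_sqrtr// qform_ge0.
have mU := measurable_lin a gaussian_meas.
have [i1 e1] : intg P (fun w => lin a (V w)) /\ Ex P (fun w => lin a (V w)) = 0.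
  apply: (@normal_mean _ _ _ P _ 0 s mU) => t; have := gaussian_lin a t.
  by rewrite mulr0 add0r s2 [_ * t ^+ 2]mulrC.
have [i2 e2] := @normal_variance _ _ _ P (fun w => lin a (V w)) s mU (fun t => ltac:(
  rewrite s2 [_ * t ^+ 2]mulrC; exact: gaussian_lin)).
by split => //; rewrite e2.
Qed.

Let linE i w : lin (fun j => (j == i)%:R) (V w) = V w i.
Proof.
by rewrite /lin (bigD1 i)//= eqxx mul1r big1 ?addr0// => j /negbTE ->; rewrite mul0r.
Qed.

Lemma gaussian_coord_mean i : intg P (fun w => V w i) /\ Ex P (fun w => V w i) = 0.
Proof. by have [] := gaussian_moments (fun j => (j == i)%:R); under eq_fun do rewrite linE. Qed.

Lemma gaussian_coord_mgf i t : intg P (fun w => expR (t * V w i)) /\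
  Ex P (fun w => expR (t * V w i)) = expR (t ^+ 2 * C i i / 2).
Proof.
have := gaussian_lin (fun j => (j == i)%:R) t.
have -> : qform C (fun j => (j == i)%:R) = C i i.
  rewrite /qform (bigD1 i)//= [X in _ + X]big1 => [|j /negbTE ->]; last first.
    by rewrite big1// => k _; rewrite !mul0r.
  by rewrite (bigD1 i)//= eqxx !mul1r big1 ?addr0// => j /negbTE ->; rewrite mulr0 mul0r.
by under eq_fun do rewrite linE.
Qed.

(** Order 3 controls the Taylor remainder of the smoothed orthant. *)
Lemma gaussian_nrm_pow k : intg P (fun w => nrm (V w) ^+ k).
Proof.
have mn : measT (fun w => nrm (V w)).
  by apply: measurable_sum => i; apply: measurable_abs; exact: gaussian_meas.
have H c : intg P (fun w => expR (c * nrm (V w))).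
  have [_ _ gE] := gV.
  have E a : same_Ex P P V V (fun=> 1) (fun=> 1) (fun v => expR (lin a v)).
    by have [h _] := gE a; split=> //; split; under eq_fun do rewrite mul1r.
  have := @both_intg_nrm R _ _ X X P P I V V (fun=> 1) (fun=> 1) gaussian_meas gaussian_meas
    (measurable_cst _) (measurable_cst _) (fun=> ler01) (fun=> ler01) E c.
  by case; under eq_fun do rewrite mul1r.
have := @intg_exp_pow _ _ _ P _ k mn H.
by under eq_fun do rewrite (ger0_norm (nrm_ge0 _)).
Qed.

(** Polarisation: the second moments of V_i + V_j and V_i - V_j are known. *)
Lemma gaussian_cov i j : intg P (fun w => V w i * V w j) /\ Ex P (fun w => V w i * V w j) = C i j.
Proof.
pose a (s : R) k : R := (k == i)%:R + s * (k == j)%:R.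
have aE s w : lin (a s) (V w) = V w i + s * V w j.
  rewrite /lin /a; under eq_bigr do rewrite mulrDl -mulrA.
  by rewrite big_split/= -mulr_sumr -!/(lin _ _) (linE i w) (linE j w).
have [_ _ i1 e1] := gaussian_moments (a 1); have [_ _ i2 e2] := gaussian_moments (a (-1)).
have E : (fun w => V w i * V w j) =
  (fun w => 4^-1 * (lin (a 1) (V w) ^+ 2 - lin (a (-1)) (V w) ^+ 2)).
  by apply/funext => w; rewrite !aE; field.
rewrite E; split; first by apply: intgZ; exact: intgB.
rewrite ExZ ?ExB//; last exact: intgB.
rewrite e1 e2 /qform -sumrB.
have H k l : a 1 k * a 1 l * C k l - a (-1) k * a (-1) l * C k l =
  2 * ((k == i)%:R * (l == j)%:R * C k l + (k == j)%:R * (l == i)%:R * C k l).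
  by rewrite /a; ring.
under eq_bigr => k _. 
  rewrite -sumrB; under eq_bigr do rewrite H; rewrite -mulr_sumr; over.
rewrite -mulr_sumr; under eq_bigr do rewrite big_split/=; rewrite big_split/=.
have D (f : I -> I -> R) (k0 l0 : I) : \sum_k \sum_l (k == k0)%:R * (l == l0)%:R * f k l = f k0 l0.
  rewrite (bigD1 k0)//= [X in _ + X]big1 => [|k /negbTE ->]; last first.
    by rewrite big1// => l _; rewrite !mul0r.
  by rewrite (bigD1 l0)//= !eqxx !mul1r big1 ?addr0// => l /negbTE ->; rewrite mulr0 mul0r.
rewrite !D; have [_ sC _] := gV; rewrite (sC j i); by field.
Qed.

End OneSystem.

Lemma gaussian_map d (X : measurableType d) (P : probability X R) (I J : finType)
  (V : X -> I -> R) (C : I -> I -> R) (M : J -> I -> R) : gaussian_sys P V C ->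
  gaussian_sys P (fun w j => lin (M j) (V w)) (fun j k => \sum_i \sum_i' M j i * M k i' * C i i').
Proof.
move=> [mV sC H]; split.
- by move=> j; exact: measurable_lin.
- move=> j k; rewrite exchange_big/=; apply: eq_bigr => i _; apply: eq_bigr => i' _.
  by rewrite sC [M j i' * _]mulrC.
move=> a; have := H (fun i => \sum_j a j * M j i).
have E v : lin (fun i => \sum_j a j * M j i) v = lin a (fun j => lin (M j) v).
  rewrite /lin; under eq_bigr do rewrite mulr_suml; rewrite exchange_big/=.
  by apply: eq_bigr => j _; rewrite mulr_sumr; apply: eq_bigr => i _; rewrite mulrA.
under eq_fun do rewrite E.
suff -> : \sum_i \sum_j (\sum_k a k * M k i) * (\sum_k a k * M k j) * C i j =
  \sum_i \sum_j a i * a j * \sum_i0 \sum_i' M i i0 * M j i' * C i0 i' by [].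
transitivity (\sum_i \sum_j \sum_k \sum_l a k * M k i * (a l * M l j) * C i j).
  apply: eq_bigr => i _; apply: eq_bigr => j _; rewrite mulr_suml mulr_suml.
  by apply: eq_bigr => k _; rewrite mulr_sumr mulr_suml.
transitivity (\sum_k \sum_l \sum_i \sum_j a k * M k i * (a l * M l j) * C i j).
  transitivity (\sum_i \sum_k \sum_j \sum_l a k * M k i * (a l * M l j) * C i j).
    by apply: eq_bigr => i _; rewrite exchange_big.
  rewrite exchange_big/=; apply: eq_bigr => k _.
  transitivity (\sum_i \sum_l \sum_j a k * M k i * (a l * M l j) * C i j).
    by apply: eq_bigr => i _; rewrite exchange_big.
  by rewrite exchange_big.
apply: eq_bigr => k _; apply: eq_bigr => l _; rewrite mulr_sumr.
apply: eq_bigr => i _; rewrite mulr_sumr; apply: eq_bigr => j _; ring.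
Qed.

Lemma gaussian_sum d1 d2 (X1 : measurableType d1) (X2 : measurableType d2)
  (P1 : probability X1 R) (P2 : probability X2 R) (I : finType)
  (V1 : X1 -> I -> R) (V2 : X2 -> I -> R) (C1 C2 : I -> I -> R) :
  gaussian_sys P1 V1 C1 -> gaussian_sys P2 V2 C2 ->
  gaussian_sys (P1 \x P2)%E (fun w i => V1 w.1 i + V2 w.2 i) (fun i j => C1 i j + C2 i j).
Proof.
move=> [m1 s1 H1] [m2 s2 H2]; split.
- move=> i; apply: measurable_funD.
    exact: (measurableT_comp (m1 i) measurable_fst).
  exact: (measurableT_comp (m2 i) measurable_snd).
- by move=> i j; rewrite s1 s2.
move=> a; have [i1 e1] := H1 a; have [i2 e2] := H2 a.
have E (w : X1 * X2) : expR (lin a (fun i => V1 w.1 i + V2 w.2 i)) =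
  expR (lin a (V1 w.1)) * expR (lin a (V2 w.2)).
  rewrite -expRD; congr expR; rewrite /lin -big_split/=.
  by apply: eq_bigr => i _; rewrite mulrDr.
under eq_fun do rewrite E.
split.
  by apply: (@intg_prod _ _ _ _ _ P1 P2 (fun x => expR (lin a (V1 x))) (fun x => expR (lin a (V2 x)))).
rewrite (@Ex_prod _ _ _ _ _ P1 P2 (fun x => expR (lin a (V1 x))) (fun x => expR (lin a (V2 x))))//.
rewrite e1 e2 -expRD -mulrDl -big_split/=; congr (expR (_ / 2)).
apply: eq_bigr => i _; rewrite -big_split/=; apply: eq_bigr => j _; ring.
Qed.

Section Uniqueness.
Context {d1 d2 : measure_display} {X1 : measurableType d1} {X2 : measurableType d2} {I : finType}
  (P1 : probability X1 R) (P2 : probability X2 R) (V1 : X1 -> I -> R) (V2 : X2 -> I -> R)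
  (C : I -> I -> R) (g1 : gaussian_sys P1 V1 C) (g2 : gaussian_sys P2 V2 C).

Lemma gaussian_same_law (A : set (fspace R I)) : measurable A ->
  P1 [set w | A (V1 w)] = P2 [set w | A (V2 w)].
Proof.
move=> mA; have [m1 _ H1] := g1; have [m2 _ H2] := g2.
have E a : same_Ex P1 P2 V1 V2 (fun=> 1) (fun=> 1) (fun v => expR (lin a v)).
  have [i1 e1] := H1 a; have [i2 e2] := H2 a.
  split; first by split; under eq_fun do rewrite mul1r.
  by under eq_fun do rewrite mul1r; under [X in _ = Ex _ X]eq_fun do rewrite mul1r; rewrite e1 e2.
have := @mgf_same_Ex R _ _ X1 X2 P1 P2 I V1 V2 (fun=> 1) (fun=> 1) m1 m2
  (measurable_cst _) (measurable_cst _) (fun=> ler01) (fun=> ler01) E A mA.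
case=> -[]; under eq_fun do rewrite mul1r; move=> j1.
under eq_fun do rewrite mul1r; move=> j2.
move=> e12; have {e12} := congr1 EFin e12; rewrite -!ExE//.
have K d (X : measurableType d) (P : probability X R) (V : X -> I -> R) :
  (forall i, measT (fun w => V w i)) -> (\int[P]_w (\1_A (V w))%:E)%E = P [set w | A (V w)].
  move=> mV; have -> : (fun w => (\1_A (V w))%:E) = EFin \o \1_[set w | A (V w)] by [].
  rewrite integral_indic ?setIT//.
  by rewrite -[[set w | _]]setTI; exact: meas_fspace.
by rewrite !K.
Qed.

Lemma gaussian_same_bounded (f : fspace R I -> R) (c : R) : measT f ->
  (forall v, 0 <= f v <= c) -> Ex P1 (fun w => f (V1 w)) = Ex P2 (fun w => f (V2 w)).
Proof.
move=> mf fc; have [m1 _ H1] := g1; have [m2 _ H2] := g2.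
have mV1 : measT (V1 : X1 -> fspace R I) by exact: meas_fspace.
have mV2 : measT (V2 : X2 -> fspace R I) by exact: meas_fspace.
rewrite !ExE0 /Rintegral; congr fine.
have mEf : measT (EFin \o f) by exact/measurable_EFinP.
have f0 v : (0 <= (EFin \o f) v)%E by rewrite lee_fin; case/andP: (fc v).
have -> : (\int[P1]_w (f (V1 w))%:E = \int[pushforward P1 (V1 : X1 -> fspace R I)]_v (EFin \o f) v)%E.
  by rewrite ge0_integral_pushforward// setTI.
have -> : (\int[P2]_w (f (V2 w))%:E = \int[pushforward P2 (V2 : X2 -> fspace R I)]_v (EFin \o f) v)%E.
  by rewrite ge0_integral_pushforward// setTI.
by apply: eq_measure_integral => A mA _; exact: gaussian_same_law.
Qed.

End Uniqueness.

(* Cameron-Martin: shifting a Gaussian vector by a multiple of a row of its covariance. *)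
Lemma cameron_martin d (X : measurableType d) (P : probability X R) (I : finType)
  (V : X -> I -> R) (C : I -> I -> R) (i : I) (t : R) (A : set (fspace R I)) :
  gaussian_sys P V C -> measurable A ->
  intg P (fun w => expR (t * V w i - t ^+ 2 * C i i / 2) * \1_A (V w)) /\
  Ex P (fun w => \1_A (fun j => V w j + t * C j i)) =
  Ex P (fun w => expR (t * V w i - t ^+ 2 * C i i / 2) * \1_A (V w)).
Proof.
move=> gV mA; have [mV sC H] := gV.
pose V1 w j := V w j + t * C j i.
pose W2 w := expR (t * V w i - t ^+ 2 * C i i / 2).
have mV1 j : measT (fun w => V1 w j) by exact: measurable_funD.
have mW2 : measT W2.
  by apply: measurableT_comp => //; by meas.
(* Shift and weight both multiply the exponential moment at [a] by exp(t b), b being the sum of the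
   a_j C_ji. *)
have E a : same_Ex P P V1 V (fun=> 1) W2 (fun v => expR (lin a v)).
  have [i1 e1] := H a.
  pose a' j := a j + t * (j == i)%:R.
  have [i2 e2] := H a'.
  have la v : lin a' v = lin a v + t * v i.
    rewrite /lin /a'; under eq_bigr do rewrite mulrDl; rewrite big_split/=; congr (_ + _).
    by rewrite (bigD1 i)//= eqxx mulr1 big1 ?addr0// => j /negbTE ->; rewrite mulr0 mul0r.
  set b := \sum_j a j * C j i.
  have qa : qform C a' = qform C a + 2 * t * b + t ^+ 2 * C i i.
    rewrite /qform; have h j k : a' j * a' k * C j k = a j * a k * C j k +
      ((t * (k == i)%:R) * a j * C j k + (t * (j == i)%:R) * (a k * C j k + t * (k == i)%:R * C j k)).
      by rewrite /a'; ring.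
    under eq_bigr do under eq_bigr do rewrite h.
    under eq_bigr do rewrite big_split/= big_split/=; rewrite big_split/= big_split/= -addrA.
    congr (_ + _).
    have -> : \sum_j \sum_k t * (k == i)%:R * a j * C j k = t * b.
      rewrite /b mulr_sumr; apply: eq_bigr => j _; rewrite (bigD1 i)//= eqxx big1 ?addr0.
        by rewrite mulr1 mulrA.
      by move=> k /negbTE ->; rewrite mulr0 !mul0r.
    rewrite (bigD1 i)//= eqxx [X in _ + (_ + X)]big1; last first.
      by move=> j /negbTE ->; rewrite big1// => k _; rewrite mulr0 !mul0r.
    under eq_bigr do rewrite mulr1 mulrDr; rewrite big_split/= -!mulr_sumr.
    have -> : \sum_k a k * C i k = b by apply: eq_bigr => k _; rewrite sC.
    rewrite (bigD1 i)//= eqxx big1; last by move=> k /negbTE ->; rewrite mulr0 mul0r.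
    by rewrite -[true%:R]/(1 : R); ring.
  have l1 w : expR (lin a (V1 w)) = expR (t * b) * expR (lin a (V w)).
    rewrite -expRD; congr expR; rewrite /lin /V1; under eq_bigr do rewrite mulrDr.
    rewrite big_split/= addrC; congr (_ + _); rewrite /b mulr_sumr.
    by apply: eq_bigr => j _; rewrite mulrCA.
  have l2 w : W2 w * expR (lin a (V w)) = expR (- (t ^+ 2 * C i i / 2)) * expR (lin a' (V w)).
    by rewrite -!expRD la; congr expR; ring.
  split; first split.
  - by under eq_fun do rewrite mul1r l1; exact: intgZ.
  - by under eq_fun do rewrite l2; exact: intgZ.
  under eq_fun do rewrite mul1r l1; under [X in _ = Ex _ X]eq_fun do rewrite l2.
  rewrite !ExZ// e1 e2 -!/(qform _ _) qa -!expRD; congr expR; by field.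
have W0 w : 0 <= W2 w by exact: expR_ge0.
have [[_ h] <-] := @mgf_same_Ex R _ _ X X P P I V1 V (fun=> 1) W2 mV1 mV
  (measurable_cst _) mW2 (fun=> ler01) W0 E A mA.
by split => //; under [X in _ = Ex _ X]eq_fun do rewrite mul1r.
Qed.

End GaussianSystems.

(** * Third-order Taylor bound along a ray *)

Section Taylor.
Context {R : realType}.

(** Mean value theorem; three applications give the Taylor remainder with constant M in place of
    M/6. *)
Lemma derive_growth (h h' : R -> R) (n : nat) (M : R) : (forall x : R, is_derive x (1 : R) h (h' x)) ->
  h 0 = 0 -> (forall x, 0 <= x -> `|h' x| <= M * x ^+ n) ->
  forall t, 0 <= t -> `|h t| <= M * t ^+ n.+1.
Proof.
move=> dh h0 hM t; rewrite le_eqVlt => /predU1P[<-|t0].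
  by rewrite h0 normr0 expr0n mulr0.
have [|c] := @MVT R h h' 0 t t0 (fun x _ => dh x).
  apply: derivable_within_continuous => y _; by have [] := dh y.
rewrite in_itv/= => /andP[c0 ct]; rewrite h0 !subr0 => ->.
rewrite normrM (gtr0_norm t0) exprSr mulrA ler_wpM2r ?(ltW t0)//.
apply: (le_trans (hM _ (ltW c0))); rewrite ler_wpM2l//.
  have := hM 1 ler01; rewrite expr1n mulr1; exact: le_trans.
by rewrite lerXn2r ?nnegrE// ltW.
Qed.

Lemma taylor2 (f f1 f2 f3 : R -> R) (M : R) : (forall x : R, is_derive x (1 : R) f (f1 x)) ->
  (forall x : R, is_derive x (1 : R) f1 (f2 x)) -> (forall x : R, is_derive x (1 : R) f2 (f3 x)) ->
  (forall x, `|f3 x| <= M) -> forall t, 0 <= t ->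
  `|f t - f 0 - t * f1 0 - t ^+ 2 / 2 * f2 0| <= M * t ^+ 3.
Proof.
move=> d1 d2 d3 b3.
have g2 t : 0 <= t -> `|f2 t - f2 0| <= M * t ^+ 1.
  apply: (@derive_growth (fun t => f2 t - f2 0) f3 0 M) => [x||x _].
  - by apply: is_derive_eq; rewrite subr0.
  - by rewrite subrr.
  - by rewrite expr0 mulr1.
have g1 t : 0 <= t -> `|f1 t - f1 0 - t * f2 0| <= M * t ^+ 2.
  apply: (@derive_growth (fun t => f1 t - f1 0 - t * f2 0) (fun t => f2 t - f2 0) 1 M) => [x||x x0].
  - apply: is_derive_eq; rewrite /= scaler0 add0r subr0; congr (_ - _); exact: mulr1.
  - by rewrite subrr mul0r subrr.
  - exact: g2.
apply: (@derive_growth (fun t => f t - f 0 - t * f1 0 - t ^+ 2 / 2 * f2 0)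
  (fun t => f1 t - f1 0 - t * f2 0) 2 M) => [x||x x0].
- apply: is_derive_eq; rewrite /= !scaler0 !add0r subr0.
  by rewrite /GRing.scale/=; field.
- by rewrite subrr mul0r subrr expr0n/= !mul0r subrr.
- exact: g1.
Qed.

Lemma is_derive_bigsum (I : Type) (r : seq I) (h h' : I -> R -> R) (x : R) :
  (forall i, is_derive x (1 : R) (h i) (h' i x)) ->
  is_derive x (1 : R) (fun y => \sum_(i <- r) h i y) (\sum_(i <- r) h' i x).
Proof.
move=> dh; elim: r => [|i r IH].
  rewrite big_nil; under eq_fun do rewrite big_nil; exact: is_derive_cst.
rewrite big_cons; under eq_fun do rewrite big_cons; exact: is_deriveD.
Qed.

Lemma is_derive_expRM (a x : R) : is_derive x (1 : R) (fun y => expR (a * y)) (a * expR (a * x)).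
Proof.
by apply: is_derive_eq; rewrite mulrC; congr (_ * _); exact: mulr1.
Qed.
End Taylor.

Section IteratedExpectation.
Context {R : realType} {d1 d2 : measure_display} {X1 : measurableType d1} {X2 : measurableType d2}
  (P1 : probability X1 R) (P2 : probability X2 R).

Lemma intg_Ex (F : X1 * X2 -> R) : intg (P1 \x P2)%E F ->
  (forall x, intg P2 (fun y => F (x, y))) -> intg P1 (fun x => Ex P2 (fun y => F (x, y))).
Proof.
rewrite !intgE => iF i2; have := integrable_fubini_F iF.
apply: eq_integrable => // x _; rewrite /fubini_F /= ExE//.
Qed.

End IteratedExpectation.

(** * The smoothed orthant and its derivatives *)

Section SoftOrthant.
Context {R : realType} {J : finType} (b x : R) (b0 : 0 < b).
Implicit Types v y : J -> R.

(* a smooth approximation of the indicator of {v | forall j, v j <= x} *)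
Definition soft v : R := expR (- \sum_j expR (b * (v j - x))).

Lemma soft_ge0 v : 0 <= soft v. Proof. exact: expR_ge0. Qed.

Lemma soft_le1 v : soft v <= 1.
Proof. by rewrite expR_le1 oppr_le0 sumr_ge0// => j _; exact: expR_ge0. Qed.

Lemma measurable_soft d (X : measurableType d) (V : X -> J -> R) :
  (forall j, measT (fun w => V w j)) -> measT (fun w => soft (V w)).
Proof.
move=> mV; apply: measurableT_comp => //; apply: measurable_funN; apply: measurable_sum => j.
by meas.
Qed.

Lemma soft_abs v : `|soft v| <= 1.
Proof. by rewrite ger0_norm ?soft_ge0// soft_le1. Qed.

(** The Hessian of [soft]; [soft1] is the gradient. *)
Definition soft2 v (j k : J) : R := soft v * b ^+ 2 *
  (expR (b * (v j - x)) * expR (b * (v k - x)) - (j == k)%:R * expR (b * (v j - x))).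

Definition soft1 v (j : J) : R := - soft v * b * expR (b * (v j - x)).

Lemma pow_expR_le (z : R) k : 0 <= z -> z ^+ k.+1 * expR (- z) <= k.+1`!%:R.
Proof.
move=> z0; rewrite expRN ler_pdivrMr ?expR_gt0//.
have := expR_ge1Dxn k z0 => h; rewrite mulrC -ler_pdivrMr//.
by apply: le_trans h; rewrite lerDr.
Qed.

(** With Z the sum of the exponentials z_j, the sum is at most b^2 (Z^2 + Z) e^(-Z), and Z^k e^(-Z)
    <= k!, so the number of coordinates disappears. *)
Lemma soft2_sum v : \sum_j \sum_k `|soft2 v j k| <= 3 * b ^+ 2.
Proof.
set z := fun j => expR (b * (v j - x)); set Z := \sum_j z j.
have z0 j : 0 <= z j by exact: expR_ge0.
have Z0 : 0 <= Z by apply: sumr_ge0.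
have h : \sum_j \sum_k `|soft2 v j k| <=
  \sum_j \sum_k soft v * b ^+ 2 * (z j * z k + (j == k)%:R * z j).
  apply: ler_sum => j _; apply: ler_sum => k _; rewrite /soft2 -!/(z _) normrM.
  have s0 : 0 <= soft v * b ^+ 2 by rewrite mulr_ge0 ?soft_ge0 ?sqr_ge0.
  rewrite (ger0_norm s0) ler_wpM2l//.
  by rewrite (le_trans (ler_normB _ _))// !ger0_norm//; pos.
apply: (le_trans h).
have -> : \sum_j \sum_k soft v * b ^+ 2 * (z j * z k + (j == k)%:R * z j) =
  b ^+ 2 * (Z ^+ 2 * expR (- Z) + Z ^+ 1 * expR (- Z)).
  under eq_bigr => j _.
    rewrite -mulr_sumr big_split/= -mulr_sumr -/Z (bigD1 j)//= eqxx mul1r.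
    rewrite big1 ?addr0; last by move=> k /negbTE nk; rewrite eq_sym nk mul0r.
    over.
  rewrite -mulr_sumr big_split/= -mulr_suml -/Z /soft -/Z; ring.
rewrite mulrC; apply: ler_wpM2r; first exact: sqr_ge0.
have := pow_expR_le 0 Z0; have := pow_expR_le 1 Z0.
by rewrite !factS fact0 !mul1n muln1; lra.
Qed.

(** Along a ray the r-th derivative of Z is at most (b |y|_1)^r Z, and the third derivative of
    exp(-Z) involves Z^3 + 3 Z^2 + Z; the constant is 13 = 3! + 3 2! + 1!. *)
Lemma soft_taylor v y t : 0 <= t ->
  `|soft (fun j => v j + t * y j) - soft v - t * (\sum_j soft1 v j * y j)
  - t ^+ 2 / 2 * (\sum_j \sum_k soft2 v j k * (y j * y k))| <= 13 * (b * nrm y) ^+ 3 * t ^+ 3.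
Proof.
pose z j := expR (b * (v j - x)); have z0 j : 0 <= z j by exact: expR_ge0.
pose Z r s := \sum_j (b * y j) ^+ r * z j * expR (b * y j * s).
have dZ r s : is_derive s (1 : R) (Z r) (Z r.+1 s).
  apply: (@is_derive_bigsum _ _ _ (fun j s => (b * y j) ^+ r * z j * expR (b * y j * s))
    (fun j s => (b * y j) ^+ r.+1 * z j * expR (b * y j * s))) => j.
  have := is_derive_expRM (b * y j) s => h; apply: is_derive_eq.
  by rewrite /GRing.scale/= exprS; ring.
pose f s := expR (- Z 0%N s).
have df s : is_derive s (1 : R) f (- Z 1%N s * f s).
  by apply: is_derive_eq; rewrite mulrC.
pose A := b * nrm y.
have ZA r s : `|Z r s| <= A ^+ r * Z 0%N s.
  apply: (le_trans (ler_norm_sum _ _ _)); rewrite mulr_sumr; apply: ler_sum => j _.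
  rewrite expr0 mul1r !normrM normrX (ger0_norm (z0 j)) (ger0_norm (expR_ge0 _)) -mulrA.
  apply: ler_wpM2r; first by pos.
  rewrite lerXn2r ?nnegrE ?mulr_ge0 ?nrm_ge0 ?(ltW b0)//.
  by rewrite normrM (gtr0_norm b0) ler_wpM2l ?(ltW b0)// coord_nrm.
have Z0 s : 0 <= Z 0%N s.
  by apply: sumr_ge0 => j _; rewrite expr0 mul1r mulr_ge0//; pos.
have A0 : 0 <= A by rewrite mulr_ge0 ?nrm_ge0 ?(ltW b0).
have := @taylor2 R f (fun s => - Z 1%N s * f s) (fun s => (Z 1%N s ^+ 2 - Z 2 s) * f s)
  (fun s => (- Z 1%N s ^+ 3 + 3 * Z 1%N s * Z 2 s - Z 3 s) * f s) (13 * A ^+ 3).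
have e0 : f 0 = soft v.
  rewrite /f /soft; congr (expR (- _)); apply: eq_bigr => j _.
  by rewrite expr0 mul1r mulr0 expR0 mulr1.
have e1 : - Z 1%N 0 * f 0 = \sum_j soft1 v j * y j.
  rewrite e0 /Z /soft1 mulNr mulr_suml -sumrN; apply: eq_bigr => j _.
  by rewrite mulr0 expR0 /z; ring.
have e2 : (Z 1%N 0 ^+ 2 - Z 2 0) * f 0 = \sum_j \sum_k soft2 v j k * (y j * y k).
  rewrite e0 expr2 /Z mulr_suml -sumrB mulr_suml; apply: eq_bigr => j _.
  rewrite mulr_sumr /soft2.
  transitivity (soft v * (\sum_k (b * y j) ^+ 1 * z j * expR (b * y j * 0) *
    ((b * y k) ^+ 1 * z k * expR (b * y k * 0)) - (b * y j) ^+ 2 * z j)).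
    by rewrite [RHS]mulrC; congr ((_ - _) * _); rewrite mulr0 expR0 mulr1.
  have -> : (b * y j) ^+ 2 * z j = \sum_k (j == k)%:R * ((b * y j) * (b * y k) * z j).
    rewrite (bigD1 j)//= eqxx big1; first by rewrite mul1r; ring.
    by move=> k /negbTE nk; rewrite eq_sym nk mul0r.
  rewrite -sumrB mulr_sumr; apply: eq_bigr => k _.
  by rewrite !mulr0 expR0 -!/(z _); ring.
have et s : f s = soft (fun j => v j + s * y j).
  rewrite /f /soft; congr (expR (- _)); apply: eq_bigr => j _.
  by rewrite expr0 mul1r /z -expRD; congr expR; ring.
move=> H t0; rewrite -e1 -e2 -e0 -et; apply: H => //.
- move=> s; have := dZ 1%N s => d1; have := df s => d2; apply: is_derive_eq.
  by rewrite /GRing.scale/=; ring.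
- move=> s; have := dZ 1%N s => d1; have := dZ 2 s => d2; have := df s => d3; apply: is_derive_eq.
  by rewrite /GRing.scale/=; ring.
move=> s; set z1 := Z 1%N s; set z2 := Z 2 s; set z3 := Z 3 s; set zz := Z 0%N s.
have h1 : `|z1| <= A * zz by have := ZA 1%N s; rewrite expr1.
have h2 : `|z2| <= A ^+ 2 * zz := ZA 2 s.
have h3 : `|z3| <= A ^+ 3 * zz := ZA 3 s.
have zz0 : 0 <= zz := Z0 s.
have H3 : `|- z1 ^+ 3 + 3 * z1 * z2 - z3| <= A ^+ 3 * (zz ^+ 3 + 3 * zz ^+ 2 + zz ^+ 1).
  apply: (le_trans (ler_normB _ _)); apply: (via ((A * zz) ^+ 3 +
    3 * ((A * zz) * (A ^+ 2 * zz)) + A ^+ 3 * zz)); last by apply: eq_ler; ring.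
  apply: lerD => //; apply: (le_trans (ler_normD _ _)); apply: lerD.
    by rewrite normrN normrX lerXn2r ?nnegrE// mulr_ge0.
  by rewrite -mulrA normrM (ger0_norm (ler0n _ 3)) ler_wpM2l// normrM ler_pM.
rewrite normrM (ger0_norm (expR_ge0 _)); apply: (le_trans (ler_wpM2r (expR_ge0 _) H3)).
rewrite -/zz -mulrA [leRHS]mulrC ler_wpM2l ?exprn_ge0//.
have := pow_expR_le 0 zz0; have := pow_expR_le 1 zz0; have := pow_expR_le 2 zz0.
by rewrite !factS fact0 !mul1n !muln1; set e := expR _; lra.
Qed.

End SoftOrthant.

Lemma gaussian_rescale {R : realType} d (X : measurableType d) (P : probability X R) (I : finType)
  (V : X -> I -> R) (C : I -> I -> R) (c : I -> R) : gaussian_sys P V C ->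
  gaussian_sys P (fun w i => c i * V w i) (fun i j => c i * c j * C i j).
Proof.
move=> [mV sC H]; split.
- by meas.
- by move=> i j; rewrite sC [c i * _]mulrC.
move=> a; have := H (fun i => c i * a i).
have E w : lin (fun i => c i * a i) (V w) = lin a (fun i => c i * V w i).
  by rewrite /lin; apply: eq_bigr => i _; ring.
under eq_fun do rewrite E; move=> [i ->]; split => //; congr (expR (_ / 2)).
apply: eq_bigr => j _; apply: eq_bigr => k _; ring.
Qed.

Lemma gaussian_scale {R : realType} d (X : measurableType d) (P : probability X R) (I : finType)
  (V : X -> I -> R) (C : I -> I -> R) (c : R) : gaussian_sys P V C ->
  gaussian_sys P (fun w i => c * V w i) (fun i j => c ^+ 2 * C i j).
Proof. exact: gaussian_rescale. Qed.

(** * Comparison of Gaussian smoothing operators *)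

Section GaussianComparison.
Context {R : realType} {d1 d2 : measure_display} {X1 : measurableType d1} {X2 : measurableType d2}
  {J : finType} (P1 : probability X1 R) (P2 : probability X2 R) (V1 : X1 -> J -> R)
  (V2 : X2 -> J -> R) (C1 C2 : J -> J -> R) (g1 : gaussian_sys P1 V1 C1)
  (g2 : gaussian_sys P2 V2 C2) (b x : R) (b0 : 0 < b).

Definition smooth d (X : measurableType d) (P : probability X R) (V : X -> J -> R) (t : R)
  (v : J -> R) : R := Ex P (fun w => soft b x (fun j => v j + t * V w j)).

Let msoft d (X : measurableType d) (V : X -> J -> R) (f : X -> J -> R) t :
  (forall j, measT (fun w => V w j)) -> (forall j, measT (fun w => f w j)) ->
  measT (fun w => soft b x (fun j => f w j + t * V w j)).
Proof.
move=> mV mf; apply: (@measurable_soft _ _ _ _ _ _ (fun w j => f w j + t * V w j)) => j.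
by meas.
Qed.

Let isoft d (X : measurableType d) (P : probability X R) (V : X -> J -> R) t v :
  (forall j, measT (fun w => V w j)) -> intg P (fun w => soft b x (fun j => v j + t * V w j)).
Proof.
move=> mV; apply: (@intg_bnd _ _ _ P _ 1); last by move=> w; exact: soft_abs.
exact: msoft.
Qed.

(* T_{sqrt 2 t} = T_t o T_t for the Gaussian smoothing operators T *)
Lemma smooth_double d (X : measurableType d) (P : probability X R) (V : X -> J -> R)
  (C : J -> J -> R) t v : gaussian_sys P V C ->
  smooth P V (Num.sqrt 2 * t) v = Ex P (fun w => smooth P V t (fun j => v j + t * V w j)) .
Proof.
move=> gV; have mV := gaussian_meas gV; rewrite /smooth.
pose F (w : X * X) := soft b x (fun j => (v j + t * V w.1 j) + t * V w.2 j).
have m1 j : measT (fun w : X * X => V w.1 j).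
  exact: (measurableT_comp (mV j) measurable_fst).
have m2 j : measT (fun w : X * X => V w.2 j).
  exact: (measurableT_comp (mV j) measurable_snd).
have mF : measT F.
  apply: (@msoft _ _ (fun w : X * X => V w.2) (fun w j => v j + t * V w.1 j)) => // j.
  by meas.
have iF : intg (P \x P)%E F by apply: (@intg_bnd _ _ _ _ _ 1) => // w; exact: soft_abs.
rewrite -(@Ex_fubini _ _ _ _ _ P P F)//; last by move=> w; exact: (isoft P t (fun j => v j + t * V w j)).
have G1 := gaussian_sum (gaussian_scale t gV) (gaussian_scale t gV).
have G2 := gaussian_scale (Num.sqrt 2 * t) gV.
have E : (fun i j => (Num.sqrt 2 * t) ^+ 2 * C i j) = (fun i j => t ^+ 2 * C i j + t ^+ 2 * C i j).
  by apply/funext => i; apply/funext => j; rewrite exprMn sqr_sqrtr//; ring.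
rewrite E in G2.
have := @gaussian_same_bounded R _ _ _ _ J _ _ _ _ _ G2 G1 (fun u => soft b x (fun j => v j + u j)) 1.
move=> -> //; first by congr (Ex _ _); apply/funext => w; rewrite /F; congr soft; apply/funext => j; rewrite addrA.
- apply: (@measurable_soft _ _ _ _ _ _ (fun (u : fspace R J) j => v j + u j)) => j.
  by apply: measurable_funD => //; exact: meas_eval.
- by move=> u; rewrite soft_ge0 soft_le1.
Qed.

(** The bound is uniform in the centre [v], as the iteration requires. *)
Let D (t D0 : R) : Prop := forall v, `|smooth P1 V1 t v - smooth P2 V2 t v| <= D0.

Let m1 := gaussian_meas g1.
Let m2 := gaussian_meas g2.

Let intg_smooth d d' (X : measurableType d) (P : probability X R) (V : X -> J -> R)
  (X' : measurableType d') (P' : probability X' R) (V' : X' -> J -> R) t v :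
  (forall j, measT (fun w => V w j)) -> (forall j, measT (fun w => V' w j)) ->
  intg P (fun w => smooth P' V' t (fun j => v j + t * V w j)).
Proof.
move=> mV mV'.
pose F (w : X * X') := soft b x (fun j => (v j + t * V w.1 j) + t * V' w.2 j).
apply: (@intg_Ex _ _ _ _ _ P P' F).
- apply: (@intg_bnd _ _ _ _ _ 1); last by move=> w; exact: soft_abs.
  apply: (@msoft _ _ (fun w : X * X' => V' w.2) (fun w j => v j + t * V w.1 j)) => j.
    exact: (measurableT_comp (mV' j) measurable_snd).
  apply: measurable_funD => //; apply: measurable_funM => //.
  exact: (measurableT_comp (mV j) measurable_fst).
- by move=> w; exact: (isoft P' t (fun j => v j + t * V w j)).
Qed.

Let smooth_comm t v : Ex P1 (fun w => smooth P2 V2 t (fun j => v j + t * V1 w j)) =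
  Ex P2 (fun w => smooth P1 V1 t (fun j => v j + t * V2 w j)).
Proof.
pose F (w : X1 * X2) := soft b x (fun j => (v j + t * V1 w.1 j) + t * V2 w.2 j).
have iF : intg (P1 \x P2)%E F.
  apply: (@intg_bnd _ _ _ _ _ 1); last by move=> w; exact: soft_abs.
  apply: (@msoft _ _ (fun w : X1 * X2 => V2 w.2) (fun w j => v j + t * V1 w.1 j)) => j.
    exact: (measurableT_comp (m2 j) measurable_snd).
  apply: measurable_funD => //; apply: measurable_funM => //.
  exact: (measurableT_comp (m1 j) measurable_fst).
rewrite /smooth -(@Ex_fubini _ _ _ _ _ P1 P2 F)//; last first.
  by move=> w; exact: (isoft P2 t (fun j => v j + t * V1 w j)).
have E (y : X2) : (fun w => F (w, y)) = (fun w => soft b x (fun j => (v j + t * V2 y j) + t * V1 w j)).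
  by apply/funext => w; rewrite /F; congr soft; apply/funext => j /=; ring.
rewrite (@Ex_fubini2 _ _ _ _ _ P1 P2 F)//; last first.
  by move=> w; rewrite E; exact: (isoft P1 t (fun j => v j + t * V2 w j)).
by congr (Ex _ _); apply/funext => y; rewrite E.
Qed.

(** For commuting operators A^2 - B^2 = A (A - B) + B (A - B), and averaging does not increase a
    supremum: the error doubles while t grows by the square root of 2. *)
Let D_double t D0 : D t D0 -> D (Num.sqrt 2 * t) (2 * D0).
Proof.
move=> Dt v; rewrite (smooth_double _ _ g1) (smooth_double _ _ g2).
have -> : Ex P1 (fun w => smooth P1 V1 t (fun j => v j + t * V1 w j)) -
  Ex P2 (fun w => smooth P2 V2 t (fun j => v j + t * V2 w j)) =
  Ex P1 (fun w => smooth P1 V1 t (fun j => v j + t * V1 w j) -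
  smooth P2 V2 t (fun j => v j + t * V1 w j)) +
  Ex P2 (fun w => smooth P1 V1 t (fun j => v j + t * V2 w j) -
  smooth P2 V2 t (fun j => v j + t * V2 w j)).
  rewrite !ExB; [|exact: intg_smooth..].
  by rewrite smooth_comm; ring.
apply: (le_trans (ler_normD _ _)); rewrite mulr_natl mulr2n; apply: lerD.
  rewrite -[leRHS](Ex_cst P1); apply: Ex_absle.
  - by apply: intgB; exact: intg_smooth.
  - exact: intg_cst.
  - by move=> w; exact: Dt.
rewrite -[leRHS](Ex_cst P2); apply: Ex_absle.
- by apply: intgB; exact: intg_smooth.
- exact: intg_cst.
- by move=> w; exact: Dt.
Qed.

(** The first-order term has mean zero and the second-order term involves the covariance only. *)
Let smooth_taylor d (X : measurableType d) (P : probability X R) (V : X -> J -> R)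
  (C : J -> J -> R) t v : gaussian_sys P V C -> 0 <= t ->
  `|smooth P V t v - soft b x v - t ^+ 2 / 2 * (\sum_j \sum_k soft2 b x v j k * C j k)| <=
  13 * b ^+ 3 * t ^+ 3 * Ex P (fun w => nrm (V w) ^+ 3).
Proof.
move=> gV t0; have mV := gaussian_meas gV.
have i1 : intg P (fun w => \sum_j soft1 b x v j * V w j).
  by apply: intg_sum => j _; apply: intgZ; case: (gaussian_coord_mean gV j).
have i2 : intg P (fun w => \sum_j \sum_k soft2 b x v j k * (V w j * V w k)).
  by apply: intg_sum => j _; apply: intg_sum => k _; apply: intgZ; case: (gaussian_cov gV j k).
have i3 := isoft P t v mV.
pose r w := soft b x (fun j => v j + t * V w j) - soft b x v - t * (\sum_j soft1 b x v j * V w j)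
  - t ^+ 2 / 2 * (\sum_j \sum_k soft2 b x v j k * (V w j * V w k)).
have ir : intg P r.
  by apply: intgB; [apply: intgB; [apply: intgB => //; exact: intg_cst|exact: intgZ]|exact: intgZ].
have -> : smooth P V t v - soft b x v - t ^+ 2 / 2 * (\sum_j \sum_k soft2 b x v j k * C j k) = Ex P r.
  rewrite /r !ExB; do ?[exact: intgZ|exact: intg_cst|exact: i3|apply: intgB].
  rewrite !ExZ// Ex_cst.
  have -> : Ex P (fun w => \sum_j soft1 b x v j * V w j) = 0.
    rewrite Ex_sum; last by move=> j _; apply: intgZ; case: (gaussian_coord_mean gV j).
    by rewrite big1// => j _; have [h e] := gaussian_coord_mean gV j; rewrite ExZ// e mulr0.
  rewrite mulr0 subr0; congr (_ - _ * _).
  rewrite Ex_sum; last by move=> j _; apply: intg_sum => k _; apply: intgZ; case: (gaussian_cov gV j k).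
  apply: eq_bigr => j _; rewrite Ex_sum; last by move=> k _; apply: intgZ; case: (gaussian_cov gV j k).
  by apply: eq_bigr => k _; have [h e] := gaussian_cov gV j k; rewrite ExZ// e.
have i4 := gaussian_nrm_pow gV 3.
rewrite -ExZ//; apply: Ex_absle => //; first exact: intgZ.
move=> w; apply: le_trans (soft_taylor x b0 v (V w) t0) _.
by rewrite exprMn; lra.
Qed.
Context (del : R) (del0 : 0 <= del) (C12 : forall j k, `|C1 j k - C2 j k| <= del).

Let K := 13 * b ^+ 3 * (Ex P1 (fun w => nrm (V1 w) ^+ 3) + Ex P2 (fun w => nrm (V2 w) ^+ 3)).

Let D_small t : 0 <= t -> D t (t ^+ 2 * (2 * b ^+ 2 * del) + K * t ^+ 3).
Proof.
move=> t0 v; have h1 := smooth_taylor v g1 t0; have h2 := smooth_taylor v g2 t0.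
set S1 := smooth P1 V1 t v in h1 *; set S2 := smooth P2 V2 t v in h2 *.
set Q1 := \sum_j _ in h1; set Q2 := \sum_j _ in h2.
have hQ : `|Q1 - Q2| <= 3 * b ^+ 2 * del.
  rewrite /Q1 /Q2 -sumrB; apply: (le_trans (ler_norm_sum _ _ _)).
  apply: (via (\sum_j \sum_k `|soft2 b x v j k| * del)).
    apply: ler_sum => j _; rewrite -sumrB; apply: (le_trans (ler_norm_sum _ _ _)).
    by apply: ler_sum => k _; rewrite -mulrBr normrM ler_wpM2l.
  under eq_bigr do rewrite -mulr_suml; rewrite -mulr_suml; apply: ler_wpM2r => //; exact: soft2_sum.
set M1 := Ex P1 _ in h1; set M2 := Ex P2 _ in h2.
have tt : 0 <= t ^+ 2 / 2 by pos.
have -> : S1 - S2 = (S1 - soft b x v - t ^+ 2 / 2 * Q1) - (S2 - soft b x v - t ^+ 2 / 2 * Q2)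
  + t ^+ 2 / 2 * (Q1 - Q2) by ring.
apply: (le_trans (ler_normD _ _)); rewrite normrM (ger0_norm tt) addrC; apply: lerD.
  apply: (le_trans (ler_wpM2l tt hQ)).
  have : 0 <= t ^+ 2 * (b ^+ 2 * del) by pos.
  lra.
apply: (le_trans (ler_normB _ _)); apply: (le_trans (lerD h1 h2)).
by rewrite /K -/M1 -/M2; lra.
Qed.

(** After n doublings from t = s^n only the covariance bound keeps its size; the third moments in
    [K] carry the factor s^n and disappear as n grows. *)
Lemma soft_compare : `|Ex P1 (fun w => soft b x (V1 w)) - Ex P2 (fun w => soft b x (V2 w))| <=
  2 * b ^+ 2 * del.
Proof.
pose s : R := (Num.sqrt 2)^-1.
have r2 : Num.sqrt 2 ^+ 2 = 2 :> R by rewrite sqr_sqrtr.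
have s0 : 0 < s by rewrite invr_gt0.
have s2 : s ^+ 2 = 2^-1 by rewrite exprVn r2.
have It n t D0 : D t D0 -> D (Num.sqrt 2 ^+ n * t) (2 ^+ n * D0).
  move=> Dt; elim: n => [|n IH]; first by rewrite !expr0 !mul1r.
  by rewrite !exprS -!mulrA; exact: D_double.
apply/ler_addgt0Pr => e e0.
have [n Hn] : exists n, K * s ^+ n <= e.
  have : K * s ^+ n @[n --> \oo] --> K * 0.
    apply: cvgM; first exact: cvg_cst.
    apply: cvg_expr; rewrite ger0_norm ?(ltW s0)// -(@ltr_pXn2r _ 2)// ?nnegrE ?(ltW s0)//.
    by rewrite s2 expr1n; lra.
  rewrite mulr0 => /cvgrPdist_le /(_ _ e0) [n _ /(_ n (leqnn n))] h; exists n.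
  by move: h; rewrite /= sub0r normrN; apply: le_trans; exact: ler_norm.
have := It n _ _ (D_small (exprn_ge0 n (ltW s0))) (fun=> 0).
have -> : Num.sqrt 2 ^+ n * s ^+ n = 1 by rewrite -exprMn /s divff// expr1n.
have h2 : 2 ^+ n * (s ^+ n) ^+ 2 = 1 by rewrite exprAC s2 -exprMn mulfV// expr1n.
have -> : 2 ^+ n * ((s ^+ n) ^+ 2 * (2 * b ^+ 2 * del) + K * (s ^+ n) ^+ 3) =
  2 * b ^+ 2 * del + K * s ^+ n.
  transitivity (2 ^+ n * (s ^+ n) ^+ 2 * (2 * b ^+ 2 * del + K * s ^+ n)); first by ring.
  by rewrite h2 mul1r.
rewrite /smooth.
have E d (X : measurableType d) (P : probability X R) (V : X -> J -> R) :
  Ex P (fun w => soft b x (fun j => 0 + 1 * V w j)) = Ex P (fun w => soft b x (V w)).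
  by congr (Ex _ _); apply/funext => w; congr soft; apply/funext => j; rewrite add0r mul1r.
rewrite (E _ X1 P1 V1) (E _ X2 P2 V2) => h; apply: (le_trans h); rewrite lerD2l; exact: Hn.
Qed.

End GaussianComparison.

(** * Comparison of orthant probabilities *)

Section OrthantComparison.
Context {R : realType}.

Definition orth d (X : measurableType d) (J : finType) (V : X -> J -> R) (u : R) : set X :=
  [set w | forall j, V w j <= u].

Definition pr d (X : measurableType d) (P : probability X R) (A : set X) : R := fine (P A).

Lemma prE d (X : measurableType d) (P : probability X R) (A : set X) : measurable A ->
  P A = (pr P A)%:E.
Proof. by move=> mA; rewrite /pr fineK// fin_num_measure. Qed.

Lemma pr_Ex d (X : measurableType d) (P : probability X R) (A : set X) : measurable A ->
  intg P (\1_A) /\ Ex P (\1_A) = pr P A.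
Proof.
move=> mA.
have i : intg P (\1_A : X -> R).
  apply: (@intg_bnd _ _ _ P _ 1) => // w; rewrite indicE; case: (_ \in _).
    by rewrite normr1.
  by rewrite normr0.
split => //; apply: EFin_inj; rewrite -ExE// -prE//.
by rewrite (@integral_indic _ _ R P setT measurableT A mA) setIT.
Qed.

Lemma measurable_orth d (X : measurableType d) (J : finType) (V : X -> J -> R) (u : R) :
  (forall j, measT (fun w => V w j)) -> measurable (orth V u).
Proof.
move=> mV; have -> : orth V u = \bigcap_(j in [set: J]) [set w | V w j <= u].
  by apply/seteqP; split => [w h j _|w h j]; exact: h.
apply: fin_bigcap_measurable => // j _.
preimage; apply: measurable_fun_le => //; exact: measurable_cst.
Qed.

(** The smooth function at level u + a is at least 1 - eta on the smaller orthant, where the sum of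
    exponentials is at most |J| e^(-ba), and at most e^(-ba) off the larger one. *)
Lemma orthant_le d1 d2 (X1 : measurableType d1) (X2 : measurableType d2) (J : finType)
  (P1 : probability X1 R) (P2 : probability X2 R) (V1 : X1 -> J -> R) (V2 : X2 -> J -> R)
  (C1 C2 : J -> J -> R) (b a del eta u : R) :
  gaussian_sys P1 V1 C1 -> gaussian_sys P2 V2 C2 -> 0 < b -> 0 < a -> 0 <= del ->
  (forall j k, `|C1 j k - C2 j k| <= del) -> #|J|%:R * expR (- (b * a)) <= eta ->
  pr P1 (orth V1 u) <= pr P2 (orth V2 (u + 2 * a)) + (2 * eta + 2 * b ^+ 2 * del).
Proof.
move=> g1 g2 b0 a0 del0 C12 Heta.
have m1 := gaussian_meas g1; have m2 := gaussian_meas g2.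
have := @soft_compare R _ _ X1 X2 J P1 P2 V1 V2 C1 C2 g1 g2 b (u + a) b0 del del0 C12.
rewrite ler_norml => /andP[_].
have i1 : intg P1 (fun w => soft b (u + a) (V1 w)).
  by apply: (@intg_bnd _ _ _ _ _ 1); [exact: measurable_soft|move=> w; exact: soft_abs].
have i2 : intg P2 (fun w => soft b (u + a) (V2 w)).
  by apply: (@intg_bnd _ _ _ _ _ 1); [exact: measurable_soft|move=> w; exact: soft_abs].
have mo1 : measurable (orth V1 u) by exact: measurable_orth.
have mo2 : measurable (orth V2 (u + 2 * a)) by exact: measurable_orth.
have [j1 e1] := pr_Ex P1 mo1; have [j2 e2] := pr_Ex P2 mo2.
have eta0 : 0 <= eta by apply: le_trans Heta; rewrite mulr_ge0//; pos.
have h1 : pr P1 (orth V1 u) <= Ex P1 (fun w => soft b (u + a) (V1 w)) + eta.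
  apply: (via (Ex P1 (\1_(orth V1 u) : X1 -> R))); first by rewrite e1.
  rewrite -[X in _ + X](Ex_cst P1) -ExD//; last exact: intg_cst.
  apply: Ex_le => //; first by apply: intgD => //; exact: intg_cst.
  move=> w; rewrite indicE; case: (boolP (w \in _)) => [|_]; last first.
    by rewrite addr_ge0// soft_ge0.
  rewrite inE => ow; rewrite -lerBlDr /soft.
  apply: (via (expR (- eta))); first exact: expR_ge1Dx.
  rewrite ler_expR lerN2; apply: le_trans Heta.
  apply: (via (\sum_(j : J) expR (- (b * a)))).
    apply: ler_sum => j _; rewrite ler_expR -mulrN ler_wpM2l ?(ltW b0)//.
    by have := ow j; lra.
  by rewrite sumr_const mulr_natl.
have h2 : Ex P2 (fun w => soft b (u + a) (V2 w)) <= pr P2 (orth V2 (u + 2 * a)) + eta.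
  apply: (via (Ex P2 (\1_(orth V2 (u + 2 * a)) : X2 -> R) + Ex P2 (fun=> eta))); last first.
    by rewrite e2 Ex_cst.
  rewrite -ExD//; last exact: intg_cst.
  apply: Ex_le => //; first by apply: intgD => //; exact: intg_cst.
  move=> w; rewrite indicE; case: (boolP (w \in _)) => [_|].
    by apply: (le_trans (soft_le1 _ _ _)); rewrite lerDl.
  move/negP; rewrite inE => ow; rewrite add0r.
  have [j Hj] : exists j, u + 2 * a < V2 w j.
    by apply/not_existsP => h; apply: ow => j; rewrite leNgt; apply/negP; exact: h.
  apply: le_trans Heta; apply: (via (expR (- (b * a)))); last first.
    by rewrite ler_peMl// ler1n; apply/card_gt0P; exists j.
  rewrite ler_expR lerN2 (bigD1 j)//=; apply: (via (expR (b * a))).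
    by apply: le_trans (expR_ge1Dx _); rewrite lerDr.
  rewrite -[leLHS]addr0; apply: lerD; last by pos.
  by rewrite ler_expR ler_wpM2l//; lra.
lra.
Qed.

End OrthantComparison.

(** * Anti-concentration of Gaussian maxima *)

Section AntiConcentration.
Context {R : realType}.

Lemma sum_indic_le1 d (X : measurableType d) (I : finType) (A : I -> set X) (v : X) :
  (forall i j, A i v -> A j v -> i = j) -> \sum_i \1_(A i) v <= 1 :> R.
Proof.
move=> H; have [[i Ai]|nA] := pselect (exists i, A i v).
  rewrite (bigD1 i)//= big1 ?addr0.
    by rewrite indicE; case: (_ \in _).
  move=> j /eqP ji; rewrite indicE memNset// => Aj; exact: ji (H _ _ Aj Ai).
rewrite big1// => i _; rewrite indicE memNset// => Ai; by apply: nA; exists i.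
Qed.

Lemma gaussian_corr_le1 d (X : measurableType d) (P : probability X R) (J : finType)
  (N : X -> J -> R) (C : J -> J -> R) j k : gaussian_sys P N C -> C j j = 1 -> C k k = 1 ->
  C j k <= 1.
Proof.
move=> gN cj ck.
have [i1 e1] := gaussian_cov gN j j; have [i2 e2] := gaussian_cov gN k k.
have [i3 e3] := gaussian_cov gN j k.
have : 0 <= Ex P (fun w => N w j * N w j + N w k * N w k - 2 * (N w j * N w k)).
  by apply: Ex_ge0 => w; have := sqr_ge0 (N w j - N w k); rewrite sqrrB; lra.
by rewrite ExB; [rewrite ExD// ExZ// e1 e2 e3 cj ck; lra|exact: intgD|exact: intgZ].
Qed.

Lemma measurable_set_lt d (X : measurableType d) (f g : X -> R) : measT f ->
  measT g -> measurable [set x | f x < g x].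
Proof.
move=> mf mg; rewrite -[X in measurable X]setCK; apply: measurableC.
have -> : ~` [set x | f x < g x] = setT `&` [set x | g x <= f x].
  by apply/seteqP; split => [x /= /negP|x /= [_ h]]; rewrite -?leNgt//; apply/negP; rewrite -leNgt.
exact: measurable_fun_le.
Qed.

Section Slabs.
Context {d : measure_display} {X : measurableType d} {J : finType} (P : probability X R)
  (N : X -> J -> R) (C : J -> J -> R) (y : J -> R) (L w : R) (gN : gaussian_sys P N C)
  (C1 : forall j, C j j = 1) (w0 : 0 < w) (yL : forall j, y j <= L) (L0 : 0 <= L).

(* i is the first index maximising v k - y k, and the maximum lies in (r, r + w] *)
Definition slab (i : J) (r : R) : set (fspace R J) :=
  [set v | r < v i - y i /\ v i - y i <= r + w /\
     forall k, if (enum_rank k < enum_rank i)%N then v k - y k < v i - y i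
               else v k - y k <= v i - y i].

Lemma measurable_slab i r : measurable (slab i r).
Proof.
have mc k : measT (fun v : fspace R J => v k - y k).
  by apply: measurable_funB => //; exact: meas_eval.
have -> : slab i r = [set v | r < v i - y i] `&` [set v | v i - y i <= r + w] `&`
  \bigcap_(k in [set: J]) [set v | if (enum_rank k < enum_rank i)%N then v k - y k < v i - y i
  else v k - y k <= v i - y i].
  apply/seteqP; split => [v [h1 [h2 h3]]|v [[h1 h2] h3]]; first by split => // k _; exact: h3.
  by split => //; split => // k; exact: h3.
apply: measurableI; first apply: measurableI.
- by apply: measurable_set_lt => //; by meas.
- by preimage; apply: measurable_fun_le => //; exact: measurable_cst.
apply: fin_bigcap_measurable => // k _; case: (enum_rank k < enum_rank i)%N.
- exact: measurable_set_lt.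
- by preimage; exact: measurable_fun_le.
Qed.

(** Ties are broken by [enum_rank] and the levels are w apart, so slabs of different indices or
    levels are disjoint. *)
Lemma slab_uniq i j (m n : nat) v : slab i (m%:R * w) v -> slab j (n%:R * w) v -> i = j /\ m = n.
Proof.
move=> [a1 [b1 c1]] [a2 [b2 c2]].
have ij : i = j.
  have := c1 j; have := c2 i; have [ij|ij|] := ltngtP (enum_rank i) (enum_rank j).
  - by move=> h1 h2; exfalso; move: h1 h2; lra.
  - by move=> h1 h2; exfalso; move: h1 h2; lra.
  - by move=> /val_inj /enum_rank_inj.
split => //; subst j.
have H (p q : nat) : p%:R * w < v i - y i -> v i - y i <= q%:R * w + w -> (p <= q)%N.
  move=> h1 h2; rewrite -ltnS -(ltr_nat R) -(ltr_pM2r w0); apply: (lt_le_trans h1).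
  by apply: (le_trans h2); rewrite -natr1; lra.
by apply/eqP; rewrite eqn_leq (H m n)// (H n m).
Qed.

Let mN : measT (N : X -> fspace R J).
Proof. by apply: meas_fspace => j; exact: gaussian_meas gN j. Qed.

Let mS i r : measurable [set o | slab i r (N o)].
Proof. by preimage; apply: mN => //; exact: measurable_slab. Qed.

(** Correlations are at most 1, so moving by t along row i raises coordinate i by t and no other by
    more: i stays the first maximiser and the maximum moves by exactly t. The density factor is at
    most e because N_i <= t + w + L on the target slab. *)
Lemma slab_shift i t : 0 <= t -> t * (1 + w + L) <= 1 ->
  pr P [set o | slab i 0 (N o)] <= expR 1 * pr P [set o | slab i t (N o)].
Proof.
move=> t0 tL.
have [j0 <-] := pr_Ex P (mS i 0); have [jt <-] := pr_Ex P (mS i t).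
have t1 : t <= 1.
  by apply: le_trans tL; rewrite ler_peMr// -addrA lerDl addr_ge0// ltW.
have [ic ec] := cameron_martin i t gN (measurable_slab i t).
apply: (via (Ex P (fun o => \1_(slab i t) (fun j => N o j + t * C j i)))).
  apply: Ex_le => //.
    apply: (@intg_bnd _ _ _ P _ 1).
      apply: (@measurableT_comp _ _ _ _ _ _ (\1_(slab i t) : fspace R J -> R) _
        (fun o => (fun j => N o j + t * C j i) : fspace R J)).
        by apply: measurable_indic; exact: measurable_slab.
      apply: meas_fspace => j; apply: measurable_funD => //; exact: gaussian_meas gN j.
    by move=> o; rewrite indicE; case: (_ \in _); rewrite ?normr1 ?normr0.
  move=> o; rewrite !indicE; case: (boolP (o \in _)) => [|_]; last by case: (_ \in _).
  rewrite inE => -[h1 [h2 h3]]; rewrite mem_set//; split; [|split].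
  - by rewrite C1; move: h1; lra.
  - by rewrite C1; move: h2; lra.
  move=> k; have ck := gaussian_corr_le1 gN (C1 k) (C1 i).
  have tck : t * C k i <= t * C i i by rewrite C1 ler_wpM2l.
  by have := h3 k; case: ifP => _; lra.
rewrite ec -ExZ//; apply: Ex_le => //; first exact: intgZ.
move=> o; rewrite !indicE.
have -> : (o \in [set o | slab i t (N o)]) = (N o \in slab i t).
  by apply/idP/idP => /set_mem h; exact: mem_set.
case: (boolP (N o \in _)) => [/set_mem[h1 [h2 h3]]|_]; last by rewrite !mulr0.
rewrite !mulr1 ler_expR C1.
have : t * N o i <= t * (t + w + L) by rewrite ler_wpM2l//; have := yL i; lra.
have : t * t <= 1 * t by rewrite ler_wpM2r.
by rewrite expr2; move: tL; lra.
Qed.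

(** The slabs at levels m w are disjoint over all m and i, so their probabilities add up to at most
    1, while each is at least 1/e times the one at level 0. *)
Lemma slab_sum : \sum_i pr P [set o | slab i 0 (N o)] <= expR 1 * w * (1 + w + L).
Proof.
set T0 := (1 + w + L)^-1.
have T0p : 0 < 1 + w + L by have := w0; have := L0; lra.
(* Every m < M satisfies m w <= T0, and M is at least T0 / w. *)
pose M := (Num.truncn (T0 / w)).+1.
have Tw : 0 <= T0 / w by rewrite divr_ge0 ?invr_ge0 ?(ltW T0p) ?(ltW w0).
have MT : T0 / w <= M%:R by apply/ltW; exact: truncnS_gt.
have h1 (m : 'I_M) i : pr P [set o | slab i 0 (N o)] <=
  expR 1 * pr P [set o | slab i (m%:R * w) (N o)].
  apply: slab_shift; first by pos.
  rewrite -ler_pdivlMr// mul1r -/T0 -ler_pdivlMr//.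
  have tr : (Num.truncn (T0 / w))%:R <= T0 / w by rewrite truncn_le.
  by apply: le_trans tr; rewrite ler_nat -ltnS.
have h2 : M%:R * \sum_i pr P [set o | slab i 0 (N o)] <=
  expR 1 * \sum_(p : 'I_M * J) pr P [set o | slab p.2 (p.1%:R * w) (N o)].
  rewrite -(pair_bigA _ (fun (m : 'I_M) i => pr P [set o | slab i (m%:R * w) (N o)]))/=.
  rewrite [leRHS]mulr_sumr [leLHS]mulr_natl -{1}[M]card_ord -sumr_const.
  apply: ler_sum => m _; rewrite mulr_sumr; apply: ler_sum => i _; exact: h1.
have h3 : \sum_(p : 'I_M * J) pr P [set o | slab p.2 (p.1%:R * w) (N o)] <= 1.
  under eq_bigr => p _ do rewrite -(pr_Ex P (mS p.2 (p.1%:R * w))).2.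
  have ip (p : 'I_M * J) := (pr_Ex P (mS p.2 (p.1%:R * w))).1.
  rewrite -Ex_sum => [|p _]; last exact: ip.
  rewrite -[leRHS](Ex_cst P); apply: Ex_le.
  - by apply: intg_sum => p _; exact: ip.
  - exact: intg_cst.
  move=> o; apply: (@sum_indic_le1 _ X _ (fun p : 'I_M * J => [set o | slab p.2 (p.1%:R * w) (N o)])).
  move=> [m i] [n j] /= si sj; have [ij mn] := slab_uniq si sj.
  by rewrite ij; congr pair; exact: val_inj.
set S := \sum_i _ in h2 *.
have e0 : 0 < expR 1 :> R by pos.
have h4 : M%:R * S <= expR 1.
  by apply: (le_trans h2); rewrite -[leRHS]mulr1 ler_wpM2l.
have S0 : 0 <= S by apply: sumr_ge0 => i _; rewrite /pr fine_ge0.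
have : T0 / w * S <= expR 1 by apply: le_trans h4; rewrite ler_wpM2r.
by rewrite mulrAC ler_pdivrMr// mulrC /T0 ler_pdivrMr//.
Qed.

Lemma first_argmax (u : J -> R) (j0 : J) : exists i, u j0 <= u i /\
  forall k, if (enum_rank k < enum_rank i)%N then u k < u i else u k <= u i.
Proof.
have [i _ Hi] := arg_maxP (fun k => u k) (isT : xpredT j0).
have ui : u i >= u i by [].
have [k uk Hk] := @arg_minnP _ i (fun k => u i <= u k) (fun k => enum_rank k : nat) ui.
exists k; split; first by apply: le_trans uk; exact: Hi.
move=> l; case: ifP => lk; last by apply: le_trans uk; exact: Hi.
rewrite ltNge; apply/negP => ukl; have := Hk l (le_trans uk ukl).
by rewrite leqNgt lk.
Qed.

End Slabs.

(* The maximum of a Gaussian vector has a bounded density: shifting along the row of the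
   covariance of the maximising coordinate moves the slab where the maximum lies, at the cost of
  a bounded Cameron-Martin factor, and about s/w disjoint shifted slabs fit. *)
Lemma gaussian_max_density d (X : measurableType d) (J : finType) (P : probability X R)
  (V : X -> J -> R) (C : J -> J -> R) (s x w : R) : gaussian_sys P V C -> 0 < s ->
  (forall j, s ^+ 2 <= C j j) -> 0 < w ->
  pr P (orth V (x + w)) - pr P (orth V x) <= expR 1 * (w / s) * (1 + w / s + `|x| / s).
Proof.
move=> gV s0 sC w0; pose sg j := Num.sqrt (C j j).
have Cp j : 0 < C j j by apply: lt_le_trans (sC j); rewrite exprn_gt0.
have sgs j : s <= sg j by rewrite /sg -(ger0_norm (ltW s0)) -sqrtr_sqr ler_wsqrtr.
have sg0 j : 0 < sg j by apply: lt_le_trans (sgs j).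
have gN := gaussian_rescale (fun j => (sg j)^-1) gV.
set N := fun o j => (sg j)^-1 * V o j in gN.
set C' := fun i j => _ in gN.
have C'1 j : C' j j = 1.
  by rewrite /C' -invfM -expr2 sqr_sqrtr ?(ltW (Cp j))// mulVf// gt_eqF.
(* After standardisation the common threshold x becomes x / sg_j, different for each coordinate;
   this is why slabs carry the offset [y]. *)
pose y j := x / sg j.
have yL j : y j <= `|x| / s.
  rewrite /y; apply: (via (`|x| / sg j)); first by rewrite ler_wpM2r ?invr_ge0 ?ler_norm// ltW.
  by rewrite ler_wpM2l// lef_pV2 ?posrE.
have ws0 : 0 < w / s by pos.
have L0 : 0 <= `|x| / s by pos.
apply: le_trans (slab_sum gN C'1 ws0 yL L0).
have mV := gaussian_meas gV.
have mo u : measurable (orth V u) by exact: measurable_orth.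
have mS i r : measurable [set o | slab y (w / s) i r (N o)].
  preimage.
  have mN : measT (N : X -> fspace R J).
    by apply: meas_fspace => j; exact: gaussian_meas gN j.
  exact: (mN measurableT _ (@measurable_slab _ y (w / s) i r)).
rewrite -(pr_Ex P (mo (x + w))).2 -(pr_Ex P (mo x)).2.
rewrite -ExB; [|by case: (pr_Ex P (mo (x + w)))|by case: (pr_Ex P (mo x))].
under eq_bigr => p _ do rewrite -(pr_Ex P (mS p 0)).2.
rewrite -Ex_sum => [|p _]; last by case: (pr_Ex P (mS p 0)).
apply: Ex_le.
- by apply: intgB; [case: (pr_Ex P (mo (x + w)))|case: (pr_Ex P (mo x))].
- by apply: intg_sum => p _; case: (pr_Ex P (mS p 0)).
move=> o; rewrite !indicE.
have sum0 : 0 <= \sum_i \1_[set o0 | slab y (w / s) i 0 (N o0)] o :> R.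
  by pos.
case: (boolP (o \in orth V x)) => [_|].
  by apply: le_trans sum0; case: (_ \in _) => /=; lra.
move=> /negP; rewrite inE => nx; case: (boolP (o \in orth V (x + w))) => [|_]; last by rewrite subr0.
rewrite inE => xw; rewrite subr0.
have [j0 Hj0] : exists j, x < V o j.
  by apply/not_existsP => h; apply: nx => j; rewrite leNgt; apply/negP; exact: h.
have [i [ui Hi]] := first_argmax (fun j => N o j - y j) j0.
rewrite (bigD1 i)//= indicE mem_set; first by rewrite lerDl sumr_ge0// => k _; rewrite indicE.
have NE j : N o j - y j = (V o j - x) / sg j by rewrite /N /y; ring.
split; [|split] => //.
- by apply: lt_le_trans ui; rewrite NE divr_gt0// subr_gt0.
- rewrite add0r NE ler_pdivrMr//; apply: (via (w / s * s)).
    by rewrite divfK//; have := xw i; lra.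
  by rewrite ler_wpM2l//; pos.
Qed.

(** Exponential Markov inequality at 1/S in each coordinate. A tail linear in the exponent suffices,
    as the threshold will be a multiple of log T. *)
Lemma gaussian_max_tail d (X : measurableType d) (J : finType) (P : probability X R)
  (V : X -> J -> R) (C : J -> J -> R) (S x : R) : gaussian_sys P V C -> 0 < S ->
  (forall j, C j j <= S ^+ 2) -> 1 - pr P (orth V x) <= #|J|%:R * expR (1 - x / S).
Proof.
move=> gV S0 CS; have mV := gaussian_meas gV.
have mo : measurable (orth V x) by exact: measurable_orth.
have [io <-] := pr_Ex P mo.
have ij j : intg P (fun o => expR (- (x / S)) * expR (S^-1 * V o j)).
  by apply: intgZ; case: (gaussian_coord_mgf gV j S^-1).
rewrite -[X in X - _](Ex_cst P) -ExB//; last exact: intg_cst.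
apply: (via (Ex P (fun o => \sum_j expR (- (x / S)) * expR (S^-1 * V o j)))).
  apply: Ex_le; [apply: intgB => //; exact: intg_cst|exact: intg_sum|].
  move=> o; rewrite indicE; have s0 : 0 <= \sum_j expR (- (x / S)) * expR (S^-1 * V o j).
    by pos.
  case: (boolP (o \in _)) => [_|/negP]; first by rewrite subrr.
  rewrite inE => nx; rewrite subr0.
  have [j Hj] : exists j, x < V o j.
    by apply/not_existsP => h; apply: nx => j; rewrite leNgt; apply/negP; exact: h.
  rewrite (bigD1 j)//= -[leLHS]addr0; apply: lerD; last first.
    by pos.
  rewrite -expRD -expR0 ler_expR addrC [S^-1 * _]mulrC -mulrBl divr_ge0 ?(ltW S0)//.
  by rewrite subr_ge0 ltW.
rewrite Ex_sum => [|j _]; last exact: ij.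
rewrite mulr_natl -sumr_const; apply: ler_sum => j _.
have [h e] := gaussian_coord_mgf gV j S^-1; rewrite ExZ// e -expRD ler_expR addrC lerD2r.
rewrite exprVn -mulrA mulrC ler_pdivrMr ?exprn_gt0// mul1r.
by apply: le_trans (CS j); have := qform_ge0 gV (fun k => (k == j)%:R); have := gaussian_cov gV j j => -[ic <-] _; rewrite ler_pdivrMr// ler_peMr ?ler1n//; apply: Ex_ge0 => o; rewrite -expr2 sqr_ge0.
Qed.

(** [orthant_le] is used at u and at u - 2a. The probability of a window of length 2a is bounded by
    the density if the window starts below [x0], and by the tail otherwise. *)
Lemma gaussian_kolmogorov d1 d2 (X1 : measurableType d1) (X2 : measurableType d2) (J : finType)
  (P1 : probability X1 R) (P2 : probability X2 R) (V1 : X1 -> J -> R) (V2 : X2 -> J -> R)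
  (C1 C2 : J -> J -> R) (b a del eta s S x0 u : R) :
  gaussian_sys P1 V1 C1 -> gaussian_sys P2 V2 C2 -> 0 < b -> 0 < a -> 0 <= del ->
  (forall j k, `|C1 j k - C2 j k| <= del) -> #|J|%:R * expR (- (b * a)) <= eta ->
  0 < s -> 0 < S -> (forall j, s ^+ 2 <= C2 j j <= S ^+ 2) -> 0 <= u -> 0 <= x0 ->
  `|pr P1 (orth V1 u) - pr P2 (orth V2 u)| <= 2 * eta + 2 * b ^+ 2 * del +
  (expR 1 * (2 * a / s) * (1 + 2 * a / s + (x0 + 2 * a) / s) + #|J|%:R * expR (1 - x0 / S)).
Proof.
move=> g1 g2 b0 a0 del0 C12 Heta s0 S0 Css u0 x00.
have C21 j k : `|C2 j k - C1 j k| <= del by rewrite distrC.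
have h1 := orthant_le u g1 g2 b0 a0 del0 C12 Heta.
have h2 := orthant_le (u - 2 * a) g2 g1 b0 a0 del0 C21 Heta.
rewrite subrK in h2.
have ac x : - (2 * a) <= x -> pr P2 (orth V2 (x + 2 * a)) - pr P2 (orth V2 x) <=
  expR 1 * (2 * a / s) * (1 + 2 * a / s + (x0 + 2 * a) / s) + #|J|%:R * expR (1 - x0 / S).
  move=> xa; have a20 : 0 < 2 * a by lra.
  have [xx|xx] := leP x x0.
    have sC2 j : s ^+ 2 <= C2 j j by case/andP: (Css j).
    apply: (le_trans (gaussian_max_density x g2 s0 sC2 a20)).
    rewrite -[leLHS]addr0; apply: lerD => //; apply: ler_wpM2l.
      by pos.
    rewrite lerD2l ler_wpM2r ?invr_ge0 ?(ltW s0)//.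
    by rewrite ler_norml; apply/andP; split; lra.
  have SC2 j : C2 j j <= S ^+ 2 by case/andP: (Css j).
  have := gaussian_max_tail x g2 S0 SC2 => t.
  apply: (via (1 - pr P2 (orth V2 x))).
    rewrite lerD2r -lee_fin -prE; last by apply: measurable_orth; exact: gaussian_meas g2.
    exact: probability_le1 (measurable_orth _ (gaussian_meas g2)).
  apply: (le_trans t); rewrite -[leLHS]add0r; apply: lerD.
    have q0 : 0 <= 2 * a / s by pos.
    by pos.
  by rewrite ler_wpM2l// ler_expR lerD2l lerN2 ler_wpM2r ?invr_ge0 ?ltW.
have ua : - (2 * a) <= u by lra.
have := ac u ua; have := ac (u - 2 * a); rewrite subrK => /(_ ltac:(lra)).
rewrite ler_norml; move: h1 h2; set K := expR 1 * _ * _ + _.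
by move=> h1 h2 h3 h4; apply/andP; split; lra.
Qed.

End AntiConcentration.

(** * Power sums *)

Section PowerSums.
Context {R : realType}.
Implicit Types (b k x : R).

Lemma ln_succ_ge (x : R) : 0 < x -> (1 + x)^-1 <= ln ((1 + x) / x).
Proof.
move=> x0; have x1 : 0 < 1 + x by pos.
have h : 0 < x / (1 + x) by pos.
rewrite -[(1 + x) / x]invf_div lnV//.
have := ln_sublinear h; have := @le_ln1Dx R (x / (1 + x) - 1).
have -> : 1 + (x / (1 + x) - 1) = x / (1 + x) by ring.
move=> /(_ _); rewrite ltrBrDr addNr => /(_ h) H _.
have : x / (1 + x) - 1 = - (1 + x)^-1 by field; rewrite gt_eqF.
by move: H; lra.
Qed.

(** The summand is compared with an increment of x^(1-b), so that sums telescope; the bound rests on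
    log((1 + x)/x) >= 1/(1 + x). *)
Lemma powR_telescope_gt b x : 1 < b -> 0 < x ->
  (b - 1) * (1 + x) `^ (- b) <= x `^ (1 - b) - (1 + x) `^ (1 - b).
Proof.
move=> b1 x0; have x1 : 0 < 1 + x by pos.
have e1 : (1 + x) `^ (- b) = (1 + x) `^ (1 - b) * (1 + x)^-1.
  rewrite -(powR_inv1 (ltW x1)) -powRD; last by rewrite (gt_eqF x1) implybT.
  by congr (_ `^ _); ring.
have e2 : x `^ (1 - b) = (1 + x) `^ (1 - b) * expR ((b - 1) * ln ((1 + x) / x)).
  rewrite /powR !gt_eqF// -expRD; congr expR.
  rewrite ln_div//; ring.
rewrite e1 e2; have p0 : 0 < (1 + x) `^ (1 - b) by pos.
have := expR_ge1Dx ((b - 1) * ln ((1 + x) / x)); have := ln_succ_ge x0.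
set E := expR _; set l := ln _; set q := _ `^ _ in p0 *; move=> h1 h2.
have h3 : (b - 1) * (1 + x)^-1 <= E - 1.
  by apply: (via ((b - 1) * l)); [rewrite ler_wpM2l//; lra|lra].
have := ler_wpM2l (ltW p0) h3; lra.
Qed.

(** The factor 1/2 comes from e^(-y) <= 1 - y/2 on [0, 1]. *)
Lemma powR_telescope_lt b x : b < 1 -> 0 <= b -> 0 < x ->
  (1 - b) / 2 * (1 + x) `^ (- b) <= (1 + x) `^ (1 - b) - x `^ (1 - b).
Proof.
move=> b1 b0 x0; have x1 : 0 < 1 + x by pos.
have e1 : (1 + x) `^ (- b) = (1 + x) `^ (1 - b) * (1 + x)^-1.
  rewrite -(powR_inv1 (ltW x1)) -powRD; last by rewrite (gt_eqF x1) implybT.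
  by congr (_ `^ _); ring.
have e2 : x `^ (1 - b) = (1 + x) `^ (1 - b) * expR (- ((1 - b) * ln ((1 + x) / x))).
  rewrite /powR !gt_eqF// -expRD; congr expR.
  rewrite ln_div//; ring.
rewrite e1 e2; have p0 : 0 < (1 + x) `^ (1 - b) by pos.
have := ln_succ_ge x0; set l := ln _; set q := _ `^ _ in p0 *; move=> h1.
set y := (1 - b) * (1 + x)^-1.
have y0 : 0 <= y by rewrite mulr_ge0 ?invr_ge0//; lra.
have y1 : y <= 1.
  rewrite /y ler_pdivrMr//; lra.
have h2 : expR (- ((1 - b) * l)) <= expR (- y) by rewrite ler_expR lerN2 /y ler_wpM2l//; lra.
have h3 : expR (- y) <= 1 - y / 2.
  rewrite expRN -[leLHS]mul1r ler_pdivrMr ?expR_gt0//.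
  have h := expR_ge1Dx y.
  have : (1 - y / 2) * (1 + y) <= (1 - y / 2) * expR y by rewrite ler_wpM2l//; lra.
  have : 0 <= y * (1 - y) by rewrite mulr_ge0//; lra.
  lra.
have h4 : y / 2 <= 1 - expR (- ((1 - b) * l)) by lra.
have := ler_wpM2l (ltW p0) h4; rewrite /y; lra.
Qed.

Lemma sum_telescope_le (f : nat -> R) (a n : nat) : (a <= n)%N ->
  \sum_(a <= h < n) (f h - f h.+1) = f a - f n.
Proof.
move=> an; rewrite -[RHS]opprB -telescope_sumr// -sumrN.
by apply: eq_bigr => h _; rewrite opprB.
Qed.

Lemma sum_tail_pow b (a n : nat) : 1 < b -> (0 < a)%N ->
  \sum_(a <= h < n) (1 + h%:R) `^ (- b) <= a%:R `^ (1 - b) / (b - 1).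
Proof.
move=> b1 a0; have b0 : 0 < b - 1 by pos.
have [an|na] := leqP a n; last by rewrite big_geq ?divr_ge0 ?(ltW b0)// ltnW.
rewrite ler_pdivlMr// mulrC mulr_sumr.
apply: (via (\sum_(a <= h < n) (h%:R `^ (1 - b) - h.+1%:R `^ (1 - b)))).
  apply: ler_sum_nat => h /andP[ah _]; rewrite -nat1r; apply: powR_telescope_gt => //.
  by rewrite ltr0n (leq_trans a0).
by rewrite (sum_telescope_le (fun h => h%:R `^ (1 - b)))// gerBl powR_ge0.
Qed.

Lemma sum_head_pow_lt b (n : nat) : b < 1 -> 0 <= b ->
  \sum_(1 <= h < n.+1) (1 + h%:R) `^ (- b) <= 2 / (1 - b) * n.+1%:R `^ (1 - b).
Proof.
move=> b1 b0; have b10 : 0 < 1 - b by pos.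
apply: (via (\sum_(1 <= h < n.+1) 2 / (1 - b) * (h.+1%:R `^ (1 - b) - h%:R `^ (1 - b)))).
  apply: ler_sum_nat => h /andP[ah _]; have -> : h.+1%:R = 1 + h%:R :> R by rewrite nat1r.
  have h0 : 0 < h%:R :> R by rewrite ltr0n.
  have := powR_telescope_lt b1 b0 h0 => H.
  rewrite -(@ler_pM2l _ ((1 - b) / 2)) ?divr_gt0//; apply: (le_trans H).
  by rewrite mulrA; apply: eq_ler; field; rewrite gt_eqF.
rewrite -mulr_sumr ler_wpM2l ?divr_ge0 ?(ltW b10)//.
by rewrite (telescope_sumr (fun h => h%:R `^ (1 - b)))// gerBl powR_ge0.
Qed.

Lemma sum_head_inv (n : nat) : \sum_(1 <= h < n.+1) (1 + h%:R) `^ (- 1) <= ln (n.+1%:R : R).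
Proof.
apply: (via (\sum_(1 <= h < n.+1) (ln (h.+1%:R : R) - ln (h%:R : R)))).
  apply: ler_sum_nat => h /andP[ah _]; rewrite powR_inv1// -ln_div ?posrE ?ltr0n//.
  by rewrite -nat1r; apply: ln_succ_ge; rewrite ltr0n.
by rewrite (telescope_sumr (fun h => ln (h%:R : R)))// ln1 subr0.
Qed.

Lemma sum_head_pow_gt b (n : nat) : 1 < b ->
  \sum_(1 <= h < n.+1) (1 + h%:R) `^ (- b) <= (b - 1)^-1 :> R.
Proof. by move=> b1; have := @sum_tail_pow b 1 n.+1 b1 isT; rewrite powR1 mul1r. Qed.

Lemma sum_dist_le (f : nat -> R) (i n : nat) : (forall h, 0 <= f h) -> (i < n)%N ->
  \sum_(j < n) f `|i%:Z - j%:Z|%N <= 2 * \sum_(h < n) f h.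
Proof.
move=> f0 ni.
apply: (via (\sum_(0 <= j < i.+1) f (i - j)%N + \sum_(i <= j < n) f (j - i)%N)).
  rewrite -(big_mkord xpredT (fun j => f `|i%:Z - j%:Z|%N)) (big_cat_nat (n := i.+1))//=.
  apply: lerD.
    apply: ler_sum_nat => j /andP[_ ji]; rewrite ltnS in ji.
    by rewrite distnEl.
  rewrite [leRHS]big_ltn// -[leLHS]add0r; apply: lerD => //.
  by apply: ler_sum_nat => j /andP[ij _]; rewrite distnEr// ltnW.
have mono (q : nat) : (q <= n)%N -> \sum_(0 <= h < q) f h <= \sum_(h < n) f h.
  move=> qn; rewrite -(big_mkord xpredT f) [leRHS](big_cat_nat (n := q))//= lerDl.
  by pos.
rewrite mulr_natl mulr2n; apply: lerD.
  rewrite big_nat_rev/= add0n; under eq_big_nat => j /andP[_ ji] do rewrite subSS subKn//.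
  exact: mono.
rewrite -[X in \sum_(X <= _ < _) _]add0n big_addn; under eq_bigr do rewrite addnK.
exact/mono/leq_subr.
Qed.

End PowerSums.

(** * Sums of the bootstrap kernel *)

Section KernelSums.
Context {R : realType} (K : R -> R) (hK : kernel_function K).
Local Notation leb := (@lebesgue_measure R).

Lemma kernel_le1 x : K x <= 1.
Proof.
have H y : 0 <= y -> K y <= 1 by move=> y0; rewrite -(kernel0 hK); exact: kernel_decreasing.
by have [x0|x0] := leP 0 x; [exact: H|rewrite -(kernel_sym hK); apply: H; rewrite oppr_ge0 ltW].
Qed.

Lemma kernel_abs x : K `|x| = K x.
Proof. by have [x0|x0] := leP 0 x; [rewrite ger0_norm|rewrite ltr0_norm// (kernel_sym hK)]. Qed.

(** On [0, 1] the derivative is bounded by continuity; beyond 1 the difference is at most 1. *)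
Lemma kernel_lip : exists2 L : R, 0 < L & forall x, `|K x - 1| <= L * `|x|.
Proof.
have dK x : is_derive x (1 : R) K ('D_1 K x).
  by apply: DeriveDef => //; exact: (kernel_derivable hK).
have cK : {within `[0, 1], continuous (fun x => `|derive1 K x|)}.
  apply: continuous_subspaceT => x; apply: continuous_comp; first exact: (kernel_C1 hK).
  exact: norm_continuous.
have [c c01 Hc] := EVT_max (@ler01 R) cK.
exists (`|derive1 K c| + 1); first by rewrite ltr_wpDl.
suff H x : 0 <= x -> `|K x - 1| <= (`|derive1 K c| + 1) * x.
  move=> x; rewrite -(kernel_abs x); exact: H.
move=> x0; have [x1|x1] := leP x 1; last first.
  rewrite ler0_norm ?subr_le0 ?kernel_le1// opprB.
  apply: (via 1); first by rewrite gerBl; exact: (kernel_ge0 hK).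
  by rewrite -[leLHS]mul1r; apply: ler_pM => //; [rewrite lerDr|exact: ltW].
have [->|x00] := eqVneq x 0; first by rewrite (kernel0 hK) subrr normr0 mulr0.
have {x00}x0 : 0 < x by rewrite lt_def x00.
have [|y] := @MVT R K (fun x => 'D_1 K x) 0 x x0 (fun x _ => dK x).
  by apply: derivable_within_continuous => y _; exact: (kernel_derivable hK).
rewrite in_itv/= => /andP[y0 yx]; rewrite (kernel0 hK) subr0 => ->.
rewrite normrM (gtr0_norm x0) ler_wpM2r ?(ltW x0)// -derive1E.
apply: (via `|derive1 K c|); last by rewrite lerDl.
by apply: Hc; rewrite in_itv/= (ltW y0)/= (le_trans (ltW yx)).
Qed.

(** Riemann sum of a decreasing function, bounded by the integral cell by cell; the term h = 0
    equals 1, at most k. *)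
Lemma kernel_sum : exists2 C : R, 0 < C & forall (k : R) (n : nat), 1 <= k ->
  \sum_(h < n) K (h%:R / k) <= C * k.
Proof.
have Kfin := kernel_integrable hK.
pose I : R := fine (\int[leb]_x (K x)%:E)%E.
have K0 x : 0 <= K x := kernel_ge0 hK x.
have I0 : 0 <= I by apply: fine_ge0; apply: integral_ge0 => x _; rewrite lee_fin.
have mK : measT K.
  apply: continuous_measurable_fun => x; apply: differentiable_continuous.
  by apply/derivable1_diffP; exact: (kernel_derivable hK).
exists (1 + I); first by rewrite ltr_wpDr.
move=> k n k1; have k0 : 0 < k := lt_le_trans ltr01 k1.
suff H : \sum_(h < n) K (h.+1%:R / k) / k <= I.
  case: n H => [|n] H; first by rewrite big_ord0 mulr_ge0 ?addr_ge0// ltW.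
  rewrite big_ord_recl/= mul0r (kernel0 hK) mulrDl mul1r; apply: lerD => //.
  rewrite -ler_pdivrMr// mulr_suml; apply: le_trans H.
  by rewrite [leRHS]big_ord_recr/= lerDl; pos.
rewrite -lee_fin /I fineK; last first.
  by rewrite ge0_fin_numE//; apply: integral_ge0 => x _; rewrite lee_fin.
pose D (h : nat) : set R := `[h%:R / k, h.+1%:R / k[%classic.
have mD h : measurable (D h) by exact: measurable_itv.
have eD h : (\int[leb]_(x in D h) (K (h.+1%:R / k))%:E = (K (h.+1%:R / k) / k)%:E)%E.
  transitivity ((K (h.+1%:R / k))%:E * leb (D h))%E; first by rewrite -(@integral_cst _ _ _ leb (D h) (mD h) (K (h.+1%:R / k))%:E).
  have -> : leb (D h) = (k^-1)%:E.
    rewrite /D lebesgue_measure_itv/= lte_fin ltr_pM2r ?invr_gt0// ltr_nat ltnSn.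
    by rewrite -EFinB -mulrBl -natrB// subSnn mul1r.
  by rewrite -EFinM.
rewrite -sumEFin; under eq_bigr do rewrite -eD.
have tD : trivIset setT D.
  apply/trivIsetP => i j _ _ ij; rewrite -subset0 => x [] /=.
  rewrite /D /= !in_itv/= => /andP[a1 b1] /andP[a2 b2].
  have H p q : p%:R / k <= x -> x < q.+1%:R / k -> (p <= q)%N.
    by move=> h1 h2; have := le_lt_trans h1 h2; rewrite ltr_pM2r ?invr_gt0// ltr_nat ltnS.
  by move/eqP: ij; apply; apply/eqP; rewrite eqn_leq (H i j)// (H j i).
apply: (via (\sum_(h < n) \int[leb]_(x in D h) (K x)%:E)%E).
  apply: lee_sum => h _; apply: ge0_le_integral => //.
  - exact: mD.
  - by move=> x _; rewrite lee_fin.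
  - by apply/measurable_EFinP; exact: measurable_funTS.
  move=> x; rewrite /D/= in_itv/= => /andP[h1 h2]; rewrite lee_fin.
  by apply: (kernel_decreasing hK); [apply: le_trans h1; rewrite divr_ge0 ?(ltW k0)|exact: ltW].
rewrite -ge0_integral_bigsetU//=; last first.
- by move=> x _; rewrite lee_fin.
- by apply/measurable_EFinP; exact: measurable_funTS.
- by apply/trivIsetP => i j _ _ ij; move/trivIsetP: tD; apply.
- exact: index_enum_uniq.
- by move=> h; exact: mD.
apply: ge0_subset_integral => //.
- by apply: bigsetU_measurable => h _; exact: mD.
- by meas.
- by move=> x _; rewrite lee_fin.
Qed.

(** The sum is cut at h = k: below, |K(h/k) - 1| <= L h/k turns the weight into (1 + h)^(1-alpha);
    above, the difference is at most 1. The growth of the sum of (1 + h)^(1-alpha) up to k separates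
    the three cases of [vrate]. *)
Lemma kernel_bias (alpha : R) : 1 < alpha -> exists2 C : R, 0 < C &
  forall (k : R) (n : nat), expR 2 <= k ->
  \sum_(h < n) `|K (h%:R / k) - 1| * (1 + h%:R) `^ (- alpha) <= C * vrate alpha k.
Proof.
move=> a1; have [L L0 HL] := kernel_lip.
have a10 : 0 < alpha - 1 by rewrite subr_gt0.
have e3 (k : R) : expR 2 <= k -> 3 <= k.
  by apply: le_trans; have := expR_ge1Dx (2 : R); lra.
pose H (k : R) (q : nat) := \sum_(1 <= h < q.+1) (1 + h%:R : R) `^ (- (alpha - 1)).
have main (k : R) n : 3 <= k -> \sum_(h < n) `|K (h%:R / k) - 1| * (1 + h%:R) `^ (- alpha) <=
  L / k * H k (Num.truncn k) + k `^ (1 - alpha) / (alpha - 1).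
  move=> k3; have k0 : 0 < k by lra.
  set q := Num.truncn k.
  have qk : q%:R <= k by rewrite truncn_le ltW.
  have kq : k < q.+1%:R := truncnS_gt k.
  rewrite -(big_mkord xpredT (fun h => `|K (h%:R / k) - 1| * (1 + h%:R) `^ (- alpha))).
  apply: (via (\sum_(0 <= h < n + q.+1) `|K (h%:R / k) - 1| * (1 + h%:R) `^ (- alpha))).
    rewrite [leRHS](big_cat_nat (n := n))//= ?leq_addr// lerDl; apply: sumr_ge0 => h _.
    exact: mulr_ge0 (normr_ge0 _) (powR_ge0 _ _).
  rewrite (big_cat_nat (n := q.+1))//= ?leq_addl//; apply: lerD.
    rewrite big_ltn// mul0r (kernel0 hK) subrr normr0 mul0r add0r /H mulr_sumr.
    apply: ler_sum_nat => h /andP[h1 hq].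
    have h0 : 0 < h%:R :> R by rewrite ltr0n.
    have -> : (1 + h%:R : R) `^ (- alpha) = (1 + h%:R) `^ (- (alpha - 1)) * (1 + h%:R)^-1.
      have x1 : 0 < 1 + h%:R :> R by rewrite addr_gt0.
      rewrite -(powR_inv1 (ltW x1)) -powRD; last by rewrite (gt_eqF x1) implybT.
      by congr (_ `^ _); ring.
    rewrite mulrCA [leRHS]mulrC; apply: ler_wpM2l; first exact: powR_ge0.
    rewrite ler_pdivrMr ?addr_gt0//; apply: (le_trans (HL _)).
    rewrite normrM normfV (gtr0_norm k0) (gtr0_norm h0) mulrA [leLHS]mulrAC.
    by rewrite ler_wpM2l ?divr_ge0 ?ltW// ltrDr.
  apply: (via (\sum_(q.+1 <= h < n + q.+1) (1 + h%:R : R) `^ (- alpha))).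
    apply: ler_sum_nat => h _; rewrite -[leRHS]mul1r ler_wpM2r ?powR_ge0//.
    rewrite ler0_norm ?subr_le0 ?kernel_le1// opprB gerBl; exact: (kernel_ge0 hK).
  apply: (le_trans (sum_tail_pow _ a1 (ltn0Sn q))); rewrite ler_pM2r ?invr_gt0//.
  have eV y : y `^ (1 - alpha) = (y `^ (alpha - 1))^-1 by rewrite -powRN opprB.
  by rewrite !eV lef_pV2 ?posrE ?powR_gt0 ?ltr0n// ge0_ler_powR ?nnegrE ?(ltW k0) ?(ltW a10) ?ler0n ?(ltW kq).

rewrite /vrate; have [alt|age] := ltP alpha 2.
  have b1 : alpha - 1 < 1 by lra.
  exists (L * (4 / (1 - (alpha - 1))) + (alpha - 1)^-1).
    by rewrite addr_gt0 ?invr_gt0// mulr_gt0// divr_gt0// subr_gt0.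
  move=> k n ke; have k3 := e3 k ke; apply: (le_trans (main k n k3)); rewrite mulrDl; apply: lerD; last by rewrite mulrC.
  have k0 : 0 < k by lra.
  have qk : (Num.truncn k)%:R <= k by rewrite truncn_le ltW.
  have h1 := sum_head_pow_lt (Num.truncn k) b1 (ltW a10).
  have h2 : (Num.truncn k).+1%:R `^ (1 - (alpha - 1)) <= 2 * k `^ (1 - (alpha - 1)).
    apply: (via ((2 * k) `^ (1 - (alpha - 1)))).
      apply: ge0_ler_powR; rewrite ?nnegrE//; [lra|lra|rewrite -natr1; lra].
    rewrite powRM//; last exact: ltW.
    rewrite ler_wpM2r ?powR_ge0// -[leRHS]powRr1// ler_powR//; lra.
  have kk : k `^ (1 - (alpha - 1)) = k * k `^ (1 - alpha).
    rewrite -{2}[k]powRr1 ?(ltW k0)// -powRD ?(gt_eqF k0) ?implybT//; congr (_ `^ _); ring.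
  have e0 : 0 < 2 / (1 - (alpha - 1)) by pos.
  apply: (via (L / k * (2 / (1 - (alpha - 1)) * (2 * (k * k `^ (1 - alpha)))))).
    rewrite ler_wpM2l ?divr_ge0 ?(ltW L0) ?(ltW k0)//; apply: (le_trans h1).
    by rewrite ler_wpM2l ?(ltW e0)// -kk.
  apply: eq_ler.
  have z0 : 1 - (alpha - 1) != 0 by rewrite gt_eqF// subr_gt0.
  by move: (1 - (alpha - 1)) (k `^ (1 - alpha)) z0 (lt0r_neq0 k0) => z y z0 kn0; field; rewrite z0 kn0.
have [a2|a2] := eqVneq alpha 2.
  exists (L * 2 + 1); first by pos.
  move=> k n ke; have k3 := e3 k ke; apply: (le_trans (main k n k3)).
  have k0 : 0 < k by lra.
  have qk : (Num.truncn k)%:R <= k by rewrite truncn_le ltW.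
  have l1 : 1 <= ln k.
    have : ln (expR 2) <= ln k by rewrite ler_ln ?posrE ?expR_gt0.
    by rewrite expRK; lra.
  have h1 := @sum_head_inv R (Num.truncn k).
  have h2 : ln (Num.truncn k).+1%:R <= 2 * ln k.
    have -> : 2 * ln k = ln (k ^+ 2) by rewrite lnXn// mulr_natl.
    rewrite ler_ln ?posrE ?exprn_gt0// -natr1 expr2; have : 3 * k <= k * k by rewrite ler_wpM2r//; pos.
    lra.
  rewrite a2 mulrDl mul1r; have -> : 2 - 1 = 1 :> R by ring.
  have -> : 1 - 2 = - 1 :> R by ring.
  apply: lerD.
    rewrite /H a2; have -> : - (2 - 1) = - 1 :> R by ring.
    have -> : L * 2 * (ln k / k) = L / k * (2 * ln k) by ring.
    by rewrite ler_wpM2l ?divr_ge0 ?(ltW L0) ?(ltW k0)//; exact: le_trans h1 h2.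
  by rewrite divr1 powR_inv1 ?(ltW k0)// -[leLHS]mul1r ler_wpM2r//; pos.
have b1 : 1 < alpha - 1 by lra.
exists (L * (alpha - 1 - 1)^-1 + (alpha - 1)^-1).
  by rewrite addr_gt0 ?invr_gt0// mulr_gt0// invr_gt0 subr_gt0.
move=> k n ke; have k3 := e3 k ke; apply: (le_trans (main k n k3)); rewrite mulrDl.
have k0 : 0 < k by lra.
apply: lerD.
  rewrite mulrAC ler_wpM2r ?invr_ge0 ?(ltW k0)// ler_wpM2l ?(ltW L0)//.
  exact: sum_head_pow_gt.
rewrite mulrC ler_wpM2l ?invr_ge0 ?(ltW a10)// -(powR_inv1 (ltW k0)) ler_powR//; lra.
Qed.

End KernelSums.

Local Open Scope sesquilinear_scope.

(** * Coercive quadratic forms and block inverses *)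

Section QuadraticForms.
Context {R : realType}.
Local Notation f := (real_complex R).

Definition quad n (A : 'M[R]_n) (v : 'I_n -> R) : R := \sum_i \sum_j v i * A i j * v j.

Definition coercive n (A : 'M[R]_n) (c : R) := forall v, c * (\sum_i v i ^+ 2) <= quad A v.

(** Complex spectral theorem for a real symmetric matrix: the form is diagonal in a unitary basis,
    and the diagonal entries are real roots of the characteristic polynomial of [A]. *)
Lemma eigenvalue_coercive n (A : 'M[R]_n) (c : R) : A^T = A ->
  (forall a, eigenvalue A a -> c < a) -> coercive A c.
Proof.
move=> sA eA v.
pose C := R[i].
pose AC := map_mx f A.
have fr (r : R) : (f r)^* = f r by apply/eqP; rewrite eq_complex /= oppr0 !eqxx.
have hA : AC \is hermsymmx.
  apply/is_hermitianmxP; rewrite expr0 scale1r; apply/matrixP => i j.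
  by rewrite !mxE fr -[in LHS]sA mxE.
have nA := hermitian_normalmx hA.
have /orthomx_spectralP AE := nA.
set Q := spectralmx AC in AE; set sp := spectral_diag AC in AE.
have Qu : Q \is unitarymx := spectral_unitarymx AC.
have sre : sp \is a mxOver Num.real := hermitian_spectral_diag_real hA.
rewrite invmx_unitary// in AE.
have spc i : f c <= sp 0 i.
  have si : sp 0 i \is Num.real by move/mxOverP: sre; apply.
  have [a sa] : exists a, sp 0 i = f a.
    exists (complex.Re (sp 0 i)); move: si; rewrite realE !lecE; case: (sp 0 i) => x y /=.
    by move=> /orP[/andP[/eqP -> _]|/andP[/eqP <- _]].
  have eC : eigenvalue AC (sp 0 i).
    apply/eigenvalueP; exists (row i Q).
      have -> : row i Q *m AC = row i (Q *m AC) by rewrite row_mul.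
      have QA : Q *m AC = diag_mx sp *m Q.
        by rewrite AE !mulmxA; move/unitarymxP: Qu => ->; rewrite mul1mx.
      by rewrite QA row_mul row_diag_mx -scalemxAl -rowE.
    apply/eqP => r0; have := spectral_unit AC; rewrite -/Q -row_free_unit => /row_freeP[B QB].
    have /rowP/(_ i) : row i (Q *m B) = 0 by rewrite row_mul r0 mul0mx.
    by rewrite QB !mxE eqxx => /eqP; rewrite oner_eq0.
  rewrite sa lecR ltW//; apply: eA; move: eC; rewrite !eigenvalue_root_char sa.
  by rewrite /AC -map_char_poly fmorph_root.
pose vC : 'cV[C]_n := \col_i f (v i).
pose u := Q *m vC.
have vCt : vC^t* = vC^T by apply/matrixP => i j; rewrite !mxE fr.
have ut : u^t* = vC^T *m Q^t* by rewrite /u trmx_mul map_mxM vCt.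
have E1 : f (quad A v) = \sum_i sp 0 i * (u i 0 * (u i 0)^*).
  transitivity ((vC^T *m AC *m vC) 0 0).
    rewrite mxE /quad exchange_big rmorph_sum/=; apply: eq_bigr => j _.
    rewrite !mxE mulr_suml rmorph_sum; apply: eq_bigr => i _.
    by rewrite !mxE !rmorphM.
  rewrite AE !mulmxA -ut -mulmxA -/u mxE; apply: eq_bigr => i _.
  rewrite mul_mx_diag !mxE; ring.
have E2 : f (\sum_i v i ^+ 2) = \sum_i u i 0 * (u i 0)^*.
  transitivity ((vC^T *m vC) 0 0).
    by rewrite mxE rmorph_sum; apply: eq_bigr => i _; rewrite !mxE expr2 rmorphM.
  have -> : vC^T *m vC = u^t* *m u.
    rewrite ut /u mulmxA -[_ *m Q^t* *m Q]mulmxA -invmx_unitary// mulVmx ?mulmx1//.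
    exact: spectral_unit.
  by rewrite mxE; apply: eq_bigr => i _; rewrite !mxE mulrC.
rewrite -lecR; have -> : f (c * \sum_i v i ^+ 2) = f c * f (\sum_i v i ^+ 2) by rewrite rmorphM.
rewrite E1 E2 mulr_sumr; apply: ler_sum => i _.
by rewrite ler_wpM2r// mul_conjC_ge0.
Qed.

Lemma quad_diff n (A B : 'M[R]_n) (D : {set 'I_n}) (th : R) v : (forall i, i \notin D -> v i = 0) ->
  (forall i j, i \in D -> j \in D -> `|A i j - B i j| <= th) ->
  `|quad A v - quad B v| <= th * #|D|%:R * \sum_i v i ^+ 2.
Proof.
move=> v0 AB.
have sE (F : 'I_n -> R) : (forall i, i \notin D -> F i = 0) -> \sum_i F i = \sum_(i in D) F i.
  move=> F0; rewrite [RHS]big_mkcond; apply: eq_bigr => i _.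
  by case: ifPn => // iD; rewrite F0.
have fE (M : 'M[R]_n) : quad M v = \sum_(i in D) \sum_(j in D) v i * M i j * v j.
  rewrite /quad sE; last first.
    by move=> i iD; rewrite big1// => j _; rewrite v0// !mul0r.
  by apply: eq_bigr => i _; rewrite sE// => j jD; rewrite (v0 j)// mulr0.
rewrite !fE -sumrB.
apply: (via (\sum_(i in D) \sum_(j in D) th * ((v i ^+ 2 + v j ^+ 2) / 2))).
  apply: (le_trans (ler_norm_sum _ _ _)); apply: ler_sum => i iD.
  rewrite -sumrB; apply: (le_trans (ler_norm_sum _ _ _)); apply: ler_sum => j jD.
  have -> : v i * A i j * v j - v i * B i j * v j = (A i j - B i j) * (v i * v j) by ring.
  rewrite normrM; apply: ler_pM => //; first exact: AB.
  have := sqr_ge0 (`|v i| - `|v j|); rewrite sqrrB !real_normK ?num_real// normrM.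
  by lra.
rewrite sE => [|i iD]; last by rewrite v0// expr0n.
under eq_bigr do rewrite -mulr_sumr -mulr_suml big_split/= sumr_const.
rewrite -mulr_sumr -mulr_suml big_split/= sumr_const -mulrA.
have -> : \sum_(i in D) v i ^+ 2 *+ #|D| = #|D|%:R * \sum_(i in D) v i ^+ 2.
  by rewrite mulr_sumr; apply: eq_bigr => i _; rewrite mulr_natl.
by rewrite -mulr_natl; apply: eq_ler; field.
Qed.

Definition coercive_on n (D : {set 'I_n}) (A : 'M[R]_n) (c : R) :=
  forall v, (forall i, i \notin D -> v i = 0) -> c * (\sum_i v i ^+ 2) <= quad A v.

Lemma coercive_perturb n (A B : 'M[R]_n) (D : {set 'I_n}) (th c : R) : coercive_on D A c ->
  (forall i j, i \in D -> j \in D -> `|B i j - A i j| <= th) -> th * #|D|%:R <= c / 2 ->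
  coercive_on D B (c / 2).
Proof.
move=> cA AB thc v v0; have := quad_diff v0 AB; rewrite ler_norml => /andP[h _].
have := cA v v0; have s0 : 0 <= \sum_i v i ^+ 2 by pos.
have := ler_wpM2r s0 thc; lra.
Qed.

(* Z is the inverse of the block of A indexed by D, extended by zero *)
Definition block_inv n (D : {set 'I_n}) (A Z : 'M[R]_n) :=
  [/\ forall i j, (i \notin D) || (j \notin D) -> Z i j = 0,
      forall i j, i \in D -> j \in D -> \sum_k A i k * Z k j = (i == j)%:R &
      forall i j, i \in D -> j \in D -> \sum_k Z i k * A k j = (i == j)%:R].

(** The j-th column of Z as test vector has quadratic form Z_jj, so c times its sum of squares is at
    most Z_jj; this bounds Z_jj by 1/c and then every entry of the column. *)
Lemma block_inv_bound n (D : {set 'I_n}) (A Z : 'M[R]_n) c : 0 < c ->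
  coercive_on D A c -> block_inv D A Z -> forall i j, `|Z i j| <= c^-1.
Proof.
move=> c0 cA [Z0 AZ _] i j; case: (boolP (j \in D)) => jD; last first.
  by rewrite Z0 ?jD ?orbT// normr0 invr_ge0 ltW.
have := cA (fun i => Z i j) (fun i iD => Z0 i j (introT orP (or_introl iD))).
have -> : quad A (fun i => Z i j) = Z j j.
  rewrite /quad (bigD1 j)//= [X in _ + X]big1 ?addr0.
    by under eq_bigr do rewrite -mulrA; rewrite -mulr_sumr AZ// eqxx mulr1.
  move=> k kj; under eq_bigr do rewrite -mulrA; rewrite -mulr_sumr.
  case: (boolP (k \in D)) => kD; first by rewrite AZ// (negbTE kj) mulr0.
  by rewrite Z0 ?kD// mul0r.
set s := \sum_k _ => h.
have h1 k : Z k j ^+ 2 <= s by rewrite /s (bigD1 k)//= lerDl sumr_ge0// => l _; exact: sqr_ge0.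
have zj : `|Z j j| <= c^-1.
  have [zz|zz] := leP (Z j j) 0.
    have s0 : s <= 0 by rewrite -(ler_pM2l c0) mulr0; exact: le_trans h zz.
    have : Z j j ^+ 2 <= 0 by exact: le_trans (h1 j) s0.
    by rewrite -real_normK ?num_real// exprn_even_le0//= normr_eq0 => /eqP ->; rewrite normr0 invr_ge0 ltW.
  rewrite gtr0_norm// -(ler_pM2l c0) mulfV ?gt_eqF// -(ler_pM2r zz) mul1r -mulrA -expr2.
  by apply: le_trans h; rewrite ler_wpM2l//; pos.
rewrite -(@ler_pXn2r _ 2) ?nnegrE ?invr_ge0 ?(ltW c0)// real_normK ?num_real//.
apply: (le_trans (h1 i)); rewrite -(ler_pM2l c0) expr2 mulrA mulfV ?gt_eqF// mul1r.
by apply: (le_trans h); exact: le_trans (ler_norm _) zj.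
Qed.

(** Resolvent identity Z - Y = - Z (B - A) Y, summed over the block. *)
Lemma block_inv_diff n (D : {set 'I_n}) (A B Y Z : 'M[R]_n) c c' th : 0 < c -> 0 < c' ->
  coercive_on D A c -> coercive_on D B c' -> block_inv D A Y -> block_inv D B Z ->
  (forall i j, i \in D -> j \in D -> `|B i j - A i j| <= th) ->
  forall i j, `|Z i j - Y i j| <= (c * c')^-1 * (#|D|%:R ^+ 2 * th).
Proof.
move=> c0 c'0 cA cB iA iB BA i j.
have [Y0 AY YA] := iA; have [Z0 BZ ZB] := iB.
have bY := block_inv_bound c0 cA iA; have bZ := block_inv_bound c'0 cB iB.
have [iD|iD] := boolP (i \in D); last first.
  have K0 : 0 <= (c * c')^-1 * (#|D|%:R ^+ 2 * th).
    case: (set_0Vmem D) => [->|[k kD]]; first by rewrite cards0 expr0n/= mul0r mulr0.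
    have th0 : 0 <= th := le_trans (normr_ge0 _) (BA k k kD kD).
    by pos.
  by rewrite Y0 ?iD// Z0 ?iD// subrr normr0.
have th0 : 0 <= th := le_trans (normr_ge0 _) (BA i i iD iD).
have [jD|jD] := boolP (j \in D); last first.
  rewrite Y0 ?jD ?orbT// Z0 ?jD ?orbT// subrr normr0.
  by pos.
have sE (F : 'I_n -> R) : (forall i, i \notin D -> F i = 0) -> \sum_i F i = \sum_(i in D) F i.
  move=> F0; rewrite [RHS]big_mkcond; apply: eq_bigr => k _.
  by case: ifPn => // kD; rewrite F0.
have -> : Z i j - Y i j = - \sum_(k in D) \sum_(l in D) Z i k * (B k l - A k l) * Y l j.
  have e1 : \sum_(k in D) \sum_(l in D) Z i k * B k l * Y l j = Y i j.
    rewrite exchange_big/= (bigD1 i)//= [X in _ + X]big1 ?addr0; last first.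
      move=> l /andP[lD li]; rewrite -mulr_suml -sE; last by move=> k kD; rewrite Z0 ?kD ?orbT ?mul0r.
      by rewrite ZB// eq_sym (negbTE li) mul0r.
    rewrite -mulr_suml -sE; last by move=> k kD; rewrite Z0 ?kD ?orbT ?mul0r.
    by rewrite ZB// eqxx mul1r.
  have e2 : \sum_(k in D) \sum_(l in D) Z i k * A k l * Y l j = Z i j.
    rewrite (bigD1 j)//= [X in _ + X]big1 ?addr0; last first.
      move=> k /andP[kD kj]; under eq_bigr do rewrite -mulrA; rewrite -mulr_sumr -sE; last by move=> l lD; rewrite Y0 ?lD ?mulr0.
      by rewrite AY// (negbTE kj) mulr0.
    under eq_bigr do rewrite -mulrA; rewrite -mulr_sumr -sE; last by move=> l lD; rewrite Y0 ?lD ?mulr0.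
    by rewrite AY// eqxx mulr1.
  rewrite -{1}e2 -{1}e1 -sumrB -sumrN; apply: eq_bigr => k _.
  rewrite -sumrB -sumrN; apply: eq_bigr => l _; ring.
rewrite normrN; apply: (le_trans (ler_norm_sum _ _ _)).
apply: (via (\sum_(k in D) \sum_(l in D) (c * c')^-1 * th)).
  apply: ler_sum => k kD; apply: (le_trans (ler_norm_sum _ _ _)); apply: ler_sum => l lD.
  rewrite !normrM invfM [c^-1 * _]mulrC -[_ * c^-1 * th]mulrA [c^-1 * th]mulrC mulrA.
  by apply: ler_pM => //; apply: ler_pM => //; exact: BA.
clear; under eq_bigr do rewrite sumr_const; rewrite sumr_const -[leLHS]mulr_natr -[_ *+ #|D|]mulr_natr.
by move: (#|D|%:R : R) ((c * c')^-1) => N K; apply: eq_ler; ring.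
Qed.

End QuadraticForms.

(** * The partial inverse on coercive blocks *)

Section PartialInverse.
Context {R : realType}.

Lemma pinv_unit n (A : 'M[R]_n) : A \in unitmx -> Defs.pinv A = invmx A.
Proof.
move=> Au; rewrite /Defs.pinv; have iA : is_pinv A (invmx A).
  split; rewrite ?mulmxV// ?mulVmx// ?mul1mx ?trmx1//.
have [Z1 _ _ _] := xgetI 0 (iA : [set Z | is_pinv A Z] (invmx A)).
set Z := xget _ _ in Z1 *.
have : invmx A *m (A *m Z *m A) *m invmx A = invmx A *m A *m invmx A by rewrite Z1.
by rewrite !mulmxA mulVmx// mul1mx -mulmxA mulmxV// mulmx1 mul1mx.
Qed.
Context (n : nat) (D : {set 'I_n}).
Implicit Types A : 'M[R]_n.
Local Notation k := (enum_val : 'I_#|D| -> 'I_n).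

Lemma partial_inverse_val A s t : partial_inverse D A (k s) (k t) = Defs.pinv (mxsub k k A) s t.
Proof.
rewrite /partial_inverse summxE (bigD1 s)//= [X in _ + X]big1 ?addr0.
  rewrite summxE (bigD1 t)//= [X in _ + X]big1 ?addr0; first by rewrite !mxE !eqxx mulr1.
  by move=> j /negbTE jt; rewrite !mxE !(inj_eq enum_val_inj) [t == j]eq_sym jt andbF mulr0.
move=> i /negbTE is_; rewrite summxE big1// => j _.
by rewrite !mxE !(inj_eq enum_val_inj) [s == i]eq_sym is_ mulr0.
Qed.

Lemma partial_inverse_out A i j : (i \notin D) || (j \notin D) -> partial_inverse D A i j = 0.
Proof.
move=> ij; rewrite /partial_inverse summxE big1// => s _; rewrite summxE big1// => t _.
rewrite !mxE; case: eqP => [is_|_]; last by rewrite mulr0.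
case: eqP => [jt|_]; last by rewrite mulr0.
by move: ij; rewrite is_ jt !enum_valP.
Qed.

(** A kernel vector of the block, extended by zero, has vanishing quadratic form. *)
Lemma coercive_unitmx A c : 0 < c -> coercive_on D A c -> mxsub k k A \in unitmx.
Proof.
move=> c0 cA; rewrite -row_free_unit; apply: inj_row_free => u uA0.
pose v i := \sum_s u 0 s * (i == k s)%:R.
have vk s : v (k s) = u 0 s.
  rewrite /v (bigD1 s)//= eqxx mulr1 big1 ?addr0// => t /negbTE ts.
  by rewrite (inj_eq enum_val_inj) eq_sym ts mulr0.
have v0 i : i \notin D -> v i = 0.
  move=> iD; rewrite /v big1// => s _; case: eqP => [is_|_]; last by rewrite mulr0.
  by move: iD; rewrite is_ enum_valP.
have sE (F : 'I_n -> R) : (forall i, i \notin D -> F i = 0) -> \sum_i F i = \sum_s F (k s).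
  move=> F0; rewrite -big_enum_val [RHS]big_mkcond; apply: eq_bigr => i _.
  by case: ifPn => // iD; rewrite F0.
have := cA v v0; have -> : quad A v = 0.
  rewrite /quad exchange_big sE => [|j jD]; last by rewrite big1// => i _; rewrite (v0 j)// mulr0.
  rewrite big1// => t _; rewrite -mulr_suml sE => [|i iD]; last by rewrite v0// mul0r.
  move/rowP: uA0 => /(_ t); rewrite !mxE => h.
  by under eq_bigr do rewrite vk; rewrite -[RHS](mul0r (v (k t))) -[in RHS]h; congr (_ * _); apply: eq_bigr => s _; rewrite mxE.
rewrite sE => [h|i iD]; last by rewrite v0// expr0n.
apply/rowP => s; rewrite mxE; apply/eqP; rewrite -sqrf_eq0 eq_le sqr_ge0 andbT.
have : \sum_s v (k s) ^+ 2 <= 0 by rewrite -(ler_pM2l c0) mulr0.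
apply: le_trans; rewrite (bigD1 s)//= vk lerDl; pos.
Qed.

Lemma partial_inverse_block A : mxsub k k A \in unitmx -> block_inv D A (partial_inverse D A).
Proof.
move=> Au; split; first exact: partial_inverse_out.
- move=> i j iD jD; rewrite -(enum_rankK_in iD iD) -(enum_rankK_in iD jD).
  set s := enum_rank_in _ _; set t := enum_rank_in _ _.
  transitivity (\sum_(l in D) A (k s) l * partial_inverse D A l (k t)).
    rewrite [RHS]big_mkcond; apply: eq_bigr => l _; case: ifPn => // lD.
    by rewrite partial_inverse_out ?lD// mulr0.
  rewrite big_enum_val/= (inj_eq enum_val_inj).
  have := mulmxV Au; rewrite -pinv_unit// => /matrixP/(_ s t); rewrite !mxE => <-.
  by apply: eq_bigr => l _; rewrite partial_inverse_val !mxE.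
- move=> i j iD jD; rewrite -(enum_rankK_in iD iD) -(enum_rankK_in iD jD).
  set s := enum_rank_in _ _; set t := enum_rank_in _ _.
  transitivity (\sum_(l in D) partial_inverse D A (k s) l * A l (k t)).
    rewrite [RHS]big_mkcond; apply: eq_bigr => l _; case: ifPn => // lD.
    by rewrite partial_inverse_out ?lD ?orbT// mul0r.
  rewrite big_enum_val/= (inj_eq enum_val_inj).
  have := mulVmx Au; rewrite -pinv_unit// => /matrixP/(_ s t); rewrite !mxE => <-.
  by apply: eq_bigr => l _; rewrite partial_inverse_val !mxE.
Qed.

End PartialInverse.

(** * The lasso *)

Section Lasso.
Context {R : realType} (T p d : nat) (X : int -> 'cV[R]_d).
Local Notation q := (p * d)%N.
Local Notation W := (Wmx T p X).

Lemma gram_quad (v : 'I_q -> R) : quad (gram T p X) v = T%:R^-1 * \sum_r (\sum_j W r j * v j) ^+ 2.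
Proof.
rewrite /quad mulr_sumr.
transitivity (\sum_i \sum_j \sum_r T%:R^-1 * (W r i * v i * (W r j * v j))).
  apply: eq_bigr => i _; apply: eq_bigr => j _; rewrite !mxE -mulr_sumr.
  under [X in _ = _ * X]eq_bigr do rewrite -mulrA.
  rewrite [v i * _]mulrC -!mulrA; congr (_ * _); rewrite mulr_suml; apply: eq_bigr => r _.
  by rewrite !mxE; ring.
under eq_bigr do rewrite exchange_big/=; rewrite exchange_big/=; apply: eq_bigr => r _.
rewrite expr2 mulr_suml mulr_sumr; apply: eq_bigr => i _; rewrite mulr_sumr.
by rewrite mulr_sumr; apply: eq_bigr => j _.
Qed.

Lemma sum_sqr_le n (D : {set 'I_n}) (v : 'I_n -> R) :
  (\sum_(j in D) `|v j|) ^+ 2 <= #|D|%:R * \sum_j v j ^+ 2.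
Proof.
rewrite expr2 mulr_suml.
apply: (via (\sum_(i in D) \sum_(j in D) (v i ^+ 2 + v j ^+ 2) / 2)).
  apply: ler_sum => i _; rewrite mulr_sumr; apply: ler_sum => j _.
  have := sqr_ge0 (`|v i| - `|v j|); rewrite sqrrB !real_normK ?num_real//; lra.
under eq_bigr do rewrite -mulr_suml big_split/= sumr_const.
rewrite -mulr_suml big_split/= sumr_const.
have -> : \sum_(i in D) v i ^+ 2 *+ #|D| = #|D|%:R * \sum_(i in D) v i ^+ 2.
  by rewrite mulr_sumr; apply: eq_bigr => i _; rewrite mulr_natl.
rewrite -[_ *+ #|D|]mulr_natl.
have h : \sum_(i in D) v i ^+ 2 <= \sum_j v j ^+ 2.
  rewrite big_mkcond; apply: ler_sum => i _; case: ifP => // _; exact: sqr_ge0.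
have := ler_wpM2l (ler0n R #|D|) h; lra.
Qed.

Lemma lasso_arith (c lam s n2 a b f : R) : 0 < c -> 0 < lam -> 0 <= s -> 0 <= n2 -> 0 <= a ->
  0 <= b -> a ^+ 2 <= s * n2 -> c / 2 * n2 <= f ->
  f / 2 <= lam / 2 * (a + b) + lam * (a - b) -> n2 <= 36 * lam ^+ 2 * s / c ^+ 2.
Proof.
move=> c0 l0 s0 n20 a0 b0 as2 cf fl.
have h1 : c * n2 <= 6 * lam * a.
  have : 0 <= lam * b by pos.
  by lra.
have h2 : (c * n2) ^+ 2 <= (6 * lam * a) ^+ 2.
  rewrite lerXn2r ?nnegrE//; first by pos.
  by pos.
have h3 : (c * n2) ^+ 2 <= 36 * lam ^+ 2 * s * n2.
  apply: (le_trans h2); have -> : (6 * lam * a) ^+ 2 = 36 * lam ^+ 2 * a ^+ 2 by ring.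
  by rewrite -[leRHS]mulrA ler_wpM2l// mulr_ge0// exprn_ge0// ltW.
rewrite ler_pdivlMr ?exprn_gt0//; move: n20; rewrite le_eqVlt => /predU1P[<-|n20].
  by rewrite mul0r mulr_ge0// mulr_ge0// sqr_ge0.
rewrite -(ler_pM2r n20); apply: le_trans h3; rewrite exprMn; lra.
Qed.

(** The noise is at most lam/2, so minimality confines the error to the cone b <= 3a, where a and b
    are its l1 norms on and off B. There the Gram matrix inherits coercivity from [Sg] with constant
    c/2: the two forms differ by at most th (a + b)^2 <= 16 th a^2 <= 16 th |B| n2. *)
Lemma lasso_oracle (lam c th : R) (l : 'I_d) (s0 sh : 'cV[R]_q) (eta : 'cV[R]_(T - p))
  (B : {set 'I_q}) (Sg : 'M[R]_q) : 0 < lam -> 0 < c -> response T p X l = W *m s0 + eta ->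
  (forall j, j \notin B -> s0 j 0 = 0) -> (forall j, `|(T%:R^-1 *: (W^T *m eta)) j 0| <= lam / 2) ->
  coercive Sg c -> (forall i j, `|gram T p X i j - Sg i j| <= th) -> 32 * th * #|B|%:R <= c ->
  lasso_objective T X lam l sh <= lasso_objective T X lam l s0 ->
  forall j, `|sh j 0 - s0 j 0| <= 6 * lam * #|B|%:R / c.
Proof.
move=> l0 c0 yE s0B etab cS gS thc obj.
pose del j := sh j 0 - s0 j 0.
pose a := \sum_(j in B) `|del j|; pose b := \sum_(j in ~: B) `|del j|.
have a0 : 0 <= a by apply: sumr_ge0.
have b0 : 0 <= b by apply: sumr_ge0.
have abE : \sum_j `|del j| = a + b.
  rewrite (bigID (mem B))/=; congr (_ + _); apply: eq_bigl => j; by rewrite inE.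
pose n2 := \sum_j del j ^+ 2.
have n20 : 0 <= n2 by apply: sumr_ge0 => j _; exact: sqr_ge0.
have as2 : a ^+ 2 <= #|B|%:R * n2 by exact: sum_sqr_le.
pose f := quad (gram T p X) del.
have f0 : 0 <= f.
  by rewrite /f gram_quad mulr_ge0 ?invr_ge0// sumr_ge0// => r _; exact: sqr_ge0.
(* Basic inequality: by minimality half the quadratic form of the error is at most the noise term
   plus the change of the penalty. *)
have key : f / 2 <= lam / 2 * (a + b) + lam * (a - b).
  pose g j := (T%:R^-1 *: (W^T *m eta)) j 0.
  have gd : \sum_j g j * del j <= lam / 2 * (a + b).
    rewrite -abE mulr_sumr; apply: ler_sum => j _; apply: (le_trans (ler_norm _)).
    by rewrite normrM ler_wpM2r// etab.
  have l1 : \sum_j `|s0 j 0| - \sum_j `|sh j 0| <= a - b.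
    rewrite -sumrB (bigID (mem B))/= /a /b; apply: lerD.
      apply: ler_sum => j _; rewrite /del distrC; exact: lerB_dist.
    rewrite -sumrN [leRHS](eq_bigl (fun j => j \notin B)); last by move=> j; rewrite inE.
    by apply: ler_sum => j jB; rewrite /del s0B// normr0 subr0 sub0r.
  have q1 : \sum_r (response T p X l - W *m s0) r 0 ^+ 2 = \sum_r eta r 0 ^+ 2.
    by rewrite yE; apply: eq_bigr => r _; rewrite addrC addKr.
  have q2 : \sum_r (response T p X l - W *m sh) r 0 ^+ 2 = \sum_r eta r 0 ^+ 2 -
    2 * \sum_r eta r 0 * (\sum_j W r j * del j) + \sum_r (\sum_j W r j * del j) ^+ 2.
    rewrite mulr_sumr -sumrB -big_split/=; apply: eq_bigr => r _.
    have -> : (response T p X l - W *m sh) r 0 = eta r 0 - \sum_j W r j * del j.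
      rewrite yE !mxE /del; under [X in _ = _ - X]eq_bigr do rewrite mulrBr.
      by rewrite sumrB; ring.
    by ring.
  have q3 : T%:R^-1 * \sum_r eta r 0 * (\sum_j W r j * del j) = \sum_j g j * del j.
    under eq_bigr do rewrite mulr_sumr; rewrite exchange_big/= mulr_sumr; apply: eq_bigr => j _.
    rewrite /g !mxE -mulrA; congr (_ * _); rewrite mulr_suml; apply: eq_bigr => r _.
    by rewrite !mxE; ring.
  move: obj; rewrite /lasso_objective q1 q2 invfM.
  have := gram_quad del; rewrite -/f; move: q3.
  set u1 := \sum_r eta r 0 ^+ 2; set u2 := \sum_r eta r 0 * _; set u3 := \sum_r (\sum_j _) ^+ 2.
  set t := T%:R^-1 => q3 fE obj.
  have h : f / 2 <= \sum_j g j * del j + lam * (\sum_j `|s0 j 0| - \sum_j `|sh j 0|).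
    move: obj; rewrite fE -q3; lra.
  apply: (le_trans h); apply: lerD => //; by rewrite ler_wpM2l// ltW.
have b3 : b <= 3 * a.
  rewrite -(ler_pM2l l0); move: key f0; lra.
have cf : c / 2 * n2 <= f.
  have d1 : `|f - quad Sg del| <= th * (a + b) ^+ 2.
    rewrite /f /quad -sumrB; apply: (le_trans (ler_norm_sum _ _ _)).
    rewrite -abE expr2 mulr_suml mulr_sumr; apply: ler_sum => i _.
    rewrite -sumrB; apply: (le_trans (ler_norm_sum _ _ _)).
    rewrite mulr_sumr mulr_sumr; apply: ler_sum => j _.
    have -> : del i * gram T p X i j * del j - del i * Sg i j * del j =
      (gram T p X i j - Sg i j) * (del i * del j) by ring.
    by rewrite !normrM ler_wpM2r ?mulr_ge0.
  case: (set_0Vmem B) => [B0|[j0 j0B]].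
    have a00 : a = 0 by rewrite /a B0 big_set0.
    have b00 : b = 0 by apply/eqP; rewrite eq_le b0 andbT; move: b3; rewrite a00 mulr0.
    have -> : n2 = 0.
      rewrite /n2 big1// => j _; apply/eqP; rewrite sqrf_eq0 -normr_eq0 eq_le normr_ge0 andbT.
      have : \sum_j `|del j| <= 0 by rewrite abE a00 b00 addr0.
      by apply: le_trans; rewrite (bigD1 j)//= lerDl sumr_ge0.
    by rewrite mulr0.
  have th0 : 0 <= th := le_trans (normr_ge0 _) (gS j0 j0).
  have d2 : th * (a + b) ^+ 2 <= c / 2 * n2.
    apply: (via (th * (16 * a ^+ 2))).
      rewrite ler_wpM2l//; have -> : 16 * a ^+ 2 = (4 * a) ^+ 2 by ring.
      rewrite lerXn2r ?nnegrE ?addr_ge0 ?mulr_ge0//; move: b3; lra.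
    apply: (via (th * (16 * (#|B|%:R * n2)))); first by rewrite ler_wpM2l// ler_wpM2l.
    have -> : th * (16 * (#|B|%:R * n2)) = 16 * th * #|B|%:R * n2 by ring.
    rewrite ler_wpM2r//; move: thc; lra.
  have := cS del; rewrite -/n2; move: d1; rewrite ler_norml => /andP[d1 _]; move: d1 d2; lra.
move=> j; have := lasso_arith c0 l0 (ler0n _ _) n20 a0 b0 as2 cf key => n2b.
(* Replacing |B| by its square turns the l2 bound into the square of the claimed one. *)
have s1 : #|B|%:R <= #|B|%:R ^+ 2 :> R by rewrite -natrX ler_nat; case: #|B| => // n; rewrite leq_pmulr.
rewrite -/(del j) -(@ler_pXn2r _ 2)// ?nnegrE ?mulr_ge0 ?invr_ge0 ?(ltW c0) ?(ltW l0)//.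
rewrite real_normK ?num_real//; apply: (via n2).
  by rewrite /n2 (bigD1 j)//= lerDl sumr_ge0// => i _; exact: sqr_ge0.
apply: (le_trans n2b); have -> : (6 * lam * #|B|%:R / c) ^+ 2 = 36 * lam ^+ 2 * #|B|%:R ^+ 2 / c ^+ 2.
  by rewrite exprMn exprVn; ring.
rewrite ler_wpM2r ?invr_ge0 ?exprn_ge0 ?(ltW c0)// ler_wpM2l// mulr_ge0// sqr_ge0.
exact: isT.
Qed.

End Lasso.

(** * Bounded backward orbits of stable linear recursions *)

Section BackwardOrbits.
Context {R : realType}.
Local Notation C := R[i].

Let rcM (a b : R) : real_complex R (a * b) = real_complex R a * real_complex R b.
Proof. by rewrite rmorphM. Qed.

Let rcX (a : R) k : real_complex R (a ^+ k) = real_complex R a ^+ k.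
Proof. by rewrite rmorphXn. Qed.

Definition bounded_seq m n (W : nat -> 'M[C]_(m, n)) :=
  exists B : R, 0 <= B /\ forall k i j, `|W k i j| <= real_complex R B.

(** What remains of a recursion v_k = G v_(k+1) F once F acts on the right as a scalar l of modulus
    below 1. *)
Definition contracting m n (G : 'M[C]_m) := forall (l : C), `|l| < 1 ->
  forall v : nat -> 'M[C]_(m, n), bounded_seq v ->
  (forall k, v k = l *: (G *m v k.+1)) -> forall k, v k = 0.

Lemma bounded_mulr m n q (W : nat -> 'M[C]_(m, n)) (M : 'M[C]_(n, q)) :
  bounded_seq W -> bounded_seq (fun k => W k *m M).
Proof.
move=> [B [B0 WB]]; pose b := \sum_j \sum_l complex.Re `|M l j|.
have nE (z : C) : `|z| = real_complex R (complex.Re `|z|) by rewrite normc_def.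
have n0 (z : C) : 0 <= complex.Re `|z| by rewrite normc_def /= sqrtr_ge0.
have b0 : 0 <= b by apply: sumr_ge0 => j _; apply: sumr_ge0.
exists (B * b); split; first by pos.
move=> k i j; rewrite mxE; apply: (le_trans (ler_norm_sum _ _ _)).
apply: (via (\sum_l real_complex R (B * complex.Re `|M l j|))).
  apply: ler_sum => l _; rewrite normrM rcM -nE; apply: ler_wpM2r => //; exact: WB.
rewrite -rmorph_sum lecR -mulr_sumr ler_wpM2l// /b (bigD1 j)//= lerDl.
by apply: sumr_ge0 => j' _; apply: sumr_ge0 => l _; exact: (n0 (M l j')).
Qed.

Lemma contracting_scalar m n (mu : C) : `|mu| <= 1 -> contracting n (mu%:M : 'M[C]_m).
Proof.
move=> mu1 l l1 v [B [B0 vB]] vE k; apply/matrixP => i j; rewrite mxE.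
pose r := l * mu.
have rE q : v q = r *: v q.+1 by rewrite vE mul_scalar_mx scalerA.
have nE (z : C) : `|z| = real_complex R (complex.Re `|z|) by rewrite normc_def.
have r1 : complex.Re `|r| < 1.
  by rewrite -ltcR -nE normrM; apply: le_lt_trans l1; rewrite ler_piMr.
have r0 : 0 <= complex.Re `|r| by rewrite normc_def /= sqrtr_ge0.
have vN N : complex.Re `|v k i j| <= complex.Re `|r| ^+ N * B.
  rewrite -lecR -nE.
  have -> : v k i j = r ^+ N * v (k + N)%N i j.
    elim: N => [|N IH]; first by rewrite expr0 mul1r addn0.
    by rewrite IH addnS [in LHS]rE mxE exprSr mulrA.
  by rewrite normrM normrX rcM rcX -nE ler_wpM2l//; pos.
have : complex.Re `|r| ^+ N * B @[N --> \oo] --> 0 * B.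
  apply: cvgM; last exact: cvg_cst.
  by apply: cvg_expr; rewrite ger0_norm.
rewrite mul0r => c0; have h : complex.Re `|v k i j| <= 0.
  rewrite -(cvg_lim _ c0)//; apply: limr_ge.
    by apply/cvg_ex; exists 0.
  by apply: nearW => N; exact: vN.
by apply/eqP; rewrite -normr_le0 nE lecR.
Qed.

(** The characteristic polynomial of F annihilates the orbit by Cayley-Hamilton. Its linear factors
    are removed one at a time: on the orbit multiplied by the remaining factors F acts as the root
    z, of modulus below 1, and contraction kills that orbit. *)
Lemma backward_orbit m n (G : 'M[C]_m) (F : 'M[C]_n) (W : nat -> 'M[C]_(m, n)) :
  contracting n G -> (forall z, eigenvalue F z -> `|z| < 1) -> bounded_seq W ->
  (forall k, W k = G *m W k.+1 *m F) -> forall k, W k = 0.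
Proof.
case: n F W => [|n] F W cG eF bW WE; first by move=> k; exact: thinmx0.
have [r rE] := closed_field_poly_normal (char_poly F).
have cpE : char_poly F = \prod_(z <- r) ('X - z%:P).
  by rewrite rE (monicP (char_poly_monic F)) scale1r.
have r1 : forall z, z \in r -> `|z| < 1.
  by move=> z zr; apply: eF; rewrite eigenvalue_root_char cpE root_prod_XsubC.
have W0 k : W k *m horner_mx F (\prod_(z <- r) ('X - z%:P)) = 0.
  by rewrite -cpE Cayley_Hamilton mulmx0.
elim: r r1 {rE cpE} W bW WE W0 => [|z r IH] r1 W bW WE W0 k.
  by have := W0 k; rewrite big_nil rmorph1 mulmx1.
apply: IH => //; first by move=> y yr; apply: r1; rewrite inE yr orbT.
set M := horner_mx F _.
have MF : M *m F = F *m M by exact/esym/comm_mx_horner.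
apply: (cG z); first by apply: r1; rewrite inE eqxx.
  exact: bounded_mulr.
have E q : W q *m M *m F = z *: (W q *m M).
  have := W0 q; rewrite big_cons rmorphM/= rmorphB/= horner_mx_X horner_mx_C -/M.
  rewrite [(F - _) * M](_ : _ = M *m F - M *m z%:M); last first.
    by rewrite MF scalar_mxC -mulmxBl.
  rewrite mulmxBr !mulmxA mul_mx_scalar => h.
  by rewrite -[LHS](subrK (z *: (W q *m M))) h add0r.
move=> q; rewrite {1}WE -!mulmxA -MF (mulmxA (W q.+1) M F) E.
by rewrite -scalemxAr.
Qed.

(** [backward_orbit] for the transposed orbit, with a scalar as the left factor. *)
Lemma contracting_trmx n m (F : 'M[C]_n) : (forall z, eigenvalue F z -> `|z| < 1) ->
  contracting m F^T.
Proof.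
move=> eF l l1 v [B [B0 vB]] vE k; apply: (can_inj (@trmxK _ _ _)); rewrite trmx0.
have cl : contracting n (l%:M : 'M[C]_m) by apply: contracting_scalar; exact: ltW.
apply: (@backward_orbit m n _ F (fun k => (v k)^T) cl eF).
  by exists B; split => // q i j; rewrite mxE.
by move=> q; rewrite {1}vE linearZ/= trmx_mul trmxK mul_scalar_mx scalemxAl.
Qed.
Context (n : nat) (F : 'M[R]_n)
  (eF : forall z : C, eigenvalue (map_mx (real_complex R) F) z -> `|z| < 1).

Let bounded_map m (W : nat -> 'M[R]_(m, n)) (B : R) : (forall k i j, `|W k i j| <= B) ->
  bounded_seq (fun k => map_mx (real_complex R) (W k)).
Proof.
move=> WB; exists `|B|; split => // k i j; rewrite mxE.
have -> : `|real_complex R (W k i j)| = real_complex R `|W k i j|.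
  by rewrite normc_def /= expr0n/= addr0 sqrtr_sqr.
by rewrite lecR; apply: (le_trans (WB k i j)); exact: ler_norm.
Qed.

Let map0 m (M : 'M[R]_(m, n)) : map_mx (real_complex R) M = 0 -> M = 0.
Proof.
by move=> /matrixP M0; apply/matrixP => i j; have := M0 i j; rewrite !mxE => -[].
Qed.

Lemma backward_row (W : nat -> 'rV[R]_n) (B : R) : (forall k i j, `|W k i j| <= B) ->
  (forall k, W k = W k.+1 *m F) -> forall k, W k = 0.
Proof.
move=> WB WE k; apply: map0.
have c1 : contracting n (1%:M : 'M[C]_1) by apply: contracting_scalar; rewrite normr1.
apply: (backward_orbit c1 eF (bounded_map WB)) => q.
by rewrite mul1mx -map_mxM -WE.
Qed.

Lemma backward_sandwich (W : nat -> 'M[R]_n) (B : R) : (forall k i j, `|W k i j| <= B) ->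
  (forall k, W k = F^T *m W k.+1 *m F) -> forall k, W k = 0.
Proof.
move=> WB WE k; apply: map0.
apply: (backward_orbit (contracting_trmx eF) eF (bounded_map WB)) => q.
rewrite [in LHS]WE !map_mxM; congr (_ *m _ *m _).
by apply/matrixP => i j; rewrite !mxE.
Qed.

End BackwardOrbits.

(** * Square integrable variables *)

Section SquareIntegrable.
Context {R : realType} {dO : measure_display} {Om : measurableType dO} (P : probability Om R).
Implicit Types f g : Om -> R.

Definition sqi f := measT f /\ intg P (fun w => f w ^+ 2).

Lemma sqiM f g : sqi f -> sqi g -> intg P (fun w => f w * g w).
Proof.
move=> [mf f2] [mg g2]; apply: (@intg_le _ _ _ P _ (fun w => f w ^+ 2 + g w ^+ 2)).
- by meas.
- exact: intgD.
move=> w; rewrite normrM; have := sqr_ge0 (`|f w| - `|g w|).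
have : 0 <= `|f w| * `|g w| by pos.
by rewrite sqrrB !real_normK ?num_real//; lra.
Qed.

Lemma sqi_Ex f g (C D : R) : sqi f -> sqi g -> Ex P (fun w => f w ^+ 2) <= C ->
  Ex P (fun w => g w ^+ 2) <= D -> `|Ex P (fun w => f w * g w)| <= C + D.
Proof.
move=> sf sg fC gD; apply: (via (Ex P (fun w => f w ^+ 2 + g w ^+ 2))).
  apply: Ex_absle.
  - exact: sqiM.
  - by apply: intgD; [case: sf|case: sg].
  move=> w; rewrite normrM; have := sqr_ge0 (`|f w| - `|g w|).
  have : 0 <= `|f w| * `|g w| by pos.
  by rewrite sqrrB !real_normK ?num_real//; lra.
by rewrite ExD ?lerD//; [case: sf|case: sg].
Qed.

Lemma sqi0 : sqi (fun=> 0).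
Proof. by split => //; exact: intg_cst. Qed.

Lemma sqiD f g : sqi f -> sqi g -> sqi (fun w => f w + g w).
Proof.
move=> sf sg; have ifg := sqiM sf sg; have [mf f2] := sf; have [mg g2] := sg.
split; first meas.
have -> : (fun w => (f w + g w) ^+ 2) = (fun w => f w ^+ 2 + g w ^+ 2 + 2 * (f w * g w)).
  by apply/funext => w; ring.
by apply: intgD; [exact: intgD|exact: intgZ].
Qed.

Lemma sqiZ (c : R) f : sqi f -> sqi (fun w => c * f w).
Proof.
move=> [mf f2]; split; first meas.
by under eq_fun do rewrite exprMn; exact: intgZ.
Qed.

Lemma sqi_sum (I : Type) (r : seq I) (F : I -> Om -> R) : (forall i, sqi (F i)) ->
  sqi (fun w => \sum_(i <- r) F i w).
Proof.
move=> sF; elim: r => [|i r IH]; first by under eq_fun do rewrite big_nil; exact: sqi0.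
by under eq_fun do rewrite big_cons; exact: sqiD.
Qed.

Lemma ae_Ex f g : measT f -> measT g -> {ae P, forall w, f w = g w} -> Ex P f = Ex P g.
Proof.
move=> mf mg fg; rewrite !ExE0 /Rintegral; congr fine.
apply: ae_eq_integral => //; [exact/measurable_EFinP|exact/measurable_EFinP|].
by apply: filterS fg => w -> _.
Qed.

Lemma Ex_expectation f (e : R) : ('E_P[f] = e%:E)%E -> Ex P f = e.
Proof. by rewrite unlock ExE0 /Rintegral => ->. Qed.

End SquareIntegrable.

Lemma sum_blocks {R : nzRingType} (p d : nat) (F : 'I_p -> 'I_d -> R) :
  \sum_(k < p * d) F (lag_block k) (block_coord k) = \sum_j \sum_i F j i.
Proof.
pose h (k : 'I_(p * d)) : 'I_p * 'I_d := (lag_block k, block_coord k).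
rewrite pair_bigA/= (reindex h)//=.
have gP (ji : 'I_p * 'I_d) : (ji.1 * d + ji.2 < p * d)%N.
  case: ji => j i /=; apply: (@leq_trans (j.+1 * d)); last by rewrite leq_mul2r ltn_ord orbT.
  by rewrite mulSn addnC ltn_add2r.
exists (fun ji => Ordinal (gP ji)) => [k _|[j i] _].
  by apply: val_inj => /=; rewrite -divn_eq.
have d0 : (0 < d)%N by apply: leq_trans (ltn_ord i).
congr pair; apply: val_inj => /=.
  by rewrite divnMDl// divn_small ?addn0.
by rewrite modnMDl modn_small.
Qed.

(** * Second-order structure of the autoregression *)

Section SecondOrder.
Context {R : realType} {dO : measure_display} {Om : measurableType dO} (P : probability Om R)
  (p d : nat) (x eps : int -> 'I_d -> Om -> R) (A : 'I_p -> 'M[R]_d) (Sig : 'M[R]_d) (C2 : R)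
  (mx : forall t i, measT (x t i)) (me : forall t i, measT (eps t i))
  (x2 : forall t i, intg P (fun w => x t i w ^+ 2))
  (x2C : forall t i, Ex P (fun w => x t i w ^+ 2) <= C2) (var : is_VAR P x eps A)
  (wn : white_noise P eps Sig).
Local Notation S := (coef_mx A).

(* coordinate k of z^(t) *)
Definition lagged (v : int -> 'I_d -> Om -> R) (t : int) (k : 'I_(p * d)) : Om -> R :=
  v (t - (lag_block k)%:Z) (block_coord k).

Local Notation z := (lagged x).

Let sx t i : sqi P (x t i). Proof. by split. Qed.
Let sz t k : sqi P (z t k). Proof. exact: sx. Qed.

Lemma noise_sqi t i : sqi P (eps t i).
Proof.
split => //; have [_ /(_ t i i) + _] := wn; rewrite unlock => E.
have [] := @intg_ge0 _ _ _ P (fun w => eps t i w ^+ 2) (Sig i i).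
- by meas.
- by move=> w; exact: sqr_ge0.
- by rewrite -E; apply: eq_ler; apply: eq_integral => w _; rewrite expr2.
by [].
Qed.

Lemma noise_cov t i j : Ex P (fun w => eps t i w * eps t j w) = Sig i j.
Proof. by have [_ /(_ t i j) + _] := wn; exact: Ex_expectation. Qed.

Lemma noise_uncorr s t i j : s != t -> Ex P (fun w => eps s i w * eps t j w) = 0.
Proof. by have [_ _ /(_ s t i j) h] := wn => st; exact: Ex_expectation (h st). Qed.

Lemma var_coord t l : {ae P, forall w, x t l w = \sum_k S k l * z (t - 1) k w + eps t l w}.
Proof.
apply: filterS (var t) => w /matrixP/(_ l 0); rewrite !mxE => ->; congr (_ + _).
rewrite summxE.
have -> : \sum_k S k l * z (t - 1) k w = \sum_(k < p * d)
  (fun j i => A j l i * x (t - 1 - j%:Z) i w) (lag_block k) (block_coord k).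
  by apply: eq_bigr => k _; rewrite !mxE.
rewrite (sum_blocks (fun j i => A j l i * x (t - 1 - j%:Z) i w)); apply: eq_bigr => j _.
rewrite !mxE; apply: eq_bigr => i _.
rewrite !mxE; congr (_ * x _ _ _); rewrite -[j.+1%:Z]/(Posz j.+1) intS; lia.
Qed.

(** The innovation of the companion form: the noise in the first block, zero in the others. *)
Definition noise_lift t (k : 'I_(p * d)) : Om -> R :=
  if (k < d)%N then eps t (block_coord k) else fun=> 0.

Lemma noise_lift_sqi t k : sqi P (noise_lift t k).
Proof. by rewrite /noise_lift; case: ifP => _; [exact: noise_sqi|exact: sqi0]. Qed.

Lemma var_lagged t k : {ae P, forall w,
  z t k w = \sum_k' z (t - 1) k' w * companion S k' k + noise_lift t k w}.
Proof.
rewrite /noise_lift; case: ifPn => kd.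
  apply: filterS (var_coord t (block_coord k)) => w.
  have l0 : lag_block k = 0%N :> nat by rewrite /= divn_small.
  rewrite /lagged l0 subr0 => ->; congr (_ + _); apply: eq_bigr => k' _.
  by rewrite !mxE kd mulrC.
apply: aeW => w; rewrite -leqNgt in kd; rewrite addr0.
have kdP : (k - d < p * d)%N by apply: leq_ltn_trans (ltn_ord k); exact: leq_subr.
rewrite (bigD1 (Ordinal kdP))//= big1 ?addr0.
  have d0 : (0 < d)%N by apply: leq_ltn_trans (ltn_ord (block_coord k)).
  rewrite !mxE/= ltnNge kd/= subnK// eqxx mulr1 /lagged.
  have e1 : (k %/ d = ((k - d) %/ d).+1)%N.
    by rewrite -{1}(subnK kd) divnDr// divnn d0 addn1.
  have e2 : block_coord (Ordinal kdP) = block_coord k.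
    by apply: val_inj => /=; rewrite -{2}(subnK kd) modnDr.
  by rewrite e2 /= e1; congr (x _ _ _); lia.
move=> k' /eqP kk'; rewrite !mxE ltnNge kd/=; case: eqP => [E|_]; last by rewrite mulr0.
by exfalso; apply: kk'; apply: val_inj => /=; rewrite -E addnK.
Qed.
Context (stable : forall y : R[i], eigenvalue (map_mx (real_complex R) (companion S)) y -> `|y| < 1).

Let mz t k : measT (z t k). Proof. exact: mx. Qed.
Let mu t k : measT (noise_lift t k). Proof. by case: (noise_lift_sqi t k). Qed.

Let szF t k : sqi P (fun w => \sum_k' z t k' w * companion S k' k).
Proof.
apply: sqi_sum => k'; under eq_fun do rewrite mulrC; exact/sqiZ/sz.
Qed.

Let Ex_lagged t k f : sqi P f -> Ex P (fun w => z t k w * f w) =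
  \sum_k' Ex P (fun w => z (t - 1) k' w * f w) * companion S k' k +
  Ex P (fun w => noise_lift t k w * f w).
Proof.
move=> sf; have [mf _] := sf.
transitivity (Ex P (fun w => (\sum_k' z (t - 1) k' w * companion S k' k) * f w +
  noise_lift t k w * f w)).
  apply: ae_Ex.
  - by meas.
  - by meas.
  by apply: filterS (var_lagged t k) => w ->; rewrite mulrDl.
rewrite ExD; last exact: (sqiM (noise_lift_sqi t k) sf); last exact: sqiM.
congr (_ + _); under eq_fun do rewrite mulr_suml.
rewrite Ex_sum => [|k' _].
  apply: eq_bigr => k' _; rewrite mulrC -ExZ; last exact: sqiM.
  by congr (Ex _ _); apply/funext => w; ring.
have -> : (fun w => z (t - 1) k' w * companion S k' k * f w) =
  (fun w => companion S k' k * (z (t - 1) k' w * f w)) by apply/funext => w; ring.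
by apply: intgZ; exact: sqiM.
Qed.

(** Taken k steps further back, the cross moments form a bounded sequence with W_k = W_(k+1) F, F
    the companion matrix, because noise earlier than t is uncorrelated with the noise at t. *)
Lemma lagged_noise s t k l : (s < t)%R -> Ex P (fun w => z s k w * eps t l w) = 0.
Proof.
move=> st.
pose W (n : nat) : 'rV[R]_(p * d) := \row_k Ex P (fun w => z (s - n%:Z) k w * eps t l w).
have := @backward_row R (p * d) (companion S) stable W (C2 + Sig l l).
move=> /(_ _ _ 0%N)/matrixP/(_ 0 k); rewrite !mxE subr0; apply.
  move=> n i j; rewrite mxE; apply: sqi_Ex => //; first exact: noise_sqi.
  - exact: x2C.
  - by under eq_fun do rewrite expr2; rewrite noise_cov.
move=> n; apply/rowP => j; rewrite !mxE Ex_lagged; last exact: noise_sqi.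
rewrite [X in _ + X](_ : _ = 0) ?addr0; last first.
  rewrite /noise_lift; case: ifP => _.
    by rewrite noise_uncorr// lt_eqF// (le_lt_trans _ st)// gerBl.
  by under eq_fun do rewrite mul0r; rewrite Ex_cst.
apply: eq_bigr => k' _; congr (_ * _); rewrite [RHS]mxE; congr (Ex _ _); apply/funext => w.
by rewrite /lagged; congr (x _ _ _ * _); lia.
Qed.

Lemma lagged_noise_lift s t k j : (s < t)%R -> Ex P (fun w => z s k w * noise_lift t j w) = 0.
Proof.
move=> st; rewrite /noise_lift; case: ifP => _; first exact: lagged_noise.
by under eq_fun do rewrite mulr0; rewrite Ex_cst.
Qed.

(** The covariance at time u is F^T G(u - 1) F plus a noise covariance that does not depend on u.
    The difference of two such matrices, pushed back in time, is therefore a bounded orbit of the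
    sandwich recursion. *)
Lemma lagged_cov_stationary s t j k :
  Ex P (fun w => z s j w * z s k w) = Ex P (fun w => z t j w * z t k w).
Proof.
have ExC (f g : Om -> R) : Ex P (fun w => f w * g w) = Ex P (fun w => g w * f w).
  by congr (Ex _ _); apply/funext => w; rewrite mulrC.
pose G (u : int) : 'M[R]_(p * d) := \matrix_(j, k) Ex P (fun w => z u j w * z u k w).
pose N (u : int) : 'M[R]_(p * d) :=
  \matrix_(j, k) Ex P (fun w => noise_lift u j w * noise_lift u k w).
have GE u : G u = (companion S)^T *m G (u - 1) *m companion S + N u.
  have uu : (u - 1 < u)%R by lia.
  apply/matrixP => a b; rewrite !mxE Ex_lagged; last exact: sz.
  congr (_ + _).
    transitivity (\sum_k' \sum_k'' companion S k' a * G (u - 1) k' k'' * companion S k'' b).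
      apply: eq_bigr => k' _; rewrite ExC Ex_lagged; last exact: sz.
      rewrite ExC lagged_noise_lift// addr0 mulr_suml; apply: eq_bigr => k'' _.
      by rewrite !mxE ExC; ring.
    rewrite exchange_big/=; apply: eq_bigr => k'' _; rewrite !mxE mulr_suml.
    by apply: eq_bigr => k' _; rewrite [in RHS]mxE.
  rewrite ExC Ex_lagged; last exact: noise_lift_sqi.
  rewrite big1 ?add0r; first by rewrite ExC.
  by move=> k' _; rewrite lagged_noise_lift// mul0r.
have NE u u' : N u = N u'.
  apply/matrixP => a b; rewrite !mxE /noise_lift; case: ifP => _; case: ifP => _.
  - by rewrite !noise_cov.
  - by congr (Ex _ _); apply/funext => w; rewrite !mulr0.
  - by congr (Ex _ _); apply/funext => w; rewrite !mul0r.
  - by [].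
have GB u a b : `|G u a b| <= C2 + C2 by rewrite mxE; apply: sqi_Ex => //; exact: x2C.
pose D (n : nat) := G (s - n%:Z) - G (t - n%:Z).
have := @backward_sandwich R (p * d) (companion S) stable D (C2 + C2 + (C2 + C2)).
move=> /(_ _ _ 0%N)/matrixP/(_ j k) H.
apply/eqP; rewrite -subr_eq0; move: H; rewrite /D !subr0 !mxE => -> //.
  move=> n a b; have -> : D n a b = G (s - n%:Z) a b - G (t - n%:Z) a b by rewrite /D !mxE.
  by rewrite (le_trans (ler_normB _ _))// lerD//; exact: GB.
move=> n; rewrite /D (GE (s - n%:Z)) (GE (t - n%:Z)) (NE (t - n%:Z) (s - n%:Z)).
have e u : u - n%:Z - 1 = u - n.+1%:Z by lia.
rewrite !e mulmxBr mulmxBl opprD addrACA subrr addr0 //.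
Qed.

End SecondOrder.

(** Terms of weight zero are dropped, since scaling preserves [mom] for positive factors. *)
Lemma mom_wsum {R : realType} {d : measure_display} {X : measurableType d} (mu : probability X R)
  (q : R) (I : finType) (Q : pred I) (f : I -> X -> R) (w C : I -> R) (eta : R) :
  1 <= q -> 0 < eta -> (forall i, 0 <= w i) -> (forall i, Q i -> mom mu q (f i) (C i)) ->
  mom mu q (fun o => \sum_(i | Q i) w i * f i o) (eta + \sum_(i | Q i) w i * C i).
Proof.
move=> q1 eta0 w0 mf.
have E (g : I -> R) : \sum_(i | Q i) w i * g i = \sum_(i | Q i && (0 < w i)) w i * g i.
  rewrite (bigID (fun i => 0 < w i))/= [X in _ + X]big1 ?addr0// => i /andP[_].
  by rewrite -leNgt => wi; rewrite (@le_anti _ _ (w i) 0) ?mul0r// wi w0.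
rewrite E; under eq_fun do rewrite E.
apply: mom_sum => // i /andP[Qi wi]; exact/mom_scale/mf.
Qed.

(** * Concentration of weighted bilinear sums *)

Section Bilinear.
Context {R : realType} {dO : measure_display} {Om : measurableType dO} (P : probability Om R)
  (e : int -> Om -> R) (me : forall i, measT (e i)) (ie : mutually_independent P e).
Local Notation E := (fspace R int).
Local Notation PP := (P \x P)%E.
Context (dl : nat -> R) (A : R) (dl0 : forall k, 0 < dl k) (dlA : forall n, \sum_(k < n) dl k <= A).

Lemma shifted_sum_rev n k :
  shifted_sum dl n k = \sum_(i < n | (rev_ord i <= k)%N) dl (k - rev_ord i)%N.
Proof. by rewrite /shifted_sum -big_mkcond/= (reindex_inj rev_ord_inj). Qed.

(** Resampling one innovation changes a product through its first or its second factor. Summing the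
    weights over the other index costs [kap], after which the dependence is that of n terms with
    coefficients [dl]. The constant 3 counts the two factors and two slacks of half size. *)
Lemma bilinear_concentration (q C D kap : R) (n : nat) (a : int) (w : 'I_n -> 'I_n -> R)
  (Y Z : 'I_n -> E -> R) : 2 <= q -> 0 < kap -> (0 < n)%N ->
  (forall i j, 0 <= w i j) -> (forall i, \sum_j w i j <= kap) -> (forall j, \sum_i w i j <= kap) ->
  (forall i : 'I_n, good P e (2 * q) C (a + i%:Z) dl (Y i)) ->
  (forall i : 'I_n, good P e (2 * q) D (a + i%:Z) dl (Z i)) ->
  let S x := \sum_i \sum_j w i j * (Y i x * Z j x) in
  mom P q (fun o => S (innov e o) - Ex P (fun o => S (innov e o)))
  (2 * Num.sqrt (2 * (q - 1)) * (3 * (C * D * kap) * A * Num.sqrt n%:R)).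
Proof.
move=> q2 kap0 n0 w0 wr wc gY gZ S.
have q1 : 1 <= q by lra.
have q0 : 0 <= q by lra.
have i0 : 'I_n by exact: Ordinal n0.
have C0 : 0 < C by case: (gY i0) => _ _ /mom_ge0.
have D0 : 0 < D by case: (gZ i0) => _ _ /mom_ge0.
have mY i : measT (Y i) by case: (gY i).
have mZ i : measT (Z i) by case: (gZ i).
have mS : measT S.
  apply: measurable_sum => i; apply: measurable_sum => j.
  by meas.
pose t0 := a + n.-1%:Z.
have tE (i : 'I_n) : a + i%:Z = t0 - (rev_ord i)%:Z.
  by rewrite /t0 /=; have := ltn_ord i; lia.
have le0 (i : 'I_n) : (a + i%:Z <= t0)%R by rewrite /t0; have := ltn_ord i; lia.
have aS : adapted t0 S.
  move=> x y; apply: eq_bigr => i _; apply: eq_bigr => j _; congr (_ * (_ * _)).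
    by have [_ /(adapted_le (le0 i)) + _ _] := gY i.
  by have [_ /(adapted_le (le0 j)) + _ _] := gZ j.
have iS : intg P (fun o => S (innov e o)).
  apply: intg_sum => i _; apply: intg_sum => j _; apply: intgZ.
  have [_ _ bY _] := gY i; have [_ _ bZ _] := gZ j.
  exact: mom_intg q1 (mom_mul q0 bY bZ).
apply: (good_concentration me ie dl0 dlA q2 _ n0 mS aS iS); first by pos.
move=> k; set sh := shifted_sum dl n k.
have sh0 : 0 < sh by apply: dsh_gt0.
set u := t0 - k%:Z.
have past0 (F : E -> R) (i : 'I_n) B : good P e (2 * q) B (a + i%:Z) dl F -> (k < rev_ord i)%N ->
  forall o : Om * Om, F (resample e u o) = F (innov e o.1).
  move=> [_ aF _ _] ki o; apply: (adapted_resample e o aF).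
  by rewrite tE /u; lia.
have dif (F : E -> R) (i : 'I_n) B : good P e (2 * q) B (a + i%:Z) dl F -> (rev_ord i <= k)%N ->
  mom PP (2 * q) (fun o => F (innov e o.1) - F (resample e u o)) (B * dl (k - rev_ord i)).
  move=> [_ _ _ /(_ (k - rev_ord i)%N)]; rewrite tE => + ki.
  by have -> : t0 - (rev_ord i)%:Z - (k - rev_ord i)%N%:Z = u by rewrite /u; lia.
pose F1 (ij : 'I_n * 'I_n) (o : Om * Om) :=
  (Y ij.1 (innov e o.1) - Y ij.1 (resample e u o)) * Z ij.2 (innov e o.1).
pose F2 (ij : 'I_n * 'I_n) (o : Om * Om) :=
  Y ij.1 (resample e u o) * (Z ij.2 (innov e o.1) - Z ij.2 (resample e u o)).
pose W (ij : 'I_n * 'I_n) := w ij.1 ij.2.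
have -> : (fun o => S (innov e o.1) - S (resample e u o)) =
  (fun o => \sum_(ij | (rev_ord ij.1 <= k)%N) W ij * F1 ij o +
  \sum_(ij | (rev_ord ij.2 <= k)%N) W ij * F2 ij o).
  apply/funext => o; rewrite /S !pair_bigA/= -sumrB.
  have -> : \sum_(ij | (rev_ord ij.1 <= k)%N) W ij * F1 ij o = \sum_ij W ij * F1 ij o.
    rewrite [RHS](bigID (fun ij : 'I_n * 'I_n => (rev_ord ij.1 <= k)%N))/= [X in _ = _ + X]big1 ?addr0//.
    by move=> ij; rewrite -ltnNge => h; rewrite /F1 (past0 _ _ _ (gY _) h) subrr mul0r mulr0.
  have -> : \sum_(ij | (rev_ord ij.2 <= k)%N) W ij * F2 ij o = \sum_ij W ij * F2 ij o.
    rewrite [RHS](bigID (fun ij : 'I_n * 'I_n => (rev_ord ij.2 <= k)%N))/= [X in _ = _ + X]big1 ?addr0//.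
    by move=> ij; rewrite -ltnNge => h; rewrite /F2 (past0 _ _ _ (gZ _) h) subrr !mulr0.
  rewrite -[RHS]big_split /=; apply: eq_bigr => ij _; rewrite /W /F1 /F2.
  set a1 := Y _ _; set a2 := Y _ _; set b1 := Z _ _; set b2 := Z _ _; ring.
have eta0 : 0 < C * D * kap * sh / 2 by pos.
have W0 ij : 0 <= W ij by exact: w0.
have H1 : mom PP q (fun o => \sum_(ij | (rev_ord ij.1 <= k)%N) W ij * F1 ij o)
  (C * D * kap * sh / 2 + \sum_(ij | (rev_ord ij.1 <= k)%N) W ij * (C * dl (k - rev_ord ij.1) * D)).
  apply: mom_wsum => // ij h; apply: mom_mul => //; first exact: dif h.
  by have [_ _ bZ _] := gZ ij.2; exact: mom_fst bZ.
have H2 : mom PP q (fun o => \sum_(ij | (rev_ord ij.2 <= k)%N) W ij * F2 ij o)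
  (C * D * kap * sh / 2 + \sum_(ij | (rev_ord ij.2 <= k)%N) W ij * (C * (D * dl (k - rev_ord ij.2)))).
  apply: mom_wsum => // ij h; apply: mom_mul => //; last exact: dif h.
  by have [_ _ bY _] := gY ij.1; exact: mom_resample.
apply: mom_wle (mom_add q1 H1 H2) => //.
have -> : \sum_(ij | (rev_ord ij.1 <= k)%N) W ij * (C * dl (k - rev_ord ij.1) * D) =
  C * D * \sum_(i < n | (rev_ord i <= k)%N) dl (k - rev_ord i) * \sum_j w i j.
  transitivity (\sum_(i < n | (rev_ord i <= k)%N) \sum_j w i j * (C * dl (k - rev_ord i)%N * D)).
    by rewrite pair_big; apply: eq_bigl => ij; rewrite andbT.
  rewrite mulr_sumr; apply: eq_bigr => i _.
  by rewrite -mulr_suml; ring.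
have -> : \sum_(ij | (rev_ord ij.2 <= k)%N) W ij * (C * (D * dl (k - rev_ord ij.2))) =
  C * D * \sum_(j < n | (rev_ord j <= k)%N) dl (k - rev_ord j) * \sum_i w i j.
  transitivity (\sum_i \sum_(j < n | (rev_ord j <= k)%N) w i j * (C * (D * dl (k - rev_ord j)%N))).
    by rewrite pair_big.
  rewrite exchange_big/= mulr_sumr; apply: eq_bigr => i _.
  by rewrite -mulr_suml; ring.
have bd (v : 'I_n -> R) : (forall i, v i <= kap) ->
  C * D * (\sum_(i < n | (rev_ord i <= k)%N) dl (k - rev_ord i) * v i) <= C * D * kap * sh.
  move=> vk; rewrite -[leRHS]mulrA ler_wpM2l ?mulr_ge0 ?(ltW C0) ?(ltW D0)// /sh shifted_sum_rev mulr_sumr.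
  by apply: ler_sum => i _; rewrite mulrC ler_wpM2r// ltW.
have := bd _ wr; have := bd _ wc; lra.
Qed.

End Bilinear.

(** * From Lebesgue norms to moment bounds *)

Section LnormMoments.
Context {R : realType} {d : measure_display} {X : measurableType d} (mu : probability X R).

Lemma mom_ae q (f g : X -> R) C : measT g -> {ae mu, forall w, f w = g w} ->
  mom mu q f C -> mom mu q g C.
Proof.
move=> mg fg [mf C0 fi fE].
have mh (h : X -> R) : measT h -> measT (fun w => (`|h w| / C) `^ q).
  by meas.
have E : (\int[mu]_w ((`|g w| / C) `^ q)%:E = \int[mu]_w ((`|f w| / C) `^ q)%:E)%E.
  apply: ae_eq_integral => //; [exact/measurable_EFinP/mh|exact/measurable_EFinP/mh|].
  by apply: filterS fg => w -> _.
have [] := @intg_ge0 _ _ _ mu (fun w => (`|g w| / C) `^ q) 1 (mh _ mg).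
- by move=> w; exact: powR_ge0.
- by rewrite E (ExE fi) lee_fin.
by split.
Qed.

Lemma Lnorm_mom q (f : X -> R) C : 0 < q -> 0 < C -> measT f ->
  ('N[mu]_(q%:E)[EFin \o f] <= C%:E)%E -> mom mu q f C.
Proof.
move=> q0 C0 mf NC.
have mp : measT (fun w => `|f w| `^ q) by meas.
have [] := @intg_ge0 _ _ _ mu (fun w => `|f w| `^ q) (C `^ q) mp.
- by move=> w; exact: powR_ge0.
- rewrite -poweR_EFin.
  have -> : (\int[mu]_w (`|f w| `^ q)%:E = 'N[mu]_(q%:E)[EFin \o f] `^ q)%E.
    by rewrite poweR_Lnorm ?gt_eqF//.
  by apply: gt0_ler_poweR; rewrite ?in_itv/= ?leey ?Lnorm_ge0 ?lee_fin ?(ltW q0) ?(ltW C0).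
move=> fi fE; have CE w : (`|f w| / C) `^ q = (C `^ q)^-1 * `|f w| `^ q.
  by rewrite powR_div ?(ltW C0)// mulrC.
split => //; under eq_fun do rewrite CE; first exact: intgZ.
by rewrite ExZ// mulrC ler_pdivrMr ?mul1r ?powR_gt0.
Qed.

End LnormMoments.

Lemma ae_fst {R : realType} d1 d2 (X1 : measurableType d1) (X2 : measurableType d2)
  (P1 : probability X1 R) (P2 : probability X2 R) (Q : X1 -> Prop) :
  {ae P1, forall w, Q w} -> {ae (P1 \x P2)%E, forall w, Q w.1}.
Proof.
move=> [N [mN N0 QN]]; exists (N `*` setT); split.
- exact: measurableX.
- have -> : (P1 \x P2)%E (N `*` setT) = (P1 N * P2 setT)%E by exact: product_measure1E.
  by rewrite N0 mul0e.
- by move=> w /= Qw; split => //; apply: QN.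
Qed.

(** * Dependence coefficients with polynomial tails *)

Section RateSequences.
Context {R : realType}.
Implicit Types (dl : nat -> R).

Definition rate_seq (alpha A : R) dl := (forall k, 0 < dl k) /\
  forall k n, \sum_(k <= j < n) dl j <= A * (1 + k%:R) `^ (- alpha).

(** Dominates [dl] and its shift by one; iterated h times it dominates all shifts up to h, so that
    one sequence serves all lags of the autoregression. *)
Definition lag_seq dl (k : nat) : R := dl k + dl k.-1.

Lemma rate_sum alpha A dl n : rate_seq alpha A dl -> \sum_(k < n) dl k <= A.
Proof. by move=> [_ /(_ 0 n)]; rewrite big_mkord addr0 powR1 mulr1. Qed.

Lemma rate_ge0 alpha A dl : rate_seq alpha A dl -> 0 < A.
Proof. by move=> rd; have := rate_sum 1 rd; rewrite big_ord1; apply: lt_le_trans; case: rd. Qed.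

(** The tail of the shifted sequence starts one step earlier, and 1 + (k + 1) <= 2 (1 + k) accounts
    for 2^alpha. *)
Lemma rate_lag alpha A dl : 0 <= alpha -> rate_seq alpha A dl ->
  rate_seq alpha (A * (3 + 2 `^ alpha)) (lag_seq dl).
Proof.
move=> a0 rd; have A0 := rate_ge0 rd; have [d0 dA] := rd; split; first by move=> k; exact: addr_gt0.
have p2 : 0 < 2 `^ alpha :> R by pos.
move=> k n; rewrite /lag_seq big_split/=.
have -> : A * (3 + 2 `^ alpha) * (1 + k%:R) `^ (- alpha) = A * (1 + k%:R) `^ (- alpha)
  + A * ((2 + 2 `^ alpha) * (1 + k%:R) `^ (- alpha)) by ring.
apply: lerD => //; case: k => [|k].
  rewrite addr0 powR1 mulr1 mulrDr ler_wpDr ?mulr_ge0 ?(ltW A0)//.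
  case: n => [|n]; first by rewrite big_nil mulr_ge0//; pos.
  rewrite big_nat_recl//= big_mkord.
  by have := rate_sum 1 rd; rewrite big_ord1; have := rate_sum n rd; lra.
rewrite big_add1/=; apply: le_trans (dA _ _) _; rewrite ler_wpM2l ?(ltW A0)//.
apply: (via (2 `^ alpha * (1 + k.+1%:R) `^ (- alpha))); last first.
  by rewrite ler_wpM2r// lerDr.
have -> : 1 + k.+1%:R = 2 * ((1 + k.+1%:R) / 2) :> R by field.
have k0 : 0 < (1 + k.+1%:R) / 2 :> R by pos.
rewrite powRM// mulrA (powRN 2) mulfV// mul1r !powRN.
rewrite lef_pV2 ?posrE//.
apply: ge0_ler_powR; rewrite ?nnegrE////.
by rewrite ler_pdivrMr//; have -> : k.+1%:R = 1 + k%:R :> R; [rewrite nat1r|have := ler0n R k; lra].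
Qed.

Lemma rate_iter alpha A dl h : 0 <= alpha -> rate_seq alpha A dl ->
  rate_seq alpha (A * (3 + 2 `^ alpha) ^+ h) (iter h lag_seq dl).
Proof.
move=> a0 rd; elim: h => [|h IH]; first by rewrite expr0 mulr1.
by rewrite exprSr mulrA; exact: rate_lag.
Qed.

Lemma iter_lag_gt0 dl h k : (forall j, 0 < dl j) -> 0 < iter h lag_seq dl k.
Proof. by move=> d0; elim: h k => //= h IH k; exact: addr_gt0. Qed.

Lemma iter_lag_ge dl h h' k : (forall j, 0 < dl j) -> (h' <= h)%N ->
  dl k <= iter h lag_seq dl (k + h')%N.
Proof.
move=> d0; elim: h h' k => [|h IH] [|h'] k //=; rewrite ?addn0// => hh; rewrite /lag_seq.
  by rewrite -[leLHS]addr0 lerD ?(ltW (iter_lag_gt0 _ _ d0))//; have := IH 0 k isT; rewrite addn0.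
by rewrite addnS -[leLHS]add0r lerD ?(ltW (iter_lag_gt0 _ _ d0))//=; exact: IH.
Qed.

Lemma powR_decr (alpha : R) (j : nat) : 0 < alpha ->
  (1 + j.+1%:R) `^ (- alpha) < (1 + j%:R) `^ (- alpha) :> R.
Proof.
move=> a0; have p0 (h : nat) : 0 < 1 + h%:R :> R by rewrite ltr_pwDl.
rewrite !powRN ltf_pV2 ?posrE// gt0_ltr_powR ?nnegrE//.
by rewrite ltrD2l ltr_nat.
Qed.

(** The increments of (1 + j)^(-alpha) are added to make every coefficient positive; they telescope,
    which costs 1 in the constant. *)
Lemma tail_rate (alpha C : R) (u : nat -> \bar R) : 0 < alpha -> (forall j, 0 <= u j)%E ->
  (forall k : nat, ((1 + k%:R) `^ alpha)%:E * \sum_(k <= j <oo) u j <= C%:E)%E ->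
  exists dl, rate_seq alpha (C + 1) dl /\ forall j, (u j <= (dl j)%:E)%E.
Proof.
move=> a0 u0 uC.
have tl k : (\sum_(k <= j <oo) u j <= (C * (1 + k%:R) `^ (- alpha))%:E)%E.
  have := uC k; rewrite muleC -lee_pdivlMr//.
  by rewrite powRN -EFinM.
have part k n : (\sum_(k <= j < n) u j <= (C * (1 + k%:R) `^ (- alpha))%:E)%E.
  by apply: le_trans (tl k); apply: nneseries_lim_ge.
have fin j : u j \is a fin_num.
  have := part j j.+1; rewrite big_nat1 => h.
  by rewrite ge0_fin_numE// (le_lt_trans h)// ltry.
pose f (h : nat) : R := (1 + h%:R) `^ (- alpha).
exists (fun j => fine (u j) + (f j - f j.+1)); split; last first.
  by move=> j; rewrite -(fineK (fin j)) lee_fin/= lerDl subr_ge0 ltW//; exact: powR_decr.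
split=> [j|k n].
  by rewrite ltr_wpDl ?fine_ge0// subr_gt0; exact: powR_decr.
rewrite big_split/= mulrDl mul1r; apply: lerD.
  rewrite -lee_fin; apply: le_trans (part k n).
  rewrite -sumEFin; apply: lee_sum => j _; by rewrite fineK.
have [nk|kn] := ltnP n k; first by rewrite big_geq// ltnW.
by rewrite sum_telescope_le// gerBl powR_ge0.
Qed.

End RateSequences.

Lemma defect_rate {R : realType} {disp : nat -> measure_display}
  {Om : forall T, measurableType (disp T)} (P : forall T, probability (Om T) R)
  (T d : nat) (v : int -> 'I_d -> Om T -> R) (e : int -> Om T -> R)
  (g : int -> 'I_d -> fspace R nat -> R) (m alpha C : R) : (0 < d)%N -> 0 < alpha ->
  (forall k : nat, ((1 + k%:R) `^ alpha)%:E *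
  \sum_(k <= j <oo) coupling_defect P v e g m j <= C%:E)%E ->
  exists dl, rate_seq alpha (C + 1) dl /\ forall t i j,
  (Lnorm (P T \x P T)%E m%:E (EFin \o (fun w : Om T * Om T => (v t i w.1 -
  g t i (fun s : nat => e (t - s%:Z) (if s == j then w.2 else w.1)))%R)) <= (dl j)%:E)%E.
Proof.
move=> d0 a0 H.
have sub t i j : (Lnorm (P T \x P T)%E m%:E (EFin \o (fun w : Om T * Om T => (v t i w.1 -
  g t i (fun s : nat => e (t - s%:Z) (if s == j then w.2 else w.1)))%R))
  <= coupling_defect P v e g m j)%E.
  by apply: ereal_sup_ubound; exists t, i.
have [|dl [rd dd]] := tail_rate a0 _ H.
  by move=> j; apply: le_trans (sub 0 (Ordinal d0) j); exact: Lnorm_ge0.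
by exists dl; split => // t i j; exact: le_trans (sub t i j) (dd j).
Qed.

(** * Causal processes as functionals of the innovations *)

Section CausalProcess.
Context {R : realType} {dO : measure_display} {Om : measurableType dO} (P : probability Om R)
  (e : int -> Om -> R) (me : forall i, measT (e i)).
Local Notation E := (fspace R int).

(** Reads the past stored backwards from time t off the whole innovation sequence, where resampling
    at time t - j is the j-th coupling. *)
Definition causal (t : int) (g : fspace R nat -> R) : E -> R :=
  fun a => g (fun s : nat => a (t - s%:Z)).

Lemma measurable_causal t g : measT g -> measT (causal t g).
Proof.
move=> mg; apply: (measurableT_comp mg); apply: meas_fspace => s.
exact: meas_eval.
Qed.

Lemma causal_good (m C : R) (t : int) (dl : nat -> R) (v : Om -> R) (g : fspace R nat -> R) :
  0 < m -> 1 <= C -> (forall j, 0 < dl j) -> measT g -> measT v ->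
  {ae P, forall w, v w = g (fun s : nat => e (t - s%:Z) w)} ->
  ('N[P]_(m%:E)[EFin \o v] <= C%:E)%E ->
  (forall j, Lnorm (P \x P)%E m%:E (EFin \o (fun w : Om * Om => (v w.1 -
  g (fun s : nat => e (t - s%:Z) (if s == j then w.2 else w.1)))%R)) <= (dl j)%:E)%E ->
  good P e m C t dl (causal t g).
Proof.
move=> m0 C1 d0 mg mv vg vC dd.
have C0 : 0 < C by lra.
have mc := measurable_causal t mg.
split => //.
- move=> x y; congr g; apply/funext => s; rewrite /mix ifT//; lia.
- apply: mom_ae (Lnorm_mom m0 C0 mv vC) => //.
  exact: (measurableT_comp mc (meas_innov me)).
move=> k; apply: (@mom_wle _ _ _ _ _ _ (dl k)); first exact: ltW.
  by rewrite ler_peMl// ltW.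
have mr : measT (fun w => causal t g (resample e (t - k%:Z) w)).
  exact: (measurableT_comp mc (measurable_resample me _)).
have E : (fun w : Om * Om => g (fun s : nat => e (t - s%:Z) (if s == k then w.2 else w.1))) =
  (fun w => causal t g (resample e (t - k%:Z) w)).
  apply/funext => w; congr g; apply/funext => s; rewrite /resample /mix /innov.
  have -> : (t - s%:Z != t - k%:Z) = (s != k) by lia.
  by case: eqP.
have mvf : measT (fun w : Om * Om => v w.1).
  by meas.
apply: mom_ae (Lnorm_mom m0 (d0 k) _ (dd k)).
- apply: measurable_funB => //; apply: (measurableT_comp mc).
  exact: (measurableT_comp (meas_innov me) measurable_fst).
- by apply: filterS (ae_fst P vg) => w ->; congr (_ - _); exact: (congr1 (@^~ w) E).
- by apply: measurable_funB => //; rewrite E.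
Qed.

End CausalProcess.

Section GoodSums.
Context {R : realType} {dO : measure_display} {Om : measurableType dO} (P : probability Om R)
  (e : int -> Om -> R) (me : forall i, measT (e i)) (ie : mutually_independent P e).
Local Notation E := (fspace R int).

Lemma good_scaleE q C t dl (Y : E -> R) (c : R) : c != 0 -> good P e q C t dl Y ->
  good P e q (`|c| * C) t dl (fun x => c * Y x).
Proof.
move=> c0 gY; have [cp|cn] := ltP 0 c; first by rewrite gtr0_norm//; exact: good_scale.
have cn' : 0 < - c by rewrite oppr_gt0 lt_neqAle c0.
rewrite ler0_norm//; have := good_opp (good_scale cn' gY).
by under eq_fun do rewrite -mulNr opprK.
Qed.

(** The leading term [Y0] keeps the constant positive when the sum is empty. *)
Lemma good_sumD q (I : Type) (r : seq I) (Q : pred I) D t dl (Y0 : E -> R) (Y : I -> E -> R)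
  (C : I -> R) : 1 <= q -> good P e q D t dl Y0 -> (forall i, Q i -> good P e q (C i) t dl (Y i)) ->
  good P e q (D + \sum_(i <- r | Q i) C i) t dl (fun x => Y0 x + \sum_(i <- r | Q i) Y i x).
Proof.
move=> q1 g0 gY; elim: r => [|i r IH].
  rewrite big_nil addr0 (_ : (fun y : E => _) = Y0)//.
  by apply/funext => y; rewrite big_nil addr0.
have [Qi|/negbTE Qi] := boolP (Q i); last first.
  rewrite big_cons Qi (_ : (fun y : E => _) = fun y : E => Y0 y + \sum_(i <- r | Q i) Y i y)//.
  by apply/funext => y; rewrite big_cons Qi.
rewrite big_cons Qi addrCA.
rewrite (_ : (fun y : E => _) = fun y : E => Y i y + (Y0 y + \sum_(i <- r | Q i) Y i y)); last first.
  by apply/funext => y; rewrite big_cons Qi addrCA.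
by apply: good_add => //; exact: gY.
Qed.

End GoodSums.

Lemma mom_sqr {R : realType} d (X : measurableType d) (P : probability X R) (f : X -> R) (C : R) :
  mom P 2 f C -> intg P (fun w => f w ^+ 2) /\ Ex P (fun w => f w ^+ 2) <= C ^+ 2.
Proof.
move=> [mf C0 fi fE].
have e w : f w ^+ 2 = C ^+ 2 * (`|f w| / C) `^ 2.
  rewrite -[2 in X in _ * _ `^ X]/(2%:R) powR_mulrn ?divr_ge0 ?(ltW C0)//.
  by rewrite -(real_normK (num_real (f w))); field; rewrite gt_eqF.
under eq_fun do rewrite e; split; first exact: intgZ.
by rewrite ExZ// ler_piMr// sqr_ge0.
Qed.

Lemma time_shift (t : int) (h : nat) : t + 1 - h.+1%:Z = t - h%:Z.
Proof. lia. Qed.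

Lemma time_shift2 (t : int) (n k : nat) : t + n%:Z + 1 - (k + n)%N%:Z = t + 1 - k%:Z.
Proof. lia. Qed.

Lemma int_dist (t t' : int) : (t <= t')%R -> exists2 n : nat, t' = t + n%:Z & `|t - t'|%N = n.
Proof. by move=> tt; exists `|t - t'|%N; lia. Qed.

Lemma time_dist (p r r' : nat) : `|(p + r)%N%:Z - (p + r')%N%:Z|%N = `|r%:Z - r'%:Z|%N.
Proof. lia. Qed.

Lemma sqrt_rate {R : realType} (a t u : R) : 0 <= a -> 0 < t -> u <= t ->
  t^-1 * (a * Num.sqrt u) <= a / Num.sqrt t.
Proof.
move=> a0 t0 ut; rewrite mulrCA ler_wpM2l// mulrC ler_pdivrMr//.
rewrite mulrC -[X in X * _]sqr_sqrtr ?(ltW t0)// expr2 mulfK ?gt_eqF ?sqrtr_gt0//.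
by rewrite ler_sqrt// ltW.
Qed.

Lemma moment_orders {R : realType} (m : R) : 8 < m -> [/\ 2 <= m, 2 <= m / 2 & 2 <= m / 4].
Proof. by split; lra. Qed.

(** * Moments of the autoregressive model *)

Section ModelMoments.
Context {R : realType} {dO : measure_display} {Om : measurableType dO} (P : probability Om R)
  (e : int -> Om -> R) (me : forall i, measT (e i)) (ie : mutually_independent P e).
Local Notation E := (fspace R int).
Context (p d : nat) (x eps : int -> 'I_d -> Om -> R) (A : 'I_p -> 'M[R]_d) (Sig : 'M[R]_d)
  (mx : forall t i, measT (x t i)) (meps : forall t i, measT (eps t i)) (var : is_VAR P x eps A)
  (wn : white_noise P eps Sig).
Local Notation S := (coef_mx A).
Context (stable : forall y : R[i], eigenvalue (map_mx (real_complex R) (companion S)) y -> `|y| < 1)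
  (m C alpha D : R) (h : nat) (dlb : nat -> R) (xx : int -> 'I_d -> E -> R) (m8 : 8 < m)
  (alpha0 : 0 < alpha) (ph : (p <= h)%N) (rd0 : rate_seq alpha D dlb)
  (gx : forall t i, good P e m C t dlb (xx t i))
  (xE : forall t i, {ae P, forall w, x t i w = xx t i (innov e w)}) (c : R) (s : nat) (c0 : 0 < c)
  (coer : coercive (Sigma0 P p x) c) (sB : forall l, (#|active_set S l| <= s)%N) (d0 : (0 < d)%N).

Let m2 : 2 <= m. Proof. by case: (moment_orders m8). Qed.
Let q2 : 2 <= m / 2. Proof. by case: (moment_orders m8). Qed.
Let q4 : 2 <= m / 4. Proof. by case: (moment_orders m8). Qed.
Let mE2 : 2 * (m / 2) = m. Proof. by field. Qed.
Let mE4 : 2 * (m / 4) = m / 2. Proof. by field. Qed.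
Let m0 : 0 < m. Proof. by apply: lt_le_trans m2. Qed.

Let dl := iter h lag_seq dlb.
Let AA := D * (3 + 2 `^ alpha) ^+ h.
Let rd : rate_seq alpha AA dl. Proof. by apply: rate_iter => //; exact: ltW. Qed.
Let dl0 : forall k, 0 < dl k. Proof. by case: rd. Qed.
Let dlA n : \sum_(k < n) dl k <= AA. Proof. exact: rate_sum rd. Qed.
Let C0 : 0 < C. Proof. by have [_ _ /mom_ge0] := gx 0 (Ordinal d0). Qed.
Local Notation z := (lagged x).

Let xmom q t i : 0 < q -> q <= m -> mom P q (x t i) C.
Proof.
move=> q0 qm; have [_ _ b _] := gx t i; apply: mom_ae (mom_le q0 qm b) => //.
by apply: filterS (xE t i) => w ->.
Qed.

Let x2 t i : intg P (fun w => x t i w ^+ 2).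
Proof. by have [] := mom_sqr (@xmom 2 t i (ltr0n R 2) m2). Qed.

Let x2C t i : Ex P (fun w => x t i w ^+ 2) <= C ^+ 2.
Proof. by have [] := mom_sqr (@xmom 2 t i (ltr0n R 2) m2). Qed.

Let sz t k : sqi P (@lagged _ _ _ p d x t k).
Proof. by split; [exact: mx|exact: x2]. Qed.

Lemma Sigma0E t i j : Sigma0 P p x i j = Ex P (fun w => z t i w * z t j w).
Proof.
rewrite (lagged_cov_stationary mx meps x2 x2C var wn stable t p%:Z) mxE ExE0 /Rintegral unlock.
by congr fine; apply: eq_integral => w _; rewrite !mxE big_ord1 !mxE.
Qed.

Lemma Sigma0_bound i j : `|Sigma0 P p x i j| <= C ^+ 2 + C ^+ 2.
Proof. by rewrite (Sigma0E 0); exact: (sqi_Ex (sz 0 i) (sz 0 j) (x2C _ _) (x2C _ _)). Qed.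

(** The regression on the lags is uncorrelated with the noise, so its second moment, which is the
    quadratic form of [Sigma0] at column l of S, is at most that of x; coercivity then bounds each
    coefficient. *)
Lemma coef_bound k l : c * S k l ^+ 2 <= C ^+ 2.
Proof.
pose u w := \sum_k S k l * z (0 - 1) k w.
have su : sqi P u by apply: sqi_sum => k'; exact/sqiZ/sz.
have se : sqi P (eps 0 l) by exact: noise_sqi meps wn _ _.
have qE : quad (Sigma0 P p x) (S^~ l) = Ex P (fun w => u w ^+ 2).
  rewrite /quad (_ : (fun w => u w ^+ 2) = fun w => \sum_i \sum_j S i l * S j l * (z (0 - 1) i w * z (0 - 1) j w)).
    rewrite Ex_sum => [|i _].
      apply: eq_bigr => i _; rewrite Ex_sum => [|j _]; last by apply: intgZ; exact: (sqiM (sz _ _) (sz _ _)).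
      by apply: eq_bigr => j _; rewrite ExZ -?(Sigma0E (0 - 1)); [ring|exact: (sqiM (sz _ _) (sz _ _))].
    by apply: intg_sum => j _; apply: intgZ; exact: (sqiM (sz _ _) (sz _ _)).
  apply/funext => w; rewrite /u expr2 mulr_suml; apply: eq_bigr => i _.
  by rewrite mulr_sumr; apply: eq_bigr => j _; ring.
have ue : Ex P (fun w => u w * eps 0 l w) = 0.
  rewrite (_ : (fun w => _) = fun w => \sum_k S k l * (z (0 - 1) k w * eps 0 l w)).
    rewrite Ex_sum => [|i _]; last by apply: intgZ; exact: sqiM.
    rewrite big1// => i _; rewrite ExZ; last exact: sqiM.
    by rewrite (lagged_noise mx meps x2 x2C var wn stable) ?mulr0.
  by apply/funext => w; rewrite mulr_suml; apply: eq_bigr => i _; ring.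
have := coer (S^~ l); rewrite qE => /(le_trans _) H; apply: (via (Ex P (fun w => u w ^+ 2))).
  apply: H; rewrite ler_wpM2l ?(ltW c0)// (bigD1 k)//= lerDl sumr_ge0// => i _; exact: sqr_ge0.
apply: le_trans (x2C 0 l).
have -> : Ex P (fun w => x 0 l w ^+ 2) = Ex P (fun w => u w ^+ 2 + (2 * (u w * eps 0 l w) + eps 0 l w ^+ 2)).
  apply: ae_Ex; first meas.
    have [mu _] := su; have [mn _] := se.
    by meas.
  by apply: filterS (var_coord var 0 l) => w ->; rewrite -/(u w); ring.
rewrite ExD; [|by case: su|by apply: intgD; [apply: intgZ; exact: sqiM|case: se]].
rewrite ExD; [|by apply: intgZ; exact: sqiM|by case: se].
rewrite ExZ ?ue ?mulr0 ?lerDl; last exact: sqiM.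
by apply: Ex_ge0 => w; exact: sqr_ge0.
Qed.

Let LS := Num.sqrt (C ^+ 2 / c).
Let Ce := C + s%:R * (LS * C).
Let Z2 := 2 * (C * Ce).

Lemma coef_abs k l : `|S k l| <= LS.
Proof.
have h1 : `|S k l| ^+ 2 <= C ^+ 2 / c.
  by rewrite real_normK ?num_real// ler_pdivlMr// mulrC coef_bound.
by rewrite -(ler_pXn2r (n := 2)) ?nnegrE ?sqrtr_ge0// sqr_sqrtr// divr_ge0 ?sqr_ge0// ltW.
Qed.

Let zz t (k : 'I_(p * d)) : E -> R := lagged (fun t i => xx t i) t k.
(** Short-range dependence is assumed for x; the noise inherits it as x minus its regression.
    Summing over the active set keeps the number of terms, hence the constant [Ce], bounded. *)
Let ee t l (a : E) := xx t l a - \sum_(k in active_set S l) S k l * zz (t - 1) k a.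

Let LS0 : 0 <= LS. Proof. exact: sqrtr_ge0. Qed.
Let CCe : C <= Ce. Proof. by rewrite lerDl !mulr_ge0// ltW. Qed.
Let Ce0 : 0 < Ce. Proof. by apply: lt_le_trans CCe. Qed.
Let Z20 : 0 < Z2. Proof. by rewrite !mulr_gt0. Qed.

(** Placed at time t + 1, where it meets the noise in the score; coordinate k is then delayed by its
    lag plus one, at most h. *)
Lemma zz_good t k : good P e m C (t + 1) dl (zz t k).
Proof.
have hh : ((lag_block k).+1 <= h)%N by apply: leq_trans ph; exact: ltn_ord.
have d00 : forall j, 0 < dlb j by case: rd0.
apply: (good_shift (h := (lag_block k).+1) (dl' := dlb) m0 dl0).
  by move=> j; apply: iter_lag_ge.
rewrite /zz /lagged; set i := block_coord k.
by rewrite time_shift.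
Qed.

Lemma ee_good t l : good P e m Ce t dl (ee t l).
Proof.
have d00 : forall j, 0 < dlb j by case: rd0.
have gt : good P e m C t dl (xx t l).
  apply: (good_shift (h := 0%N) (dl' := dlb) m0 dl0) => [j|]; first exact: iter_lag_ge.
  by rewrite subr0.
have m1 : 1 <= m by apply: le_trans m2; rewrite ler1n.
have H := @good_sumD R dO Om P e m _ (index_enum _) (fun k => k \in active_set S l) C t dl (xx t l)
  (fun k a => - (S k l) * zz (t - 1) k a) (fun k => `|- S k l| * C) m1 gt.
have {}H : good P e m (C + \sum_(k in active_set S l) `|- S k l| * C) t dl (ee t l).
  have -> : ee t l = fun a => xx t l a + \sum_(k in active_set S l) - (S k l) * zz (t - 1) k a.
    by apply/funext => a; rewrite /ee -sumrN; congr (_ + _); apply: eq_bigr => k _; rewrite mulNr.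
  apply: H => k kB; apply: good_scaleE; first by rewrite oppr_eq0; rewrite inE in kB.
  by have := zz_good (t - 1) k; rewrite subrK.
apply: good_wle H => //; first exact: ltW.
rewrite lerD2l; apply: (via (\sum_(k in active_set S l) (LS * C))).
  by apply: ler_sum => k _; rewrite normrN ler_wpM2r ?coef_abs// ltW.
rewrite sumr_const -[leLHS]mulr_natl ler_wpM2r ?mulr_ge0 ?(ltW C0)//.
by rewrite ler_nat.
Qed.

Lemma sum_active l (f : 'I_(p * d) -> R) : \sum_k S k l * f k = \sum_(k in active_set S l) S k l * f k.
Proof.
rewrite [RHS]big_mkcond; apply: eq_bigr => k _; rewrite inE; case: eqP => //= ->.
by rewrite mul0r.
Qed.

Lemma ae_lagged t : {ae P, forall w, forall k, z t k w = zz t k (innov e w)}.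
Proof. by apply: filter_forall => k; exact: xE. Qed.

Lemma ae_noise t l : {ae P, forall w, eps t l w = ee t l (innov e w)}.
Proof.
near=> w.
have vc : x t l w = \sum_k S k l * z (t - 1) k w + eps t l w by near: w; exact: var_coord.
have zE : forall k, z (t - 1) k w = zz (t - 1) k (innov e w) by near: w; exact: ae_lagged.
have xw : x t l w = xx t l (innov e w) by near: w; exact: xE.
rewrite /ee -xw vc -sum_active.
have -> : \sum_k S k l * zz (t - 1) k (innov e w) = \sum_k S k l * z (t - 1) k w.
  by apply: eq_bigr => k _; rewrite zE.
by rewrite addrAC subrr add0r.
Unshelve. all: by end_near.
Qed.

(* the score z_j eps_l of coordinate j in equation l *)
Definition score t (j : 'I_(p * d)) l (w : Om) : R := z t j w * eps (t + 1) l w.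
Let sc t j l (a : E) := zz t j a * ee (t + 1) l a.

Lemma ae_score t j l : {ae P, forall w, score t j l w = sc t j l (innov e w)}.
Proof.
near=> w.
have zE : forall k, z t k w = zz t k (innov e w) by near: w; exact: ae_lagged.
have eE : eps (t + 1) l w = ee (t + 1) l (innov e w) by near: w; exact: ae_noise.
by rewrite /score /sc zE eE.
Unshelve. all: by end_near.
Qed.

Lemma sc_good t j l : good P e (m / 2) Z2 (t + 1) dl (sc t j l).
Proof.
have q1 : 1 <= m / 2 by apply: le_trans q2; rewrite ler1n.
apply: good_mul => //.
  rewrite mE2; exact: zz_good.
rewrite mE2; apply: ee_good.
Qed.

Lemma measurable_score t j l : measT (score t j l).
Proof. apply: measurable_funM; [exact: mx|exact: meps]. Qed.

Lemma score_mean t j l : Ex P (score t j l) = 0.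
Proof. by apply: (lagged_noise mx meps x2 x2C var wn stable); rewrite ltrDl. Qed.
Lemma mom_score t j l : mom P (m / 2) (score t j l) Z2.
Proof.
have [_ _ b _] := sc_good t j l; apply: mom_ae b; first exact: measurable_score.
by apply: filterS (ae_score t j l) => w ->.
Qed.

Lemma score_sqi t j l : sqi P (score t j l).
Proof.
split; first exact: measurable_score.
by have [] := mom_sqr (mom_le (ltr0n R 2) q2 (mom_score t j l)).
Qed.

Let AA0 : 0 <= AA. Proof. exact: ltW (rate_ge0 rd). Qed.
Let DD := Z2 * (Z2 * AA).
Let DD0 : 0 <= DD.
Proof. by apply: mulr_ge0; [exact: ltW|apply: mulr_ge0 AA0; exact: ltW]. Qed.

(** The earlier score is known at time t + 1, and the later one sees the innovations from there back
    at lags k + n; the tail of [dl] from n gives the decay. The order m/2 >= 4 of the scores makes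
    products of three of them integrable. *)
Let score_cov_le t (n : nat) j l j' l' :
  `|Ex P (fun w => score t j l w * score (t + n%:Z) j' l' w)| <= DD * (1 + n%:R) `^ (- alpha).
Proof.
have gf := sc_good t j l; have gg := sc_good (t + n%:Z) j' l'.
have [mf af bf _] := gf; have [mg _ bg dg] := gg.
have two : (0 : R) < 2 by exact: ltr0n.
have bf2 := mom_le two q2 bf; have bg2 := mom_le two q2 bg.
have one : (1 : R) <= 2 by rewrite ler1n.
have one1 : (1 : R) <= 1 by [].
have minn (F : E -> R) : measT F -> measT (fun w => F (innov e w)).
  by move=> mF; exact: (measurableT_comp mF (meas_innov me)).
have EE : Ex P (fun w => score t j l w * score (t + n%:Z) j' l' w) =
  Ex P (fun w => sc t j l (innov e w) * sc (t + n%:Z) j' l' (innov e w)).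
  apply: ae_Ex.
  - by apply: measurable_funM; exact: measurable_score.
  - by apply: measurable_funM; exact: minn.
  near=> w.
  have -> : score t j l w = sc t j l (innov e w) by near: w; exact: ae_score.
  have -> // : score (t + n%:Z) j' l' w = sc (t + n%:Z) j' l' (innov e w).
  by near: w; exact: ae_score.
have Eg : Ex P (fun w => sc (t + n%:Z) j' l' (innov e w)) = 0.
  rewrite -(score_mean (t + n%:Z) j' l'); apply: ae_Ex; [exact: minn|exact: measurable_score|].
  by apply: filterS (ae_score (t + n%:Z) j' l') => w ->.
rewrite EE /DD -mulrA.
have ff : mom P 2 (fun w => sc t j l (innov e w) * sc t j l (innov e w)) (Z2 * Z2).
  have h4 : (2 : R) * 2 <= m / 2 by rewrite -mE4 ler_wpM2l.
  have b4 := mom_le (mulr_gt0 two two) h4 bf.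
  by apply: mom_mul => //; exact: ltW.
have h2 : (2 : R) * 1 <= 2 by rewrite mulr1.
have p2 : (0 : R) < 2 * 1 by rewrite mulr1.
have le01 : (0 : R) <= 1 by [].
apply: (@covariance_decay _ _ _ P e me ie (sc t j l) (sc (t + n%:Z) j' l') (t + 1) Z2
  (Z2 * AA * (1 + n%:R) `^ (- alpha)) (fun k => Z2 * dl (k + n)%N) mf mg af bf2 _ Eg).
- exact: mom_intg one bg2.
- have := intg_abs (mom_intg one1 (mom_mul le01 (mom_le p2 h2 ff) (mom_le p2 h2 bg2))).
  by congr (is_true (intg _ _)); apply/funext => w; rewrite normrM -expr2 (ger0_norm (sqr_ge0 _)).
- exact: mom_intg one1 (mom_mul le01 (mom_le p2 h2 bf2) (mom_le p2 h2 bg2)).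
- move=> k; have := mom_le two q2 (dg (k + n)%N).
  by rewrite time_shift2.
move=> N; rewrite -mulr_sumr -mulrA ler_wpM2l ?(ltW Z20)//.
have [_ /(_ n (N + n)%N)] := rd.
by rewrite -{1}[n]add0n big_addn addnK big_mkord.
Unshelve. all: by end_near.
Qed.

Lemma score_cov t t' j l j' l' :
  `|Ex P (fun w => score t j l w * score t' j' l' w)| <= DD * (1 + `|t - t'|%N%:R) `^ (- alpha).
Proof.
have [tt|/ltW tt] := lerP t t'.
  by have [n -> ->] := int_dist tt; exact: score_cov_le.
have [n -> dE] := int_dist tt; rewrite distnC dE.
by under eq_fun do rewrite mulrC; exact: score_cov_le.
Qed.

Section Samples.
Context (T : nat) (pT : (p < T)%N).
Local Notation n := (T - p)%N.
Local Notation tm r := ((p + r)%N%:Z).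

Let n0 : (0 < n)%N. Proof. by rewrite subn_gt0. Qed.
Let T0 : 0 < T%:R :> R. Proof. by rewrite ltr0n (leq_ltn_trans _ pT). Qed.

Let nT : n%:R <= T%:R :> R. Proof. by rewrite ler_nat leq_subr. Qed.

Let bilinear_mom (q CF CG kap : R) (w : 'I_n -> 'I_n -> R) (F G : 'I_n -> Om -> R)
  (Fc Gc : 'I_n -> E -> R) : 2 <= q -> 0 < kap ->
  (forall i j, 0 <= w i j) -> (forall i, \sum_j w i j <= kap) -> (forall j, \sum_i w i j <= kap) ->
  (forall i, measT (F i)) -> (forall i, measT (G i)) ->
  (forall i, {ae P, forall o, F i o = Fc i (innov e o)}) ->
  (forall i, {ae P, forall o, G i o = Gc i (innov e o)}) ->
  (forall i : 'I_n, good P e (2 * q) CF (tm i + 1) dl (Fc i)) ->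
  (forall i : 'I_n, good P e (2 * q) CG (tm i + 1) dl (Gc i)) ->
  mom P q (fun o => T%:R^-1 * (\sum_i \sum_j w i j * (F i o * G j o)) -
  T%:R^-1 * (\sum_i \sum_j w i j * Ex P (fun o => F i o * G j o)))
  (2 * Num.sqrt (2 * (q - 1)) * (3 * (CF * CG * kap) * AA) / Num.sqrt T%:R).
Proof.
move=> qq k0 w0 wr wc mF mG aF aG gF gG.
have q0 : 0 < q by apply: lt_le_trans qq.
have CF0 : 0 < CF by have [_ _ /mom_ge0] := gF (Ordinal n0).
have CG0 : 0 < CG by have [_ _ /mom_ge0] := gG (Ordinal n0).
have tE (i : nat) : tm i + 1 = (p%:Z + 1) + i%:Z by rewrite PoszD addrAC.
have gF' (i : 'I_n) : good P e (2 * q) CF ((p%:Z + 1) + i%:Z) dl (Fc i) by rewrite -tE.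
have gG' (i : 'I_n) : good P e (2 * q) CG ((p%:Z + 1) + i%:Z) dl (Gc i) by rewrite -tE.
have /= := bilinear_concentration me ie dl0 dlA qq k0 n0 w0 wr wc gF' gG'.
set S0 := fun o => \sum_i \sum_j w i j * (Fc i (innov e o) * Gc j (innov e o)).
have mS0 : measT S0.
  apply: measurable_sum => i; apply: measurable_sum => j.
  apply: measurable_funM => //; apply: measurable_funM.
    by have [mf _ _ _] := gF i; exact: (measurableT_comp mf (meas_innov me)).
  by have [mg _ _ _] := gG j; exact: (measurableT_comp mg (meas_innov me)).
set S1 := fun o => \sum_i \sum_j w i j * (F i o * G j o).
have mS1 : measT S1.
  by apply: measurable_sum => i; by meas.
have S01 : {ae P, forall o, S0 o = S1 o}.
  near=> o.
  have f1 : forall i, F i o = Fc i (innov e o) by near: o; exact: filter_forall.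
  have g1 : forall i, G i o = Gc i (innov e o) by near: o; exact: filter_forall.
  by apply: eq_bigr => i _; apply: eq_bigr => j _; rewrite f1 g1.
have momF i : mom P (2 * q) (F i) CF.
  have [_ _ b _] := gF i; apply: mom_ae b => //.
  by apply: filterS (aF i) => o ->.
have momG i : mom P (2 * q) (G i) CG.
  have [_ _ b _] := gG i; apply: mom_ae b => //.
  by apply: filterS (aG i) => o ->.
have iFG i j : intg P (fun o => F i o * G j o).
  by apply: (mom_intg _ (mom_mul (ltW q0) (momF i) (momG j))); apply: le_trans qq; rewrite ler1n.
have -> : Ex P S0 = \sum_i \sum_j w i j * Ex P (fun o => F i o * G j o).
  rewrite (ae_Ex mS0 mS1 S01) Ex_sum => [|i _].
    apply: eq_bigr => i _; rewrite Ex_sum => [|j _]; last exact: intgZ.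
    by apply: eq_bigr => j _; rewrite ExZ.
  by apply: intg_sum => j _; exact: intgZ.
set e0 := (\sum_i _) => H.
have Ti : 0 < T%:R^-1 :> R by pos.
apply: (@mom_ae _ _ _ _ _ (fun o => T%:R^-1 * (S0 o - e0))).
- by meas.
- by apply: filterS S01 => o ->; rewrite mulrBr.
apply: mom_wle (mom_scale Ti H); first exact: ltW.
have a0 : 0 <= 2 * Num.sqrt (2 * (q - 1)) * (3 * (CF * CG * kap) * AA).
  apply: mulr_ge0; first by pos.
  by pos.
by rewrite [X in _ * X <= _]mulrA; exact: sqrt_rate.
Unshelve. all: by end_near.
Qed.

Let diag_row (i : 'I_n) : \sum_j (i == j)%:R = 1 :> R.
Proof. by rewrite (bigD1 i)//= eqxx big1 ?addr0// => j /negbTE; rewrite eq_sym => ->. Qed.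
Let diag_col (j : 'I_n) : \sum_i (i == j)%:R = 1 :> R.
Proof. by rewrite (bigD1 j)//= eqxx big1 ?addr0// => i /negbTE ->. Qed.
Let diag_sum (f : 'I_n -> 'I_n -> R) : \sum_i \sum_j (i == j)%:R * f i j = \sum_i f i i.
Proof.
apply: eq_bigr => i _; rewrite (bigD1 i)//= eqxx mul1r big1 ?addr0// => j /negbTE.
by rewrite eq_sym => ->; rewrite mul0r.
Qed.

(** Centred at (n/T) [Sigma0], since n = T - p products are divided by T; the remaining p/T is
    accounted for in the analysis of a fixed sample. *)
Lemma gram_mom i j : mom P (m / 2)
  (fun w => gram T p (sample_path x w) i j - n%:R / T%:R * Sigma0 P p x i j)
  (2 * Num.sqrt (2 * (m / 2 - 1)) * (3 * (C * C * 1) * AA) / Num.sqrt T%:R).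
Proof.
have := @bilinear_mom (m / 2) C C 1 (fun i j => (i == j)%:R) (fun r => z (tm r) i) (fun r => z (tm r) j)
  (fun r => zz (tm r) i) (fun r => zz (tm r) j) q2 ltr01 (fun _ _ => ler0n _ _) _ _ _ _ _ _ _ _.
have -> : (fun w => gram T p (sample_path x w) i j - n%:R / T%:R * Sigma0 P p x i j) =
  (fun o => T%:R^-1 * (\sum_(i0 < n) \sum_(j0 < n) (i0 == j0)%:R * (z (tm i0) i o * z (tm j0) j o)) -
  T%:R^-1 * (\sum_(i0 < n) \sum_(j0 < n) (i0 == j0)%:R * Ex P (fun o => z (tm i0) i o * z (tm j0) j o))).
  apply/funext => w; rewrite !diag_sum; congr (_ - _).
    rewrite !mxE; congr (_ * _); apply: eq_bigr => r _; rewrite !mxE.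
    by [].
  under eq_bigr do rewrite -Sigma0E.
  by rewrite sumr_const card_ord -mulr_natl; ring.
apply => //.
- by move=> k; rewrite diag_row.
- by move=> k; rewrite diag_col.
- by move=> r; exact: mx.
- by move=> r; exact: mx.
- by move=> r; apply: filterS (ae_lagged (tm r)) => w.
- by move=> r; apply: filterS (ae_lagged (tm r)) => w.
- by move=> r; rewrite mE2; exact: zz_good.
- by move=> r; rewrite mE2; exact: zz_good.
Qed.

Lemma cross_mom j l : mom P (m / 2)
  (fun w => (T%:R^-1 *: ((Wmx T p (sample_path x w))^T *m response T p (sample_path eps w) l)) j 0)
  (2 * Num.sqrt (2 * (m / 2 - 1)) * (3 * (C * Ce * 1) * AA) / Num.sqrt T%:R).
Proof.
have := @bilinear_mom (m / 2) C Ce 1 (fun i j => (i == j)%:R) (fun r => z (tm r) j) (fun r => eps (tm r + 1) l)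
  (fun r => zz (tm r) j) (fun r => ee (tm r + 1) l) q2 ltr01 (fun _ _ => ler0n _ _) _ _ _ _ _ _ _ _.
have -> : (fun w => (T%:R^-1 *: ((Wmx T p (sample_path x w))^T *m response T p (sample_path eps w) l)) j 0) =
  (fun o => T%:R^-1 * (\sum_(i0 < n) \sum_(j0 < n) (i0 == j0)%:R * (z (tm i0) j o * eps (tm j0 + 1) l o)) -
  T%:R^-1 * (\sum_(i0 < n) \sum_(j0 < n) (i0 == j0)%:R * Ex P (fun o => z (tm i0) j o * eps (tm j0 + 1) l o))).
  apply/funext => w; rewrite !diag_sum [X in _ - _ * X]big1 ?mulr0 ?subr0; last first.
    by move=> r _; exact: score_mean.
  rewrite !mxE; congr (_ * _); apply: eq_bigr => r _; rewrite !mxE; congr (_ * _).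
  by rewrite -[in LHS]addn1 PoszD.
apply => //.
- by move=> k; rewrite diag_row.
- by move=> k; rewrite diag_col.
- by move=> r; exact: mx.
- by move=> r; apply: filterS (ae_lagged (tm r)) => w.
- by move=> r; exact: ae_noise.
- by move=> r; rewrite mE2; exact: zz_good.
- by move=> r; rewrite mE2; exact: ee_good.
Qed.

(** A product of two scores multiplies four variables of order m, hence the order m/4. *)
Lemma longrun_mom (K : R -> R) (k kap : R) j l j' l' : (forall u, 0 <= K u) ->
  (forall u, K (- u) = K u) -> 0 < kap ->
  (forall r : 'I_n, \sum_(r' < n) K ((r%:R - r'%:R) / k) <= kap) -> mom P (m / 4)
  (fun w => T%:R^-1 * (\sum_(r < n) \sum_(r' < n) K ((r%:R - r'%:R) / k) *
  (score (tm r) j l w * score (tm r') j' l' w)) -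
  T%:R^-1 * (\sum_(r < n) \sum_(r' < n) K ((r%:R - r'%:R) / k) *
  Ex P (fun w => score (tm r) j l w * score (tm r') j' l' w)))
  (2 * Num.sqrt (2 * (m / 4 - 1)) * (3 * (Z2 * Z2 * kap) * AA) / Num.sqrt T%:R).
Proof.
move=> K0 Ks k0 rows.
apply: (@bilinear_mom (m / 4) Z2 Z2 kap (fun r r' => K ((r%:R - r'%:R) / k)) (fun r => score (tm r) j l)
  (fun r => score (tm r) j' l') (fun r => sc (tm r) j l) (fun r => sc (tm r) j' l') q4 k0) => //.
- move=> r; apply: le_trans (rows r); apply: eq_ler.
  by apply: eq_bigr => r' _; rewrite -Ks -mulNr opprB.
- by move=> r; exact: measurable_score.
- by move=> r; exact: measurable_score.
- by move=> r; exact: ae_score.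
- by move=> r; exact: ae_score.
- by move=> r; rewrite mE4; exact: sc_good.
- by move=> r; rewrite mE4; exact: sc_good.
Qed.

Let mean_mom (q B : R) (F : 'I_n -> Om -> R) : 1 <= q -> 0 < B -> (forall r, mom P q (F r) B) ->
  mom P q (fun w => T%:R^-1 * \sum_r F r w) (1 + B).
Proof.
move=> q1 B0 mF; have Ti : 0 < T%:R^-1 :> R by pos.
have := mom_scale Ti (mom_sum (index_enum _) q1 T0 (fun r (_ : true) => mF r)).
apply: mom_wle; first by apply: le_trans q1.
rewrite sumr_const card_ord -[X in _ + X]mulr_natl mulrDr mulVf ?gt_eqF// lerD2l.
by rewrite mulrA ler_piMl ?(ltW B0)// mulrC ler_pdivrMr// mul1r.
Qed.

Let q41 : 1 <= m / 4. Proof. by apply: le_trans q4; rewrite ler1n. Qed.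
Let q40 : 0 <= m / 4. Proof. by apply: le_trans q41. Qed.

Lemma score_sqr_mom j l : mom P (m / 4)
  (fun w => T%:R^-1 * \sum_(r < n) score (tm r) j l w ^+ 2) (1 + Z2 * Z2).
Proof.
apply: mean_mom => //; first pos.
move=> r; under eq_fun do rewrite expr2.
by apply: mom_mul => //; rewrite mE4; exact: mom_score.
Qed.

Lemma lagged_sqr_mom (i j : 'I_(p * d)) : mom P (m / 4)
  (fun w => T%:R^-1 * \sum_(r < n) (z (tm r) i w * z (tm r) j w) ^+ 2) (1 + C * C * (C * C)).
Proof.
apply: mean_mom => //; first by pos.
move=> r; under eq_fun do rewrite expr2.
have b2 : mom P (m / 2) (fun w => z (tm r) i w * z (tm r) j w) (C * C).
  have q20 : 0 <= m / 2 by apply: le_trans q2.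
  by apply: mom_mul => //; rewrite mE2; exact: xmom.
by apply: mom_mul => //; rewrite mE4.
Qed.

(** Each row is a sum over the distances |r - r'|, at most twice the one-sided sum. *)
Lemma longrun_cov_bound (f : nat -> R) (V : R) j l j' l' : (forall u, 0 <= f u) ->
  \sum_(u < n) f u * (1 + u%:R) `^ (- alpha) <= V ->
  T%:R^-1 * (\sum_(r < n) \sum_(r' < n) f `|r%:Z - r'%:Z|%N *
  `|Ex P (fun w => score (tm r) j l w * score (tm r') j' l' w)|) <= DD * (2 * V).
Proof.
move=> f0 fV.
pose g u := f u * (1 + u%:R) `^ (- alpha).
have g0 u : 0 <= g u by rewrite mulr_ge0// powR_ge0.
have V0 : 0 <= V by apply: le_trans fV; pos.
have row (r : 'I_n) : \sum_(r' < n) f `|r%:Z - r'%:Z|%N *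
  `|Ex P (fun w => score (tm r) j l w * score (tm r') j' l' w)| <= DD * (2 * V).
  apply: (via (\sum_(r' < n) DD * g `|r%:Z - r'%:Z|%N)).
    apply: ler_sum => r' _; rewrite /g mulrCA ler_wpM2l//.
    by have := score_cov (tm r) (tm r') j l j' l'; rewrite time_dist.
  rewrite -mulr_sumr ler_wpM2l// (le_trans (sum_dist_le g0 (ltn_ord r)))// ler_wpM2l//.
rewrite mulrC ler_pdivrMr//.
apply: (via (\sum_(r < n) DD * (2 * V))); first exact: ler_sum.
rewrite sumr_const card_ord -[leLHS]mulr_natr ler_wpM2l// mulr_ge0// mulr_ge0//.
Qed.

End Samples.
End ModelMoments.

(** * The bootstrap root as a linear form in the multipliers *)

Section BootstrapAlgebra.
Context {R : realType} (T p d : nat) (X : int -> 'cV[R]_d) (p0 : (0 < p)%N).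
Local Notation q := (p * d)%N.
Local Notation W := (Wmx T p X).
Implicit Types (B : 'I_d -> {set 'I_q}) (Sh : 'M[R]_(q, d)).

Definition residual Sh (t : nat) l : R := X t.+1%:Z l 0 - \sum_k zvec p X t%:Z k 0 * Sh k l.

(* the estimated score z_i eps_l of time t *)
Definition fitted_score B (t : nat) i l : R :=
  zvec p X t%:Z i 0 * residual (post_selection T X B) t l.

Definition root_coef B (t : nat) j l : R := (Num.sqrt T%:R)^-1 *
  \sum_i partial_inverse (B l) (gram T p X) j i * fitted_score B t i l.

Let lift_subproof (l : 'I_d) : (l < q)%N.
Proof. by apply: leq_trans (ltn_ord l) _; rewrite leq_pmull. Qed.
Let lift (l : 'I_d) : 'I_q := Ordinal (lift_subproof l).

Let lift_coord l : block_coord (lift l) = l.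
Proof. by apply: val_inj; rewrite /= modn_small. Qed.

Let lift_zvec (t : int) l : zvec p X t (lift l) 0 = X t l 0.
Proof. by rewrite mxE lift_coord /= divn_small// subr0. Qed.

Let pid_col (M : 'M[R]_q) i l : (M *m (pid_mx d : 'M[R]_(q, d))) i l = M i (lift l).
Proof.
rewrite mxE (bigD1 (lift l))//= big1 ?addr0 => [|k kl]; rewrite mxE /=.
  by rewrite eqxx ltn_ord mulr1.
case: eqP => [kE|_]; last by rewrite mulr0.
by case/eqP: kl; apply: val_inj.
Qed.

(** The first d columns of the companion matrix are the estimator, so column l of [Theta_hat] is z
    times the residual of equation l; the part without multipliers cancels against the
    post-selection estimator. *)
Lemma bootstrap_rootE B (e : nat -> R) j l :
  bootstrap_root T X B e j l = \sum_(p <= t < T) root_coef B t j l * e t.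
Proof.
set Sh := post_selection T X B; set Z := partial_inverse (B l) (gram T p X).
have colE i : (Sigma1_star T X Sh e *m (pid_mx d : 'M[R]_(q, d))) i l =
  (T%:R^-1 *: (W^T *m response T p X l)) i 0 +
  T%:R^-1 * \sum_(p <= t < T) fitted_score B t i l * e t.
  rewrite pid_col /Sigma1_star mxE; congr (_ + _).
    rewrite /Sigma1_hat mxE summxE [RHS]mxE; congr (_ * _).
    rewrite [RHS]mxE -{1}[p]add0n big_addn big_mkord; apply: eq_bigr => r _.
    rewrite [LHS]mxE big_ord1.
    have -> : (zvec p X (r + p).+1%:Z)^T 0 (lift l) = X (r + p).+1%:Z l 0 by rewrite mxE lift_zvec.
    have -> : W^T i r = zvec p X (p + r)%N%:Z i 0 by rewrite mxE mxE.
    have -> : response T p X l r 0 = X (p + r).+1%:Z l 0 by rewrite mxE.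
    by rewrite addnC.
  rewrite mxE summxE; congr (_ * _); apply: eq_bigr => t _.
  rewrite mxE mulrC; congr (_ * _); rewrite /fitted_score /residual -/Sh.
  have -> : Theta_hat X Sh t i (lift l) = zvec p X t%:Z i 0 * zvec p X t.+1%:Z (lift l) 0 -
    \sum_k (zvec p X t%:Z i 0 * zvec p X t%:Z k 0) * companion Sh k (lift l).
    rewrite /Theta_hat mxE [X in _ + X]mxE; congr (_ - _).
      by rewrite mxE big_ord1 [X in _ * X]mxE.
    rewrite mxE; apply: eq_bigr => k _; congr (_ * _).
    by rewrite mxE big_ord1 [X in _ * X]mxE.
  rewrite lift_zvec mulrBr mulr_sumr; congr (_ - _); apply: eq_bigr => k _.
  by rewrite /companion [X in _ * X = _]mxE /= ltn_ord lift_coord mulrA.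
rewrite /bootstrap_root mxE [X in _ * X]mxE.
have -> : bootstrap_estimator T X B e j l = \sum_i Z j i *
  ((T%:R^-1 *: (W^T *m response T p X l)) i 0 +
  T%:R^-1 * \sum_(p <= t < T) fitted_score B t i l * e t).
  rewrite /bootstrap_estimator mxE mxE; apply: eq_bigr => i _; congr (_ * _).
  by rewrite mxE colE.
have -> : (- post_selection T X B) j l = - \sum_i Z j i * (T%:R^-1 *: (W^T *m response T p X l)) i 0.
  by rewrite mxE /post_selection mxE mxE.
rewrite -sumrB mulr_sumr.
(* At T = 0 both sides are 0, the inverse of 0 being 0. *)
have sT : Num.sqrt T%:R * T%:R^-1 = (Num.sqrt T%:R)^-1 :> R.
  case: T => [|n]; first by rewrite sqrtr0 invr0 mulr0.
  by rewrite -[X in _ * X^-1](@sqr_sqrtr R n.+1%:R)// expr2 invfM mulrA mulfV// mul1r.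
transitivity (\sum_i \sum_(p <= t < T) (Num.sqrt T%:R)^-1 * (Z j i * fitted_score B t i l * e t)).
  apply: eq_bigr => i _; set u := fun_of_matrix _ i 0; set v := \sum_(p <= t < T) _.
  have -> : Num.sqrt T%:R * (Z j i * (u + T%:R^-1 * v) - Z j i * u) =
    (Num.sqrt T%:R * T%:R^-1) * (Z j i * v) by ring.
  rewrite sT /v !mulr_sumr.
  by apply: eq_bigr => t _; rewrite !mulrA.
rewrite exchange_big/=; apply: eq_bigr => t _.
by rewrite /root_coef -mulrA mulr_suml mulr_sumr; apply: eq_bigr => i _; rewrite mulrA.
Qed.
Context (Ep : int -> 'cV[R]_d) (S : 'M[R]_(q, d))
  (fit : forall t : nat, (p <= t < T)%N -> forall l, X t.+1%:Z l 0 = \sum_k S k l * zvec p X t%:Z k 0 + Ep t.+1%:Z l 0).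

Lemma responseE l : response T p X l = W *m col l S + response T p Ep l.
Proof.
apply/colP => r; rewrite mxE fit; last by have := ltn_ord r; lia.
rewrite !mxE; congr (_ + _); apply: eq_bigr => k _; rewrite !mxE mulrC.
by [].
Qed.

(** After insertion of the regression equation the block inverse reproduces S on its support, and
    the cross moments with the noise remain. *)
Lemma post_selection_error B c th l j : 0 < c -> coercive_on (B l) (gram T p X) c ->
  (forall j, j \notin B l -> S j l = 0) ->
  (forall j, `|(T%:R^-1 *: (W^T *m response T p Ep l)) j 0| <= th) ->
  (forall j, j \notin B l -> post_selection T X B j l = 0) /\
  `|post_selection T X B j l - S j l| <= c^-1 * #|B l|%:R * th.
Proof.
move=> c0 co S0 hth.
have bi := partial_inverse_block (coercive_unitmx c0 co).
set Z := partial_inverse _ _ in bi.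
have [Zout _ ZA] := bi.
have E j' : post_selection T X B j' l = \sum_i Z j' i * (\sum_k gram T p X i k * S k l) +
  \sum_i Z j' i * (T%:R^-1 *: (W^T *m response T p Ep l)) i 0.
  rewrite /post_selection mxE mxE -big_split; apply: eq_bigr => i _ /=.
  rewrite responseE mulmxDr scalerDr mulmxA -mulrDr; congr (_ * _).
  by rewrite [LHS]mxE; congr (_ + _); rewrite scalemxAl [LHS]mxE; apply: eq_bigr => k _; congr (_ * _); rewrite mxE.
have out j' : j' \notin B l -> post_selection T X B j' l = 0.
  by move=> jB; rewrite E !big1 ?addr0// => i _; rewrite Zout ?jB ?mul0r.
split=> //.
have th0 : 0 <= th by apply: le_trans (hth j).
have [jB|jB] := boolP (j \in B l); last first.
  by rewrite out// S0// subr0 normr0 !mulr_ge0// invr_ge0 ltW.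
have -> : post_selection T X B j l - S j l = \sum_(i in B l) Z j i * (T%:R^-1 *: (W^T *m response T p Ep l)) i 0.
  rewrite E; have -> : \sum_i Z j i * (\sum_k gram T p X i k * S k l) = S j l.
    under eq_bigr do rewrite mulr_sumr.
    rewrite exchange_big/= (bigD1 j)//= [X in _ + X]big1 ?addr0 => [|k kj].
      by under eq_bigr do rewrite mulrA; rewrite -mulr_suml ZA// eqxx mul1r.
    under eq_bigr do rewrite mulrA; rewrite -mulr_suml.
    have [kB|kB] := boolP (k \in B l); last by rewrite S0// mulr0.
    by rewrite ZA// eq_sym (negbTE kj) mul0r.
  rewrite addrAC subrr add0r [RHS]big_mkcond; apply: eq_bigr => i _.
  by case: ifPn => // iB; rewrite Zout ?iB ?orbT// mul0r.
apply: le_trans (ler_norm_sum _ _ _) _.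
apply: (via (\sum_(i in B l) c^-1 * th)).
  apply: ler_sum => i _; rewrite normrM ler_pM//.
  exact: block_inv_bound co bi _ _.
by rewrite sumr_const -mulr_natl; lra.
Qed.

End BootstrapAlgebra.

(** * Perturbation of sandwiched matrices *)

Section BlockInverse.
Context {R : realType} (n : nat).
Implicit Types (A Z : 'M[R]_n) (D : {set 'I_n}).

Lemma block_inv_sym D A Z : A^T = A -> block_inv D A Z -> Z^T = Z.
Proof.
move=> As [Z0 AZ ZA].
have Asym i j : A i j = A j i by rewrite -{1}As mxE.
apply/matrixP => i j; rewrite mxE.
have [iD|iD] := boolP (i \in D); last by rewrite !Z0 ?iD ?orbT.
have [jD|jD] := boolP (j \in D); last by rewrite !Z0 ?jD ?orbT.
transitivity (\sum_a \sum_b Z a i * (A a b * Z b j)).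
  under eq_bigr do rewrite -mulr_sumr.
  rewrite (bigD1 j)//= AZ// eqxx mulr1 big1 ?addr0// => a aj.
  have [aD|aD] := boolP (a \in D); last by rewrite Z0 ?aD// mul0r.
  by rewrite AZ// (negbTE aj) mulr0.
rewrite exchange_big/= (bigD1 i)//= [X in _ + X]big1 ?addr0 => [|b bi].
  rewrite (_ : \sum_a _ = (\sum_a A i a * Z a i) * Z i j); last first.
    by rewrite mulr_suml; apply: eq_bigr => a _; rewrite (Asym a i); ring.
  by rewrite AZ// eqxx mul1r.
rewrite (_ : \sum_a _ = (\sum_a A b a * Z a i) * Z b j); last first.
  by rewrite mulr_suml; apply: eq_bigr => a _; rewrite (Asym a b); ring.
have [bD|bD] := boolP (b \in D); last by rewrite (Z0 b j) ?bD// mulr0.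
by rewrite AZ// (negbTE bi) mul0r.
Qed.

(** Product rule over at most s^2 pairs of indices: the middle matrices differ by e, the outer
    vectors by th. *)
Lemma sandwich_diff (D D' : {set 'I_n}) (s : nat) (z f z' f' : 'I_n -> R)
  (M N : 'I_n -> 'I_n -> R) (a b th mu e : R) : (#|D| <= s)%N -> (#|D'| <= s)%N ->
  0 <= a -> 0 <= b -> 0 <= th -> 0 <= mu ->
  (forall i, i \notin D -> z i = 0 /\ f i = 0) -> (forall i, i \notin D' -> z' i = 0 /\ f' i = 0) ->
  (forall i, `|z i| <= a) -> (forall i, `|z' i| <= a) ->
  (forall i, `|f i| <= b) -> (forall i, `|f' i| <= b) ->
  (forall i, `|z i - f i| <= th) -> (forall i, `|z' i - f' i| <= th) ->
  (forall i i', i \in D -> i' \in D' -> `|M i i' - N i i'| <= e) ->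
  (forall i i', i \in D -> i' \in D' -> `|N i i'| <= mu) -> 0 <= e ->
  `|\sum_i \sum_i' z i * M i i' * z' i' - \sum_i \sum_i' f i * N i i' * f' i'|
  <= s%:R ^+ 2 * (a ^+ 2 * e + (a + b) * th * mu).
Proof.
move=> Ds D's a0 b0 th0 mu0 zD zD' za za' fb fb' zf zf' MN Nmu e0.
have bnd i i' : i \in D -> i' \in D' ->
  `|z i * M i i' * z' i' - f i * N i i' * f' i'| <= a ^+ 2 * e + (a + b) * th * mu.
  move=> iD i'D.
  have -> : z i * M i i' * z' i' - f i * N i i' * f' i' = z i * z' i' * (M i i' - N i i') +
    ((z i - f i) * z' i' + f i * (z' i' - f' i')) * N i i' by ring.
  apply: le_trans (ler_normD _ _) _; apply: lerD.
    rewrite normrM; apply: ler_pM => //; last exact: MN.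
    by rewrite normrM expr2 ler_pM.
  rewrite normrM; apply: ler_pM => //; last exact: Nmu.
  apply: le_trans (ler_normD _ _) _; rewrite [leRHS]mulrDl; apply: lerD; rewrite normrM.
    by rewrite mulrC; apply: ler_pM.
  by apply: ler_pM.
have B0 : 0 <= a ^+ 2 * e + (a + b) * th * mu by pos.
rewrite !pair_bigA/= -sumrB.
have -> : \sum_i (z i.1 * M i.1 i.2 * z' i.2 - f i.1 * N i.1 i.2 * f' i.2) =
  \sum_(i | (i.1 \in D) && (i.2 \in D')) (z i.1 * M i.1 i.2 * z' i.2 - f i.1 * N i.1 i.2 * f' i.2).
  rewrite [RHS]big_mkcond; apply: eq_bigr => [[i i'] _] /=.
  case: ifPn => //; rewrite negb_and => /orP[iD|iD].
    by have [-> ->] := zD _ iD; rewrite !mul0r subrr.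
  by have [-> ->] := zD' _ iD; rewrite !mulr0 subrr.
apply: le_trans (ler_norm_sum _ _ _) _.
apply: (via (\sum_(i : 'I_n * 'I_n | (i.1 \in D) && (i.2 \in D')) (a ^+ 2 * e + (a + b) * th * mu))).
  by apply: ler_sum => [[i i']] /= /andP[]; exact: bnd.
rewrite -(pair_big (mem D) (mem D') (fun _ _ => a ^+ 2 * e + (a + b) * th * mu))/=.
rewrite sumr_const sumr_const -mulrnA -[leLHS]mulr_natl ler_wpM2r// expr2 -natrM ler_nat.
exact: leq_mul.
Qed.

End BlockInverse.

(** * Weighted averages of products *)

Section WeightedAverages.
Context {R : realType} (n : nat) (T kap : R) (w : 'I_n -> 'I_n -> R) (T0 : 0 < T) (kap0 : 0 <= kap)
  (w0 : forall i j, 0 <= w i j) (wr : forall i, \sum_j w i j <= kap)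
  (wc : forall j, \sum_i w i j <= kap).

Definition waverage (u v : 'I_n -> R) : R := T^-1 * \sum_i \sum_j w i j * (u i * v j).

Lemma waverageB (u v u' v' : 'I_n -> R) : waverage u v - waverage u' v' =
  waverage (fun i => u i - u' i) v + waverage u' (fun i => v i - v' i).
Proof.
rewrite /waverage -mulrBr -mulrDr -sumrB -big_split; congr (_ * _); apply: eq_bigr => i _ /=.
by rewrite -sumrB -big_split; apply: eq_bigr => j _ /=; ring.
Qed.

Lemma waverage_le (u v u' v' : 'I_n -> R) : (forall i, `|u i| <= u' i) -> (forall i, `|v i| <= v' i) ->
  `|waverage u v| <= waverage u' v'.
Proof.
move=> uu vv; rewrite /waverage normrM ger0_norm ?invr_ge0 ?(ltW T0)// ler_wpM2l ?invr_ge0 ?(ltW T0)//.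
apply: le_trans (ler_norm_sum _ _ _) _; apply: ler_sum => i _.
apply: le_trans (ler_norm_sum _ _ _) _; apply: ler_sum => j _.
by rewrite !normrM ger0_norm// ler_wpM2l// ler_pM.
Qed.

(* Schur test *)
Lemma waverage_schur (u v : 'I_n -> R) (h : R) : T^-1 * (\sum_i u i ^+ 2) <= h ->
  T^-1 * (\sum_i v i ^+ 2) <= h -> waverage u v <= kap * h.
Proof.
move=> uh vh; have Ti : 0 <= T^-1 by pos.
apply: (via (T^-1 * \sum_i \sum_j (w i j * (2^-1 * u i ^+ 2) + w i j * (2^-1 * v j ^+ 2)))).
  rewrite ler_wpM2l//; apply: ler_sum => i _; apply: ler_sum => j _.
  rewrite -mulrDr ler_wpM2l// -subr_ge0.
  have -> : 2^-1 * u i ^+ 2 + 2^-1 * v j ^+ 2 - u i * v j = 2^-1 * (u i - v j) ^+ 2 by field.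
  by pos.
have S1 : \sum_i \sum_j w i j * (2^-1 * u i ^+ 2) <= kap * (2^-1 * \sum_i u i ^+ 2).
  rewrite 2!mulr_sumr; apply: ler_sum => i _; rewrite -mulr_suml.
  by apply: ler_wpM2r (wr i); rewrite mulr_ge0//; pos.
have S2 : \sum_i \sum_j w i j * (2^-1 * v j ^+ 2) <= kap * (2^-1 * \sum_i v i ^+ 2).
  rewrite exchange_big/= 2!mulr_sumr; apply: ler_sum => i _.
  by rewrite -mulr_suml; apply: ler_wpM2r (wc i); rewrite mulr_ge0//; pos.
under eq_bigr do rewrite big_split/=.
rewrite big_split/=.
apply: (le_trans (ler_wpM2l Ti (lerD S1 S2))).
rewrite -mulrDr -mulrDr mulrCA ler_wpM2l// mulrCA mulrDr.
by rewrite mulrC ler_pdivrMr// mulr_natr mulr2n lerD.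
Qed.

Lemma waverage_suml (I : Type) (r : seq I) (Q : pred I) (F : I -> 'I_n -> R) (v : 'I_n -> R) :
  waverage (fun i => \sum_(k <- r | Q k) F k i) v = \sum_(k <- r | Q k) waverage (F k) v.
Proof.
rewrite /waverage -mulr_sumr; congr (_ * _); rewrite [RHS]exchange_big/=; apply: eq_bigr => i _.
rewrite [RHS]exchange_big/=; apply: eq_bigr => j _; rewrite -mulr_sumr; congr (_ * _).
by rewrite mulr_suml.
Qed.

Lemma waverage_sumr (I : Type) (r : seq I) (Q : pred I) (F : I -> 'I_n -> R) (u : 'I_n -> R) :
  waverage u (fun i => \sum_(k <- r | Q k) F k i) = \sum_(k <- r | Q k) waverage u (F k).
Proof.
rewrite /waverage -mulr_sumr; congr (_ * _); rewrite [RHS]exchange_big/=; apply: eq_bigr => i _.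
rewrite [RHS]exchange_big/=; apply: eq_bigr => j _; rewrite -mulr_sumr; congr (_ * _).
by rewrite mulr_sumr.
Qed.

Lemma waverageZl (a : R) (u v : 'I_n -> R) : waverage (fun i => a * u i) v = a * waverage u v.
Proof.
rewrite /waverage mulrCA; congr (_ * _); rewrite mulr_sumr; apply: eq_bigr => i _.
by rewrite mulr_sumr; apply: eq_bigr => j _; ring.
Qed.

Lemma waverageZr (a : R) (u v : 'I_n -> R) : waverage u (fun i => a * v i) = a * waverage u v.
Proof.
rewrite /waverage mulrCA; congr (_ * _); rewrite mulr_sumr; apply: eq_bigr => i _.
by rewrite mulr_sumr; apply: eq_bigr => j _; ring.
Qed.

(* replacing u by a perturbation dominated by del * sum_(k in D) |F k| *)
Lemma waverage_perturb (I I' : finType) (D : {set I}) (D' : {set I'}) (s : nat)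
  (F : I -> 'I_n -> R) (F' : I' -> 'I_n -> R) (u u' v v' : 'I_n -> R) (h del : R) :
  (#|D| <= s)%N -> (#|D'| <= s)%N -> 0 <= del -> 0 <= h ->
  (forall i, `|u i - u' i| <= del * \sum_(k in D) `|F k i|) ->
  (forall i, `|v i - v' i| <= del * \sum_(k in D') `|F' k i|) ->
  (forall k, k \in D -> T^-1 * (\sum_i F k i ^+ 2) <= h) ->
  (forall k, k \in D' -> T^-1 * (\sum_i F' k i ^+ 2) <= h) ->
  T^-1 * (\sum_i u' i ^+ 2) <= h -> T^-1 * (\sum_i v' i ^+ 2) <= h ->
  `|waverage u v - waverage u' v'| <= kap * h * (2 * (del * s%:R) + (del * s%:R) ^+ 2).
Proof.
move=> Ds D's del0 h0 uu vv Fh F'h uh vh.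
have sq (f : 'I_n -> R) : \sum_i `|f i| ^+ 2 = \sum_i f i ^+ 2.
  by apply: eq_bigr => i _; rewrite real_normK ?num_real.
have kh0 : 0 <= kap * h by pos.
pose Su i := \sum_(k in D) `|F k i|; pose Sv i := \sum_(k in D') `|F' k i|.
have cards (J : finType) (E : {set J}) (x : R) : (#|E| <= s)%N -> 0 <= x -> \sum_(k in E) x <= s%:R * x.
  by move=> Es x0; rewrite sumr_const -[leLHS]mulr_natl ler_wpM2r// ler_nat.
have -> : waverage u v - waverage u' v' = waverage (fun i => u i - u' i) v' +
  waverage (fun i => u i - u' i) (fun i => v i - v' i) + waverage u' (fun i => v i - v' i).
  by rewrite waverageB; congr (_ + _); rewrite /waverage -mulrDr -big_split; congr (_ * _);
    apply: eq_bigr => i _; rewrite -big_split; apply: eq_bigr => j _ /=; ring.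
have H1 : `|waverage (fun i => u i - u' i) v'| <= del * (s%:R * (kap * h)).
  apply: le_trans (waverage_le uu (fun i => lexx `|v' i|)) _.
  rewrite waverageZl ler_wpM2l// waverage_suml; apply: le_trans (cards _ D _ Ds kh0).
  by apply: ler_sum => k kD; apply: waverage_schur; rewrite sq//; exact: Fh.
have H3 : `|waverage u' (fun i => v i - v' i)| <= del * (s%:R * (kap * h)).
  apply: le_trans (waverage_le (fun i => lexx `|u' i|) vv) _.
  rewrite waverageZr ler_wpM2l// waverage_sumr; apply: le_trans (cards _ D' _ D's kh0).
  by apply: ler_sum => k kD; apply: waverage_schur; rewrite sq//; exact: F'h.
have H2 : `|waverage (fun i => u i - u' i) (fun i => v i - v' i)| <= del * (del * (s%:R * (s%:R * (kap * h)))).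
  apply: le_trans (waverage_le uu vv) _.
  rewrite waverageZl ler_wpM2l// waverageZr ler_wpM2l// waverage_suml.
  apply: le_trans (cards _ D _ Ds _); last by pos.
  apply: ler_sum => k kD; rewrite waverage_sumr; apply: le_trans (cards _ D' _ D's kh0).
  by apply: ler_sum => k' kD'; apply: waverage_schur; rewrite sq//; [exact: Fh|exact: F'h].
apply: le_trans (ler_normD _ _) _; apply: le_trans (lerD (ler_normD _ _) (lexx _)) _.
apply: le_trans (lerD (lerD H1 H2) H3) _.
by apply: eq_ler; ring.
Qed.

End WeightedAverages.

(** * Covariance of the bootstrap root *)

Section RootCovariance.
Context {R : realType} (T p d : nat) (X Ep : int -> 'cV[R]_d) (S : 'M[R]_(p * d, d)).
Local Notation q := (p * d)%N.
Local Notation n := (T - p)%N.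
Local Notation gr := (gram T p X).
Context (p0 : (0 < p)%N) (T0 : (0 < T)%N)
  (fit : forall t : nat, (p <= t < T)%N -> forall l, X t.+1%:Z l 0 = \sum_k S k l * zvec p X t%:Z k 0 + Ep t.+1%:Z l 0)
  (B : 'I_d -> {set 'I_q}) (s : nat) (Bs : forall l, (#|B l| <= s)%N)
  (S0 : forall l j, j \notin B l -> S j l = 0).

Definition true_score (r : 'I_n) (i : 'I_q) (l : 'I_d) : R :=
  zvec p X (p + r)%N%:Z i 0 * Ep (p + r).+1%N%:Z l 0.

Definition lag_product (r : 'I_n) (i k : 'I_q) : R :=
  zvec p X (p + r)%N%:Z i 0 * zvec p X (p + r)%N%:Z k 0.
Context (c th2 : R) (c0 : 0 < c) (co : forall l, coercive_on (B l) gr (c / 2))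
  (cross : forall l j, `|(T%:R^-1 *: ((Wmx T p X)^T *m response T p Ep l)) j 0| <= th2).

Let del := (c / 2)^-1 * s%:R * th2.
Let c20 : 0 < c / 2. Proof. by pos. Qed.

(** Noise minus residual is the regression on the estimation error, so the error of a score is a
    combination of products of two lagged variables, over the support only. *)
Lemma fitted_score_error (r : 'I_n) i l :
  `|fitted_score T X B (p + r)%N i l - true_score r i l| <= del * \sum_(k in B l) `|lag_product r i k|.
Proof.
have hr : (p <= p + r < T)%N by have := ltn_ord r; lia.
have E : fitted_score T X B (p + r)%N i l - true_score r i l =
  - \sum_(k in B l) (post_selection T X B k l - S k l) * lag_product r i k.
  have -> : \sum_(k in B l) (post_selection T X B k l - S k l) * lag_product r i k =
    \sum_k (post_selection T X B k l - S k l) * lag_product r i k.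
    rewrite big_mkcond; apply: eq_bigr => k _; case: ifPn => // kB.
    have [out _] := post_selection_error p0 fit k c20 (@co l) (@S0 l) (cross l).
    by rewrite out// S0// subrr mul0r.
  rewrite /fitted_score /true_score /residual fit//.
  set zi := zvec p X _ i 0; set a := \sum_k S k l * _; set b := \sum_k _ * post_selection _ _ _ _ _.
  have -> : zi * (a + Ep (p + r).+1%N%:Z l 0 - b) - zi * Ep (p + r).+1%N%:Z l 0 = - (zi * (b - a)).
    by ring.
  congr (- _); rewrite /a /b -sumrB mulr_sumr; apply: eq_bigr => k _.
  by rewrite /lag_product -/zi; ring.
rewrite E normrN mulr_sumr; apply: le_trans (ler_norm_sum _ _ _) _; apply: ler_sum => k _.
rewrite normrM ler_wpM2r//.
have [_ h] := post_selection_error p0 fit k c20 (@co l) (@S0 l) (cross l).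
apply: le_trans h _; rewrite /del -!mulrA ler_wpM2l ?invr_ge0 ?(ltW c20)//.
have th0 : 0 <= th2 by apply: le_trans (cross l k).
by rewrite ler_wpM2r// ler_nat.
Qed.
Context (kap th1 th4 th5 mb : R) (w : 'I_n -> 'I_n -> R) (Sg : 'M[R]_q)
  (Mid : 'I_q -> 'I_d -> 'I_q -> 'I_d -> R) (Sgs : Sg^T = Sg) (Sgc : coercive Sg c)
  (kap0 : 0 <= kap) (w0 : forall i j, 0 <= w i j) (wr : forall i, \sum_j w i j <= kap)
  (wc : forall j, \sum_i w i j <= kap) (grth : forall i j, `|gr i j - Sg i j| <= th1)
  (th40 : 0 <= th4) (th50 : 0 <= th5) (mb0 : 0 <= mb)
  (sc4 : forall l i, i \in B l -> T%:R^-1 * (\sum_r true_score r i l ^+ 2) <= th4)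
  (lp4 : forall l i k, i \in B l -> k \in B l -> T%:R^-1 * (\sum_r lag_product r i k ^+ 2) <= th4)
  (mid5 : forall l l' i i', i \in B l -> i' \in B l' -> `|waverage T%:R w (fun r => true_score r i l) (fun r => true_score r i' l') - Mid i l i' l'| <= th5)
  (midb : forall l l' i i', i \in B l -> i' \in B l' -> `|Mid i l i' l'| <= mb).

(** Three errors meet: fitted instead of true scores ([del]), the weighted average of true scores
    ([th5]), and sample instead of population blocks in the inverses ([th1]). *)
Lemma root_covariance_bound j l j' l' :
  `|\sum_(r < n) \sum_(r' < n) root_coef T X B (p + r)%N j l * root_coef T X B (p + r')%N j' l' * w r r' -
  \sum_i \sum_i' partial_inverse (B l) Sg j i * Mid i l i' l' * partial_inverse (B l') Sg j' i'|
  <= s%:R ^+ 2 * ((c / 2)^-1 ^+ 2 * (kap * th4 * (2 * (del * s%:R) + (del * s%:R) ^+ 2) + th5) +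
  ((c / 2)^-1 + c^-1) * ((c * (c / 2))^-1 * (s%:R ^+ 2 * th1)) * mb).
Proof.
have T0' : 0 < T%:R :> R by rewrite ltr0n.
have Sgo l0 : coercive_on (B l0) Sg c by move=> v _; exact: Sgc.
have bZ l0 := partial_inverse_block (coercive_unitmx c20 (@co l0)).
have bF l0 := partial_inverse_block (coercive_unitmx c0 (@Sgo l0)).
have th10 : 0 <= th1 by apply: le_trans (grth j j).
have th20 : 0 <= th2 by apply: le_trans (cross l j).
have del0 : 0 <= del by rewrite !mulr_ge0// invr_ge0 ltW.
pose Mh i i' := waverage T%:R w (fun r => fitted_score T X B (p + r)%N i l)
  (fun r => fitted_score T X B (p + r)%N i' l').
have -> : \sum_(r < n) \sum_(r' < n) root_coef T X B (p + r)%N j l * root_coef T X B (p + r')%N j' l' * w r r' =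
  \sum_i \sum_i' partial_inverse (B l) gr j i * Mh i i' * partial_inverse (B l') gr j' i'.
  pose Z := partial_inverse (B l) gr j; pose Z' := partial_inverse (B l') gr j'.
  pose f (r : 'I_n) i := fitted_score T X B (p + r)%N i l.
  pose f' (r : 'I_n) i := fitted_score T X B (p + r)%N i l'.
  transitivity (\sum_r \sum_r' \sum_i \sum_i' T%:R^-1 * (Z i * f r i * (Z' i' * f' r' i') * w r r')).
    apply: eq_bigr => r _; apply: eq_bigr => r' _; rewrite /root_coef.
    have sT : (Num.sqrt T%:R)^-1 * (Num.sqrt T%:R)^-1 = T%:R^-1 :> R.
      by rewrite -invfM -expr2 sqr_sqrtr// ltW.
    rewrite mulrACA sT -mulrA mulr_suml mulr_suml mulr_sumr; apply: eq_bigr => i _.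
    by rewrite mulr_sumr mulr_suml mulr_sumr; apply: eq_bigr => i' _.
  transitivity (\sum_r \sum_i \sum_i' \sum_r' T%:R^-1 * (Z i * f r i * (Z' i' * f' r' i') * w r r')).
    apply: eq_bigr => r _; rewrite exchange_big; apply: eq_bigr => i _; exact: exchange_big.
  rewrite exchange_big; apply: eq_bigr => i _ /=; rewrite exchange_big; apply: eq_bigr => i' _ /=.
  rewrite /Mh /waverage 2!mulr_sumr mulr_suml; apply: eq_bigr => r _.
  rewrite 2!mulr_sumr mulr_suml; apply: eq_bigr => r' _.
  by rewrite -/(f r i) -/(f' r' i') -/(Z i) -/(Z' i'); ring.
have e0 : 0 <= kap * th4 * (2 * (del * s%:R) + (del * s%:R) ^+ 2) + th5.
  apply: addr_ge0 => //; apply: mulr_ge0; first exact: mulr_ge0.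
  by pos.
have zf l0 j0 i : `|partial_inverse (B l0) gr j0 i - partial_inverse (B l0) Sg j0 i| <=
  (c * (c / 2))^-1 * (s%:R ^+ 2 * th1).
  apply: le_trans (block_inv_diff c0 c20 (@Sgo l0) (@co l0) (bF l0) (bZ l0) (fun i j _ _ => grth i j) _ _) _.
  rewrite ler_wpM2l ?invr_ge0 ?mulr_ge0 ?(ltW c0)// ler_wpM2r//.
  by rewrite -!natrX ler_nat leq_sqr.
apply: (@sandwich_diff _ _ (B l) (B l') s (partial_inverse (B l) gr j) (partial_inverse (B l) Sg j)
  (partial_inverse (B l') gr j') (partial_inverse (B l') Sg j') Mh (fun i i' => Mid i l i' l')) => //.
- by pos.
- by pos.
- by pos.
- by move=> i iB; rewrite !partial_inverse_out ?iB ?orbT.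
- by move=> i iB; rewrite !partial_inverse_out ?iB ?orbT.
- by move=> i; exact: block_inv_bound c20 (@co l) (bZ l) _ _.
- by move=> i; exact: block_inv_bound c20 (@co l') (bZ l') _ _.
- by move=> i; exact: block_inv_bound c0 (@Sgo l) (bF l) _ _.
- by move=> i; exact: block_inv_bound c0 (@Sgo l') (bF l') _ _.
- move=> i i' iB i'B; rewrite -(subrKA (waverage T%:R w (fun r => true_score r i l) (fun r => true_score r i' l'))).
  apply: le_trans (ler_normD _ _) _; apply: lerD; last exact: mid5.
  apply: (@waverage_perturb R n T%:R kap w T0' kap0 w0 wr wc 'I_q 'I_q (B l) (B l') s
    (fun k r => lag_product r i k) (fun k r => lag_product r i' k)) => //.
  + by move=> r; exact: fitted_score_error.
  + by move=> r; exact: fitted_score_error.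
  + by move=> k kB; exact: lp4 iB kB.
  + by move=> k kB; exact: lp4 i'B kB.
  + exact: sc4.
  + exact: sc4.
- by move=> i i' iB i'B; exact: midb.
Qed.

End RootCovariance.

(** * Measurability of determinants and inverses *)

Section MeasurableMatrices.
Context {R : realType} {dd : measure_display} {Y : measurableType dd}.

Lemma measurable_det n (M : Y -> 'M[R]_n) : (forall i j, measT (fun w => M w i j)) ->
  measT (fun w => \det (M w)).
Proof.
move=> mM; rewrite /determinant; apply: measurable_sum => s; apply: measurable_funM => //.
exact: measurable_prod.
Qed.

Lemma measurable_adj n (M : Y -> 'M[R]_n) i j : (forall i j, measT (fun w => M w i j)) ->
  measT (fun w => (\adj (M w)) i j).
Proof.
move=> mM; under eq_fun do rewrite mxE /cofactor.
apply: measurable_funM => //; apply: measurable_det => a b.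
by under eq_fun do rewrite !mxE; exact: mM.
Qed.

(** Writing 1/x as x times the power -1 of x^2 reduces the inverse to a real power of a nonnegative
    function, with value 0 at 0. *)
Lemma measurable_inv (f : Y -> R) : measT f -> measT (fun w => (f w)^-1).
Proof.
move=> mf; have -> : (fun w => (f w)^-1) = (fun w => f w * (f w ^+ 2) `^ (- 1)).
  apply/funext => w; rewrite powRN powRr1 ?sqr_ge0// expr2 invfM mulrA.
  have [->|f0] := eqVneq (f w) 0; first by rewrite mul0r invr0 mul0r.
  by rewrite mulfV// mul1r.
by meas.
Qed.

Lemma measurable_forall_fin (I : finType) (F : I -> set Y) : (forall i, measurable (F i)) ->
  measurable [set y | forall i, F i y].
Proof.
move=> mF; rewrite (_ : [set y | _] = \bigcap_(i in [set: I]) F i).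
  by apply: fin_bigcap_measurable => //; by meas.
by apply/seteqP; split => y /= H i; [move=> _; exact: H|exact: H].
Qed.

End MeasurableMatrices.

(** * Conditional laws given the data *)

Section ConditionalLaw.
Context {R : realType} {dO : measure_display} {Om : measurableType dO} (P : probability Om R).
Local Notation PP := (P \x P)%E.

Definition fjoin (I J : Type) (a : fspace R I) (b : fspace R J) : fspace R (I + J)%type :=
  fun ij => match ij with inl i => a i | inr j => b j end.

Lemma measurable_fjoin (I J : choiceType) d (Y : measurableType d) (f : Y -> fspace R I)
  (g : Y -> fspace R J) : measT f -> measT g -> measT (fun y => fjoin (f y) (g y)).
Proof.
move=> mf mg; apply: meas_fspace => -[i|j] /=.
  exact: (measurableT_comp (meas_eval i) mf).
exact: (measurableT_comp (meas_eval j) mg).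
Qed.
Context (I J : choiceType) (X : I -> Om -> R) (Z : J -> Om -> R) (mX : forall i, measT (X i))
  (mZ : forall j, measT (Z j)) (ind : independent_vectors P X Z).

Let mXf : measT (fun w => (X ^~ w : fspace R I)).
Proof. by apply: meas_fspace. Qed.
Let mZf : measT (fun w => (Z ^~ w : fspace R J)).
Proof. by apply: meas_fspace. Qed.

(** A rectangle of the joined family splits into one for each part, so independence of the parts
    gives the joint law. *)
Lemma independent_join (A : set (fspace R (I + J)%type)) : measurable A ->
  P [set w | A (fjoin (X ^~ w) (Z ^~ w))] = PP [set w | A (fjoin (X ^~ w.1) (Z ^~ w.2))].
Proof.
have m1 : measT (fun w => fjoin (X ^~ w) (Z ^~ w)) by exact: measurable_fjoin.
have m2 : measT (fun w : Om * Om => fjoin (X ^~ w.1) (Z ^~ w.2)).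
  apply: measurable_fjoin; first exact: (measurableT_comp mXf measurable_fst).
  exact: (measurableT_comp mZf measurable_snd).
apply: (@fspace_measure_unique R _ (pushforward P (fun w => fjoin (X ^~ w) (Z ^~ w)))
  (pushforward PP (fun w : Om * Om => fjoin (X ^~ w.1) (Z ^~ w.2)))).
  by rewrite -[X in (X < _)%E]/(P setT) probability_setT ltry.
move=> s q; rewrite /pushforward.
pose A1 : set (fspace R I) := ray_rect (pmap (fun k => if k is inl i then Some i else None) s)
  (fun i => q (inl i)).
pose A2 : set (fspace R J) := ray_rect (pmap (fun k => if k is inr j then Some j else None) s)
  (fun j => q (inr j)).
have E a b : ray_rect s q (fjoin a b) <-> A1 a /\ A2 b.
  split=> [H|[H1 H2] [i|j] ks].
  - split=> [i|j]; rewrite mem_pmap => /mapP[[k|k] ks //= [->]]; exact: (H _ ks).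
  - by apply: H1; rewrite mem_pmap; apply/mapP; exists (inl i).
  - by apply: H2; rewrite mem_pmap; apply/mapP; exists (inr j).
have mA1 : measurable A1 by exact: measurable_ray_rect.
have mA2 : measurable A2 by exact: measurable_ray_rect.
transitivity (P [set w | A1 (X ^~ w) /\ A2 (Z ^~ w)]).
  by congr (P _); apply/seteqP; split => w /= /E.
rewrite ind//.
transitivity (PP ([set w | A1 (X ^~ w)] `*` [set w | A2 (Z ^~ w)])).
  apply/esym; apply: product_measure1E.
    by preimage; exact: mXf.
  by preimage; exact: mZf.
by congr (PP _); apply/seteqP; split => w /= /E.
Qed.

Lemma Ex0_ae (f : Om -> R) : intg P f -> (forall w, 0 <= f w) -> Ex P f = 0 ->
  {ae P, forall w, f w = 0}.
Proof.
move=> fi f0 fE; have mf := intg_meas fi.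
have /(ae_eq_integral_abs P measurableT (f := EFin \o f)) : measT (EFin \o f).
  exact/measurable_EFinP.
case=> + _; have -> : (\int[P]_x `|(EFin \o f) x|)%E = 0%E.
  rewrite -[RHS]/(0%:E) -fE -(ExE fi); apply: eq_integral => w _ /=.
  by rewrite ger0_norm.
by move=> /(_ erefl); apply: filterS => w /(_ Logic.I) [].
Qed.
Context (K : finType) (D : K -> Om -> R) (k : R.-pker (fspace R I) ~> (fspace R K))
  (claw : is_cond_law P X D k) (L : fspace R (I + J)%type -> fspace R K) (H : set (fspace R I))
  (mL : measT L) (mH : measurable H)
  (DL : forall w, H (X ^~ w) -> (fun jl => D jl w) = L (fjoin (X ^~ w) (Z ^~ w))).

(** The candidate for the conditional law: the data are frozen at [o] and only [Z] is random. *)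
Let F (B : set (fspace R K)) (o : fspace R I) : \bar R := P [set w | B (L (fjoin o (Z ^~ w)))].

Let mjoin : measT (fun ow : fspace R I * Om => L (fjoin ow.1 (Z ^~ ow.2))).
Proof.
apply: (measurableT_comp mL); apply: measurable_fjoin; first exact: measurable_fst.
exact: (measurableT_comp mZf measurable_snd).
Qed.

Let mF B : measurable B -> measT (F B).
Proof.
move=> mB.
have mS : measurable [set ow : fspace R I * Om | B (L (fjoin ow.1 (Z ^~ ow.2)))].
  by preimage; exact: mjoin.
have := measurable_fun_xsection P mS.
congr (measurable_fun _ _); apply/funext => o /=; rewrite /F; congr (P _).
by apply/seteqP; split => w; rewrite /xsection/= inE.
Qed.

Let Fint (A : set (fspace R I)) (B : set (fspace R K)) : measurable A -> measurable B -> A `<=` H ->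
  (\int[P]_(w in [set w | A (X ^~ w)]) k (X ^~ w) B = \int[P]_(w in [set w | A (X ^~ w)]) F B (X ^~ w))%E.
Proof.
move=> mA mB AH; rewrite -claw//.
pose W : set (fspace R (I + J)%type) := [set v | A (fun i => v (inl i)) /\ B (L v)].
have mW : measurable W.
  apply: measurableI; last by preimage; exact: mL.
  have mi : measT (fun v : fspace R (I + J)%type => ((fun i => v (inl i)) : fspace R I)).
    by apply: meas_fspace => i; exact: meas_eval.
  by preimage; exact: mi.
transitivity (P [set w | W (fjoin (X ^~ w) (Z ^~ w))]).
  by congr (P _); apply/seteqP; split => w /= [Aw Bw]; split => //; move: Bw; rewrite DL//; exact: AH.
rewrite independent_join// [RHS]integral_mkcond; apply: eq_integral => w _.
rewrite /patch; case: ifPn => [|wA].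
  rewrite inE /= => Aw; rewrite /F; congr (P _); apply/seteqP; split => w'; rewrite /xsection/= inE /=.
    by case.
  by [].
have -> : (point : \bar R) = 0%E by [].
rewrite -(@measure0 _ _ _ P) /=; congr (P _); apply/seteqP; split => // w'.
by rewrite /xsection/= inE /= => -[Aw _]; move/negP: wA; rewrite inE.
Qed.

(** On the part of [H] where f exceeds g, the difference f - g is nonnegative with integral zero. *)
Let le_law (f g : fspace R I -> R) : measT f -> measT g ->
  (forall o, 0 <= f o <= 1) -> (forall o, 0 <= g o <= 1) -> (forall A, measurable A -> A `<=` H ->
  (\int[P]_(w in [set w | A (X ^~ w)]) (f (X ^~ w))%:E =
  \int[P]_(w in [set w | A (X ^~ w)]) (g (X ^~ w))%:E)%E) ->
  {ae P, forall w, H (X ^~ w) -> f (X ^~ w) <= g (X ^~ w)}.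
Proof.
move=> mf mg f01 g01 fgA.
pose A := H `&` [set o | g o < f o].
have mA : measurable A by apply: measurableI => //; exact: measurable_set_lt.
have mAX : measurable [set w | A (X ^~ w)] by preimage; exact: mXf.
have mfX (h : fspace R I -> R) : measT h -> measT (fun w => h (X ^~ w)).
  by meas.
pose ch w : R := \1_[set w | A (X ^~ w)] w.
have mch : measT ch by exact: measurable_indic.
have ih (h : fspace R I -> R) : measT h -> (forall o, 0 <= h o <= 1) ->
  intg P (fun w => h (X ^~ w) * ch w).
  move=> mh h01; apply: (@intg_bnd _ _ _ _ _ 1); first meas.
  move=> w; have /andP[h0 h1] := h01 (X ^~ w); rewrite normrM !ger0_norm////.
  by rewrite /ch indicE; case: (_ \in _); rewrite ?mulr1 ?mulr0.
have Eh (h : fspace R I -> R) : measT h -> (forall o, 0 <= h o <= 1) ->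
  ((Ex P (fun w => h (X ^~ w) * ch w))%:E = \int[P]_(w in [set w | A (X ^~ w)]) (h (X ^~ w))%:E)%E.
  move=> mh h01; rewrite -ExE; last exact: ih.
  rewrite [RHS]integral_mkcond; apply: eq_integral => w _; rewrite /patch /ch indicE.
  by case: (_ \in _); rewrite ?mulr1 ?mulr0.
pose u w := f (X ^~ w) * ch w - g (X ^~ w) * ch w.
have iu : intg P u by apply: intgB; exact: ih.
have u0 w : 0 <= u w.
  rewrite /u /ch indicE; case: (boolP (_ \in _)); rewrite ?mulr1 ?mulr0//.
  by rewrite inE /= => -[_ /= /ltW]; rewrite subr_ge0.
have Eu : Ex P u = 0.
  rewrite ExB; [|exact: ih|exact: ih].
  have := fgA A mA (@subIsetl _ _ _); rewrite -!Eh// => -[->].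
  by rewrite subrr.
apply: filterS (Ex0_ae iu u0 Eu) => w uw HX; rewrite leNgt; apply/negP => gf.
move: uw; rewrite /u /ch indicE mem_set//= !mulr1 => /eqP; rewrite subr_eq0 => /eqP fg.
by rewrite fg ltxx in gf.
Qed.

Let ae_law B : measurable B -> {ae P, forall w, H (X ^~ w) -> k (X ^~ w) B = F B (X ^~ w)}.
Proof.
move=> mB.
have k1 o : (k o B <= 1)%E.
  by rewrite -(@prob_kernel _ _ _ _ _ k o); apply: le_meas.
have kf o : k o B \is a fin_num by rewrite ge0_fin_numE// (le_lt_trans (k1 o))// ltry.
have mBo o : measurable [set w | B (L (fjoin o (Z ^~ w)))].
  have m1 : measT (fun w => L (fjoin o (Z ^~ w))).
    by apply: (measurableT_comp mL); apply: measurable_fjoin => //; exact: measurable_cst.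
  by preimage; exact: m1.
have Ff o : F B o \is a fin_num by exact: fin_num_measure.
pose fk o := fine (k o B); pose fF o := fine (F B o).
have mfk : measT fk.
  by apply: (measurableT_comp (fine_measurable measurableT)); exact: measurable_kernel.
have mfF : measT fF.
  by apply: (measurableT_comp (fine_measurable measurableT)); exact: mF.
have k01 o : 0 <= fk o <= 1.
  by rewrite fine_ge0//= -lee_fin fineK.
have F01 o : 0 <= fF o <= 1.
  by rewrite fine_ge0//= -lee_fin fineK// probability_le1.
have HA A : measurable A -> A `<=` H -> (\int[P]_(w in [set w | A (X ^~ w)]) (fk (X ^~ w))%:E =
  \int[P]_(w in [set w | A (X ^~ w)]) (fF (X ^~ w))%:E)%E.
  move=> mA AH; under eq_integral do rewrite fineK//.
  by under [RHS]eq_integral do rewrite fineK//; exact: Fint.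
have HA' A : measurable A -> A `<=` H -> (\int[P]_(w in [set w | A (X ^~ w)]) (fF (X ^~ w))%:E =
  \int[P]_(w in [set w | A (X ^~ w)]) (fk (X ^~ w))%:E)%E by move=> mA AH; rewrite HA.
near=> w => HX.
rewrite -(fineK (kf _)) -(fineK (Ff _)); congr (_%:E); apply/eqP; rewrite eq_le; apply/andP; split.
  by move: HX; near: w; exact: (le_law mfk mfF k01 F01 HA).
by move: HX; near: w; exact: (le_law mfF mfk F01 k01 HA').
Unshelve. all: by end_near.
Qed.

(** The kernel and the candidate agree almost surely on each rational rectangle; the finite index
    set has countably many of them, and they determine a law. The representation by [L] holds on
    [H], so only data in [H] are tested. *)
Lemma conditional_law : {ae P, forall w, H (X ^~ w) -> forall B, measurable B ->
  k (X ^~ w) B = P [set w' | B (L (fjoin (X ^~ w) (Z ^~ w')))]}.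
Proof.
pose BB (n : nat) : set (fspace R K) :=
  if unpickle n is Some (s, q) then ray_rect (s : seq K) (q : {ffun K -> rat}) else setT.
have mBB n : measurable (BB n).
  by rewrite /BB; case: (unpickle _) => [[s q]|] //; exact: measurable_ray_rect.
have := ae_foralln (fun n => ae_law (mBB n)); apply: filterS => w Hw HX B mB.
have mLw : measT (fun w' => L (fjoin (X ^~ w) (Z ^~ w'))).
  apply: (measurableT_comp mL); apply: measurable_fjoin => //; exact: measurable_cst.
apply: (@fspace_measure_unique R _ (k (X ^~ w)) (pushforward P (fun w' => L (fjoin (X ^~ w) (Z ^~ w'))))) => //.
  by rewrite prob_kernel ltry.
move=> s q; have := Hw (pickle (s, [ffun i => q i])) HX.
rewrite /BB pickleK; have -> // : @ray_rect R _ s [ffun i => q i] = ray_rect s q.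
by apply/seteqP; split => f /= h i iis; have := h i iis; rewrite ffunE.
Qed.

End ConditionalLaw.

Lemma measurable_ext {R : realType} d (Y : measurableType d) (f g : Y -> R) : f =1 g ->
  measT g -> measT f.
Proof. by move=> /funext ->. Qed.

(** * Measurable dependence on the observed path *)

Section ObservedPath.
Context {R : realType} (T p d : nat).
Local Notation q := (p * d)%N.
Local Notation I := ('I_T * 'I_d)%type.

(* the path x_1, ..., x_T, extended by zero *)
Definition observed_path (o : fspace R I) (t : int) : 'cV[R]_d :=
  \col_i (if t is Posz n.+1 then oapp (fun r : 'I_T => o (r, i)) 0 (insub n) else 0).

Lemma observed_pathE (dO : measure_display) (Om : measurableType dO) (x : int -> 'I_d -> Om -> R) w t :
  (0 < t <= T)%N -> observed_path (observations x ^~ w) t%:Z = sample_path x w t%:Z.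
Proof.
case: t => // t /= tT; apply/colP => i; rewrite !mxE /=.
by rewrite insubT.
Qed.

Lemma measurable_path t i : measT (fun o : fspace R I => observed_path o t i 0).
Proof.
have -> : (fun o : fspace R I => observed_path o t i 0) = (fun o : fspace R I =>
  if t is Posz n.+1 then oapp (fun r : 'I_T => o (r, i)) 0 (insub n) else 0).
  by apply/funext => o; rewrite mxE.
case: t => [[|n]|n]; try meas.
by case: insubP => [r _ _|_] /=; [exact: meas_eval|exact: measurable_cst].
Qed.

Section Agree.
Context (X X' : int -> 'cV[R]_d) (p0 : (0 < p)%N)
  (XX : forall t : nat, (0 < t <= T)%N -> X t%:Z = X' t%:Z).

Let zvec_eq (t : nat) : (p <= t <= T)%N -> zvec p X t%:Z = zvec p X' t%:Z.
Proof.
move=> tp; apply/colP => k; rewrite !mxE.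
have kp := ltn_ord (lag_block k).
have -> : t%:Z - (lag_block k)%:Z = (t - lag_block k)%N%:Z by lia.
by rewrite XX//; lia.
Qed.

Let Wmx_eq : Wmx T p X = Wmx T p X'.
Proof. by apply/matrixP => r k; rewrite mxE [RHS]mxE zvec_eq//; have := ltn_ord r; lia. Qed.

Let response_eq l : response T p X l = response T p X' l.
Proof. by apply/colP => r; rewrite mxE [RHS]mxE XX//; have := ltn_ord r; lia. Qed.

Lemma gram_eq : gram T p X = gram T p X'.
Proof. by rewrite /gram Wmx_eq. Qed.

Lemma root_coef_eq (B : 'I_d -> {set 'I_q}) (t : nat) j l : (p <= t < T)%N ->
  root_coef T X B t j l = root_coef T X' B t j l.
Proof.
move=> /andP[pt tT]; rewrite /root_coef gram_eq; congr (_ * _); apply: eq_bigr => i _; congr (_ * _).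
rewrite /fitted_score /residual zvec_eq ?pt ?(ltnW tT)// XX//; congr (_ * (_ - _)).
apply: eq_bigr => k _; congr (_ * _); rewrite /post_selection mxE [RHS]mxE gram_eq.
by rewrite Wmx_eq response_eq.
Qed.

End Agree.

(* measurable version of the partial inverse, exact on invertible blocks *)
Definition cramer_inverse n (D : {set 'I_n}) (A : 'M[R]_n) : 'M[R]_n :=
  let k := enum_val : 'I_#|D| -> 'I_n in
  \sum_s \sum_t ((\det (mxsub k k A))^-1 * (\adj (mxsub k k A)) s t) *: delta_mx (k s) (k t).

Lemma cramer_inverseE n (D : {set 'I_n}) (A : 'M[R]_n) :
  \det (mxsub (enum_val : 'I_#|D| -> 'I_n) enum_val A) != 0 ->
  cramer_inverse D A = partial_inverse D A.
Proof.
move=> dA; apply: eq_bigr => s _; apply: eq_bigr => t _; congr (_ *: _).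
have uA : mxsub (enum_val : 'I_#|D| -> 'I_n) enum_val A \in unitmx by rewrite unitmxE unitfE.
by rewrite pinv_unit// /invmx uA [RHS]mxE.
Qed.

Lemma measurable_cramer dd (Y : measurableType dd) n (D : {set 'I_n}) (A : Y -> 'M[R]_n) i j :
  (forall i j, measT (fun y => A y i j)) -> measT (fun y => cramer_inverse D (A y) i j).
Proof.
move=> mA; rewrite /cramer_inverse; under eq_fun do rewrite summxE.
apply: measurable_sum => s; under eq_fun do rewrite summxE.
apply: measurable_sum => t; under eq_fun do rewrite mxE.
have mM a b : measT (fun y => mxsub (enum_val : 'I_#|D| -> 'I_n) enum_val (A y) a b).
  by under eq_fun do rewrite mxE; exact: mA.
apply: measurable_funM; last exact: measurable_cst.
apply: measurable_funM; first exact/measurable_inv/measurable_det.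
exact: measurable_adj.
Qed.
Context (B : 'I_d -> {set 'I_q}).

(** The coefficient of a multiplier in the root, written out with Cramer inverses for fixed sets
    [B], so that measurability in the data is immediate; where the blocks are invertible it is
    [root_coef]. *)
Definition cramer_coef (o : fspace R I) (t : nat) j l : R :=
  let X := observed_path o in let Z l := cramer_inverse (B l) (gram T p X) in
  (Num.sqrt T%:R)^-1 * \sum_i Z l j i * (zvec p X t%:Z i 0 *
    (X t.+1%:Z l 0 - \sum_k zvec p X t%:Z k 0 *
       \sum_a Z l k a * (T%:R^-1 * \sum_r Wmx T p X r a * response T p X l r 0))).

Lemma measurable_zvec u i : measT (fun o : fspace R I => zvec p (observed_path o) u i 0).
Proof. by apply: measurable_ext => [y|]; [rewrite mxE; reflexivity|exact: measurable_path]. Qed.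

Lemma measurable_gram i j : measT (fun o => gram T p (observed_path o) i j).
Proof.
apply: (measurable_ext (g := fun o : fspace R I => T%:R^-1 * \sum_r Wmx T p (observed_path o) r i *
  Wmx T p (observed_path o) r j)) => [y|].
  by rewrite mxE [X in _ * X]mxE; congr (_ * _); apply: eq_bigr => r _; rewrite mxE.
apply: measurable_funM => //.
apply: measurable_sum => r; apply: measurable_funM;
  (apply: measurable_ext => [y|]; [rewrite mxE; reflexivity|exact: measurable_zvec]).
Qed.

Lemma measurable_cramer_coef t j l : measT (fun o => cramer_coef o t j l).
Proof.
have mz := measurable_zvec.
have mZ a b : measT (fun o : fspace R I => cramer_inverse (B l) (gram T p (observed_path o)) a b).
  by apply: measurable_cramer => i k; exact: measurable_gram.
apply: measurable_funM => //; apply: measurable_sum => i; apply: measurable_funM => //.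
apply: measurable_funM => //; apply: measurable_funB; first exact: measurable_path.
apply: measurable_sum => k; apply: measurable_funM => //; apply: measurable_sum => a.
apply: measurable_funM => //; apply: measurable_funM => //; apply: measurable_sum => r.
apply: measurable_funM; (apply: measurable_ext => [y|]; [rewrite mxE; reflexivity|]); first exact: mz.
exact: measurable_path.
Qed.

Lemma cramer_coefE o t j l :
  \det (mxsub (enum_val : 'I_#|B l| -> 'I_q) enum_val (gram T p (observed_path o))) != 0 ->
  cramer_coef o t j l = root_coef T (observed_path o) B t j l.
Proof.
move=> dl; rewrite /cramer_coef /root_coef cramer_inverseE//; congr (_ * _).
apply: eq_bigr => i _; congr (_ * (_ * (_ - _))); apply: eq_bigr => k _; congr (_ * _).
rewrite /post_selection mxE mxE; apply: eq_bigr => a _; congr (_ * _).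
rewrite mxE [X in _ = _ * X]mxE; congr (_ * _); apply: eq_bigr => r _; congr (_ * _).
by rewrite [RHS]mxE.
Qed.

End ObservedPath.

(** Index t of ['I_T] is time t + 1, and the scores occupy the times p, ..., T - 1. *)
Lemma sum_window {R : realType} (T p : nat) (g : nat -> R) : (0 < p)%N ->
  \sum_(t < T) (if (p <= t.+1 < T)%N then g t.+1 else 0) = \sum_(r < T - p) g (p + r)%N.
Proof.
move=> p0.
have -> : \sum_(r < T - p) g (p + r)%N = \sum_(p <= u < T) g u.
  by rewrite -[X in _ = \sum_(X <= _ < _) _]add0n big_addn big_mkord; apply: eq_bigr => r _; rewrite addnC.
rewrite -(big_mkord xpredT (fun t => if (p <= t.+1 < T)%N then g t.+1 else 0)).
rewrite -(big_add1 _ _ 0 T.+1 xpredT (fun t => if (p <= t < T)%N then g t else 0)).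
have [pT|Tp] := leqP p T; last first.
  rewrite [RHS]big_geq ?(ltnW Tp)//; apply: big1_seq => t /andP[_].
  by rewrite mem_index_iota => _; case: ifP => // /andP[]; lia.
rewrite (big_cat_nat _ (n := p)) ?(leqW pT)//= big1_seq ?add0r => [|t /andP[_]]; last first.
  by rewrite mem_index_iota => ?; case: ifP => // /andP[]; lia.
rewrite big_nat_recr//= ltnn andbF addr0.
by apply: eq_big_nat => t ->.
Qed.

Lemma pushforward_second_moment {R : realType} d1 (X1 : measurableType d1) (P1 : probability X1 R)
  (n d : nat) (V : X1 -> 'I_n * 'I_d -> R) (C : 'I_n * 'I_d -> 'I_n * 'I_d -> R)
  (Q : {measure set (fspace R ('I_n * 'I_d)) -> \bar R}) : gaussian_sys P1 V C ->
  (forall S : set (fspace R ('I_n * 'I_d)), measurable S -> Q S = P1 [set w | S (V w)]) ->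
  forall j1 l1 j2 l2, second_moment Q j1 l1 j2 l2 = C (j1, l1) (j2, l2).
Proof.
move=> gV QV j1 l1 j2 l2; have [iV EV] := gaussian_cov gV (j1, l1) (j2, l2).
have mVf : measT (V : X1 -> fspace R ('I_n * 'I_d)).
  by apply: meas_fspace => i; exact: gaussian_meas gV i.
rewrite -EV ExE0 /second_moment /Rintegral; congr fine.
rewrite (eq_measure_integral (pushforward P1 (V : X1 -> fspace R ('I_n * 'I_d)))) => [|S mS _]; last exact: QV.
have mf : measT (fun v : fspace R ('I_n * 'I_d) => v (j1, l1) * v (j2, l2)).
  by apply: measurable_funM; exact: meas_eval.
rewrite intgE in iV.
transitivity (\int[P1]_(w in (V : X1 -> fspace R ('I_n * 'I_d)) @^-1` setT)
  ((fun v : fspace R ('I_n * 'I_d) => (v (j1, l1) * v (j2, l2))%:E) \o V) w)%E.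
  apply: (integral_pushforward mVf) => //; by meas.
  by rewrite preimage_setT.
Qed.

(** * Conditional law of the bootstrap root *)

Section BootstrapLaw.
Context {R : realType} {dO : measure_display} {Om : measurableType dO} (P : probability Om R)
  (T p d : nat).
Local Notation q := (p * d)%N.
Context (x : int -> 'I_d -> Om -> R) (e : nat -> Om -> R) (p0 : (0 < p)%N)
  (mx : forall t i, measT (x t i)) (me : forall t, measT (e t)) (K : R -> R) (k : R)
  (Ks : forall u, K (- u) = K u) (bm : bootstrap_multipliers P T K k x e)
  (lasso : 'I_q -> 'I_d -> fspace R ('I_T * 'I_d) -> R) (b : R) (ml : forall j l, measT (lasso j l)).
Local Notation obs w := (observations (T := T) x ^~ w).
Local Notation Btil w := (thresholded (\matrix_(j, l) lasso j l (obs w)) b).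
Context (Q : R.-pker (fspace R ('I_T * 'I_d)) ~> (fspace R ('I_q * 'I_d)))
  (claw : is_cond_law P (observations (T := T) x) (fun jl w => bootstrap_root T (sample_path x w) (Btil w) (e ^~ w) jl.1 jl.2) Q)
  (B : 'I_d -> {set 'I_q}).

Let J := 'I_T.
Let L (v : fspace R ('I_T * 'I_d + 'I_T)%type) : fspace R ('I_q * 'I_d) :=
  fun jl => \sum_(t < T) (if (p <= t.+1 < T)%N
     then cramer_coef B (fun i => v (inl i)) t.+1 jl.1 jl.2 else 0) * v (inr t).

Let mL : measT L.
Proof.
apply: meas_fspace => jl; apply: measurable_sum => t; apply: measurable_funM.
  case: (p <= t.+1 < T)%N; last meas.
  have mi : measT (fun v : fspace R ('I_T * 'I_d + 'I_T)%type =>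
    ((fun i => v (inl i)) : fspace R ('I_T * 'I_d))).
    by apply: meas_fspace => i; exact: meas_eval.
  exact: (measurableT_comp (measurable_cramer_coef B t.+1 jl.1 jl.2) mi).
exact: meas_eval.
Qed.

Let blockdet l (o : fspace R ('I_T * 'I_d)) : R :=
  \det (mxsub (enum_val : 'I_#|B l| -> 'I_q) enum_val (gram T p (observed_path o))).

(** Exact selection and invertible blocks, as an event of the observations; squaring turns a nonzero
    determinant into a strict inequality. *)
Let H : set (fspace R ('I_T * 'I_d)) :=
  [set o | forall lj : 'I_d * 'I_q, (b < `|lasso lj.2 lj.1 o|) = (lj.2 \in B lj.1)] `&`
  [set o | forall l, 0 < blockdet l o ^+ 2].

Let mH : measurable H.
Proof.
apply: measurableI.
  apply: measurable_forall_fin => lj.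
  have mb : measurable [set o | b < `|lasso lj.2 lj.1 o|].
    by apply: measurable_set_lt => //; by meas.
  case: (lj.2 \in B lj.1); first exact: mb.
  have -> : (fun y => (b < `|lasso lj.2 lj.1 y|) = false) = ~` [set o | b < `|lasso lj.2 lj.1 o|].
    by apply/seteqP; split => y /=; [move=> ->|move=> /negP/negbTE].
  exact: measurableC.
apply: measurable_forall_fin => l.
apply: measurable_set_lt => //; apply: measurable_funX; apply: measurable_det => i j.
apply: measurable_ext => [y|]; first by rewrite mxE; reflexivity.
exact: measurable_gram.
Qed.

Let agree w (t : nat) : (0 < t <= T)%N -> sample_path x w t%:Z = observed_path (obs w) t%:Z.
Proof. by move=> tT; rewrite observed_pathE. Qed.

Let coefE w t j l : H (obs w) -> (p <= t < T)%N ->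
  cramer_coef B (obs w) t j l = root_coef T (sample_path x w) B t j l.
Proof.
move=> [_ /(_ l) /= Hl] tT; rewrite (root_coef_eq p0 (@agree w))//; apply: cramer_coefE.
by apply: contraTneq Hl; rewrite /blockdet => ->; rewrite expr0n ltxx.
Qed.

Let DL w : H (obs w) -> (fun jl => bootstrap_root T (sample_path x w) (Btil w) (e ^~ w) jl.1 jl.2) =
  L (fjoin (obs w) (fun t : 'I_T => e t.+1 w)).
Proof.
move=> Hw; apply/funext => jl.
have -> : Btil w = B.
  apply/funext => l; apply/setP => j; rewrite inE mxE.
  by case: Hw => /(_ (l, j)) /=.
rewrite bootstrap_rootE// /L /=.
rewrite -{1}[p]add0n big_addn big_mkord.
have := @sum_window R T p (fun t => root_coef T (sample_path x w) B t jl.1 jl.2 * e t w) p0.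
under [in RHS]eq_bigr do rewrite addnC.
move=> <-; apply: eq_bigr => t _; case: ifP => tT; last by rewrite mul0r.
by rewrite coefE.
Qed.

Definition root_cov w (jl jl' : 'I_q * 'I_d) : R := \sum_(r < T - p) \sum_(r' < T - p)
  root_coef T (sample_path x w) B (p + r)%N jl.1 jl.2 *
  root_coef T (sample_path x w) B (p + r')%N jl'.1 jl'.2 * K ((r%:R - r'%:R) / k).

(** Given data in [H] the root is a linear image of the multipliers with frozen coefficients, hence
    Gaussian. *)
Lemma bootstrap_gaussian : {ae P, forall w, (forall l, Btil w l = B l) ->
  (forall l, mxsub (enum_val : 'I_#|B l| -> 'I_q) enum_val (gram T p (sample_path x w)) \in unitmx) ->
  exists V : Om -> 'I_q * 'I_d -> R, [/\ gaussian_sys P V (root_cov w),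
  forall S : set (fspace R ('I_q * 'I_d)), measurable S -> Q (obs w) S = P [set w' | S (V w')] &
  forall w' jl, jl.1 \notin B jl.2 -> V w' jl = 0]}.
Proof.
have [jn ind e0 eC] := bm.
have mobs ti : measT (observations (T := T) x ti) by exact: mx.
have mez (t : 'I_T) : measT (e t.+1) by exact: me.
have := conditional_law mobs mez ind claw mL mH DL.
apply: filterS => w Hw Bw uw.
have Ho : H (obs w).
  split=> [lj|l] /=.
    by rewrite -Bw inE mxE.
  rewrite /blockdet -(gram_eq p0 (@agree w)); have := uw l; rewrite unitmxE unitfE => dl.
  by rewrite lt_neqAle sqr_ge0 andbT eq_sym sqrf_eq0.
have {}Hw := Hw Ho.
pose C (t t' : 'I_T) : R := K ((t.+1%:R - t'.+1%:R) / k).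
have ge : gaussian_sys P (fun w' (t : 'I_T) => e t.+1 w') C.
  apply: gaussian_sys_normal => //.
  - move=> a; have [mu [s [_ h]]] := jn a; exists mu, s => S mS; rewrite -h//.
    congr (P _); apply/seteqP; split => w' /=; rewrite /lin; congr (S _); apply: eq_bigl => t; by rewrite inE.
  - by move=> t; exact: Ex_expectation (e0 t).
  - by move=> t t'; exact: Ex_expectation (eC t t').
pose M (jl : 'I_q * 'I_d) (t : 'I_T) : R :=
  if (p <= t.+1 < T)%N then cramer_coef B (obs w) t.+1 jl.1 jl.2 else 0.
exists (fun w' jl => lin (M jl) (fun t : 'I_T => e t.+1 w')); split; last 2 first.
- exact: Hw.
- move=> w' jl jlB; apply: big1 => t _; rewrite /M; case: ifP => tT; last by rewrite mul0r.
  rewrite coefE// /root_coef big1 ?mulr0 ?mul0r// => i _.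
  by rewrite partial_inverse_out ?jlB// mul0r.
have := gaussian_map M ge.
congr (gaussian_sys _ _ _); apply/funext => jl; apply/funext => jl'.
pose c0 (u : nat) := root_coef T (sample_path x w) B u jl.1 jl.2.
pose c1 (u : nat) := root_coef T (sample_path x w) B u jl'.1 jl'.2.
transitivity (\sum_(t < T) (if (p <= t.+1 < T)%N then \sum_(t' < T) (if (p <= t'.+1 < T)%N then
  c0 t.+1 * c1 t'.+1 * K ((t.+1%:R - t'.+1%:R) / k) else 0) else 0)).
  apply: eq_bigr => t _; rewrite /M; case: ifP => tT; last by rewrite big1// => t' _; rewrite !mul0r.
  apply: eq_bigr => t' _; case: ifP => t'T; last by rewrite mulr0 mul0r.
  by rewrite !coefE.
rewrite (@sum_window R T p (fun u => \sum_(t' < T) (if (p <= t'.+1 < T)%N then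
  c0 u * c1 t'.+1 * K ((u%:R - t'.+1%:R) / k) else 0)) p0).
apply: eq_bigr => r _.
rewrite (@sum_window R T p (fun u => c0 (p + r)%N * c1 u * K (((p + r)%:R - u%:R) / k)) p0).
apply: eq_bigr => r' _; congr (_ * K (_ / _)).
by rewrite !natrD; ring.
Qed.

End BootstrapLaw.

(** * Union bounds *)

Section UnionBounds.
Context {R : realType} {dO : measure_display} {Om : measurableType dO} (P : probability Om R).

Lemma union_bound (I : eqType) (r : seq I) (A : I -> set Om) (rho : R) :
  (forall i, i \in r -> measurable (A i) /\ (P (A i) <= rho%:E)%E) ->
  exists E, [/\ measurable E, (P E <= ((size r)%:R * rho)%:E)%E & forall i, i \in r -> A i `<=` E].
Proof.
elim: r => [|i r IH] H; first by exists set0; split => //; rewrite measure0 mul0r.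
have [|E [mE PE AE]] := IH; first by move=> j jr; apply: H; rewrite inE jr orbT.
have [mA PA] := H i (mem_head _ _).
exists (A i `|` E); split; first exact: measurableU.
  have PU : (P (A i `|` E) <= P (A i) + P E)%E by exact: measureU2.
  apply: le_trans PU _.
  by rewrite /= -nat1r mulrDl mul1r EFinD; apply: leeD.
move=> j; rewrite inE => /orP[/eqP->|jr]; first exact: subsetUl.
by apply: subset_trans (AE j jr) _; exact: subsetUr.
Qed.

Lemma mom_union (I : finType) (D : {set I}) (f : I -> Om -> R) (q C u : R) : 0 < q -> 0 < u ->
  (forall i, i \in D -> mom P q (f i) C) ->
  exists E, [/\ measurable E, (P E <= (#|D|%:R * u `^ (- q))%:E)%E &
  forall w, ~ E w -> forall i, i \in D -> `|f i w| <= u * C].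
Proof.
move=> q0 u0 H.
have [i|E [mE PE AE]] := @union_bound I (enum D) (fun i => [set w | u * C < `|f i w|]) (u `^ (- q)).
  rewrite mem_enum => iD; split; last exact: mom_markov (H i iD).
  apply: measurable_set_lt => //; apply: measurable_abs; exact: mom_meas (H i iD).
exists E; split => //; first by rewrite -cardE in PE.
move=> w wE i iD; rewrite leNgt; apply/negP => lt; apply: wE.
by apply: (AE i); rewrite ?mem_enum.
Qed.

Lemma ae_event (Q : Om -> Prop) : {ae P, forall w, Q w} ->
  exists E, [/\ measurable E, P E = 0%E & forall w, ~ E w -> Q w].
Proof.
by move=> [E [mE E0 QE]]; exists E; split => // w wE; apply: contrapT => /QE.
Qed.

(** Restricts union bounds to active indices, whose number is linear in the dimension. *)
Definition fibered (I J : finType) (D : {set J}) (B : J -> {set I}) : {set I * J} :=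
  [set jl | (jl.2 \in D) && (jl.1 \in B jl.2)].

Lemma card_fibered (I J : finType) (D : {set J}) (B : J -> {set I}) (s : nat) :
  (forall l, l \in D -> (#|B l| <= s)%N) -> (#|fibered D B| <= #|D| * s)%N.
Proof.
move=> Bs; rewrite -sum1_card.
have -> : (\sum_(jl in fibered D B) 1 = \sum_(l in D) \sum_(j in B l) 1)%N.
  transitivity (\sum_(jl : I * J | (jl.2 \in D) && (jl.1 \in B jl.2)) 1)%N.
    by apply: eq_bigl => jl; rewrite inE.
  by rewrite pair_big_dep/= (reindex (fun jl : I * J => (jl.2, jl.1)))//=; exists (fun lj => (lj.2, lj.1)) => -[].
rewrite -sum_nat_const; apply: leq_sum => l lD; rewrite sum1_card; exact: Bs.
Qed.

End UnionBounds.

(** * Moment bounds for one sample *)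

Section MomentBounds.
Context {R : realType} {dO : measure_display} {Om : measurableType dO} (P : probability Om R)
  (T p d : nat) (x eps : int -> 'I_d -> Om -> R) (K : R -> R) (k : R).
Local Notation q := (p * d)%N.
Local Notation n := (T - p)%N.
Local Notation tm r := ((p + r)%N%:Z).
Local Notation sc := (score (p := p) x eps).
Local Notation kw := (fun r r' : 'I_n => K ((r%:R - r'%:R) / k)).

(** The middle matrix of [Lambda]; [kmean] is its kernel-weighted version, and their difference is
    the bias. *)
Definition mid i l i' l' : R := T%:R^-1 * \sum_(r < n) \sum_(r' < n)
  Ex P (fun w => sc (tm r) i l w * sc (tm r') i' l' w).

Definition kmean j l j' l' : R := T%:R^-1 * (\sum_(r < n) \sum_(r' < n) kw r r' *
  Ex P (fun w => sc (tm r) j l w * sc (tm r') j' l' w)).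

(** Everything that the analysis of a fixed sample takes from the dependence structure, with
    abstract constants. *)
Record moment_bounds (m g1 g2 g3 g4 sg kap bias mb : R) : Prop := MomentBounds {
  _ : forall (r r' : 'I_n) i l i' l', intg P (fun w => sc (tm r) i l w * sc (tm r') i' l' w);
  _ : forall r, \sum_(r' < n) kw r r' <= kap;
  _ : forall i j, mom P (m / 2)
    (fun w => gram T p (sample_path x w) i j - n%:R / T%:R * Sigma0 P p x i j) g1;
  _ : forall j l, mom P (m / 2) (fun w =>
    (T%:R^-1 *: ((Wmx T p (sample_path x w))^T *m response T p (sample_path eps w) l)) j 0) g2;
  _ : forall j l j' l', mom P (m / 4) (fun w => T%:R^-1 * (\sum_(r < n) \sum_(r' < n) kw r r' *
    (sc (tm r) j l w * sc (tm r') j' l' w)) - kmean j l j' l') g3;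
  _ : forall j l, mom P (m / 4) (fun w => T%:R^-1 * \sum_(r < n) sc (tm r) j l w ^+ 2) g4;
  _ : forall i j : 'I_q, mom P (m / 4)
    (fun w => T%:R^-1 * \sum_(r < n) (lagged x (tm r) i w * lagged x (tm r) j w) ^+ 2) g4;
  _ : forall i j, `|Sigma0 P p x i j| <= sg;
  _ : forall j l j' l', `|kmean j l j' l' - mid j l j' l'| <= bias;
  _ : forall j l j' l', `|mid j l j' l'| <= mb }.

End MomentBounds.

Lemma lasso_threshold {R : realType} (a b c : R) : 0 <= a -> a <= b -> 32 * b <= c -> a <= c / 2.
Proof. lra. Qed.

Lemma threshold_in {R : realType} (a b u v : R) : v <= u + a -> a <= b -> 2 * b < v -> b < u.
Proof. lra. Qed.

(** What both conclusions take from the bootstrap. The exceptional event is measurable, so it can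
    serve directly in the outer probabilities. *)
Definition gaussian_approximation {R : realType} {dO : measure_display} {Om : measurableType dO}
    (P : probability Om R) (n d : nat) (B : 'I_d -> {set 'I_n}) (L : 'I_d -> 'I_d -> 'M[R]_n)
    (Q : Om -> set (fspace R ('I_n * 'I_d)) -> \bar R) (del eta : R) : Prop :=
  exists E, [/\ measurable E, (P E <= eta%:E)%E & forall w, ~ E w ->
    exists V C, [/\ gaussian_sys P V C, forall w' jl, jl.1 \notin B jl.2 -> V w' jl = 0,
      forall U : set (fspace R ('I_n * 'I_d)), measurable U -> Q w U = P [set w' | U (V w')] &
      forall jl jl', `|C jl jl' - L jl.2 jl'.2 jl.1 jl'.1| <= del]].

(** * The bootstrap law at a fixed sample size *)

Section FixedSample.
Context {R : realType} {dO : measure_display} {Om : measurableType dO} (P : probability Om R)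
  (T p d : nat).
Local Notation q := (p * d)%N.
Local Notation n := (T - p)%N.
Local Notation tm r := ((p + r)%N%:Z).
Context (x eps : int -> 'I_d -> Om -> R) (A : 'I_p -> 'M[R]_d) (p0 : (0 < p)%N) (pT : (p < T)%N)
  (mx : forall t i, measT (x t i)) (var : is_VAR P x eps A).
Local Notation S := (coef_mx A).
Local Notation Sg := (Sigma0 P p x).
Let B := active_set S.
Context (s : nat) (c : R) (Bs : forall l, (#|B l| <= s)%N) (c0 : 0 < c) (Sgs : Sg^T = Sg)
  (Sgc : coercive Sg c) (e : nat -> Om -> R) (K : R -> R) (k : R) (me : forall t, measT (e t))
  (K0 : forall u, 0 <= K u) (Ks : forall u, K (- u) = K u) (bm : bootstrap_multipliers P T K k x e)
  (lasso : 'I_q -> 'I_d -> fspace R ('I_T * 'I_d) -> R) (lam b : R)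
  (ml : forall j l, measT (lasso j l)).
Local Notation obs w := (observations (T := T) x ^~ w).
Local Notation Stil w := (\matrix_(j, l) lasso j l (obs w)).
Local Notation Btil w := (thresholded (Stil w) b).
Context (las : forall w, is_lasso T (sample_path x w) lam (Stil w))
  (Q : R.-pker (fspace R ('I_T * 'I_d)) ~> (fspace R ('I_q * 'I_d)))
  (claw : is_cond_law P (observations (T := T) x) (fun jl w => bootstrap_root T (sample_path x w) (Btil w) (e ^~ w) jl.1 jl.2) Q).

Local Notation sc := (score (p := p) x eps).
Local Notation kw := (fun r r' : 'I_n => K ((r%:R - r'%:R) / k)).
Local Notation mid := (mid P T x eps).
Local Notation kmean := (kmean P T x eps K k).
Context (m g1 g2 g3 g4 sg kap bias mb u2 u3 u4 : R)
  (bd : moment_bounds P T p x eps K k m g1 g2 g3 g4 sg kap bias mb).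

(** Symmetry of the block inverse moves j' to the first index of the right factor, as in the
    covariance of the root. *)
Lemma LambdaE l l' j j' : Lambda P T x eps S l l' j j' =
  \sum_i \sum_i' partial_inverse (B l) Sg j i * mid i l i' l' * partial_inverse (B l') Sg j' i'.
Proof.
have [isc _ _ _ _ _ _ _ _ _] := bd.
have Sgo l0 : coercive_on (B l0) Sg c by move=> v _; exact: Sgc.
have Fs : (partial_inverse (B l') Sg)^T = partial_inverse (B l') Sg.
  exact: block_inv_sym Sgs (partial_inverse_block (coercive_unitmx c0 (@Sgo l'))).
have Fsym i' : partial_inverse (B l') Sg i' j' = partial_inverse (B l') Sg j' i'.
  by rewrite -{1}Fs mxE.
rewrite /Lambda -/B mxE exchange_big/=; apply: eq_bigr => i' _.
rewrite Fsym [X in X * _]mxE mulr_suml; apply: eq_bigr => i _; congr (_ * _ * _).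
rewrite mxE mxE /mid; congr (_ * _).
transitivity (Ex P (fun w => \sum_(r < n) \sum_(r' < n) sc (tm r) i l w * sc (tm r') i' l' w)).
  rewrite ExE0 /Rintegral unlock; congr fine; apply: eq_integral => w _; congr (_%:E).
  rewrite mxE.
  have E1 r' : ((Wmx T p (sample_path x w))^T *m response T p (sample_path eps w) l *m
    (response T p (sample_path eps w) l')^T) i r' =
    (\sum_(r < n) sc (tm r) i l w) * response T p (sample_path eps w) l' r' 0.
    rewrite mxE big_ord1 [X in _ * X]mxE; congr (_ * _); rewrite mxE; apply: eq_bigr => r _.
    rewrite !mxE /score /lagged; congr (_ * eps _ _ _).
    by rewrite -addn1 PoszD.
  rewrite exchange_big/=; apply: eq_bigr => r' _; rewrite E1 -mulrA mulr_suml; apply: eq_bigr => r _.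
  congr (_ * _); rewrite !mxE /score /lagged mulrC; congr (_ * eps _ _ _).
  by rewrite -addn1 PoszD.
rewrite Ex_sum => [|r _]; last by apply: intg_sum => r' _; exact: isc.
by apply: eq_bigr => r _; rewrite Ex_sum.
Qed.
Context (m0 : 0 < m) (kap0 : 0 <= kap) (u20 : 0 < u2) (u30 : 0 < u3) (u40 : 0 < u4).
(** A threshold u times a moment bound is the deviation allowed off the exceptional events; [th1]
    adds the deficit p/T of the Gram mean. *)
Let th1 := u2 * g1 + p%:R / T%:R * sg.
Let th2 := u2 * g2.
Let th4 := u4 * g4.
Let th5 := u3 * g3 + bias.
Let del := (c / 2)^-1 * s%:R * th2.
Context (lam0 : 0 < lam) (th2lam : th2 <= lam / 2) (th1c : 32 * th1 * s%:R <= c)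
  (lamb : 6 * lam * s%:R / c <= b) (Sb : forall l j, j \in B l -> 2 * b < `|S j l|).

Definition covariance_rate : R := s%:R ^+ 2 * ((c / 2)^-1 ^+ 2 *
       (kap * th4 * (2 * (del * s%:R) + (del * s%:R) ^+ 2) + th5) +
     ((c / 2)^-1 + c^-1) * ((c * (c / 2))^-1 * (s%:R ^+ 2 * th1)) * mb).

(** The comparison of sandwiches, with one pair of outer vectors equal to zero. *)
Lemma Lambda_bound l l' j j' : `|Lambda P T x eps S l l' j j'| <= s%:R ^+ 2 * (c^-1 * c^-1 * mb).
Proof.
have [_ _ _ _ _ _ _ _ _ hmb] := bd.
have Sgo l0 : coercive_on (B l0) Sg c by move=> v _; exact: Sgc.
have bF l0 := partial_inverse_block (coercive_unitmx c0 (@Sgo l0)).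
have ci : 0 <= c^-1 by pos.
rewrite LambdaE -normrN.
have := @sandwich_diff R q (B l) (B l') s (fun=> 0) (partial_inverse (B l) Sg j) (fun=> 0)
  (partial_inverse (B l') Sg j') (fun i i' => mid i l i' l') (fun i i' => mid i l i' l')
  0 c^-1 c^-1 mb 0 (Bs l) (Bs l') (lexx 0) ci ci (le_trans (normr_ge0 _) (hmb j l j' l')).
rewrite expr0n mul0r !add0r big1 => [|i _]; last by rewrite big1// => i' _; rewrite mul0r mul0r.
move=> H; rewrite -[X in `|X|]sub0r; apply: H => //.
- by move=> i iB; rewrite partial_inverse_out ?iB ?orbT.
- by move=> i iB; rewrite partial_inverse_out ?iB ?orbT.
- by move=> i; rewrite normr0.
- by move=> i; rewrite normr0.
- by move=> i; exact: block_inv_bound c0 (@Sgo l) (bF l) _ _.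
- by move=> i; exact: block_inv_bound c0 (@Sgo l') (bF l') _ _.
- by move=> i; rewrite sub0r normrN; exact: block_inv_bound c0 (@Sgo l) (bF l) _ _.
- by move=> i; rewrite sub0r normrN; exact: block_inv_bound c0 (@Sgo l') (bF l') _ _.
- by move=> i i' _ _; rewrite subrr normr0.
Qed.

Let T0 : 0 < T%:R :> R. Proof. by rewrite ltr0n (leq_ltn_trans _ pT). Qed.
Let Da : {set 'I_q * 'I_d} := fibered [set: 'I_d] B.

(** The exceptional events are deviations of the Gram matrix and of the cross moments over all
    indices, deviations of products of scores and of mean squares over active indices only, and two
    null sets. Off them the argument is deterministic. *)
Lemma bootstrap_good_event : gaussian_approximation P B (Lambda P T x eps S) (fun w => Q (obs w))
  covariance_rate
  ((q * q + q * d)%:R * u2 `^ (- (m / 2)) + ((d * s) * (d * s))%:R * u3 `^ (- (m / 4)) +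
  (d * s + d * s * s)%:R * u4 `^ (- (m / 4))).
Proof.
have [isc rows hgram hcross hlong hsq hlp hsg hbias hmb] := bd.
have q20 : 0 < m / 2 by pos.
have q40 : 0 < m / 4 by pos.
have [E1 [mE1 PE1 hE1]] := @mom_union _ _ _ P ('I_q * 'I_q)%type [set: _]
  (fun ij w => gram T p (sample_path x w) ij.1 ij.2 - n%:R / T%:R * Sg ij.1 ij.2) (m / 2) g1 u2
  q20 u20 (fun ij _ => hgram ij.1 ij.2).
have [E2 [mE2 PE2 hE2]] := @mom_union _ _ _ P ('I_q * 'I_d)%type [set: _]
  (fun jl w => (T%:R^-1 *: ((Wmx T p (sample_path x w))^T *m response T p (sample_path eps w) jl.2)) jl.1 0)
  (m / 2) g2 u2 q20 u20 (fun jl _ => hcross jl.1 jl.2).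
have [E3 [mE3 PE3 hE3]] := @mom_union _ _ _ P (('I_q * 'I_d) * ('I_q * 'I_d))%type (finset.setX Da Da)
  _ (m / 4) g3 u3 q40 u30 (fun ab _ => hlong ab.1.1 ab.1.2 ab.2.1 ab.2.2).
have [E4 [mE4 PE4 hE4]] := @mom_union _ _ _ P ('I_q * 'I_d)%type Da
  _ (m / 4) g4 u4 q40 u40 (fun ab _ => hsq ab.1 ab.2).
have [E5 [mE5 PE5 hE5]] := @mom_union _ _ _ P ('I_q * ('I_q * 'I_d))%type
  (fibered Da (fun jl => B jl.2)) _ (m / 4) g4 u4 q40 u40 (fun ab _ => hlp ab.2.1 ab.1).
have ae6 : {ae P, forall w, forall (t : nat) l,
  x t%:Z l w = \sum_k0 S k0 l * lagged x (t%:Z - 1) k0 w + eps t%:Z l w}.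
  by apply: ae_foralln => t; apply: filter_forall => l; exact: var_coord.
have [E6 [mE6 PE6 hE6]] := ae_event ae6.
have [E7 [mE7 PE7 hE7]] := ae_event (bootstrap_gaussian p0 mx me bm ml claw B).
pose E := E1 `|` (E2 `|` (E3 `|` (E4 `|` (E5 `|` (E6 `|` E7))))).
exists E; split.
- by do 6! (apply: measurableU => //).
- have U (F G : set Om) (a a' : R) : measurable F -> measurable G -> (P F <= a%:E)%E ->
  (P G <= a'%:E)%E -> (P (F `|` G) <= (a + a')%:E)%E.
    move=> mF mG Fa Ga; have FG : (P (F `|` G) <= P F + P G)%E by exact: measureU2.
    by apply: le_trans FG _; rewrite EFinD; exact: leeD.
  have PE6' : (P E6 <= 0%:E)%E by rewrite PE6.
  have PE7' : (P E7 <= 0%:E)%E by rewrite PE7.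
  have m7 : measurable (E6 `|` E7) by exact: measurableU.
  have m6 : measurable (E5 `|` (E6 `|` E7)) by exact: measurableU.
  have m5 : measurable (E4 `|` (E5 `|` (E6 `|` E7))) by exact: measurableU.
  have m4 : measurable (E3 `|` (E4 `|` (E5 `|` (E6 `|` E7)))) by exact: measurableU.
  have m3 : measurable (E2 `|` (E3 `|` (E4 `|` (E5 `|` (E6 `|` E7))))) by exact: measurableU.
  have := U _ _ _ _ mE1 m3 PE1 (U _ _ _ _ mE2 m4 PE2 (U _ _ _ _ mE3 m5 PE3 (U _ _ _ _ mE4 m6 PE4
    (U _ _ _ _ mE5 m7 PE5 (U _ _ _ _ mE6 mE7 PE6' PE7'))))).
  move=> h; apply: le_trans h _; rewrite lee_fin !addr0.
  have cDa : (#|Da| <= d * s)%N.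
    by apply: leq_trans (card_fibered (s := s) _) _; rewrite ?cardsT ?card_ord.
  rewrite !cardsT !card_prod !card_ord finset.cardsX.
  have le_scale (N N' : nat) (v : R) : 0 <= v -> (N <= N')%N -> N%:R * v <= N'%:R * v.
    by move=> v0 NN; rewrite ler_wpM2r// ler_nat.
  have c3 : (#|Da| * #|Da| <= (d * s) * (d * s))%N by exact: leq_mul.
  have c5 : (#|fibered Da (fun jl => B jl.2)| <= d * s * s)%N.
    by apply: leq_trans (card_fibered (s := s) _) _ => //; rewrite leq_mul2r cDa orbT.
  have b3 := le_scale _ _ _ (powR_ge0 u3 (- (m / 4))) c3.
  have b4 := le_scale _ _ _ (powR_ge0 u4 (- (m / 4))) cDa.
  have b5 := le_scale _ _ _ (powR_ge0 u4 (- (m / 4))) c5.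
  rewrite !natrD !mulrDl -!addrA; apply: lerD => //; apply: lerD => //.
  by apply: lerD => //; apply: lerD.
move=> w wE.
have [w1 w2 w3 w4] : [/\ ~ E1 w, ~ E2 w, ~ E3 w & ~ E4 w].
  by split => Ew; apply: wE; rewrite /E /=; tauto.
have [w5 w6 w7] : [/\ ~ E5 w, ~ E6 w & ~ E7 w].
  by split => Ew; apply: wE; rewrite /E /=; tauto.
pose X := sample_path x w; pose Ep := sample_path eps w.
have XE (t : int) l : X t l 0 = x t l w by rewrite mxE.
have EE (t : int) l : Ep t l 0 = eps t l w by rewrite mxE.
have zE (t : int) i : zvec p X t i 0 = lagged x t i w by rewrite mxE XE.
have succE (t : nat) : t.+1%:Z = t%:Z + 1 by rewrite -addn1 PoszD.
have fit (t : nat) : (p <= t < T)%N -> forall l,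
  X t.+1%:Z l 0 = \sum_k0 S k0 l * zvec p X t%:Z k0 0 + Ep t.+1%:Z l 0.
  move=> _ l; rewrite XE EE (hE6 w w6 t.+1 l); congr (_ + _); apply: eq_bigr => k0 _.
  by rewrite zE succE addrK.
have grth i j : `|gram T p X i j - Sg i j| <= th1.
  have -> : gram T p X i j - Sg i j = (gram T p X i j - n%:R / T%:R * Sg i j) - p%:R / T%:R * Sg i j.
    rewrite natrB ?(ltnW pT)//; field; by rewrite gt_eqF.
  apply: le_trans (ler_normB _ _) _; apply: lerD; first exact: hE1 w1 (i, j) _.
  by rewrite normrM ger0_norm// ler_wpM2l//; pos.
have cross l j : `|(T%:R^-1 *: ((Wmx T p X)^T *m response T p Ep l)) j 0| <= th2.
  exact: (hE2 w w2 (j, l)).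
have i0 (l : 'I_d) : 'I_q.
  by apply: (@Ordinal _ l); apply: leq_trans (ltn_ord l) _; rewrite leq_pmull.
have th10 (l : 'I_d) : 0 <= th1 by apply: le_trans (grth (i0 l) (i0 l)).
have th1s l : th1 * #|B l|%:R <= th1 * s%:R by rewrite ler_wpM2l ?(th10 l)// ler_nat.
have S0 l j : j \notin B l -> S j l = 0 by rewrite inE negbK => /eqP.
have Sgo l0 : coercive_on (B l0) Sg c by move=> v _; exact: Sgc.
have co l : coercive_on (B l) (gram T p X) (c / 2).
  apply: (coercive_perturb (@Sgo l) (th := th1)) => [i j _ _|]; first exact: grth.
  by apply: (lasso_threshold _ (th1s l)); rewrite ?mulr_ge0 ?(th10 l)// mulrA.
(* The lasso error is at most b, active coefficients exceed 2b and the others vanish: the threshold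
   b separates them. *)
have Bw l : Btil w l = B l.
  have th1B : 32 * th1 * #|B l|%:R <= c.
    by apply: le_trans th1c; rewrite ler_wpM2l ?ler_nat// mulr_ge0// (th10 l).
  have crl j : `|(T%:R^-1 *: ((Wmx T p X)^T *m response T p Ep l)) j 0| <= lam / 2.
    exact: le_trans (cross l j) th2lam.
  have cS j : j \notin B l -> col l S j 0 = 0 by move=> jB; rewrite mxE S0.
  have lo := lasso_oracle lam0 c0 (responseE p0 fit l) cS crl Sgc grth th1B (las w l (col l S)).
  have dist j : `|Stil w j l - S j l| <= b.
    have := lo j; rewrite [col l (Stil w) j 0]mxE [col l S j 0]mxE => h.
    apply: le_trans h _; apply: le_trans lamb; rewrite ler_wpM2r ?invr_ge0 ?(ltW c0)//.
    by rewrite ler_wpM2l ?ler_nat// mulr_ge0// ltW.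
  apply/setP => j; rewrite [LHS]inE; have [jB|jB] := boolP (j \in B l).
    have := Sb jB; have := dist j; have := ler_distD (Stil w j l) 0 (S j l).
    by rewrite !sub0r !normrN; exact: threshold_in.
  by apply/negbTE; rewrite -leNgt; have := dist j; rewrite S0// subr0.
have unit l : mxsub (enum_val : 'I_#|B l| -> 'I_q) enum_val (gram T p X) \in unitmx.
  by apply: coercive_unitmx (@co l); rewrite divr_gt0.
have [V [gV QV V0]] := hE7 w w7 Bw unit.
exists V, (root_cov T x K k B w); split => // jl jl'.
rewrite LambdaE /root_cov.
have tsE (r : 'I_n) i l : true_score X Ep r i l = sc (tm r) i l w.
  by rewrite /true_score zE EE /score -succE.
have lpE (r : 'I_n) i k0 : lag_product X r i k0 = lagged x (tm r) i w * lagged x (tm r) k0 w.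
  by rewrite /lag_product !zE.
have inDa i l : i \in B l -> (i, l) \in Da.
  by move=> iB; rewrite inE /= iB andbT inE.
have w4p : 0 <= th4 by rewrite mulr_ge0// ltW// (mom_ge0 (hsq jl.1 jl.2)).
have w5p : 0 <= th5.
  rewrite addr_ge0 ?mulr_ge0 ?(ltW u30)//; first by rewrite ltW// (mom_ge0 (hlong jl.1 jl.2 jl.1 jl.2)).
  exact: le_trans (hbias jl.1 jl.2 jl.1 jl.2).
apply: (root_covariance_bound p0 _ fit Bs S0 c0 co cross Sgc kap0 _ rows _ grth).
- by rewrite (leq_trans _ pT).
- by move=> r r'; exact: K0.
- move=> r'; apply: le_trans (rows r'); apply: eq_ler.
  by apply: eq_bigr => r _; rewrite -Ks -mulNr opprB.
- exact: w4p.
- exact: w5p.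
- exact: le_trans (hmb jl.1 jl.2 jl.1 jl.2).
- move=> l i iB; have h := hE4 w w4 (i, l) (inDa _ _ iB).
  under eq_bigr do rewrite tsE.
  exact: le_trans (ler_norm _) h.
- move=> l i k0 iB k0B; have kD : (k0, (i, l)) \in fibered Da (fun jl => B jl.2).
    by rewrite inE; apply/andP; split; [exact: inDa|].
  have h := hE5 w w5 _ kD.
  under eq_bigr do rewrite lpE.
  exact: le_trans (ler_norm _) h.
- move=> l l' i i' iB i'B; have kD : ((i, l), (i', l')) \in finset.setX Da Da.
    by rewrite finset.in_setX !inDa.
  have h := hE3 w w3 _ kD.
  have -> : waverage T%:R kw (fun r => true_score X Ep r i l) (fun r => true_score X Ep r i' l') =
    T%:R^-1 * (\sum_(r < n) \sum_(r' < n) kw r r' * (sc (tm r) i l w * sc (tm r') i' l' w)).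
    by congr (_ * _); apply: eq_bigr => r _; apply: eq_bigr => r' _; rewrite !tsE.
  rewrite -(subrKA (kmean i l i' l')); apply: le_trans (ler_normD _ _) _.
  by apply: lerD; [exact: h|exact: hbias].
- by move=> l l' i i' _ _; exact: hmb.
Qed.

End FixedSample.

(** * Constants uniform in the sample size *)

Section ModelConstants.
Context {R : realType} (m C alpha D c : R) (h s : nat) (K : R -> R) (m8 : 8 < m)
  (alpha1 : 1 < alpha) (c0 : 0 < c) (hK : kernel_function K).

Let alpha0 : 0 < alpha. Proof. by rewrite (lt_trans _ alpha1). Qed.

Let AA := D * (3 + 2 `^ alpha) ^+ h.
Let Ce := C + s%:R * (Num.sqrt (C ^+ 2 / c) * C).
Let Z2 := 2 * (C * Ce).
Let DD := Z2 * (Z2 * AA).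

(** The hypotheses at one sample size, with constants that do not depend on it. *)
Record model {dO : measure_display} {Om : measurableType dO} (P : probability Om R)
    (p d : nat) (x eps : int -> 'I_d -> Om -> R) (A : 'I_p -> 'M[R]_d) : Prop := Model {
  model_x : forall t i, measT (x t i);
  model_eps : forall t i, measT (eps t i);
  model_var : is_VAR P x eps A;
  model_noise : exists Sig, white_noise P eps Sig;
  model_stable : forall y : R[i],
    eigenvalue (map_mx (real_complex R) (companion (coef_mx A))) y -> `|y| < 1;
  model_lag : (p <= h)%N;
  model_dim : (0 < d)%N;
  model_srd : exists (e : int -> Om -> R) (dlb : nat -> R) (xx : int -> 'I_d -> fspace R int -> R),
    [/\ forall i, measT (e i), mutually_independent P e, rate_seq alpha D dlb,
        forall t i, good P e m C t dlb (xx t i) &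
        forall t i, {ae P, forall w, x t i w = xx t i (innov e w)}];
  model_coercive : coercive (Sigma0 P p x) c;
  model_sparse : forall l, (#|active_set (coef_mx A) l| <= s)%N }.

(** [G] is chosen before the probability space and the sample size, as the constants in the final
    rates must be. *)
Lemma model_constants : exists2 G : R, 0 < G &
  forall (dO : measure_display) (Om : measurableType dO) (P : probability Om R)
  (p d : nat) (x eps : int -> 'I_d -> Om -> R) (A : 'I_p -> 'M[R]_d) (T : nat) (k : R),
  model P x eps A -> (p < T)%N -> expR 2 <= k ->
  moment_bounds P T p x eps K k m (G / Num.sqrt T%:R) (G / Num.sqrt T%:R) (G * k / Num.sqrt T%:R) G G
  (G * k) (G * vrate alpha k) G.
Proof.
have [CK CK0 hCK] := kernel_sum hK.
have [CV CV0 hCV] := kernel_bias hK alpha1.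
(* For C <= 0 no model exists, because moment bounds are positive; any constant then serves, and
   likewise for D <= 0. *)
have [C0|C0] := ltP 0 C; last first.
  exists 1 => // dO Om P p d x eps A T k [_ _ _ _ _ _ d0 [e [dlb [xx [_ _ _ gx _]]]] _ _].
  by have [_ _ /mom_ge0] := gx 0 (Ordinal d0); rewrite ltNge C0.
have [D0|D0] := ltP 0 D; last first.
  exists 1 => // dO Om P p d x eps A T k [_ _ _ _ _ _ d0 [e [dlb [xx [_ _ /rate_ge0 rd _ _]]]] _ _].
  by rewrite ltNge D0 in rd.
have AA0 : 0 < AA by rewrite mulr_gt0// exprn_gt0// addr_gt0// powR_gt0.
have Ce0 : 0 < Ce by rewrite ltr_wpDr// !mulr_ge0 ?sqrtr_ge0// ltW.
have Z20 : 0 < Z2 by rewrite !mulr_gt0.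
have DD0 : 0 < DD by rewrite !mulr_gt0.
pose a1 := 2 * Num.sqrt (2 * (m / 2 - 1)) * (3 * (C * C * 1) * AA).
pose a2 := 2 * Num.sqrt (2 * (m / 2 - 1)) * (3 * (C * Ce * 1) * AA).
pose a3 := 2 * Num.sqrt (2 * (m / 4 - 1)) * (3 * (Z2 * Z2 * (2 * CK)) * AA).
pose a4 := 1 + Z2 * Z2.
pose a5 := 1 + C * C * (C * C).
pose a6 := C ^+ 2 + C ^+ 2.
pose a7 := DD * (2 * CV).
pose a8 := DD * (2 * (1 + (alpha - 1)^-1)).
pose a9 := 2 * CK.
have p1 : 0 <= a1 by rewrite !mulr_ge0 ?sqrtr_ge0// ltW.
have p2 : 0 <= a2 by rewrite !mulr_ge0 ?sqrtr_ge0// ltW.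
have p3 : 0 <= a3 by rewrite !mulr_ge0 ?sqrtr_ge0// ltW.
have p4 : 1 <= a4 by rewrite lerDl mulr_ge0 ?ltW.
have p5 : 0 <= a5 by rewrite addr_ge0// !mulr_ge0 ?ltW.
have p6 : 0 <= a6 by rewrite addr_ge0 ?sqr_ge0.
have p7 : 0 <= a7 by rewrite !mulr_ge0 ?ltW.
have al : 0 < alpha - 1 by rewrite subr_gt0.
have p8 : 0 <= a8 by rewrite mulr_ge0 ?(ltW DD0)// mulr_ge0// addr_ge0// invr_ge0 ltW.
have p9 : 0 <= a9 by rewrite mulr_ge0 ?ltW.
pose G := a1 + a2 + a3 + a4 + a5 + a6 + a7 + a8 + a9.
have [G1 G2 G3] : [/\ a1 <= G, a2 <= G & a3 <= G] by split; rewrite /G; lra.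
have [G4 G5 G6] : [/\ a4 <= G, a5 <= G & a6 <= G] by split; rewrite /G; lra.
have [G7 G8 G9] : [/\ a7 <= G, a8 <= G & a9 <= G] by split; rewrite /G; lra.
have G0 : 0 < G by rewrite /G; lra.
have [q1 q2 q3] := moment_orders m8.
have m20 : 0 <= m / 2 by apply: le_trans q2.
have m40 : 0 <= m / 4 by apply: le_trans q3.
clearbody G; exists G => // dO Om P p d x eps A T k [mx meps var [Sig wn] stable ph d0 [e [dlb [xx [me ie rd0 gx xE]]]] coer sB] pT k2.
pose n := (T - p)%N; pose kw (r r' : 'I_n) := K ((r%:R - r'%:R) / k).
have k1 : 1 <= k by apply: le_trans k2; rewrite -expR0 ler_expR.
have k0 : 0 < k by apply: lt_le_trans k1.
have K0 u : 0 <= K u by exact: kernel_ge0.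
have Ks u : K (- u) = K u by exact: kernel_sym.
have T0 : 0 < T%:R :> R by rewrite ltr0n (leq_ltn_trans _ pT).
have sT0 : 0 <= (Num.sqrt T%:R)^-1 :> R by rewrite invr_ge0 sqrtr_ge0.
have kwE (r r' : 'I_n) : kw r r' = K (`|r%:Z - r'%:Z|%N%:R / k).
  rewrite /kw -(kernel_abs hK) normrM [in LHS](gtr0_norm (x := k^-1)) ?invr_gt0//; congr (K (_ / _)).
  by rewrite natr_absz intr_norm rmorphB.
have rows r : \sum_(r' < n) kw r r' <= a9 * k.
  under eq_bigr do rewrite kwE.
  apply: le_trans (sum_dist_le (f := fun u => K (u%:R / k)) _ (ltn_ord r)) _ => //.
  by rewrite /a9 -mulrA ler_wpM2l// hCK.
split.
- move=> r r' i l i' l'; apply: sqiM; exact: (score_sqi me ie mx meps var wn stable m8 alpha0 ph rd0 gx xE c0 coer sB d0).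
- by move=> r; apply: le_trans (rows r) _; rewrite ler_wpM2r// ltW.
- move=> i j; apply: mom_wle m20 _ (gram_mom me ie mx meps var wn stable m8 alpha0 ph rd0 gx xE pT i j).
  by rewrite ler_wpM2r.
- move=> j l; apply: mom_wle m20 _ (cross_mom me ie mx meps var wn stable m8 alpha0 ph rd0 gx xE c0 coer sB d0 pT j l).
  by rewrite ler_wpM2r.
- move=> j l j' l'; have kap0 : 0 < a9 * k by rewrite !mulr_gt0.
  apply: mom_wle m40 _ (longrun_mom me ie mx meps var wn stable m8 alpha0 ph rd0 gx xE c0 coer sB d0 pT
    j l j' l' K0 Ks kap0 rows).
  rewrite ler_wpM2r//; apply: (via (a3 * k)); last by rewrite ler_wpM2r// ltW.
  by rewrite le_eqVlt /a3 /a9 /Z2 /Ce /AA; apply/orP; left; apply/eqP; ring.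
- move=> j l; apply: mom_wle m40 _ (score_sqr_mom me ie mx meps var wn stable m8 alpha0 ph rd0 gx xE c0 coer sB d0 pT j l).
  exact: G4.
- move=> i j; apply: mom_wle m40 _ (lagged_sqr_mom mx m8 gx xE d0 pT i j).
  exact: G5.
- move=> i j; apply: le_trans G6.
  exact: (Sigma0_bound mx meps var wn stable m8 gx xE).
- move=> j l j' l'; have f0 u : 0 <= `|K (u%:R / k) - 1| by [].
  have := longrun_cov_bound me ie mx meps var wn stable m8 alpha0 ph rd0 gx xE c0 coer sB d0 pT
    j l j' l' f0 (hCV k n k2).
  rewrite -/Ce -/Z2 -/AA -/DD => H.
  have v0 : 0 <= vrate alpha k.
    rewrite -(pmulr_rge0 _ CV0); apply: le_trans (hCV k n k2); apply: sumr_ge0 => u _.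
    by rewrite mulr_ge0// powR_ge0.
  apply: (via (a7 * vrate alpha k)); last by rewrite ler_wpM2r.
  apply: (via (DD * (2 * (CV * vrate alpha k)))); last by rewrite /a7 !mulrA.
  apply: le_trans H; rewrite /kmean /mid -mulrBr normrM ger0_norm ?invr_ge0 ?(ltW T0)//.
  rewrite ler_wpM2l ?invr_ge0 ?(ltW T0)// -sumrB.
  apply: le_trans (ler_norm_sum _ _ _) _; apply: ler_sum => r _; rewrite -sumrB.
  apply: le_trans (ler_norm_sum _ _ _) _; apply: ler_sum => r' _.
  by rewrite -[X in _ - X]mul1r -mulrBl normrM -kwE.
- move=> j l j' l'; have f0 (u : nat) : 0 <= (1 : R) by [].
  have hs : \sum_(u < n) 1 * (1 + u%:R) `^ (- alpha) <= 1 + (alpha - 1)^-1 :> R.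
    have n0 : (0 < n)%N by rewrite subn_gt0.
    rewrite -(big_mkord xpredT (fun u => 1 * (1 + u%:R) `^ (- alpha))) big_ltn// addr0 powR1 mulr1.
    rewrite lerD2l; under eq_bigr do rewrite mul1r.
    by rewrite -(prednK n0); exact: sum_head_pow_gt.
  have := longrun_cov_bound me ie mx meps var wn stable m8 alpha0 ph rd0 gx xE c0 coer sB d0 pT
    j l j' l' f0 hs.
  rewrite -/Ce -/Z2 -/AA -/DD => H; apply: le_trans G8; apply: le_trans H.
  rewrite /mid normrM ger0_norm ?invr_ge0 ?(ltW T0)// ler_wpM2l ?invr_ge0 ?(ltW T0)//.
  apply: le_trans (ler_norm_sum _ _ _) _; apply: ler_sum => r _.
  apply: le_trans (ler_norm_sum _ _ _) _; apply: ler_sum => r' _.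
  by rewrite mul1r.
Qed.

End ModelConstants.

Lemma bigO_bound {R : realType} (f g : nat -> R) : f =O_\oo g ->
  exists2 C : R, 0 < C & \forall T \near \oo, `|f T| <= C * `|g T|.
Proof. by move=> /eqO_exP[C C0 H]; exists C. Qed.

Lemma Sigma0_sym {R : realType} {dO : measure_display} {Om : measurableType dO}
  (P : probability Om R) (p d : nat) (x : int -> 'I_d -> Om -> R) : (Sigma0 P p x)^T = Sigma0 P p x.
Proof.
apply/matrixP => i j; rewrite mxE /Sigma0 mxE [RHS]mxE; congr (fine (expectation _ _)).
by apply/funext => w; rewrite !mxE !big_ord1 !mxE mulrC.
Qed.

(** * Arithmetic of the rates *)

Section RateArithmetic.
Context {R : realType}.

Lemma near_pow_small (M g eps : R) : 0 < g -> 0 < eps -> 0 <= M ->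
  \forall T \near \oo, M * (T%:R : R) `^ (- g) <= eps.
Proof.
move=> g0 eps0 M0; near=> T.
have T0 : 0 < T%:R :> R by rewrite ltr0n; near: T; exact: nbhs_infty_gt.
have TM : (M / eps) `^ (g^-1) <= T%:R by near: T; exact: nbhs_infty_ger.
rewrite powRN ler_pdivrMr ?powR_gt0// mulrC -ler_pdivrMr//.
have Me : 0 <= M / eps by pos.
have gn : g != 0 by rewrite gt_eqF.
have -> : M / eps = ((M / eps) `^ g^-1) `^ g by rewrite -powRrM mulVf// powRr1.
by apply: ge0_ler_powR; rewrite ?nnegrE ?powR_ge0 ?(ltW g0).
Unshelve. all: by end_near.
Qed.

(** Here a stands for T^ad, the growth of d: tail probabilities 1/(L a^2) and 1/(L a) cancel the
    numbers of indices and leave a constant over L. *)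
Lemma event_probability (h s d p : nat) (Cd a L eta : R) : (p <= h)%N -> d%:R <= Cd * a ->
  0 < a -> 0 < L ->
  (h%:R ^+ 2 + h%:R) * Cd ^+ 2 + s%:R ^+ 2 * Cd ^+ 2 + (s%:R + s%:R ^+ 2) * Cd <= eta * L ->
  ((p * d) * (p * d) + p * d * d)%:R * (L * a ^+ 2)^-1 + ((d * s) * (d * s))%:R * (L * a ^+ 2)^-1 +
  (d * s + d * s * s)%:R * (L * a)^-1 <= eta.
Proof.
move=> ph dC a0 L0 H.
have d2 : d%:R ^+ 2 <= Cd ^+ 2 * a ^+ 2 :> R.
  by rewrite -exprMn !expr2; apply: ler_pM.
have phR : p%:R <= h%:R :> R by rewrite ler_nat.
have ph2 : p%:R ^+ 2 + p%:R <= h%:R ^+ 2 + h%:R :> R by apply: lerD => //; rewrite !expr2 ler_pM.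
have aL (x y z : R) : 0 < z -> x <= y * z -> x * (L * z)^-1 <= y / L.
  move=> z0 xy; rewrite invfM mulrCA mulrC ler_wpM2r ?invr_ge0 ?(ltW L0)//.
  by rewrite ler_pdivrMr.
have t1 : ((p * d) * (p * d) + p * d * d)%:R * (L * a ^+ 2)^-1 <= (h%:R ^+ 2 + h%:R) * Cd ^+ 2 / L.
  apply: aL; first pos.
  have -> : (p * d * (p * d) + p * d * d)%:R = (p%:R ^+ 2 + p%:R) * d%:R ^+ 2 :> R.
    by rewrite natrD !natrM; ring.
  by rewrite -mulrA; apply: ler_pM; rewrite//; pos.
have t2 : ((d * s) * (d * s))%:R * (L * a ^+ 2)^-1 <= s%:R ^+ 2 * Cd ^+ 2 / L.
  apply: aL; first pos.
  have -> : (d * s * (d * s))%:R = s%:R ^+ 2 * d%:R ^+ 2 :> R by rewrite !natrM; ring.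
  by rewrite -mulrA ler_wpM2l//; pos.
have t3 : (d * s + d * s * s)%:R * (L * a)^-1 <= (s%:R + s%:R ^+ 2) * Cd / L.
  apply: aL => //.
  have -> : (d * s + d * s * s)%:R = (s%:R + s%:R ^+ 2) * d%:R :> R by rewrite natrD !natrM; ring.
  by rewrite -mulrA ler_wpM2l// addr_ge0//; pos.
apply: le_trans (lerD (lerD t1 t2) t3) _.
by rewrite -[X in X + _ <= _]mulrDl -mulrDl ler_pdivrMr.
Qed.

Lemma powR_ratio (t u w : R) : 0 < t -> t `^ u / t `^ w = t `^ (u - w).
Proof. by move=> t0; rewrite -powRN -powRD// (gt_eqF t0) implybT. Qed.

Lemma powR_ge_one (y q : R) : 1 <= y -> 0 <= q -> 1 <= y `^ q.
Proof. by move=> y1 q0; rewrite -[leLHS](powRr0 y) ler_powR. Qed.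

End RateArithmetic.

(** As u2 is at most the square root of T, products of errors are dominated by single ones; as k, u2
    and u4 are at least 1, every term reduces to v, k u2 u4 / sqrt T or k u3 / sqrt T. *)
Lemma covariance_rate_bound {R : realType} (G c : R) (s h : nat) : 0 < G -> 0 < c ->
  exists2 M : R, 0 < M & forall (T p : nat) (k v u2 u3 u4 : R),
  (p <= h)%N -> (0 < T)%N -> 1 <= k -> 0 <= v -> 1 <= u2 -> u2 <= Num.sqrt T%:R -> 0 <= u3 ->
  1 <= u4 ->
  covariance_rate T p s c (G / Num.sqrt T%:R) (G / Num.sqrt T%:R) (G * k / Num.sqrt T%:R) G G
  (G * k) (G * v) G u2 u3 u4 <= M * (v + k * (u2 * u4 + u3) / Num.sqrt T%:R).
Proof.
move=> G0 c0.
pose s' : R := s%:R; pose A2 := (c / 2)^-1 ^+ 2; pose a := (c / 2)^-1 * s' * G * s'.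
pose B1 := ((c / 2)^-1 + c^-1) * ((c * (c / 2))^-1 * s' ^+ 2).
have A20 : 0 <= A2 by exact: sqr_ge0.
have a0 : 0 <= a by rewrite !mulr_ge0//; pos.
have B10 : 0 <= B1.
  by rewrite !mulr_ge0//; pos.
pose M := s' ^+ 2 * (A2 * (G * G * (2 * a + a ^+ 2) + G) + B1 * ((1 + h%:R) * G) * G).
have G0' := ltW G0.
have h1 : 0 <= (1 + h%:R) * G by pos.
have GGa : 0 <= G * G * (2 * a + a ^+ 2) by pos.
have Ma : 0 <= A2 * (G * G * (2 * a + a ^+ 2) + G) by pos.
have Mb : 0 <= B1 * ((1 + h%:R) * G) * G by pos.
have Mge : 0 <= M by apply: mulr_ge0; [exact: sqr_ge0|exact: addr_ge0].
exists (M + 1); first by rewrite ltr_wpDl.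
move=> T p k v u2 u3 u4 ph T0 k1 v0 u21 u2T u30 u41.
have k0 : 0 <= k by apply: le_trans k1.
have u20 : 0 <= u2 by apply: le_trans u21.
have u40 : 0 <= u4 by apply: le_trans u41.
have T0' : 0 < T%:R :> R by rewrite ltr0n.
pose r : R := (Num.sqrt T%:R)^-1.
have sT : 0 < Num.sqrt T%:R :> R by pos.
have r0 : 0 <= r by rewrite invr_ge0 ltW.
have r2 : T%:R^-1 = r * r by rewrite /r -invfM -expr2 sqr_sqrtr// ltW.
have u2r : u2 * r <= 1 by rewrite ler_pdivrMr// mul1r.
have r1 : r <= u2 * r by rewrite ler_peMl.
have rr : r * r <= u2 * r.
  by rewrite (le_trans _ r1)// ler_piMl// (le_trans r1 u2r).
pose X := k * (u2 * u4) * r; pose Y := k * u3 * r.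
have uX : u2 * r <= X.
  rewrite /X ler_wpM2r//; apply: (via (1 * (u2 * 1))); first by rewrite mul1r mulr1.
  by apply: ler_pM; rewrite ?mulr_ge0// ler_wpM2l.
have X0 : 0 <= X by apply: le_trans uX; rewrite mulr_ge0.
have Y0 : 0 <= Y by rewrite !mulr_ge0.
have th1X : u2 * (G / Num.sqrt T%:R) + p%:R / T%:R * G <= (1 + h%:R) * G * X.
  rewrite -/r r2; have -> : (1 + h%:R) * G * X = G * X + h%:R * (G * X) by ring.
  apply: lerD; first by rewrite mulrCA ler_wpM2l.
  rewrite -mulrA; apply: ler_pM => //; rewrite ?mulr_ge0// ?ler_nat//.
  by rewrite mulrC ler_wpM2l// (le_trans rr).
have delE : (c / 2)^-1 * s%:R * (u2 * (G / Num.sqrt T%:R)) * s%:R = a * (u2 * r).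
  by rewrite /a /s' -/r; ring.
have ur0 : 0 <= u2 * r by pos.
have sq : 2 * (a * (u2 * r)) + (a * (u2 * r)) ^+ 2 <= (2 * a + a ^+ 2) * (u2 * r).
  have -> : (2 * a + a ^+ 2) * (u2 * r) = 2 * (a * (u2 * r)) + a ^+ 2 * (u2 * r) by ring.
  rewrite lerD2l exprMn; apply: ler_wpM2l; first exact: sqr_ge0.
  by rewrite expr2 ler_piMl.
have goalE : v + k * (u2 * u4 + u3) / Num.sqrt T%:R = v + X + Y by rewrite /X /Y -/r; ring.
rewrite goalE /covariance_rate delE.
apply: (via (M * (v + X + Y))); last first.
  by rewrite ler_wpM2r ?lerDl// !addr_ge0.
rewrite /M -[leRHS]mulrA; apply: ler_wpM2l; first exact: sqr_ge0.
rewrite [leRHS]mulrDl; apply: lerD.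
  rewrite -[leRHS]mulrA; apply: ler_wpM2l => //.
  apply: (via (G * G * (2 * a + a ^+ 2) * X + (G * Y + G * v))).
    apply: lerD; last first.
      by rewrite lerD2r /Y -/r; apply: eq_ler; ring.
    have -> : G * G * (2 * a + a ^+ 2) * X = G * k * (u4 * G) * ((2 * a + a ^+ 2) * (u2 * r)).
      by rewrite /X; ring.
    apply: ler_wpM2l sq; by pos.
  rewrite [leRHS]mulrDl; have -> : G * (v + X + Y) = (G * Y + G * v) + G * X by ring.
  apply: lerD; last by rewrite lerDl mulr_ge0.
  apply: ler_wpM2l => //.
  by rewrite addrAC addrC lerDl addr_ge0.
have -> : ((c / 2)^-1 + c^-1) * ((c * (c / 2))^-1 * (s%:R ^+ 2 * (u2 * (G / Num.sqrt T%:R) + p%:R / T%:R * G))) * G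
  = B1 * (u2 * (G / Num.sqrt T%:R) + p%:R / T%:R * G) * G by rewrite /B1 /s'; ring.
rewrite [leRHS]mulrAC; apply: ler_wpM2r => //; rewrite -[leRHS]mulrA; apply: ler_wpM2l => //.
apply: le_trans th1X _.
apply: ler_wpM2l => //.
by rewrite addrAC addrC lerDl addr_ge0.
Qed.

(** * The sequence of models *)

Section Families.
Context {R : realType} {disp : nat -> measure_display} {Om : forall T, measurableType (disp T)}
  (P : forall T, probability (Om T) R) (p d : nat -> nat)
  (x eps : forall T, int -> 'I_(d T) -> {RV (P T) >-> R}) (A : forall T, 'I_(p T) -> 'M[R]_(d T))
  (Sig : forall T, 'M[R]_(d T)) (m alpha ad clam alam c : R) (lam b k : nat -> R) (K : R -> R)
  (lasso : forall T, 'I_(p T * d T) -> 'I_(d T) -> {mfun fspace R ('I_T * 'I_(d T)) >-> R})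
  (e : forall T, nat -> {RV (P T) >-> R})
  (Q : forall T, R.-pker (fspace R ('I_T * 'I_(d T))) ~> (fspace R ('I_(p T * d T) * 'I_(d T)))).
Arguments A T : clear implicits.
Arguments x T : clear implicits.
Arguments eps T : clear implicits.
Arguments Sig T : clear implicits.
Arguments lasso T : clear implicits.
Arguments e T : clear implicits.
Arguments Q T : clear implicits.
Local Notation S T := (coef_mx (A T)).
Local Notation B T := (active_set (S T)).
Local Notation obs T w := (observations (T := T) (x T) ^~ w).
Local Notation Stil T w := (\matrix_(j, l) lasso T j l (obs T w)).
Local Notation Btil T w := (thresholded (Stil T w) (b T)).
Local Notation Lam T := (Lambda (P T) T (x T) (eps T) (S T)).
Context (var : forall T, is_VAR (P T) (x T) (eps T) (A T))
  (wn : forall T, white_noise (P T) (eps T) (Sig T))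
  (las : forall T w, is_lasso T (sample_path (x T) w) (lam T) (Stil T w))
  (bm : forall T, bootstrap_multipliers (P T) T K (k T) (x T) (e T))
  (claw : forall T, is_cond_law (P T) (observations (T := T) (x T)) (fun jl w => bootstrap_root T (sample_path (x T) w) (Btil T w) (e T ^~ w) jl.1 jl.2) (Q T))
  (m8 : 8 < m) (alpha1 : 1 < alpha) (srd : short_range_dependent P x m alpha)
  (pO : (fun T => (p T)%:R : R) =O_\oo (fun=> 1 : R))
  (dO : (fun T => (d T)%:R : R) =O_\oo (fun T => T%:R `^ ad)) (ad0 : 0 <= ad) (clam0 : 0 < clam)
  (alam0 : 0 < alam) (alam1 : alam < 2^-1 - 4 * ad / m)
  (lamE : forall T, lam T = clam * T%:R `^ (- alam)) (blam : (fun T => b T / lam T) @ \oo --> +oo)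
  (BO : (fun T => (\max_l #|B T l|)%:R : R) =O_\oo (fun=> 1 : R))
  (B0 : forall T, (0 < \max_l #|B T l|)%N) (Sb : forall T l j, j \in B T l -> 2 * b T < `|S T j l|)
  (stable : forall T (z : R[i]), eigenvalue (map_mx (real_complex R) (companion (S T))) z -> `|z| < 1)
  (c0 : 0 < c) (eig : forall T a, eigenvalue (Sigma0 (P T) (p T) (x T)) a -> c < a)
  (hK : kernel_function K) (koo : k @ \oo --> +oo).

Lemma active_pair T : exists jl : 'I_(p T * d T) * 'I_(d T), jl.1 \in B T jl.2.
Proof.
have := B0 T; rewrite lt0n => /eqP h.
apply: contrapT => none; apply: h; apply/eqP; rewrite -leqn0; apply/bigmax_leqP => l _.
rewrite leqn0 cards_eq0; apply/eqP/setP => j; rewrite [RHS]inE; apply/negbTE/negP => jB.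
by apply: none; exists (j, l).
Qed.

Lemma dim_gt0 T : (0 < p T)%N /\ (0 < d T)%N.
Proof.
have [[j l] _] := active_pair T; split; last exact: leq_ltn_trans (ltn_ord l).
by have := leq_ltn_trans (leq0n j) (ltn_ord j); rewrite muln_gt0 => /andP[].
Qed.

Lemma nat_bound (f : nat -> nat) : (fun T => (f T)%:R : R) =O_\oo (fun=> 1 : R) ->
  exists h : nat, \forall T \near \oo, (f T <= h)%N.
Proof.
move=> /bigO_bound[C C0 H]; exists (Num.truncn C).
apply: filterS H => T; rewrite normr1 mulr1 ger0_norm// => fC.
by rewrite truncn_ge_nat// ltW.
Qed.

Lemma family_model : exists C D h s, \forall T \near \oo,
  model m C alpha D c h s (P T) (x T) (eps T) (A T).
Proof.
have [e0 [g [ind xg x0 [C1 nC1] [C2 nC2]]]] := srd.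
have [h nh] := nat_bound pO; have [s ns] := nat_bound BO.
pose C := Num.max 1 C1; exists C, (C2 + 1), h, s.
near=> T.
have [p0 d0] := dim_gt0 T.
have ph : (p T <= h)%N by near: T.
have bs : (\max_l #|B T l| <= s)%N by near: T.
have hC1 : forall t i, ('N[P T]_(m%:E)[EFin \o x T t i] <= C1%:E)%E by near: T.
have hC2 : forall k : nat, (((1 + k%:R) `^ alpha)%:E *
  \sum_(k <= j <oo) coupling_defect P (x T) (e0 T) (g T) m j <= C2%:E)%E by near: T.
have a0 : 0 < alpha by rewrite (lt_trans _ alpha1).
have m0 : 0 < m by rewrite (lt_trans _ m8).
have [dl [rd dd]] := defect_rate d0 a0 hC2.
split => //.
- by exists (Sig T); exact: wn.
- exact: stable.
- exists (e0 T), dl, (fun t i => causal t (g T t i)); split => //.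
  move=> t i; apply: (@causal_good _ _ _ _ _ _ _ _ _ _ (x T t i)) => //.
  + by rewrite le_max lexx.
  + by case: rd.
  + by apply: le_trans (hC1 t i) _; rewrite lee_fin le_max lexx orbT.
- apply: eigenvalue_coercive; first exact: Sigma0_sym.
  exact: eig.
- by move=> l; apply: leq_trans bs; exact: leq_bigmax.
Unshelve. all: by end_near.
Qed.

Let v T := vrate alpha (k T).
Let rate T := v T + k T * T%:R `^ (8 * ad / m - 2^-1).

(** With a = T^ad the thresholds are u2 = (L a^2)^(2/m), u3 = (L a^2)^(4/m) and u4 = (L a)^(4/m):
    the union bounds cost a constant over L, and both u2 u4 and u3 are of order T^(8 ad/m). *)
Lemma key_event : exists2 Lb : R, 0 < Lb & forall eta : R, 0 < eta -> exists2 M : R, 0 < M &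
  \forall T \near \oo, [/\ 0 <= rate T, forall l l' j j', `|Lam T l l' j j'| <= Lb &
  gaussian_approximation (P T) (B T) (Lam T) (fun w => Q T (obs T w)) (M * rate T) eta].
Proof.
have [C [D [h [s nmodel]]]] := family_model.
have [G G0 HG] := @model_constants R m C alpha D c h s K m8 alpha1 c0 hK.
have [Cd Cd0 nd] := bigO_bound dO.
have [M0 M00 HM0] := @covariance_rate_bound R G c s h G0 c0.
have m0 : 0 < m by rewrite (lt_trans _ m8).
have [CV CV0 hCV] := kernel_bias hK alpha1.
exists (s%:R ^+ 2 * (c^-1 * c^-1 * G) + 1).
  by rewrite ltr_wpDl// mulr_ge0 ?sqr_ge0// !mulr_ge0 ?invr_ge0 ?(ltW c0) ?(ltW G0).
move=> eta eta0.
pose N0 := (h%:R ^+ 2 + h%:R) * Cd ^+ 2 + s%:R ^+ 2 * Cd ^+ 2 + (s%:R + s%:R ^+ 2) * Cd.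
have N00 : 0 <= N0.
  by rewrite /N0 !addr_ge0// mulr_ge0 ?sqr_ge0 ?addr_ge0 ?sqr_ge0// ltW.
(* This L makes the total probability of the exceptional events at most eta. *)
pose L := N0 / eta + 1.
have L1 : 1 <= L by rewrite lerDr divr_ge0// ltW.
have L0 : 0 < L by apply: lt_le_trans L1.
have NL : N0 <= eta * L by rewrite /L mulrDr mulr1 mulrCA divff ?gt_eqF// mulr1 lerDl ltW.
pose L2 := L `^ (2 / m); pose L4 := L `^ (4 / m).
have L20 : 0 < L2 by exact: powR_gt0.
have L40 : 0 < L4 by exact: powR_gt0.
exists (M0 * (1 + L2 * L4 + L4)); first by rewrite mulr_gt0// ltr_wpDr ?addr_gt0 ?mulr_gt0// ltW.
(* The deviation u2 / sqrt T is L2 T^(-g1); the upper bound on [alam] says that it is of smaller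
   order than the penalty. *)
pose g1 := 2^-1 - 4 * ad / m.
have g10 : 0 < g1 by exact: lt_trans alam1.
have g2 : 0 < g1 - alam by rewrite subr_gt0.
have LG0 : 0 <= L2 * G by rewrite mulr_ge0// ltW.
near=> T.
have T0n : (0 < T)%N by near: T; exact: nbhs_infty_gt.
have hT : (h < T)%N by near: T; exact: nbhs_infty_gt.
have md : model m C alpha D c h s (P T) (x T) (eps T) (A T) by near: T.
have dC : `|(d T)%:R| <= Cd * `|T%:R `^ ad| :> R by near: T; exact: nd.
have k2 : expR 2 <= k T by near: T; move/cvgryPge: koo; exact.
have f5 : L2 * G * T%:R `^ (- (g1 - alam)) <= clam / 2.
  by near: T; apply: near_pow_small => //; rewrite divr_gt0.
have f6 : 32 * s%:R * (L2 * G) * T%:R `^ (- g1) <= c / 2.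
  by near: T; apply: near_pow_small => //; [exact: divr_gt0|exact: mulr_ge0 (mulr_ge0 _ _) LG0].
have f6' : 32 * s%:R * (h%:R * G) * T%:R `^ (- 1) <= c / 2.
  near: T; apply: near_pow_small => //; first exact: divr_gt0.
  by apply: mulr_ge0; rewrite mulr_ge0// ltW.
have f7 : 6 * s%:R / c <= b T / lam T by near: T; move/cvgryPge: blam; exact.
have f8 : L2 * T%:R `^ (- g1) <= 1 by near: T; apply: near_pow_small => //; exact: ltW.
have [p0 d0] := dim_gt0 T.
have ph : (p T <= h)%N by case: md.
have pT : (p T < T)%N by exact: leq_ltn_trans hT.
have t0 : 0 < T%:R :> R by rewrite ltr0n.
have t1 : 1 <= T%:R :> R by rewrite ler1n.
set t : R := T%:R in dC f5 f6 f6' f8 t0 t1 *.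
have lamT : lam T = clam * t `^ (- alam) by exact: lamE.
have lam0 : 0 < lam T by rewrite lamT mulr_gt0// powR_gt0.
have k1 : 1 <= k T by apply: le_trans k2; rewrite -expR0 ler_expR.
have v0 : 0 <= v T.
  rewrite -(pmulr_rge0 _ CV0); apply: le_trans (hCV (k T) 0%N k2); apply: sumr_ge0 => u _.
  by rewrite mulr_ge0// powR_ge0.
have rate0 : 0 <= rate T by rewrite addr_ge0// mulr_ge0 ?powR_ge0// (le_trans _ k1).
have bd := HG _ _ (P T) (p T) (d T) (x T) (eps T) (A T) T (k T) md pT k2.
pose a := t `^ ad.
have a0 : 0 < a by exact: powR_gt0.
have a1 : 1 <= a by exact: powR_ge_one.
have La1 : 1 <= L * a by rewrite -[leLHS]mulr1 ler_pM.
have La2 : 1 <= L * a ^+ 2 by rewrite -[leLHS]mulr1 ler_pM// exprn_ege1.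
pose u2 := (L * a ^+ 2) `^ (2 / m); pose u3 := (L * a ^+ 2) `^ (4 / m); pose u4 := (L * a) `^ (4 / m).
have m2 : 0 <= 2 / m by rewrite divr_ge0// ltW.
have m4 : 0 <= 4 / m by rewrite divr_ge0// ltW.
have a2E : a ^+ 2 = t `^ (ad * 2) by rewrite powRrM -/a powR_mulrn// ltW.
have u2E : u2 = L2 * t `^ (4 * ad / m).
  rewrite /u2 a2E powRM ?powR_ge0 ?(ltW L0)// -powRrM; congr (_ * _ `^ _).
  by rewrite mulrCA mulrC; field; rewrite gt_eqF.
have u3E : u3 = L4 * t `^ (8 * ad / m).
  rewrite /u3 a2E powRM ?powR_ge0 ?(ltW L0)// -powRrM; congr (_ * _ `^ _).
  by field; rewrite gt_eqF.
have u4E : u4 = L4 * t `^ (4 * ad / m).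
  rewrite /u4 powRM ?(ltW a0) ?(ltW L0)// /a -powRrM; congr (_ * _ `^ _).
  by field; rewrite gt_eqF.
have u21 : 1 <= u2 by exact: powR_ge_one.
have u31 : 1 <= u3 by exact: powR_ge_one.
have u41 : 1 <= u4 by exact: powR_ge_one.
have u20 : 0 < u2 by apply: lt_le_trans u21.
have u30 : 0 < u3 by apply: lt_le_trans u31.
have u40 : 0 < u4 by apply: lt_le_trans u41.
have sE : Num.sqrt t = t `^ 2^-1 by rewrite powR12_sqrt// ltW.
have s0 : 0 < Num.sqrt t by rewrite sqrtr_gt0.
have u2s : u2 / Num.sqrt t = L2 * t `^ (- g1).
  by rewrite u2E sE -mulrA powR_ratio// /g1 opprB.
have th2E : u2 * (G / Num.sqrt t) = L2 * G * t `^ (- g1) by rewrite mulrCA u2s; ring.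
have th2 : u2 * (G / Num.sqrt t) <= lam T / 2.
  rewrite th2E lamT; have -> : - g1 = - (g1 - alam) + (- alam) by ring.
  rewrite powRD ?(gt_eqF t0) ?implybT// mulrA [leRHS]mulrAC.
  by rewrite ler_wpM2r ?powR_ge0.
have t1E : t `^ (- 1) = t^-1 by rewrite powRN powRr1// ltW.
have th1 : 32 * (u2 * (G / Num.sqrt t) + (p T)%:R / t * G) * s%:R <= c.
  have -> : c = c / 2 + c / 2 by field.
  rewrite mulrDr [leLHS]mulrDl; apply: lerD.
    by rewrite th2E; apply: le_trans f6; apply: eq_ler; ring.
  apply: le_trans f6'; rewrite t1E.
  have -> : 32 * ((p T)%:R / t * G) * s%:R = (32 * s%:R * G / t) * (p T)%:R by ring.
  have -> : 32 * s%:R * (h%:R * G) * t^-1 = (32 * s%:R * G / t) * h%:R by ring.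
  by rewrite ler_wpM2l ?ler_nat// !mulr_ge0 ?invr_ge0// ltW.
have lb : 6 * lam T * s%:R / c <= b T.
  have -> : 6 * lam T * s%:R / c = 6 * s%:R / c * lam T by ring.
  by rewrite -ler_pdivlMr.
have kap0 : 0 <= G * k T by rewrite mulr_ge0 ?(ltW G0)// (le_trans _ k1).
have Ks u : K (- u) = K u by exact: kernel_sym.
have K0 u : 0 <= K u by exact: kernel_ge0.
have me t' : measT (e T t') by [].
have mx t' i : measT (x T t' i) by [].
have ml j l : measT (lasso T j l) by [].
split; first exact: rate0.
  move=> l l' j j'; apply: (via (s%:R ^+ 2 * (c^-1 * c^-1 * G))); last by rewrite lerDl.
  exact: (Lambda_bound (model_sparse md) c0 (Sigma0_sym _ _ _) (model_coercive md) bd).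
have [E [mE PE HE]] := bootstrap_good_event p0 pT mx (model_var md) (model_sparse md) c0
  (Sigma0_sym _ _ _) (model_coercive md) me K0 Ks (@bm T) ml (@las T) (@claw T) bd m0 kap0 u20 u30 u40 lam0 th2 th1 lb (@Sb T).
exists E; split => //.
  apply: le_trans PE _; rewrite lee_fin.
  have p2 : u2 `^ (- (m / 2)) = (L * a ^+ 2)^-1.
    rewrite /u2 -powRrM (_ : 2 / m * - (m / 2) = - 1); last by field; rewrite gt_eqF.
    by rewrite powRN powRr1// (le_trans _ La2).
  have p3 : u3 `^ (- (m / 4)) = (L * a ^+ 2)^-1.
    rewrite /u3 -powRrM (_ : 4 / m * - (m / 4) = - 1); last by field; rewrite gt_eqF.
    by rewrite powRN powRr1// (le_trans _ La2).
  have p4 : u4 `^ (- (m / 4)) = (L * a)^-1.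
    rewrite /u4 -powRrM (_ : 4 / m * - (m / 4) = - 1); last by field; rewrite gt_eqF.
    by rewrite powRN powRr1// (le_trans _ La1).
  have dC' : (d T)%:R <= Cd * a by rewrite -/a (ger0_norm (ltW a0)) ger0_norm in dC.
  by rewrite p2 p3 p4; apply: (event_probability ph dC' a0 L0 NL).
move=> w /HE[V [C' [gV V0 QV CL]]]; exists V, C'; split => // jl jl'.
apply: le_trans (CL jl jl') _.
apply: le_trans (HM0 T (p T) (k T) (v T) u2 u3 u4 ph T0n k1 v0 u21 _ (ltW u30) u41) _.
  by rewrite -[leRHS]mul1r -ler_pdivrMr// u2s.
have b8 : (u2 * u4 + u3) / Num.sqrt t = (L2 * L4 + L4) * t `^ (8 * ad / m - 2^-1).
  rewrite -powR_ratio// -sE mulrA; congr (_ / _); rewrite u2E u3E u4E.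
  have -> : t `^ (8 * ad / m) = t `^ (4 * ad / m) * t `^ (4 * ad / m).
    by rewrite -powRD ?(gt_eqF t0) ?implybT//; congr (_ `^ _); ring.
  ring.
rewrite -mulrA b8 /rate -/t -[leRHS]mulrA ler_wpM2l ?(ltW M00)//.
set y := t `^ _.
have ky : 0 <= k T * y by rewrite mulr_ge0 ?powR_ge0// (le_trans _ k1).
have -> : (1 + L2 * L4 + L4) * (v T + k T * y) = v T + k T * ((L2 * L4 + L4) * y) +
  (k T * y + (L2 * L4 + L4) * v T) by ring.
rewrite lerDl addr_ge0// mulr_ge0// addr_ge0 ?mulr_ge0// ltW.
Unshelve. all: by end_near.
Qed.

End Families.

(** * Covariance error and maxima of signed vectors *)

Lemma covariance_error_le {R : realType} d1 (X1 : measurableType d1) (P1 : probability X1 R)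
  (n d : nat) (V : X1 -> 'I_n * 'I_d -> R) (C : 'I_n * 'I_d -> 'I_n * 'I_d -> R)
  (Q : {measure set (fspace R ('I_n * 'I_d)) -> \bar R}) (L : 'I_d -> 'I_d -> 'M[R]_n) (del : R) :
  0 <= del -> gaussian_sys P1 V C ->
  (forall S : set (fspace R ('I_n * 'I_d)), measurable S -> Q S = P1 [set w | S (V w)]) ->
  (forall jl jl', `|C jl jl' - L jl.2 jl'.2 jl.1 jl'.1| <= del) -> 0 <= covariance_error Q L <= del.
Proof.
move=> del0 gV QV CL; apply/andP; split; rewrite /covariance_error.
  exact: bigmax_ge_id.
do 4! (apply: bigmax_le => // ? _).
by rewrite (pushforward_second_moment gV QV); apply: (CL (_, _) (_, _)).
Qed.

Lemma max_abs_le {R : realType} (n d : nat) (D : {set 'I_n * 'I_d}) (v : 'I_n * 'I_d -> R) (u : R) :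
  0 <= u -> (max_abs D v <= u) <-> (forall jl, jl \in D -> `|v jl| <= u).
Proof.
move=> u0; split=> [h jl jlD|h]; last exact: bigmax_le.
by apply: le_trans h; rewrite /max_abs; apply: (le_bigmax_cond 0 (fun jl => `|v jl|)).
Qed.

Lemma max_abs_ge0 {R : realType} (n d : nat) (D : {set 'I_n * 'I_d}) (v : 'I_n * 'I_d -> R) :
  0 <= max_abs D v.
Proof. exact: bigmax_ge_id. Qed.

(** Doubling the index by a sign turns the bound |v| <= u into an orthant, and covariances change by
    signs only. *)
Lemma gaussian_signed {R : realType} d1 (X1 : measurableType d1) (P1 : probability X1 R)
  (I J : finType) (f : J -> I) (V : X1 -> I -> R) (C : I -> I -> R) : gaussian_sys P1 V C ->
  gaussian_sys P1 (fun w (xb : J * bool) => (-1) ^+ xb.2 * V w (f xb.1))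
  (fun a b => (-1) ^+ a.2 * (-1) ^+ b.2 * C (f a.1) (f b.1)).
Proof.
move=> gV; have := gaussian_map (fun (xb : J * bool) i => (-1) ^+ xb.2 * (i == f xb.1)%:R) gV.
congr (gaussian_sys _ _ _).
  apply/funext => w; apply/funext => xb; rewrite /lin (bigD1 (f xb.1))//= eqxx mulr1 big1 ?addr0//.
  by move=> i /negbTE ->; rewrite mulr0 mul0r.
apply/funext => a; apply/funext => b; rewrite (bigD1 (f a.1))//= [X in _ + X]big1 ?addr0.
  rewrite (bigD1 (f b.1))//= [X in _ + X]big1 ?addr0 ?eqxx ?mulr1//.
  by move=> i /negbTE ->; rewrite mulr0 mulr0 mul0r.
by move=> i /negbTE ->; apply: big1 => i' _; rewrite mulr0 !mul0r.
Qed.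

(** * Kolmogorov distance of the maxima *)

Section Comparison.
Context {R : realType} {d1 d2 : measure_display} {X1 : measurableType d1} {X2 : measurableType d2}
  (P1 : probability X1 R) (P2 : probability X2 R) (n d : nat).
Local Notation I := ('I_n * 'I_d)%type.
Context (B : 'I_d -> {set 'I_n}) (V : X1 -> I -> R) (C : I -> I -> R) (L : 'I_d -> 'I_d -> 'M[R]_n)
  (Gam : I -> X2 -> R) (Q : {measure set (fspace R I) -> \bar R}) (gV : gaussian_sys P1 V C)
  (V0 : forall w jl, jl.1 \notin B jl.2 -> V w jl = 0)
  (QV : forall S : set (fspace R I), measurable S -> Q S = P1 [set w | S (V w)])
  (mG : forall jl, measT (Gam jl)) (gG : gaussian_family P2 B L Gam) (del c' Lb : R)
  (CL : forall jl jl', `|C jl jl' - L jl.2 jl'.2 jl.1 jl'.1| <= del) (del0 : 0 <= del)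
  (c'0 : 0 < c') (Lb0 : 0 < Lb) (Lc : forall l j, j \in B l -> c' < L l l j j)
  (LLb : forall l l' j j', `|L l l' j j'| <= Lb).

Local Notation J0 := {jl : I | jl.1 \in B jl.2}.
Local Notation J := (J0 * bool)%type.

(** The Gaussian family is specified on the active pairs, so the system is indexed by their
    subtype. *)
Lemma gaussian_family_sys : gaussian_sys P2 (fun w (y : J0) => Gam (val y) w)
  (fun y y' => L (val y).2 (val y').2 (val y).1 (val y').1).
Proof.
have [jn e0 eC] := gG.
apply: gaussian_sys_normal => //.
- move=> a; pose a' (jl : I) : R := if insub jl is Some y then a y else 0.
  have [mu [s [_ h]]] := jn a'; exists mu, s => U mU; rewrite -h//; congr (P2 _).
  have E w : lin a (fun y => Gam (val y) w) =
    \sum_(i in [set jl | jl.1 \in B jl.2]%SET) a' i * Gam i w.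
    rewrite /lin [RHS](reindex_omap (val : J0 -> I) insub) => [|i iB].
      apply: eq_big => [y|y _]; last by rewrite /a' valK.
      by rewrite inE (valP y) valK eqxx.
    by rewrite inE in iB; rewrite insubT.
  by apply/seteqP; split => w /=; rewrite E.
- by move=> y; exact: Ex_expectation (e0 _ (valP y)).
move=> y y'; have := eC _ _ (valP y) (valP y').
rewrite covariance.unlock (e0 _ (valP y)) (e0 _ (valP y')) /= => h; rewrite -(Ex_expectation h).
by congr (Ex _ _); apply/funext => w; rewrite /= fctE /= !subr0.
Qed.

(** The root vanishes off the active pairs, so both maxima are maxima over the active pairs, and the
    signed orthants can be compared. *)
Lemma kolmogorov_le (be a eta x0 : R) : 0 < be -> 0 < a -> 0 <= x0 ->
  (2 * #|{: J0}|)%:R * expR (- (be * a)) <= eta -> kolmogorov_distance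
  (fun u => fine (Q [set f | max_abs [set: _] f <= u]))
  (fun u => fine (P2 [set w' | max_abs [set jl | jl.1 \in B jl.2] (Gam ^~ w') <= u])) <=
  2 * eta + 2 * be ^+ 2 * del + (expR 1 * (2 * a / Num.sqrt c') *
  (1 + 2 * a / Num.sqrt c' + (x0 + 2 * a) / Num.sqrt c') +
  (2 * #|{: J0}|)%:R * expR (1 - x0 / Num.sqrt Lb)).
Proof.
move=> be0 a0 x00 hN; set bound := (X in _ <= X).
have eta0 : 0 <= eta by apply: le_trans hN; rewrite mulr_ge0//; pos.
have sc : 0 < Num.sqrt c' by pos.
have sL : 0 < Num.sqrt Lb by pos.
have bound0 : 0 <= bound.
  rewrite /bound !addr_ge0////; pos.
have g1 := gaussian_signed (fun y : J0 => val y) gV.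
have g2 := gaussian_signed (fun y : J0 => y) gaussian_family_sys.
have cardJ : #|{: J}| = (2 * #|{: J0}|)%N by rewrite card_prod card_bool mulnC.
have sgn (b1 b2 : bool) (r : R) : `|(-1) ^+ b1 * (-1) ^+ b2 * r| = `|r|.
  by rewrite !normrM !normrX !normrN1 !expr1n !mul1r.
have key u : 0 <= u -> `|pr P1 (orth (fun w (xb : J) => (-1) ^+ xb.2 * V w (val xb.1)) u) -
  pr P2 (orth (fun w (xb : J) => (-1) ^+ xb.2 * Gam (val xb.1) w) u)| <= bound.
  move=> u0; rewrite /bound -cardJ.
  apply: (gaussian_kolmogorov g1 g2 be0 a0 del0 _ _ sc sL _ u0 x00).
  - by move=> j k; rewrite -mulrBr sgn; exact: CL.
  - by rewrite cardJ.
  - move=> [y b]; rewrite /= -expr2 sqrr_sign mul1r !sqr_sqrtr ?(ltW c'0) ?(ltW Lb0)//.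
    rewrite ltW ?Lc ?(valP y)//=; apply: le_trans (LLb (val y).2 (val y).2 (val y).1 (val y).1).
    exact: ler_norm.
rewrite /kolmogorov_distance; apply: sup_le_ub; first by eexists; exists 0.
move=> _ [u _ <-].
(* For negative u both events are empty, a maximum starting from 0 being nonnegative. *)
have [u0|u0] := leP 0 u; last first.
  have emp (Y : Type) (D : {set I}) (f : Y -> I -> R) : [set y | max_abs D (f y) <= u] = set0.
    by apply/seteqP; split => // y /= /(le_trans (max_abs_ge0 _ _)); rewrite leNgt u0.
  by rewrite (emp _ _ (fun f : fspace R I => f)) (emp _ _ (fun w => Gam ^~ w)) !measure0 subrr normr0.
apply: le_trans (key u u0); apply: eq_ler.
have signs (v : I -> R) : (forall xb : J, (-1) ^+ xb.2 * v (val xb.1) <= u) <->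
  (forall y : J0, `|v (val y)| <= u).
  split=> [H y|H [y b]] /=.
    by rewrite ler_norml lerNl -mulN1r (H (y, true)) -[v _]mul1r (H (y, false)).
  by apply: le_trans (H y); apply: le_trans (ler_norm _) _; rewrite normrM normrX normrN1 expr1n mul1r.
congr `|_ - _|; rewrite /pr; congr fine.
  rewrite QV.
    congr (P1 _); apply/seteqP; split => w /=.
      by move=> /(max_abs_le _ _ u0) H; apply/signs => y; apply: H; rewrite inE.
    move=> /signs H; apply/max_abs_le => // jl _.
    have [jB|jB] := boolP (jl.1 \in B jl.2); last by rewrite V0// normr0.
    exact: (H (exist _ jl jB)).
  have -> : [set f : fspace R I | max_abs [set: I]%SET f <= u] = [set f | forall jl, `|f jl| <= u].
    apply/seteqP; split => f /=; first by move=> /(max_abs_le _ _ u0) H jl; apply: H; rewrite inE.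
    by move=> H; apply/max_abs_le.
  apply: measurable_forall_fin => jl.
  preimage; apply: measurable_fun_le => //.
  exact: measurable_abs (meas_eval jl).
congr (P2 _); apply/seteqP; split => w /=.
  by move=> /(max_abs_le _ _ u0) H; apply/(signs (Gam ^~ w)) => y; apply: H; rewrite inE (valP y).
move=> /(signs (Gam ^~ w)) H; apply/max_abs_le => // jl; rewrite inE => jB.
exact: (H (exist _ jl jB)).
Qed.

End Comparison.

(** * Smallness of the error terms *)

Section SmallTerms.
Context {R : realType}.
Implicit Types (M v w l e sg sL : R).

Lemma kolmogorov_distance_ge0 (F G : R -> R) : 0 <= kolmogorov_distance F G.
Proof.
rewrite /kolmogorov_distance; set A := (X in sup X).
have [hA|nA] := pselect (has_sup A); last by rewrite sup_out.
apply: le_trans (normr_ge0 (F 0 - G 0)) _.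
by apply: sup_upper_bound => //; exists 0.
Qed.

Lemma rate_small M v w l8 e : 0 < M -> v * l8 <= e / (2 * M) -> w * l8 <= e / (2 * M) ->
  2 * l8 * (M * (v + w)) <= 2 * e.
Proof.
move=> M0 hv hw; have -> : 2 * l8 * (M * (v + w)) = 2 * M * (v * l8 + w * l8) by ring.
have -> : 2 * e = 2 * M * (e / (2 * M) + e / (2 * M)) by field; rewrite gt_eqF.
by rewrite ler_wpM2l ?lerD// mulr_ge0// ltW.
Qed.

Lemma anticoncentration_small sg sL (A0 : R) l e : 0 < sg -> 0 < sL -> 0 < A0 -> 1 <= l -> 0 <= e ->
  e * (2 * (A0 / l ^+ 3) / sg) *
  (1 + 2 * (A0 / l ^+ 3) / sg + (sL * A0 * l + 2 * (A0 / l ^+ 3)) / sg) <=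
  e * (2 * A0 / sg) * (1 + 4 * A0 / sg + sL * A0 / sg) / l.
Proof.
move=> sg0 sL0 A00 l1 e0; have l0 : 0 < l by apply: lt_le_trans l1.
have i0 : 0 < l^-1 by pos.
have i1 : l^-1 <= 1 by rewrite invf_le1.
have -> : A0 / l ^+ 3 = A0 * l^-1 ^+ 3 by rewrite exprVn.
have [j0 j1] : 0 <= A0 / sg /\ 0 <= sL * A0 / sg by rewrite !divr_ge0//; pos.
have c3 : l^-1 ^+ 3 <= l by apply: le_trans l1; exact: (exprn_ile1 3 (ltW i0) i1).
have -> : e * (2 * (A0 * l^-1 ^+ 3) / sg) *
  (1 + 2 * (A0 * l^-1 ^+ 3) / sg + (sL * A0 * l + 2 * (A0 * l^-1 ^+ 3)) / sg) =
  e * (2 * A0 / sg) * l^-1 ^+ 3 * (1 + 4 * (A0 / sg) * l^-1 ^+ 3 + sL * A0 / sg * l) by ring.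
have -> : e * (2 * A0 / sg) * (1 + 4 * A0 / sg + sL * A0 / sg) / l =
  e * (2 * A0 / sg) * l^-1 ^+ 2 * ((1 + 4 * (A0 / sg) + sL * A0 / sg) * l).
  by field; rewrite !gt_eqF.
have q0 : 0 <= e * (2 * A0 / sg) by pos.
apply: ler_pM.
- by pos.
- apply: addr_ge0; last by pos; exact: ltW.
  by pos.
- by rewrite ler_wpM2l// exprS ler_piMl// exprn_ge0 ?ltW.
- have : 0 <= 4 * (A0 / sg) by pos.
  move: (4 * (A0 / sg)) => q q1; rewrite !mulrDl mul1r; apply: lerD => //; apply: lerD => //.
  exact: ler_wpM2l.
Qed.

Lemma six_eighths (eps b1 b2 b3 : R) : 0 < eps -> b1 <= 2 * (eps / 8) -> b2 <= eps / 8 -> b3 <= eps / 8 ->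
  2 * (eps / 8) + b1 + (b2 + b3) <= eps.
Proof. by move=> *; lra. Qed.

End SmallTerms.

(** * The two limits *)

Section Asymptotics.
Context {R : realType} {disp dispG : nat -> measure_display}
  {Om : forall T, measurableType (disp T)} (P : forall T, probability (Om T) R)
  {OmG : forall T, measurableType (dispG T)} (PG : forall T, probability (OmG T) R)
  (p d : nat -> nat) (B : forall T, 'I_(d T) -> {set 'I_(p T * d T)})
  (Lam : forall T, 'I_(d T) -> 'I_(d T) -> 'M[R]_(p T * d T))
  (Qo : forall T, Om T -> {measure set (fspace R ('I_(p T * d T) * 'I_(d T))) -> \bar R})
  (Gam : forall T, 'I_(p T * d T) * 'I_(d T) -> {RV (PG T) >-> R}).
Arguments B T : clear implicits.
Arguments Lam T : clear implicits.
Arguments Qo T : clear implicits.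
Arguments Gam T : clear implicits.
Context (v w0 : nat -> R) (Lb : R).
Let rate T := v T + w0 T.
Context (key : forall eta : R, 0 < eta -> exists2 M : R, 0 < M & \forall T \near \oo, [/\ 0 <= rate T, forall l l' j j', `|Lam T l l' j j'| <= Lb & gaussian_approximation (P T) (B T) (Lam T) (fun w => Qo T w) (M * rate T) eta]).

Lemma near_ln (c : R) : \forall T \near \oo, c <= ln (T%:R : R).
Proof.
near=> T; have T0 : 0 < T%:R :> R by rewrite ltr0n; near: T; exact: nbhs_infty_gt.
rewrite -[leLHS]expRK ler_ln ?posrE ?expR_gt0//.
by near: T; exact: nbhs_infty_ger.
Unshelve. all: by end_near.
Qed.
Context (w00 : \forall T \near \oo, 0 <= w0 T).

(** The error is at most M (v + w0) off a small event, and log T is at least 1 eventually, so the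
    factor sqrt(log T) only enlarges the rate. *)
Lemma covariance_error_bigO :
  bigO_p P (fun T w => covariance_error (Qo T w) (Lam T)) (fun T => v T + w0 T * Num.sqrt (ln T%:R)).
Proof.
move=> eta eta0; have [M M0 H] := key eta0; exists M; near=> T.
have [r0 _ [E [mE PE HE]]] : [/\ 0 <= rate T, forall l l' j j', `|Lam T l l' j j'| <= Lb &
  gaussian_approximation (P T) (B T) (Lam T) (fun w => Qo T w) (M * rate T) eta] by near: T.
have l1 : 1 <= ln (T%:R : R) by near: T; exact: near_ln.
have w0T : 0 <= w0 T by near: T.
exists E; split => // w /= lt; apply: contrapT => /HE[V [C [gV V0 QV CL]]].
have /andP[c0 cle] := covariance_error_le (mulr_ge0 (ltW M0) r0) gV QV CL.
move: lt; rewrite (ger0_norm c0) ltNge => /negP; apply; apply: le_trans cle _.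
rewrite ler_wpM2l ?(ltW M0)//; apply: le_trans (ler_norm _).
rewrite lerD2l ler_peMr// -[leLHS]sqrtr1 ler_sqrt//; lra.
Unshelve. all: by end_near.
Qed.
Context (s : nat) (ad Cd c' : R) (Lb0 : 0 < Lb) (c'0 : 0 < c')
  (Lc : \forall T \near \oo, forall l j, j \in B T l -> c' < Lam T l l j j)
  (gG : \forall T \near \oo, gaussian_family (PG T) (B T) (Lam T) (Gam T)) (ad0 : 0 <= ad)
  (Cd0 : 0 < Cd) (nd : \forall T \near \oo, (d T)%:R <= Cd * T%:R `^ ad)
  (ns : \forall T \near \oo, forall l, (#|B T l| <= s)%N) (v00 : \forall T \near \oo, 0 <= v T)
  (v9 : (fun T => v T * ln T%:R ^+ 9) @ \oo --> (0 : R))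
  (w9 : (fun T => w0 T * ln T%:R `^ (19 / 2)) @ \oo --> (0 : R)).

Lemma near_cvg0 (f : nat -> R) (eps : R) : f @ \oo --> (0 : R) -> 0 < eps ->
  \forall T \near \oo, f T <= eps.
Proof.
move=> /cvgrPdist_le f0 e0; apply: filterS (f0 _ e0) => T.
by rewrite sub0r normrN; apply: le_trans; exact: ler_norm.
Qed.

(** With l = log T the smoothing scale is l^4, the window A0 / l^3 and the cut sL A0 l. Scale times
    window is A0 l with A0 = ad + 1, so the number of active pairs, O(T^ad), times the exponential
    of its negative is O(1/T), and the Gaussian tail at the cut gives the same. The comparison costs
    l^8 times the rate, within the powers of log T that the bandwidth condition allows, and the
    anti-concentration term is O(1/l). *)
Lemma kolmogorov_littleo : littleo_p1 P (fun T w => kolmogorov_distance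
  (fun u => fine (Qo T w [set f | max_abs [set: _] f <= u])) (fun u => fine (PG T [set w' |
  max_abs [set jl | jl.1 \in B T jl.2] (Gam T ^~ w') <= u]))).
Proof.
move=> eps eta eps0 eta0; have [M M0 H] := key eta0.
pose A0 := ad + 1; have A00 : 0 < A0 by rewrite ltr_wpDl.
pose sg := Num.sqrt c'; have sg0 : 0 < sg by rewrite sqrtr_gt0.
pose sL := Num.sqrt Lb; have sL0 : 0 < sL by rewrite sqrtr_gt0.
pose CN : R := 2 * s%:R * Cd; have CN0 : 0 <= CN by rewrite !mulr_ge0// ltW.
pose c2 := expR 1 * (2 * A0 / sg) * (1 + 4 * A0 / sg + sL * A0 / sg).
have c20 : 0 <= c2.
  by rewrite !mulr_ge0//; pos.
pose e5 := eps / 8; have e50 : 0 < e5 by rewrite divr_gt0.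
have e6 : 0 < e5 / (2 * M) by pos.
near=> T.
have [r0 LLb [E [mE PE HE]]] : [/\ 0 <= rate T, forall l l' j j', `|Lam T l l' j j'| <= Lb &
  gaussian_approximation (P T) (B T) (Lam T) (fun w => Qo T w) (M * rate T) eta] by near: T.
have t0 : 0 < T%:R :> R by rewrite ltr0n; near: T; exact: nbhs_infty_gt.
have l1 : 1 <= ln (T%:R : R) by near: T; exact: near_ln.
have l2 : c2 / e5 <= ln (T%:R : R) by near: T; exact: near_ln.
have w0T : 0 <= w0 T by near: T.
have v0T : 0 <= v T by near: T.
have LcT : forall l j, j \in B T l -> c' < Lam T l l j j by near: T.
have gGT : gaussian_family (PG T) (B T) (Lam T) (Gam T) by near: T.
have ndT : (d T)%:R <= Cd * T%:R `^ ad by near: T.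
have nsT : forall l, (#|B T l| <= s)%N by near: T.
have f1 : CN * T%:R `^ (- 1) <= e5 by near: T; exact: near_pow_small.
have f1' : expR 1 * CN * T%:R `^ (- 1) <= e5.
  by near: T; apply: near_pow_small => //; rewrite mulr_ge0//; pos.
have f2 : v T * ln T%:R ^+ 9 <= e5 / (2 * M) by near: T; exact: (near_cvg0 v9 e6).
have f3 : w0 T * ln T%:R `^ (19 / 2) <= e5 / (2 * M) by near: T; exact: (near_cvg0 w9 e6).
exists E; split => // w /= lt; apply: contrapT => /HE[V [C [gV V0 QV CL]]].
move: lt; apply/negP; rewrite -leNgt.
set l := ln (T%:R : R) in l1 l2 f2 f3.
have l0 : 0 < l by apply: lt_le_trans l1.
have mG jl : measT (Gam T jl) by [].
pose be := l ^+ 4; pose a := A0 / l ^+ 3; pose x0 := sL * A0 * l.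
have be0 : 0 < be by rewrite exprn_gt0.
have a0 : 0 < a by rewrite divr_gt0// exprn_gt0.
have x00 : 0 <= x0 by rewrite !mulr_ge0// ltW.
have bea : be * a = A0 * l.
  by rewrite /be /a; field; rewrite gt_eqF.
have exA : expR (- (A0 * l)) = T%:R `^ (- A0) by rewrite /powR (gt_eqF t0) mulNr.
pose N := #|{: {jl : 'I_(p T * d T) * 'I_(d T) | jl.1 \in B T jl.2}}|.
have N1 : (2 * N)%:R * T%:R `^ (- A0) <= CN * T%:R `^ (- 1).
  have Ns : (N <= d T * s)%N.
    have := card_fibered (D := [set: 'I_(d T)]%SET) (fun l' _ => nsT l').
    rewrite cardsT card_ord; apply: leq_trans.
    rewrite /N card_sig; apply: subset_leq_card; apply/fintype.subsetP => jl.
    by rewrite !inE.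
  have NR : (2 * N)%:R <= CN * T%:R `^ ad.
    rewrite natrM; apply: (via (2 * ((d T)%:R * s%:R))).
      by rewrite ler_wpM2l// -natrM ler_nat.
    have -> : CN * T%:R `^ ad = 2 * ((Cd * T%:R `^ ad) * s%:R) by rewrite /CN; ring.
    by rewrite ler_wpM2l// ler_wpM2r.
  apply: le_trans (ler_wpM2r (powR_ge0 _ _) NR) _.
  rewrite -mulrA -powRD ?(gt_eqF t0) ?implybT//.
  by have -> : ad + - A0 = - 1 by rewrite /A0; ring.
have hN : (2 * N)%:R * expR (- (be * a)) <= e5 by rewrite bea exA (le_trans N1).
have Mr0 : 0 <= M * rate T by pos.
have := kolmogorov_le gV V0 QV mG gGT CL Mr0 c'0 Lb0 LcT LLb be0 a0 x00 hN.
rewrite ger0_norm ?kolmogorov_distance_ge0// => /le_trans; apply.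
have h1 : 2 * be ^+ 2 * (M * rate T) <= 2 * e5.
  rewrite /be -exprM (_ : 4 * 2 = 8)%N//; apply: rate_small; rewrite//.
  - apply: le_trans f2; rewrite ler_wpM2l//; exact: ler_weXn2l.
  - apply: le_trans f3; rewrite ler_wpM2l// -powR_mulrn ?(ltW l0)//.
    by apply: ler_powR => //; rewrite ler_pdivlMr// -natrM ler_nat.
have h2 : expR 1 * (2 * a / sg) * (1 + 2 * a / sg + (x0 + 2 * a) / sg) <= e5.
  apply: (le_trans (anticoncentration_small sg0 sL0 A00 l1 (expR_ge0 1))).
  by rewrite -/c2 ler_pdivrMr// mulrC -ler_pdivrMr.
have h3 : (2 * N)%:R * expR (1 - x0 / sL) <= e5.
  have -> : x0 / sL = A0 * l by rewrite /x0; field; rewrite gt_eqF.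
  rewrite expRD exA mulrCA; apply: le_trans f1'; rewrite -mulrA ler_wpM2l//; pos.
rewrite /e5 in h1 h2 h3 *; exact: six_eighths.
Unshelve. all: by end_near.
Qed.

End Asymptotics.

Theorem theorem4 (R : realType)
  (disp dispG : nat -> measure_display)
  (Om : forall T, measurableType (disp T)) (P : forall T, probability (Om T) R)
  (OmG : forall T, measurableType (dispG T)) (PG : forall T, probability (OmG T) R)
  (p d : nat -> nat)
  (x eps : forall T, int -> 'I_(d T) -> {RV (P T) >-> R})
  (A : forall T, 'I_(p T) -> 'M[R]_(d T)) (Sig : forall T, 'M[R]_(d T))
  (m alpha ad clam alam c c' : R) (lam b k : nat -> R) (K : R -> R)
  (lasso : forall T, 'I_(p T * d T) -> 'I_(d T) ->
             {mfun fspace R ('I_T * 'I_(d T)) >-> R})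
  (e : forall T, nat -> {RV (P T) >-> R})
  (Gam : forall T, 'I_(p T * d T) * 'I_(d T) -> {RV (PG T) >-> R})
  (Q : forall T, R.-pker (fspace R ('I_T * 'I_(d T)))
                      ~> (fspace R ('I_(p T * d T) * 'I_(d T)))) :
  let S T := coef_mx (A T) in
  let B T := active_set (S T) in
  let obs T (w : Om T) := observations (T := T) (x T) ^~ w in
  let Stil T (w : Om T) := \matrix_(j, l) lasso T j l (obs T w) in
  let Btil T (w : Om T) := thresholded (Stil T w) (b T) in
  let Delta T (w : Om T) :=
    bootstrap_root T (sample_path (x T) w) (Btil T w) (e T ^~ w) in
  let Lam T := Lambda (P T) T (x T) (eps T) (S T) in
  let v T := vrate alpha (k T) in
  let N T : R := T%:R in
  (* the model *)
  (forall T, is_VAR (P T) (x T) (eps T) (A T)) ->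
  (forall T, white_noise (P T) (eps T) (Sig T)) ->
  (forall T w, is_lasso T (sample_path (x T) w) (lam T) (Stil T w)) ->
  (forall T, bootstrap_multipliers (P T) T K (k T) (x T) (e T)) ->
  (forall T, is_cond_law (P T) (observations (T := T) (x T))
               (fun jl w => Delta T w jl.1 jl.2) (Q T)) ->
  (\forall T \near \oo, gaussian_family (PG T) (B T) (Lam T) (Gam T)) ->
  (* (1) *)
  8 < m -> 1 < alpha ->
  short_range_dependent P x m alpha ->
  (fun T => (p T)%:R : R) =O_\oo (fun=> 1 : R) ->
  (fun T => (d T)%:R : R) =O_\oo (fun T => N T `^ ad) ->
  0 <= ad -> ad < m * alpha / (2 + 24 * alpha) ->
  (* (2) *)
  0 < clam -> 0 < alam -> alam < 2^-1 - 4 * ad / m ->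
  (forall T, lam T = clam * N T `^ (- alam)) ->
  b @ \oo --> (0 : R) ->
  (fun T => b T / lam T) @ \oo --> +oo ->
  (fun T => (\max_l #|B T l|)%:R : R) =O_\oo (fun=> 1 : R) ->
  (forall T, (0 < \max_l #|B T l|)%N) ->
  (forall T l j, j \in B T l -> 2 * b T < `|S T j l|) ->
  (forall T (z : R[i]),
     eigenvalue (map_mx (real_complex R) (companion (S T))) z -> `|z| < 1) ->
  0 < c ->
  (forall T a, eigenvalue (Sigma0 (P T) (p T) (x T)) a -> c < a) ->
  (* (3) *)
  0 < c' ->
  (\forall T \near \oo, forall l j, j \in B T l -> c' < Lam T l l j j) ->
  (* (4) *)
  kernel_function K ->
  (forall T, 0 < k T) ->
  k @ \oo --> +oo ->
  (fun T => v T * ln (N T) ^+ 9) @ \oo --> (0 : R) ->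
  (fun T => k T * N T `^ (8 * ad / m - 2^-1) * ln (N T) `^ (19 / 2))
    @ \oo --> (0 : R) ->
  bigO_p P (fun T w => covariance_error (Q T (obs T w)) (Lam T))
    (fun T => v T + k T * N T `^ (8 * ad / m - 2^-1) * Num.sqrt (ln (N T)))
  /\
  littleo_p1 P (fun T w => kolmogorov_distance
    (fun u => fine (Q T (obs T w) [set f | max_abs [set: _] f <= u]))
    (fun u => fine (PG T [set w' |
       max_abs [set jl | jl.1 \in B T jl.2] (Gam T ^~ w') <= u]))).
Proof.
move=> S B obs Stil Btil Delta Lam v N var wn las bm claw gG m8 alpha1 srd pO dO ad0 _ clam0
  alam0 alam1 lamE _ blam BO B0 Sb stable c0 eig c'0 Lc hK k0 koo v9 w9.
have [Lb Lb0 key] := key_event var wn las bm claw m8 alpha1 srd pO dO ad0 clam0 alam0 alam1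
  lamE blam BO B0 Sb stable c0 eig hK koo.
have w00 : \forall T \near \oo, 0 <= k T * N T `^ (8 * ad / m - 2^-1).
  by near=> T; rewrite mulr_ge0 ?powR_ge0// ltW.
split; first exact: (covariance_error_bigO key w00).
have [CV CV0 hCV] := kernel_bias hK alpha1.
have v00 : \forall T \near \oo, 0 <= v T.
  near=> T; have k2 : expR 2 <= k T by near: T; move/cvgryPge: koo; exact.
  (* The kernel bound for an empty sum says that [v T] is nonnegative. *)
  rewrite -(pmulr_rge0 _ CV0); apply: le_trans (hCV (k T) 0%N k2); apply: sumr_ge0 => u _.
  by rewrite mulr_ge0// powR_ge0.
have [Cd Cd0 nd'] := bigO_bound dO.
have nd : \forall T \near \oo, (d T)%:R <= Cd * N T `^ ad.
  by apply: filterS nd' => T; rewrite ger0_norm// ger0_norm// powR_ge0.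
have [s ns'] := nat_bound BO.
have ns : \forall T \near \oo, forall l, (#|B T l| <= s)%N.
  by apply: filterS ns' => T h l; apply: leq_trans h; exact: leq_bigmax.
exact: (kolmogorov_littleo key w00 Lb0 c'0 Lc gG ad0 Cd0 nd ns v00 v9 w9).
Unshelve. all: by end_near.
Qed.
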